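(* Let $Q:\infty\text{-}\mathrm{Gpd}\to\mathrm{Top}$ be a Simpson realization functor and let $R:\infty\text{-}\mathrm{Gpd}\to\mathrm{Hot}$ be its composite with the localization functor $\mathrm{Top}\to\mathrm{Hot}$. Then the simply connected homotopy types in the essential image of $R$ are exactly the products of Eilenberg–Mac Lane spaces; that is, a simply connected homotopy type $X$ is isomorphic in $\mathrm{Hot}$ to $R(G)$ for some strict $\infty$-groupoid $G$ if and only if $X$ is isomorphic in $\mathrm{Hot}$ to a product of Eilenberg–Mac Lane spaces.
   Context: Strict $\infty$-categories and $\infty$-groupoids. A strict $\infty$-category $X$ consists of sets $X_i$ ($i\ge 0$) of $i$-arrows (objects are $0$-arrows), maps $s_i,t_i:X_i\to X_{i-1}$ ($i\ge1$; source and target) with $s_is_{i+1}=s_it_{i+1}$ and $t_is_{i+1}=t_it_{i+1}$, maps $k_i:X_i\to X_{i+1}$ (units), and, for $i>j\ge0$, compositions $*^i_j$ defined on pairs $(v,u)\in X_i\times X_i$ with $s^i_j(v)=t^i_j(u)$ and with values in $X_i$; here $s^i_j=s_{j+1}\cdots s_i$, $t^i_j=t_{j+1}\cdots t_i$, $k^i_j=k_{i-1}\cdots k_j:X_j\to X_i$. Axioms: $s_i(v*^i_ju)$ is $s_i(u)$ if $j=i-1$ and $s_i(v)*^{i-1}_js_i(u)$ if $j<i-1$; $t_i(v*^i_ju)$ is $t_i(v)$ if $j=i-1$ and $t_i(v)*^{i-1}_jt_i(u)$ if $j<i-1$; $s_{i+1}k_i(u)=u=t_{i+1}k_i(u)$;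 each $*^i_j$ is associative; exchange law $(\delta *^i_j\gamma)*^i_k(\beta*^i_j\alpha)=(\delta*^i_k\beta)*^i_j(\gamma*^i_k\alpha)$ for $i>j>k\ge0$ when $s^i_j\delta=t^i_j\gamma$, $s^i_k\gamma=t^i_k\beta$, $s^i_j\beta=t^i_j\alpha$; units $u*^i_jk^i_js^i_j(u)=u=k^i_jt^i_j(u)*^i_ju$; and $k_i(v*^i_ju)=k_i(v)*^{i+1}_jk_i(u)$. Morphisms preserve all structure. $X$ is a strict $\infty$-groupoid if for all $i>j\ge0$ every $i$-arrow $u$ has a $*^i_j$-inverse, i.e. an $i$-arrow $v$ with $s^i_j(v)=t^i_j(u)$, $t^i_j(v)=s^i_j(u)$, $u*^i_jv=k^i_jt^i_j(u)$, $v*^i_ju=k^i_js^i_j(u)$. The category of strict $\infty$-groupoids is denoted $\infty\text{-}\mathrm{Gpd}$. Homotopy groups. Two $n$-arrows $u,v$ of a strict $\infty$-groupoid $G$ are homotopic if there is an $(n+1)$-arrow $u\to v$; this is an equivalence relation. $\pi_0(G)$ is the set of objects modulo homotopy; for $n\ge1$ and an object $x$, $\pi_n(G,x)$ is the group, under $*^n_{n-1}$, of $n$-arrows $k^{n-1}_0(x)\to k^{n-1}_0(x)$ modulo homotopy. A Simpson realization functor is a functor $Q:\infty\text{-}\mathrm{Gpd}\to\mathrm{Top}$ together with a map $e:G_0\to Q(G)$, natural in $G$, inducing a bijection $\pi_0(G)\to\pi_0(Q(G))$, and with group isomorphisms $\pi_n(G,x)\to\pi_n(Q(G),e(x))$ for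 $n\ge1$, natural in $(G,x)$ ($x$ an object of $G$). $\mathrm{Hot}$ is the localization of the category $\mathrm{Top}$ of topological spaces at the weak homotopy equivalences; its objects (up to isomorphism) are homotopy types. A simply connected homotopy type is that of a (non-empty) path-connected space with trivial fundamental group. An Eilenberg–Mac Lane space $K(A,n)$ ($A$ a group, abelian if $n\ge2$; $n\geq 1$) is a connected space with $\pi_n\simeq A$ and all other homotopy groups trivial. The localization functor $\mathrm{Top}\to\mathrm{Hot}$ commutes with products. *)

(* Defs.v *)
From HB Require Import structures.
From mathcomp Require Import all_boot all_order all_algebra.
From mathcomp Require Import generic_quotient.
From mathcomp Require Import all_classical all_reals all_analysis.
From mathcomp Require Import ring lra.

Set Implicit Arguments.
Unset Strict Implicit.
Unset Printing Implicit Defensive.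

Import Order.TTheory GRing.Theory Num.Theory.
Import numFieldNormedType.Exports.

Local Open Scope classical_set_scope.
Local Open Scope quotient_scope.

Record infGraph := InfGraph {
  arr : nat -> Type;
  src : forall i, arr i.+1 -> arr i;
  tgt : forall i, arr i.+1 -> arr i;
  unt : forall i, arr i -> arr i.+1
}.
Arguments src {i0 i}.
Arguments tgt {i0 i}.
Arguments unt {i0 i}.

HB.instance Definition _ (X : infGraph) (i : nat) := gen_eqMixin (arr X i).
HB.instance Definition _ (X : infGraph) (i : nat) := gen_choiceMixin (arr X i).

Section Iterates.
Context {X : infGraph}.

Fixpoint src_iter d j : arr X (d + j) -> arr X j :=
  if d is d'.+1 then fun u => @src_iter d' j (src u) else id.

Fixpoint tgt_iter d j : arr X (d + j) -> arr X j :=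
  if d is d'.+1 then fun u => @tgt_iter d' j (tgt u) else id.

Fixpoint unt_iter d j : arr X j -> arr X (d + j) :=
  if d is d'.+1 then fun u => unt (@unt_iter d' j u) else id.

(* [src_to], [tgt_to] and [unt_to] are the iterated maps s^i_j, t^i_j and
   k^i_j; the casts are along i = (i - j) + j, and the lemmas [src_toS] etc.
   below are the recursive equations that avoid them. *)
Definition src_to i j (h : j <= i) (u : arr X i) : arr X j :=
  src_iter (ecast k (arr X k) (esym (subnK h)) u).

Definition tgt_to i j (h : j <= i) (u : arr X i) : arr X j :=
  tgt_iter (ecast k (arr X k) (esym (subnK h)) u).

Definition unt_to i j (h : j <= i) (u : arr X j) : arr X i :=
  ecast k (arr X k) (subnK h) (unt_iter (i - j) u).

Lemma iter_toE d j i (e : i = d + j) (h : j <= i) :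
  [/\ forall u, src_to h u = src_iter (ecast k (arr X k) e u),
      forall u, tgt_to h u = tgt_iter (ecast k (arr X k) e u) &
      forall u, unt_to h u = ecast k (arr X k) (esym e) (unt_iter d u)].
Proof.
have ed : i - j = d by rewrite e addnK.
rewrite /src_to /tgt_to /unt_to; move: (subnK h); rewrite ed => e'.
by split=> u; rewrite ?(eq_irrelevance (esym e') e) ?(eq_irrelevance e' (esym e)).
Qed.

Lemma src_to_id i (h : i <= i) u : src_to h u = u.
Proof. by have [-> _ _] := @iter_toE 0 i i erefl h. Qed.

Lemma tgt_to_id i (h : i <= i) u : tgt_to h u = u.
Proof. by have [_ -> _] := @iter_toE 0 i i erefl h. Qed.

Lemma unt_to_id i (h : i <= i) u : unt_to h u = u.
Proof. by have [_ _ ->] := @iter_toE 0 i i erefl h. Qed.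

Lemma src_toS i j (h : j <= i) (h' : j <= i.+1) u :
  src_to h' u = src_to h (src u).
Proof.
have e : i = (i - j) + j by rewrite subnK.
have [-> _ _] := @iter_toE (i - j).+1 j i.+1 (congr1 S e) h'.
have [-> _ _] := iter_toE e h.
by move: (i - j) e h h' u => d e h h' u; subst i.
Qed.

Lemma tgt_toS i j (h : j <= i) (h' : j <= i.+1) u :
  tgt_to h' u = tgt_to h (tgt u).
Proof.
have e : i = (i - j) + j by rewrite subnK.
have [_ -> _] := @iter_toE (i - j).+1 j i.+1 (congr1 S e) h'.
have [_ -> _] := iter_toE e h.
by move: (i - j) e h h' u => d e h h' u; subst i.
Qed.

Lemma unt_toS i j (h : j <= i) (h' : j <= i.+1) u :
  unt_to h' u = unt (unt_to h u).
Proof.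
have e : i = (i - j) + j by rewrite subnK.
have [_ _ ->] := @iter_toE (i - j).+1 j i.+1 (congr1 S e) h'.
have [_ _ ->] := iter_toE e h.
by move: (i - j) e h h' u => d e h h' u; subst i.
Qed.

End Iterates.

(* [acomp h v u c] is the composition v *^i_j u, which is only defined on the
   composable pairs. An axiom about compositions is quantified over all the
   composability proofs that occur in it: they are proofs of equations which
   follow from the other axioms, so this does not weaken the axiom. *)
Record infCat := InfCat {
  infcat_graph :> infGraph;
  acomp : forall i j (h : j < i) (v u : arr infcat_graph i),
    src_to (ltnW h) v = tgt_to (ltnW h) u -> arr infcat_graph i;
  src_src : forall i (u : arr infcat_graph i.+2), src (src u) = src (tgt u);
  tgt_src : forall i (u : arr infcat_graph i.+2), tgt (src u) = tgt (tgt u);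
  src_comp_top : forall i (h : i < i.+1) v u (c : _ = _),
    src (@acomp i.+1 i h v u c) = src u;
  src_comp : forall i j (h' : j < i.+1) (h : j < i) v u (c' c : _ = _),
    src (@acomp i.+1 j h' v u c') = @acomp i j h (src v) (src u) c;
  tgt_comp_top : forall i (h : i < i.+1) v u (c : _ = _),
    tgt (@acomp i.+1 i h v u c) = tgt v;
  tgt_comp : forall i j (h' : j < i.+1) (h : j < i) v u (c' c : _ = _),
    tgt (@acomp i.+1 j h' v u c') = @acomp i j h (tgt v) (tgt u) c;
  src_unt : forall i (u : arr infcat_graph i), src (unt u) = u;
  tgt_unt : forall i (u : arr infcat_graph i), tgt (unt u) = u;
  compA : forall i j (h : j < i) w v u (c1 c2 c3 c4 : _ = _),
    @acomp i j h (@acomp i j h w v c1) u c2 =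
    @acomp i j h w (@acomp i j h v u c3) c4;
  comp_exchange : forall i j k (hij : j < i) (hjk : k < j) (hik : k < i)
      (d c b a : arr infcat_graph i),
    src_to (ltnW hij) d = tgt_to (ltnW hij) c ->
    src_to (ltnW hik) c = tgt_to (ltnW hik) b ->
    src_to (ltnW hij) b = tgt_to (ltnW hij) a ->
    forall c1 c2 c3 c4 c5 c6 : _ = _,
    @acomp i k hik (@acomp i j hij d c c1) (@acomp i j hij b a c2) c3 =
    @acomp i j hij (@acomp i k hik d b c4) (@acomp i k hik c a c5) c6;
  comp_unt_r : forall i j (h : j < i) u (c : _ = _),
    @acomp i j h u (unt_to (ltnW h) (src_to (ltnW h) u)) c = u;
  comp_unt_l : forall i j (h : j < i) u (c : _ = _),
    @acomp i j h (unt_to (ltnW h) (tgt_to (ltnW h) u)) u c = u;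
  unt_comp : forall i j (h : j < i) (h' : j < i.+1) v u (c c' : _ = _),
    unt (@acomp i j h v u c) = @acomp i.+1 j h' (unt v) (unt u) c'
}.
Arguments acomp {i0 i j}.

Record infFunctor (X Y : infCat) := InfFunctor {
  arr_map :> forall i, arr X i -> arr Y i;
  arr_map_src : forall i (u : arr X i.+1), arr_map (src u) = src (arr_map u);
  arr_map_tgt : forall i (u : arr X i.+1), arr_map (tgt u) = tgt (arr_map u);
  arr_map_unt : forall i (u : arr X i), arr_map (unt u) = unt (arr_map u);
  arr_map_comp : forall i j (h : j < i) (v u : arr X i) (c c' : _ = _),
    arr_map (acomp h v u c) = acomp h (arr_map v) (arr_map u) c'
}.

Lemma arr_map_to (X Y : infCat) (F : infFunctor X Y) i j (h : j <= i) :
  [/\ forall u, F j (src_to h u) = src_to h (F i u),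
      forall u, F j (tgt_to h u) = tgt_to h (F i u) &
      forall u, F i (unt_to h u) = unt_to h (F j u)].
Proof.
elim: i h => [|i IHi] h.
  case: j h => [|//] h.
  by split=> u; rewrite ?src_to_id ?tgt_to_id ?unt_to_id.
have [lji|] := leqP j i.
  have [IHs IHt IHu] := IHi lji.
  by split=> u; rewrite ?(src_toS lji) ?(tgt_toS lji) ?(unt_toS lji)
    ?arr_map_unt ?IHs ?IHt ?IHu ?arr_map_src ?arr_map_tgt.
move=> lij; have e : i.+1 = j by apply/eqP; rewrite eqn_leq lij h.
by subst j; split=> u; rewrite ?src_to_id ?tgt_to_id ?unt_to_id.
Qed.

Definition infFunctor_id (X : infCat) : infFunctor X X.
Proof.
by refine (@InfFunctor X X (fun _ => id) _ _ _ _) => // i j h v u c c';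
  rewrite (Prop_irrelevance c c').
Defined.

Definition infFunctor_comp (X Y Z : infCat) (F' : infFunctor Y Z)
  (F : infFunctor X Y) : infFunctor X Z.
Proof.
refine (@InfFunctor X Z (fun i => F' i \o F i) _ _ _ _) => /=.
- by move=> i u; rewrite !arr_map_src.
- by move=> i u; rewrite !arr_map_tgt.
- by move=> i u; rewrite !arr_map_unt.
- move=> i j h v u c c'.
  have c1 : src_to (ltnW h) (F i v) = tgt_to (ltnW h) (F i u).
    by have [<- <- _] := arr_map_to F (ltnW h); rewrite c.
  by rewrite (arr_map_comp _ c1) (arr_map_comp _ c').
Defined.

Definition inverses (X : infCat) i j (h : j < i) (u v : arr X i) :=
  exists (c : src_to (ltnW h) u = tgt_to (ltnW h) v)
         (c' : src_to (ltnW h) v = tgt_to (ltnW h) u),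
    acomp h u v c = unt_to (ltnW h) (tgt_to (ltnW h) u) /\
    acomp h v u c' = unt_to (ltnW h) (src_to (ltnW h) u).

(* The category [oo-Gpd] is the full subcategory on these objects: its
   morphisms are the [infFunctor]s. *)
Record infGpd := InfGpd {
  infgpd_cat :> infCat;
  infgpd_inv : forall i j (h : j < i) (u : arr infgpd_cat i),
    exists v, inverses h u v
}.

Definition arr_htpy (G : infGpd) n (u v : arr G n) :=
  exists a : arr G n.+1, src a = u /\ tgt a = v.

Section ArrHtpy.
Context {G : infGpd} {n : nat}.
Implicit Types u v w : arr G n.

Lemma src_to1 (X : infGraph) (h : n <= n.+1) (u : arr X n.+1) :
  src_to h u = src u.
Proof. by rewrite (src_toS (leqnn n)) src_to_id. Qed.

Lemma tgt_to1 (X : infGraph) (h : n <= n.+1) (u : arr X n.+1) :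
  tgt_to h u = tgt u.
Proof. by rewrite (tgt_toS (leqnn n)) tgt_to_id. Qed.

Lemma unt_to1 (X : infGraph) (h : n <= n.+1) (u : arr X n) :
  unt_to h u = unt u.
Proof. by rewrite (unt_toS (leqnn n)) unt_to_id. Qed.

Lemma comp1_subproof (u v : arr G n.+1) : src v = tgt u ->
  src_to (ltnW (ltnSn n)) v = tgt_to (ltnW (ltnSn n)) u.
Proof. by rewrite src_to1 tgt_to1. Qed.

Definition comp1 (v u : arr G n.+1) (c : src v = tgt u) : arr G n.+1 :=
  acomp (ltnSn n) v u (comp1_subproof c).

Lemma inv1 (u : arr G n.+1) : exists v : arr G n.+1, exists (c : src u = tgt v)
  (c' : src v = tgt u), comp1 c = unt (tgt u) /\ comp1 c' = unt (src u).
Proof.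
have [v [c [c' [e e']]]] := infgpd_inv (ltnSn n) u.
have d : src u = tgt v by rewrite -(src_to1 (ltnW (ltnSn n))) c tgt_to1.
have d' : src v = tgt u by rewrite -(src_to1 (ltnW (ltnSn n))) c' tgt_to1.
exists v, d, d'; rewrite /comp1 (Prop_irrelevance (comp1_subproof d) c).
by rewrite (Prop_irrelevance (comp1_subproof d') c') e e' !unt_to1 tgt_to1 src_to1.
Qed.

Lemma arr_htpy_refl u : arr_htpy u u.
Proof. by exists (unt u); rewrite src_unt tgt_unt. Qed.

Lemma arr_htpy_sym u v : arr_htpy u v -> arr_htpy v u.
Proof. by move=> [a [<- <-]]; have [b [c [c' _]]] := inv1 a; exists b. Qed.

Lemma arr_htpy_trans u v w : arr_htpy u v -> arr_htpy v w -> arr_htpy u w.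
Proof.
move=> [a [<- at_]] [b [bs <-]].
have c : src b = tgt a by rewrite bs at_.
by exists (comp1 c); rewrite src_comp_top tgt_comp_top.
Qed.

End ArrHtpy.

Section GpdPi0.
Context (G : infGpd).

Definition arr_htpyb : rel (arr G 0) := fun u v => `[< arr_htpy u v >].

Lemma arr_htpyb_refl : reflexive arr_htpyb.
Proof. by move=> u; apply/asboolP; exact: arr_htpy_refl. Qed.

Lemma arr_htpyb_sym : symmetric arr_htpyb.
Proof. by move=> u v; apply/asboolP/asboolP => /arr_htpy_sym. Qed.

Lemma arr_htpyb_trans : transitive arr_htpyb.
Proof.
by move=> v u w /asboolP uv /asboolP vw; apply/asboolP/(arr_htpy_trans uv vw).
Qed.

Canonical arr_htpy_equiv :=
  EquivRel arr_htpyb arr_htpyb_refl arr_htpyb_sym arr_htpyb_trans.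

Definition gpd_pi0 := {eq_quot arr_htpy_equiv}.
HB.instance Definition _ := EqQuotient.on gpd_pi0.
HB.instance Definition _ := Choice.on gpd_pi0.

Lemma gpd_pi0P (u v : arr G 0) : \pi_gpd_pi0 u = \pi_gpd_pi0 v <-> arr_htpy u v.
Proof. by split=> [/eqmodP/asboolP//|uv]; apply/eqmodP/asboolP. Qed.

End GpdPi0.

(* The (n+1)-arrows k^n_0(x) -> k^n_0(x). *)
Record gloop (G : infGpd) (n : nat) (x : arr G 0) := GLoop {
  gloop_arr :> arr G n.+1;
  gloop_src : src gloop_arr = unt_to (leq0n n) x;
  gloop_tgt : tgt gloop_arr = unt_to (leq0n n) x
}.

HB.instance Definition _ G n x := gen_eqMixin (@gloop G n x).
HB.instance Definition _ G n x := gen_choiceMixin (@gloop G n x).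

Section GpdPi.
Context (G : infGpd) (n : nat) (x : arr G 0).
Notation loop := (@gloop G n x).
Implicit Types u v w : loop.

Lemma gloop_eq u v : u = v :> arr G n.+1 -> u = v.
Proof.
case: u v => [u us ut] [v vs vt] /= e; subst v.
by rewrite (Prop_irrelevance us vs) (Prop_irrelevance ut vt).
Qed.

Definition gloop_htpyb : rel loop := fun u v => `[< arr_htpy u v >].

Lemma gloop_htpyb_refl : reflexive gloop_htpyb.
Proof. by move=> u; apply/asboolP; exact: arr_htpy_refl. Qed.

Lemma gloop_htpyb_sym : symmetric gloop_htpyb.
Proof. by move=> u v; apply/asboolP/asboolP => /arr_htpy_sym. Qed.

Lemma gloop_htpyb_trans : transitive gloop_htpyb.
Proof.
by move=> v u w /asboolP uv /asboolP vw; apply/asboolP/(arr_htpy_trans uv vw).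
Qed.

Canonical gloop_htpy_equiv :=
  EquivRel gloop_htpyb gloop_htpyb_refl gloop_htpyb_sym gloop_htpyb_trans.

Lemma gloopC u v : src u = tgt v.
Proof. by rewrite gloop_src gloop_tgt. Qed.

Lemma gloop_mul_src u v : src (comp1 (gloopC u v)) = unt_to (leq0n n) x.
Proof. by rewrite src_comp_top gloop_src. Qed.

Lemma gloop_mul_tgt u v : tgt (comp1 (gloopC u v)) = unt_to (leq0n n) x.
Proof. by rewrite tgt_comp_top gloop_tgt. Qed.

Definition gloop_mul u v : loop :=
  GLoop (gloop_mul_src u v) (gloop_mul_tgt u v).

Definition gloop_one : loop :=
  GLoop (src_unt (unt_to (leq0n n) x)) (tgt_unt (unt_to (leq0n n) x)).

Lemma gloop_inv_subproof u :
  exists v, gloop_mul u v = gloop_one /\ gloop_mul v u = gloop_one.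
Proof.
have [v [c [c' [e e']]]] := inv1 u.
have vs : src v = unt_to (leq0n n) x by rewrite c' gloop_tgt.
have vt : tgt v = unt_to (leq0n n) x by rewrite -c gloop_src.
exists (GLoop vs vt); split; apply: gloop_eq => /=.
  by rewrite (Prop_irrelevance (gloopC u (GLoop vs vt)) c) e gloop_tgt.
by rewrite (Prop_irrelevance (gloopC (GLoop vs vt) u) c') e' gloop_src.
Qed.

Definition gloop_inv u : loop := projT1 (cid (gloop_inv_subproof u)).

Lemma gloop_mulA : associative gloop_mul.
Proof. by move=> u v w; apply: gloop_eq; rewrite /= /comp1; symmetry; apply: compA. Qed.

Lemma gloop_mul1 : left_id gloop_one gloop_mul.
Proof.
move=> u; apply: gloop_eq => /=; rewrite /comp1.
have e : unt (unt_to (leq0n n) x) =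
    unt_to (ltnW (ltnSn n)) (tgt_to (ltnW (ltnSn n)) u).
  by rewrite unt_to1 tgt_to1 gloop_tgt.
by move: (comp1_subproof _); rewrite /= e => c; rewrite comp_unt_l.
Qed.

Lemma gloop_1mul : right_id gloop_one gloop_mul.
Proof.
move=> u; apply: gloop_eq => /=; rewrite /comp1.
have e : unt (unt_to (leq0n n) x) =
    unt_to (ltnW (ltnSn n)) (src_to (ltnW (ltnSn n)) u).
  by rewrite unt_to1 src_to1 gloop_src.
by move: (comp1_subproof _); rewrite /= e => c; rewrite comp_unt_r.
Qed.

Lemma gloop_mulV u : gloop_mul u (gloop_inv u) = gloop_one.
Proof. by rewrite /gloop_inv; case: cid => v []. Qed.

Lemma gloop_Vmul u : gloop_mul (gloop_inv u) u = gloop_one.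
Proof. by rewrite /gloop_inv; case: cid => v []. Qed.

Lemma gloop_mul_htpy u u' v v' : arr_htpy u u' -> arr_htpy v v' ->
  arr_htpy (gloop_mul u v) (gloop_mul u' v').
Proof.
move=> [a [as_ at_]] [b [bs bt]].
have h : n < n.+2 by rewrite ltnS leqnSn.
have c : src_to (ltnW h) a = tgt_to (ltnW h) b.
  by rewrite (src_toS (leqnSn n)) (tgt_toS (leqnSn n)) src_to1 tgt_to1 as_ bt;
    rewrite gloop_src gloop_tgt.
exists (acomp h a b c); split.
  rewrite (@src_comp G n.+1 n h (ltnSn n)).
    by rewrite as_ bs src_to1 tgt_to1; exact: gloopC.
  by move=> c1; rewrite /= /comp1; move: c1; rewrite as_ bs => c1; congr acomp;
    exact: Prop_irrelevance.
rewrite (@tgt_comp G n.+1 n h (ltnSn n)).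
  by rewrite at_ bt src_to1 tgt_to1; exact: gloopC.
by move=> c1; rewrite /= /comp1; move: c1; rewrite at_ bt => c1; congr acomp;
  exact: Prop_irrelevance.
Qed.

(* The group pi_{n+1}(G, x). *)
Definition gpd_pi := {eq_quot gloop_htpy_equiv}.
HB.instance Definition _ := EqQuotient.on gpd_pi.
HB.instance Definition _ := Choice.on gpd_pi.

Lemma gpd_piP u v : \pi_gpd_pi u = \pi_gpd_pi v <-> arr_htpy u v.
Proof. by split=> [/eqmodP/asboolP//|uv]; apply/eqmodP/asboolP. Qed.

Lemma gpd_repr u : arr_htpy (repr (\pi_gpd_pi u)) u.
Proof. by apply/gpd_piP; rewrite reprK. Qed.

Definition gpd_pi_one : gpd_pi := \pi_gpd_pi gloop_one.
Definition gpd_pi_mul (a b : gpd_pi) : gpd_pi :=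
  \pi_gpd_pi (gloop_mul (repr a) (repr b)).
Definition gpd_pi_inv (a : gpd_pi) : gpd_pi := \pi_gpd_pi (gloop_inv (repr a)).

Lemma gpd_pi_mulE u v :
  gpd_pi_mul (\pi_gpd_pi u) (\pi_gpd_pi v) = \pi_gpd_pi (gloop_mul u v).
Proof. by apply/gpd_piP/gloop_mul_htpy; exact: gpd_repr. Qed.

Lemma gpd_pi_mulA : associative gpd_pi_mul.
Proof.
move=> a b c; elim/quotW: a => u; elim/quotW: b => v; elim/quotW: c => w.
by rewrite (gpd_pi_mulE v w) (gpd_pi_mulE u v) !gpd_pi_mulE gloop_mulA.
Qed.

Lemma gpd_pi_mul1g : left_id gpd_pi_one gpd_pi_mul.
Proof. by elim/quotW=> u; rewrite gpd_pi_mulE gloop_mul1. Qed.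

Lemma gpd_pi_mulg1 : right_id gpd_pi_one gpd_pi_mul.
Proof. by elim/quotW=> u; rewrite gpd_pi_mulE gloop_1mul. Qed.

Lemma gpd_pi_mulVg : left_inverse gpd_pi_one gpd_pi_inv gpd_pi_mul.
Proof.
by move=> a; rewrite -[X in gpd_pi_mul _ X]reprK gpd_pi_mulE gloop_Vmul.
Qed.

Lemma gpd_pi_mulgV : right_inverse gpd_pi_one gpd_pi_inv gpd_pi_mul.
Proof.
by move=> a; rewrite -[X in gpd_pi_mul X _]reprK gpd_pi_mulE gloop_mulV.
Qed.

HB.instance Definition _ := isGroup.Build gpd_pi gpd_pi_mulA
  gpd_pi_mul1g gpd_pi_mulg1 gpd_pi_mulVg gpd_pi_mulgV.

End GpdPi.

Section GpdPiMap.
Context (G H : infGpd) (F : infFunctor G H) (n : nat) (x : arr G 0).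

Lemma gloop_map_src (u : gloop n x) : src (F n.+1 u) = unt_to (leq0n n) (F 0 x).
Proof.
by rewrite -arr_map_src gloop_src; have [_ _ ->] := arr_map_to F (leq0n n).
Qed.

Lemma gloop_map_tgt (u : gloop n x) : tgt (F n.+1 u) = unt_to (leq0n n) (F 0 x).
Proof.
by rewrite -arr_map_tgt gloop_tgt; have [_ _ ->] := arr_map_to F (leq0n n).
Qed.

Definition gloop_map (u : gloop n x) : gloop n (F 0 x) :=
  GLoop (gloop_map_src u) (gloop_map_tgt u).

Definition gpd_pi_map (a : gpd_pi n x) : gpd_pi n (F 0 x) :=
  \pi_(gpd_pi n (F 0 x)) (gloop_map (repr a)).

Lemma gpd_pi_mapE (u : gloop n x) :
  gpd_pi_map (\pi_(gpd_pi n x) u) = \pi_(gpd_pi n (F 0 x)) (gloop_map u).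
Proof.
have [a [as_ at_]] := gpd_repr u.
by apply/gpd_piP; exists (F _ a); rewrite -arr_map_src -arr_map_tgt as_ at_.
Qed.

End GpdPiMap.

Local Open Scope ring_scope.

Section Continuity.

Lemma continuous_within_comp (T U V : topologicalType) (A : set T) (B : set U)
    (p : T -> U) (f : U -> V) : continuous p -> (forall t, A t -> B (p t)) ->
  {within B, continuous f} -> {within A, continuous (f \o p)}.
Proof.
move=> cp AB /subspace_continuousP cf; apply/subspace_continuousP => t At W WB.
have /cp : nbhs (p t) [set s | B s -> W (f s)] by exact: cf (AB _ At) _ WB.
rewrite /= /nbhs /=; apply: (@filterS _ (nbhs t)) => s /= + /AB; apply.
Qed.

Lemma cts_comp (T U V : topologicalType) (p : T -> U) (q : U -> V) :
  continuous p -> continuous q -> continuous (fun t => q (p t)).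
Proof. by move=> cp cq t; apply: (@continuous_comp _ _ _ p q); [exact: cp|exact: cq]. Qed.

Lemma cts_fst (T U : topologicalType) : continuous (@fst T U).
Proof. by move=> z; exact: cvg_fst. Qed.

Lemma cts_snd (T U : topologicalType) : continuous (@snd T U).
Proof. by move=> z; exact: cvg_snd. Qed.

Lemma cts_pair (T U V : topologicalType) (p : T -> U) (q : T -> V) :
  continuous p -> continuous q -> continuous (fun t => (p t, q t)).
Proof. by move=> cp cq t; apply: cvg_pair => /=; [exact: cp|exact: cq]. Qed.

Lemma cts_cst (T U : topologicalType) (a : U) : continuous (fun _ : T => a).
Proof. by move=> t; exact: cvg_cst. Qed.

Lemma cts_id (T : topologicalType) : continuous (fun t : T => t).
Proof. by move=> t; exact: cvg_id. Qed.

Section Arith.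
Context (R : realType) (T : topologicalType).
Implicit Types p q : T -> R.

Lemma cts_add p q : continuous p -> continuous q -> continuous (fun t => p t + q t).
Proof. by move=> cp cq t; apply: cvgD; [exact: cp|exact: cq]. Qed.

Lemma cts_mul p q : continuous p -> continuous q -> continuous (fun t => p t * q t).
Proof. by move=> cp cq t; apply: cvgM; [exact: cp|exact: cq]. Qed.

Lemma cts_aff_id (a b : R) : continuous (fun s : R => a * s + b).
Proof.
move=> s; apply: cvgD; last exact: cvg_cst.
by apply: cvgM; [exact: cvg_cst|exact: cvg_id].
Qed.

Lemma cts_aff_fst (a b : R) : continuous (fun z : R * T => a * z.1 + b).
Proof.
by apply: (@cts_comp _ _ _ fst (fun s : R => a * s + b)); [exact: cts_fst|exact: cts_aff_id].
Qed.

Lemma cts_aff_pair (a b : R) : continuous (fun z : R * T => (a * z.1 + b, z.2)).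
Proof. by apply: cts_pair; [exact: cts_aff_fst|exact: cts_snd]. Qed.

Lemma cts_max p q : continuous p -> continuous q ->
  continuous (fun t => Num.max (p t) (q t)).
Proof. by move=> cp cq t; apply: continuous_max; [exact: cp|exact: cq]. Qed.

Lemma cts_min p q : continuous p -> continuous q ->
  continuous (fun t => Num.min (p t) (q t)).
Proof. by move=> cp cq t; apply: continuous_min; [exact: cp|exact: cq]. Qed.

End Arith.

Lemma closed_preim (T U : topologicalType) (p : T -> U) (D : set U) :
  continuous p -> closed D -> closed (p @^-1` D).
Proof. by move=> cp; apply: preimage_closed => t _; exact: cp. Qed.

Lemma continuous_within_paste (R : realType) (T U : topologicalType)
    (D : set T) (a : T -> R) (c : R) (f g : T -> U) :
  closed D -> continuous a ->
  {within [set t | D t /\ a t <= c], continuous f} ->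
  {within [set t | D t /\ c <= a t], continuous g} ->
  (forall t, D t -> a t = c -> f t = g t) ->
  {within D, continuous (fun t => if a t <= c then f t else g t)}.
Proof.
move=> cD ca cf cg fg.
have -> : D = [set t | D t /\ a t <= c] `|` [set t | D t /\ c <= a t].
  apply/seteqP; split=> [t Dt|t [[]|[]]//].
  by have [ac|/ltW ca'] := leP (a t) c; [left|right].
apply: withinU_continuous.
- apply: closedI => //; apply: (closed_preim ca (@closed_le _ c)).
- apply: closedI => //; apply: (closed_preim ca (@closed_ge _ c)).
- apply: subspace_eq_continuous cf => t; rewrite inE => -[_ ac].
  by rewrite /from_subspace ac.
- apply: subspace_eq_continuous cg => t; rewrite inE => -[Dt ca'].
  rewrite /from_subspace; case: ifPn => // ac; apply/esym/fg => //.
  by apply/eqP; rewrite eq_le ac ca'.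
Qed.

Lemma continuous_row (R : realType) (T : topologicalType) n (p : T -> 'rV[R]_n) :
  (forall i, continuous (fun t => p t ord0 i)) -> continuous p.
Proof.
move=> cp t W [P Pt sW]; apply: (@filterS _ _ _ (fun s => forall i, P ord0 i (p s ord0 i))).
  by move=> s /= Ps; apply: sW => i j; rewrite (ord1 i).
apply: filter_forall => i; exact: cp.
Qed.

End Continuity.

Definition cube (R : realType) n : set 'rV[R]_n :=
  [set t | forall i, 0 <= t ord0 i <= 1].

Definition cube_boundary (R : realType) n : set 'rV[R]_n :=
  [set t | cube t /\ exists i, t ord0 i = 0 \/ t ord0 i = 1].

(* Only the values on the cube matter: two functions which agree on it are
   homotopic. *)
Record tloop (R : realType) (n : nat) (X : topologicalType) (x : X) := TLoop {
  tloop_fun :> 'rV[R]_n -> X;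
  tloop_cts : {within @cube R n, continuous tloop_fun};
  tloop_bd : forall t, cube_boundary t -> tloop_fun t = x
}.

Arguments tloop_cts {R n X x}.

HB.instance Definition _ R n X x := gen_eqMixin (@tloop R n X x).
HB.instance Definition _ R n X x := gen_choiceMixin (@tloop R n X x).

Definition tloop_htpy (R : realType) n (X : topologicalType) (x : X)
    (f g : tloop R n x) :=
  exists H : R * 'rV[R]_n -> X,
  [/\ {within [set z : R * 'rV[R]_n | 0 <= z.1 <= 1 /\ cube z.2], continuous H},
      forall t, cube t -> H (0, t) = f t,
      forall t, cube t -> H (1, t) = g t &
      forall (s : R) t, 0 <= s <= 1 -> cube_boundary t -> H (s, t) = x].

Definition joined (R : realType) (X : topologicalType) (x y : X) :=
  exists p : R -> X,
  [/\ {within [set s : R | 0 <= s <= 1], continuous p}, p 0 = x & p 1 = y].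

Section Closed.
Context (R : realType).

Lemma closed_itv01 (T : topologicalType) (a : T -> R) : continuous a ->
  closed [set t | 0 <= a t <= 1].
Proof.
move=> ca.
have -> : [set t | 0 <= a t <= 1] = (a @^-1` [set x | 0 <= x]) `&` (a @^-1` [set x | x <= 1]).
  by apply/seteqP; split=> [t /andP[]|t /= [-> ->]].
by apply: closedI; apply: closed_preim.
Qed.

Lemma closed_cube (T : topologicalType) n (a : T -> 'rV[R]_n) : continuous a ->
  closed [set t | cube (a t)].
Proof.
move=> ca; have -> : [set t | cube (a t)] =
    \bigcap_(i in setT) [set t | 0 <= (a t : 'rV[R]_n) ord0 i <= 1].
  by apply/seteqP; split=> [t ct i _|t ct i]; [exact: ct|exact: ct].
apply: closed_bigI => i _; apply: (@closed_itv01 _ (fun t => a t ord0 i)).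
exact: (cts_comp ca (@coord_continuous R 1 _ ord0 i)).
Qed.

Lemma closed_itv_cube n :
  closed [set z : R * 'rV[R]_n | 0 <= z.1 <= 1 /\ cube z.2].
Proof.
apply: closedI; first by apply: closed_itv01 => z; exact: cvg_fst.
by apply: closed_cube => z; exact: cvg_snd.
Qed.

Lemma closed_unit_itv : closed [set s : R | 0 <= s <= 1].
Proof. by apply: (@closed_itv01 _ id) => s; exact: cvg_id. Qed.

End Closed.

Section Joined.
Context (R : realType) (X : topologicalType).
Implicit Types x y z : X.

Lemma joined_refl x : joined R x x.
Proof. by exists (cst x); split=> //; apply: continuous_subspaceT => s; exact: cvg_cst. Qed.

Lemma joined_sym x y : joined R x y -> joined R y x.
Proof.
move=> [p [cp <- <-]]; exists (p \o (fun s => -1 * s + 1)); split; rewrite /= ?mulr0 ?add0r ?mulr1 ?addNr//.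
apply: continuous_within_comp cp => [|s /= /andP[s0 s1]]; last by lra.
exact: cts_aff_id.
Qed.

Lemma joined_trans x y z : joined R x y -> joined R y z -> joined R x z.
Proof.
move=> [p [cp p0 p1]] [q [cq q0 q1]].
exists (fun s => if s <= 2^-1 then (p \o (fun s => 2 * s + 0)) s else (q \o (fun s => 2 * s + - 1)) s).
split.
- apply: (@continuous_within_paste _ _ _ _ id) => /=.
  + exact: closed_unit_itv.
  + by move=> s; exact: cvg_id.
  + apply: continuous_within_comp cp => [|s /= [/andP[s0 s1] h]]; last by lra.
    exact: cts_aff_id.
  + apply: continuous_within_comp cq => [|s /= [/andP[s0 s1] h]]; last by lra.
    exact: cts_aff_id.
  + by move=> s _ ->; rewrite divff ?pnatr_eq0// addr0 subrr q0.
- by rewrite invr_ge0 ler0n /= mulr0 addr0.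
- rewrite ifN /=; last by rewrite -ltNge; lra.
  by rewrite (_ : 2 * 1 - 1 = 1 :> R)//; lra.
Qed.

Definition joinedb : rel X := fun x y => `[< joined R x y >].

Lemma joinedb_refl : reflexive joinedb.
Proof. by move=> u; apply/asboolP; exact: joined_refl. Qed.

Lemma joinedb_sym : symmetric joinedb.
Proof. by move=> u v; apply/asboolP/asboolP => /joined_sym. Qed.

Lemma joinedb_trans : transitive joinedb.
Proof.
by move=> v u w /asboolP uv /asboolP vw; apply/asboolP/(joined_trans uv vw).
Qed.

Canonical joined_equiv := EquivRel joinedb joinedb_refl joinedb_sym joinedb_trans.

Definition top_pi0 := {eq_quot joined_equiv}.
HB.instance Definition _ := EqQuotient.on top_pi0.
HB.instance Definition _ := Choice.on top_pi0.

Lemma top_pi0P x y : \pi_top_pi0 x = \pi_top_pi0 y <-> joined R x y.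
Proof. by split=> [/eqmodP/asboolP//|uv]; apply/eqmodP/asboolP. Qed.

End Joined.

Section TopPi0Map.
Context (R : realType) (X Y : topologicalType) (f : continuousType X Y).

Definition top_pi0_map (a : top_pi0 R X) : top_pi0 R Y :=
  \pi_(top_pi0 R Y) (f (repr a)).

Lemma joined_map x y : joined R x y -> joined R (f x) (f y).
Proof.
move=> [p [cp <- <-]]; exists (f \o p); split=> //.
by apply: within_continuous_comp => // t _; exact: cts_fun.
Qed.

Lemma top_pi0_mapE x : top_pi0_map (\pi_(top_pi0 R X) x) = \pi_(top_pi0 R Y) (f x).
Proof. by apply/top_pi0P/joined_map/top_pi0P; rewrite reprK. Qed.

End TopPi0Map.

Section TLoop.
Context (R : realType) (n : nat) (X : topologicalType) (x : X).
Implicit Types f g h : tloop R n x.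

Lemma tloop_htpy_eq f g : (forall t, cube t -> f t = g t) -> tloop_htpy f g.
Proof.
move=> fg; exists (f \o snd); split=> //=.
  apply: continuous_within_comp (tloop_cts f).
    by move=> z; exact: cvg_snd.
  by move=> z [].
by move=> s t _; exact: tloop_bd.
Qed.

Lemma tloop_htpy_refl f : tloop_htpy f f.
Proof. exact: tloop_htpy_eq. Qed.

Lemma tloop_htpy_sym f g : tloop_htpy f g -> tloop_htpy g f.
Proof.
move=> [H [cH H0 H1 Hb]]; exists (H \o (fun z => (-1 * z.1 + 1, z.2))); split=> /=.
- apply: continuous_within_comp cH.
    exact: cts_aff_pair.
  by move=> z /= [/andP[z0 z1] ?]; split=> //; lra.
- by move=> t /H1; rewrite mulr0 add0r.
- by move=> t /H0; rewrite mulr1 addNr.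
- by move=> s t /andP[s0 s1]; apply: Hb; lra.
Qed.

Lemma tloop_htpy_trans f g h : tloop_htpy f g -> tloop_htpy g h -> tloop_htpy f h.
Proof.
move=> [H [cH H0 H1 Hb]] [K [cK K0 K1 Kb]].
exists (fun z => if z.1 <= 2^-1 then (H \o (fun z => (2 * z.1 + 0, z.2))) z
                 else (K \o (fun z => (2 * z.1 + - 1, z.2))) z); split=> /=.
- apply: (@continuous_within_paste _ _ _ _ fst).
  + exact: closed_itv_cube.
  + by move=> z; exact: cvg_fst.
  + apply: continuous_within_comp cH.
      exact: cts_aff_pair.
    by move=> z /= [[/andP[z0 z1] ?] ?]; split=> //; lra.
  + apply: continuous_within_comp cK.
      exact: cts_aff_pair.
    by move=> z /= [[/andP[z0 z1] ?] ?]; split=> //; lra.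
  + move=> [s t] /= [_ ct] ->; rewrite divff ?pnatr_eq0// addr0 subrr.
    by rewrite H1// K0.
- by move=> t ct; rewrite invr_ge0 ler0n mulr0 addr0 H0.
- move=> t ct; rewrite ifN; last by rewrite -ltNge; lra.
  by rewrite (_ : 2 * 1 - 1 = 1 :> R) ?K1//; lra.
- move=> s t /andP[s0 s1] bt; case: ifPn => [s2|]; first by apply: Hb => //; lra.
  by rewrite -ltNge => s2; apply: Kb => //; lra.
Qed.

Definition tloop_htpyb : rel (tloop R n x) := fun u v => `[< tloop_htpy u v >].

Lemma tloop_htpyb_refl : reflexive tloop_htpyb.
Proof. by move=> u; apply/asboolP; exact: tloop_htpy_refl. Qed.

Lemma tloop_htpyb_sym : symmetric tloop_htpyb.
Proof. by move=> u v; apply/asboolP/asboolP => /tloop_htpy_sym. Qed.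

Lemma tloop_htpyb_trans : transitive tloop_htpyb.
Proof.
by move=> v u w /asboolP uv /asboolP vw; apply/asboolP/(tloop_htpy_trans uv vw).
Qed.

Canonical tloop_htpy_equiv :=
  EquivRel tloop_htpyb tloop_htpyb_refl tloop_htpyb_sym tloop_htpyb_trans.

End TLoop.

Section Reparam.
Context (R : realType) (n : nat).
Implicit Types (t : 'rV[R]_n.+1) (a b : R).

Definition set_fst a t : 'rV[R]_n.+1 :=
  \row_j (if j == ord0 then a else t ord0 j).

Lemma continuous_set_fst (T : topologicalType) (p : T -> R)
    (q : T -> 'rV[R]_n.+1) : continuous p -> continuous q ->
  continuous (fun z => set_fst (p z) (q z)).
Proof.
move=> cp cq; apply: continuous_row => i.
have -> : (fun z => set_fst (p z) (q z) ord0 i) =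
    if i == ord0 then p else fun z => q z ord0 i.
  by apply: funext => z; rewrite mxE; case: ifP.
case: ifPn => // _; exact: (cts_comp cq (@coord_continuous R 1 _ ord0 i)).
Qed.

Lemma set_fst_cube a t : 0 <= a <= 1 -> cube t -> cube (set_fst a t).
Proof. by move=> a01 ct i; rewrite mxE; case: ifP. Qed.

Lemma set_fst_bd a t : 0 <= a <= 1 ->
  (t ord0 ord0 = 0 \/ t ord0 ord0 = 1 -> a = 0 \/ a = 1) ->
  cube_boundary t -> cube_boundary (set_fst a t).
Proof.
move=> a01 ta [ct [i ti]]; split; first exact: set_fst_cube.
exists i; rewrite mxE; case: eqP => // i0; apply: ta; by rewrite -i0.
Qed.

Lemma set_fst_bd0 a t : cube t -> a = 0 \/ a = 1 -> cube_boundary (set_fst a t).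
Proof.
move=> ct a01; split; last by exists ord0; rewrite mxE eqxx.
by apply: set_fst_cube => //; case: a01 => ->; rewrite lexx ler01.
Qed.

Lemma set_fstK t : set_fst (t ord0 ord0) t = t.
Proof. by apply/rowP => i; rewrite mxE; case: eqP => [->|]. Qed.

Lemma set_fst0 a t : set_fst a t ord0 ord0 = a.
Proof. by rewrite mxE. Qed.

Lemma set_fst_set a b t : set_fst a (set_fst b t) = set_fst a t.
Proof. by apply/rowP => i; rewrite !mxE; case: eqP. Qed.

Context (X : topologicalType) (x : X).
Implicit Types f g h : tloop R n.+1 x.

Lemma reparam_htpy f (g h : tloop R n.+1 x) (p q : R -> R) :
  continuous p -> continuous q ->
  (forall s : R, 0 <= s <= 1 -> 0 <= p s <= 1) ->
  (forall s : R, 0 <= s <= 1 -> 0 <= q s <= 1) ->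
  p 0 = q 0 -> p 1 = q 1 -> p 0 = 0 \/ p 0 = 1 -> p 1 = 0 \/ p 1 = 1 ->
  (forall t, cube t -> g t = f (set_fst (p (t ord0 ord0)) t)) ->
  (forall t, cube t -> h t = f (set_fst (q (t ord0 ord0)) t)) ->
  tloop_htpy g h.
Proof.
move=> cp cq p01 q01 pq0 pq1 p0 p1 gE hE.
pose r (s a : R) : R := (-1 * s + 1) * p a + s * q a.
have r01 (s a : R) : 0 <= s <= 1 -> 0 <= a <= 1 -> 0 <= r s a <= 1.
  move=> /andP[s0 s1] a01; have /andP[? ?] := p01 _ a01.
  by have /andP[? ?] := q01 _ a01; rewrite /r; apply/andP; split; nra.
exists (f \o (fun z : R * 'rV[R]_n.+1 => set_fst (r z.1 (z.2 ord0 ord0)) z.2)); split=> /=.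
- apply: continuous_within_comp (tloop_cts f); last first.
    by move=> z [z1 z2]; apply: set_fst_cube => //; apply: r01.
  apply: continuous_set_fst; last exact: cts_snd.
  have c2 : continuous (fun z : R * 'rV[R]_n.+1 => z.2 ord0 ord0).
    exact: (cts_comp (@cts_snd _ _) (@coord_continuous R 1 _ ord0 ord0)).
  apply: cts_add; apply: cts_mul.
  + exact: cts_aff_fst.
  + exact: (cts_comp c2 cp).
  + exact: cts_fst.
  + exact: (cts_comp c2 cq).
- by move=> t ct; rewrite gE// /r mulr0 add0r mul1r mul0r addr0.
- by move=> t ct; rewrite hE// /r mulr1 addNr mul1r mul0r add0r.
- move=> s t s01 bt; apply: tloop_bd; apply: set_fst_bd => //.
    by apply: r01 => //; case: bt => ct _; exact: ct.
  have rE (a : R) : p a = q a -> r s a = p a by rewrite /r => <-; ring.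
  by move=> [->|->]; rewrite rE.
Qed.

Lemma continuous_set_affine a b :
  continuous (fun t => set_fst (a * t ord0 ord0 + b) t).
Proof.
apply: continuous_set_fst; last exact: cts_id.
apply: (@cts_comp _ _ _ (fun t : 'rV[R]_n.+1 => t ord0 ord0) (fun s : R => a * s + b)).
  exact: coord_continuous.
exact: cts_aff_id.
Qed.

#[local] Ltac minmax := rewrite ?maxEle ?minEle;
  repeat match goal with |- context [if ?c then _ else _] =>
    lazymatch c with
    | context [if _ then _ else _] => fail
    | _ => case: (boolP c); rewrite -?ltNge => ?
    end
  end; lra.

(* f comes first, whereas in [gloop_mul u v] it is v that comes first. This is
   immaterial when such groups are compared, inversion being a natural
   isomorphism from a group to its opposite. *)
Definition tloop_mul_fun f g (t : 'rV[R]_n.+1) : X :=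
  if t ord0 ord0 <= 2^-1 then f (set_fst (2 * t ord0 ord0 + 0) t)
  else g (set_fst (2 * t ord0 ord0 + - 1) t).

Lemma tloop_mul_cts f g : {within @cube R n.+1, continuous (tloop_mul_fun f g)}.
Proof.
apply: (@continuous_within_paste R _ _ _ (fun t : 'rV[R]_n.+1 => t ord0 ord0)).
- by apply: (@closed_cube R _ n.+1 (fun t => t)); exact: cts_id.
- exact: coord_continuous.
- apply: continuous_within_comp (tloop_cts f) => [|t [ct t2]].
    exact: continuous_set_affine.
  by apply: set_fst_cube => //; have /andP[? ?] := ct ord0; lra.
- apply: continuous_within_comp (tloop_cts g) => [|t [ct t2]].
    exact: continuous_set_affine.
  by apply: set_fst_cube => //; have /andP[? ?] := ct ord0; lra.
- move=> t ct ->; rewrite divff ?pnatr_eq0// addr0 subrr.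
  by rewrite !tloop_bd//; apply: set_fst_bd0 => //; [left|right].
Qed.

Lemma tloop_mul_bd f g t : cube_boundary t -> tloop_mul_fun f g t = x.
Proof.
move=> bt; have ct := bt.1; have /andP[t0 t1] := ct ord0.
rewrite /tloop_mul_fun; case: ifPn => [t2|].
  by rewrite tloop_bd//; apply: set_fst_bd => //; [lra|move=> [] e; move: t2; rewrite e; [left|]; lra].
rewrite -ltNge => t2.
by rewrite tloop_bd//; apply: set_fst_bd => //; [lra|move=> [] e; move: t2; rewrite e; [|right]; lra].
Qed.

Definition tloop_mul f g : tloop R n.+1 x :=
  TLoop (@tloop_mul_cts f g) (@tloop_mul_bd f g).

Definition tloop_inv_fun f (t : 'rV[R]_n.+1) : X :=
  f (set_fst (-1 * t ord0 ord0 + 1) t).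

Lemma tloop_inv_cts f : {within @cube R n.+1, continuous (tloop_inv_fun f)}.
Proof.
apply: continuous_within_comp (tloop_cts f) => [|t ct].
  exact: continuous_set_affine.
by apply: set_fst_cube => //; have /andP[? ?] := ct ord0; lra.
Qed.

Lemma tloop_inv_bd f t : cube_boundary t -> tloop_inv_fun f t = x.
Proof.
move=> bt; have ct := bt.1; have /andP[t0 t1] := ct ord0.
by rewrite /tloop_inv_fun tloop_bd//; apply: set_fst_bd => //; [lra|move=> [] ->; [right|left]; lra].
Qed.

Definition tloop_inv f : tloop R n.+1 x :=
  TLoop (@tloop_inv_cts f) (@tloop_inv_bd f).

Lemma tloop_one_cts : {within @cube R n.+1, continuous (cst x : 'rV[R]_n.+1 -> X)}.
Proof. by apply: continuous_subspaceT; exact: cts_cst. Qed.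

Definition tloop_one : tloop R n.+1 x :=
  @TLoop R n.+1 X x (cst x) tloop_one_cts (fun _ _ => erefl).

Lemma tloop_mul_htpy f f' g g' : tloop_htpy f f' -> tloop_htpy g g' ->
  tloop_htpy (tloop_mul f g) (tloop_mul f' g').
Proof.
move=> [H [cH H0 H1 Hb]] [K [cK K0 K1 Kb]].
have c2 : continuous (fun z : R * 'rV[R]_n.+1 => z.2 ord0 ord0).
  exact: (cts_comp (@cts_snd _ _) (@coord_continuous R 1 _ ord0 ord0)).
have cA a b : continuous (fun z : R * 'rV[R]_n.+1 =>
    (z.1, set_fst (a * z.2 ord0 ord0 + b) z.2)).
  apply: cts_pair; first exact: cts_fst.
  apply: (@cts_comp _ _ _ snd (fun t => set_fst (a * t ord0 ord0 + b) t)).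
    exact: cts_snd.
  exact: continuous_set_affine.
exists (fun z : R * 'rV[R]_n.+1 => if z.2 ord0 ord0 <= 2^-1
  then (H \o (fun z : R * 'rV[R]_n.+1 => (z.1, set_fst (2 * z.2 ord0 ord0 + 0) z.2))) z
  else (K \o (fun z : R * 'rV[R]_n.+1 => (z.1, set_fst (2 * z.2 ord0 ord0 + - 1) z.2))) z); split=> /=.
- apply: (@continuous_within_paste _ _ _ _ (fun z : R * 'rV[R]_n.+1 => z.2 ord0 ord0)) => //.
  + exact: closed_itv_cube.
  + apply: continuous_within_comp cH => [|z /= [[z1 ct] t2]]; first exact: cA.
    by split=> //; apply: set_fst_cube => //; have /andP[? ?] := ct ord0; lra.
  + apply: continuous_within_comp cK => [|z /= [[z1 ct] t2]]; first exact: cA.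
    by split=> //; apply: set_fst_cube => //; have /andP[? ?] := ct ord0; lra.
  + move=> [s t] /= [s01 ct] ->; rewrite divff ?pnatr_eq0// addr0 subrr.
    by rewrite Hb ?Kb//; apply: set_fst_bd0 => //; [left|right].
- move=> t ct; have /andP[t0 t1] := ct ord0; rewrite /tloop_mul_fun.
  case: ifPn => [t2|]; first by apply: H0; apply: set_fst_cube => //; lra.
  by rewrite -ltNge => t2; apply: K0; apply: set_fst_cube => //; lra.
- move=> t ct; have /andP[t0 t1] := ct ord0; rewrite /tloop_mul_fun.
  case: ifPn => [t2|]; first by apply: H1; apply: set_fst_cube => //; lra.
  by rewrite -ltNge => t2; apply: K1; apply: set_fst_cube => //; lra.
- move=> s t s01 bt; have ct := bt.1; have /andP[t0 t1] := ct ord0.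
  case: ifPn => [t2|].
    by apply: Hb => //; apply: set_fst_bd => //; [lra|move=> [] e; move: t2; rewrite e; [left|]; lra].
  rewrite -ltNge => t2.
  by apply: Kb => //; apply: set_fst_bd => //; [lra|move=> [] e; move: t2; rewrite e; [|right]; lra].
Qed.

Lemma tloop_mulA f g h :
  tloop_htpy (tloop_mul f (tloop_mul g h)) (tloop_mul (tloop_mul f g) h).
Proof.
pose k := tloop_mul (tloop_mul f g) h.
pose p (s : R) : R := Num.max (2^-1 * s + 0) (Num.max (1 * s + - 4^-1) (2 * s + - 1)).
have p01 (s : R) : 0 <= s <= 1 -> 0 <= p s <= 1.
  by move=> /andP[? ?]; rewrite /p; minmax.
apply: (@reparam_htpy k _ _ p (fun s => s)) => //.
- apply: cts_max; first exact: cts_aff_id.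
  by apply: cts_max; exact: cts_aff_id.
- exact: cts_id.
- by rewrite /p; minmax.
- by rewrite /p; minmax.
- by left; rewrite /p; minmax.
- by right; rewrite /p; minmax.
- move=> t ct; have /andP[t0 t1] := ct ord0.
  rewrite /k /= /tloop_mul_fun /= /tloop_mul_fun !set_fst0 !set_fst_set.
  move: (t ord0 ord0) t0 t1 => s s0 s1.
  have pE : [\/ s <= 2^-1 /\ p s = 2^-1 * s,
    (2^-1 < s <= 3/4) /\ p s = s - 4^-1 | 3/4 < s /\ p s = 2 * s - 1].
    have [h2|h2] := leP s 2^-1.
      by apply: Or31; split=> //; rewrite /p; minmax.
    have [h3|h3] := leP s (3/4).
      by apply: Or32; split=> //; rewrite /p; minmax.
    by apply: Or33; split=> //; rewrite /p; minmax.
  case: pE => -[hs ->].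
  + rewrite hs ifT; last by lra.
    rewrite ifT; last by lra.
    by congr (f (set_fst _ _)); lra.
  + rewrite ifN; last by rewrite -ltNge; lra.
    rewrite ifT; last by lra.
    rewrite ifT; last by lra.
    rewrite ifN; last by rewrite -ltNge; lra.
    by congr (g (set_fst _ _)); lra.
  + rewrite ifN; last by rewrite -ltNge; lra.
    rewrite ifN; last by rewrite -ltNge; lra.
    rewrite ifN; last by rewrite -ltNge; lra.
    by congr (h (set_fst _ _)); lra.
- by move=> t ct; rewrite set_fstK.
Qed.

Lemma tloop_mul1 f : tloop_htpy (tloop_mul tloop_one f) f.
Proof.
pose p (s : R) : R := Num.max (0 * s + 0) (2 * s + - 1).
apply: (@reparam_htpy f _ _ p (fun s => s)) => //.
- by apply: cts_max; exact: cts_aff_id.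
- exact: cts_id.
- by move=> s /andP[? ?]; rewrite /p; minmax.
- by rewrite /p; minmax.
- by rewrite /p; minmax.
- by left; rewrite /p; minmax.
- by right; rewrite /p; minmax.
- move=> t ct; have /andP[t0 t1] := ct ord0.
  rewrite /= /tloop_mul_fun /=; case: ifPn => [t2|].
    rewrite tloop_bd//; apply: set_fst_bd0 => //; left.
    by rewrite /p; minmax.
  rewrite -ltNge => t2; congr (f (set_fst _ _)).
  by rewrite /p; minmax.
- by move=> t ct; rewrite set_fstK.
Qed.

Lemma tloop_1mul f : tloop_htpy (tloop_mul f tloop_one) f.
Proof.
pose p (s : R) : R := Num.min (2 * s + 0) (0 * s + 1).
apply: (@reparam_htpy f _ _ p (fun s => s)) => //.
- by apply: cts_min; exact: cts_aff_id.
- exact: cts_id.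
- by move=> s /andP[? ?]; rewrite /p; minmax.
- by rewrite /p; minmax.
- by rewrite /p; minmax.
- by left; rewrite /p; minmax.
- by right; rewrite /p; minmax.
- move=> t ct; have /andP[t0 t1] := ct ord0.
  rewrite /= /tloop_mul_fun /=; case: ifPn => [t2|].
    congr (f (set_fst _ _)).
    by rewrite /p; minmax.
  rewrite -ltNge => t2; rewrite tloop_bd//; apply: set_fst_bd0 => //; right.
  by rewrite /p; minmax.
- by move=> t ct; rewrite set_fstK.
Qed.

Lemma tloop_Vmul f : tloop_htpy (tloop_mul (tloop_inv f) f) tloop_one.
Proof.
pose p (s : R) : R := Num.max (2 * s + - 1) (- 2 * s + 1).
apply: (@reparam_htpy f _ _ p (fun s : R => 0 * s + 1)) => //.
- by apply: cts_max; exact: cts_aff_id.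
- exact: cts_aff_id.
- by move=> s /andP[? ?]; rewrite /p; minmax.
- by move=> s /andP[? ?]; lra.
- by rewrite /p; minmax.
- by rewrite /p; minmax.
- by right; rewrite /p; minmax.
- by right; rewrite /p; minmax.
- move=> t ct; have /andP[t0 t1] := ct ord0.
  rewrite /= /tloop_mul_fun /= /tloop_inv_fun set_fst0 set_fst_set.
  case: ifPn => [t2|].
    congr (f (set_fst _ _)).
    by rewrite /p; minmax.
  rewrite -ltNge => t2; congr (f (set_fst _ _)).
  by rewrite /p; minmax.
- by move=> t ct; rewrite /= tloop_bd//; apply: set_fst_bd0 => //; right; lra.
Qed.

Lemma tloop_mulV f : tloop_htpy (tloop_mul f (tloop_inv f)) tloop_one.
Proof.
pose p (s : R) : R := Num.min (2 * s + 0) (- 2 * s + 2).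
apply: (@reparam_htpy f _ _ p (fun s : R => 0 * s + 0)) => //.
- by apply: cts_min; exact: cts_aff_id.
- exact: cts_aff_id.
- by move=> s /andP[? ?]; rewrite /p; minmax.
- by move=> s /andP[? ?]; lra.
- by rewrite /p; minmax.
- by rewrite /p; minmax.
- by left; rewrite /p; minmax.
- by left; rewrite /p; minmax.
- move=> t ct; have /andP[t0 t1] := ct ord0.
  rewrite /= /tloop_mul_fun /= /tloop_inv_fun set_fst0 set_fst_set.
  case: ifPn => [t2|].
    congr (f (set_fst _ _)).
    by rewrite /p; minmax.
  rewrite -ltNge => t2; congr (f (set_fst _ _)).
  by rewrite /p; minmax.
- by move=> t ct; rewrite /= tloop_bd//; apply: set_fst_bd0 => //; left; lra.
Qed.

End Reparam.

Section TopPi.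
Context (R : realType) (n : nat) (X : topologicalType) (x : X).
Implicit Types f g h : tloop R n.+1 x.

(* The group pi_{n+1}(X, x). *)
Definition top_pi := {eq_quot tloop_htpy_equiv R n.+1 x}.
HB.instance Definition _ := EqQuotient.on top_pi.
HB.instance Definition _ := Choice.on top_pi.

Lemma top_piP f g : \pi_top_pi f = \pi_top_pi g <-> tloop_htpy f g.
Proof. by split=> [/eqmodP/asboolP//|uv]; apply/eqmodP/asboolP. Qed.

Lemma top_repr f : tloop_htpy (repr (\pi_top_pi f)) f.
Proof. by apply/top_piP; rewrite reprK. Qed.

Definition top_pi_one : top_pi := \pi_top_pi (tloop_one R n x).
Definition top_pi_mul (a b : top_pi) : top_pi :=
  \pi_top_pi (tloop_mul (repr a) (repr b)).
Definition top_pi_inv (a : top_pi) : top_pi := \pi_top_pi (tloop_inv (repr a)).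

Lemma top_pi_mulE f g :
  top_pi_mul (\pi_top_pi f) (\pi_top_pi g) = \pi_top_pi (tloop_mul f g).
Proof. by apply/top_piP/tloop_mul_htpy; exact: top_repr. Qed.

Lemma top_pi_mulA : associative top_pi_mul.
Proof.
move=> a b c; elim/quotW: a => f; elim/quotW: b => g; elim/quotW: c => h.
rewrite (top_pi_mulE g h) (top_pi_mulE f g) !top_pi_mulE.
by apply/top_piP/tloop_mulA.
Qed.

Lemma top_pi_mul1g : left_id top_pi_one top_pi_mul.
Proof. by elim/quotW=> f; rewrite top_pi_mulE; apply/top_piP/tloop_mul1. Qed.

Lemma top_pi_mulg1 : right_id top_pi_one top_pi_mul.
Proof. by elim/quotW=> f; rewrite top_pi_mulE; apply/top_piP/tloop_1mul. Qed.

Lemma top_pi_mulVg : left_inverse top_pi_one top_pi_inv top_pi_mul.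
Proof.
move=> a; rewrite -[X in top_pi_mul _ X]reprK top_pi_mulE.
by apply/top_piP/tloop_Vmul.
Qed.

Lemma top_pi_mulgV : right_inverse top_pi_one top_pi_inv top_pi_mul.
Proof.
move=> a; rewrite -[X in top_pi_mul X _]reprK top_pi_mulE.
by apply/top_piP/tloop_mulV.
Qed.

HB.instance Definition _ := isGroup.Build top_pi top_pi_mulA
  top_pi_mul1g top_pi_mulg1 top_pi_mulVg top_pi_mulgV.

End TopPi.

Section TopPiMap.
Context (R : realType) (n : nat) (X Y : topologicalType).
Context (f : continuousType X Y) (x : X) (y : Y) (fxy : f x = y).

Lemma tloop_map_cts m (u : tloop R m x) : {within @cube R m, continuous (f \o u)}.
Proof.
apply: within_continuous_comp (tloop_cts u).
by move=> t _; exact: cts_fun.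
Qed.

Lemma tloop_map_bd m (u : tloop R m x) t : cube_boundary t -> (f \o u) t = y.
Proof. by move=> bt; rewrite /= tloop_bd. Qed.

Definition tloop_map m (u : tloop R m x) : tloop R m y :=
  TLoop (@tloop_map_cts m u) (@tloop_map_bd m u).

(* The map induced on pi_{n+1} by the pointed map f : (X, x) -> (Y, y). *)
Definition top_pi_map (a : top_pi R n x) : top_pi R n y :=
  \pi_(top_pi R n y) (tloop_map (repr a)).

Lemma top_pi_mapE (u : tloop R n.+1 x) :
  top_pi_map (\pi_(top_pi R n x) u) = \pi_(top_pi R n y) (tloop_map u).
Proof.
have [H [cH H0 H1 Hb]] := top_repr u; apply/top_piP.
exists (f \o H); split=> /=.
- by apply: within_continuous_comp cH => t _; exact: cts_fun.
- by move=> t /H0 ->.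
- by move=> t /H1 ->.
- by move=> s t s01 bt; rewrite Hb.
Qed.

End TopPiMap.

Definition ccomp (X Y Z : topologicalType) (g : continuousType Y Z)
  (f : continuousType X Y) : continuousType X Z := g \o f.

Definition cid_map (X : topologicalType) : continuousType X X := @idfun X.

Definition weak_equiv (R : realType) (X Y : topologicalType)
    (f : continuousType X Y) :=
  bijective (@top_pi0_map R X Y f) /\
  forall n (x : X), bijective (@top_pi_map R n X Y f x (f x) erefl).

(* The Gabriel-Zisman localization Hot of Top at the weak homotopy
   equivalences, by generators and relations. Its objects are those of Top; its
   morphisms are the words in the continuous maps and in the formal inverses of
   the weak equivalences, modulo the least congruence [hot_eq] which makes them
   a category, makes [hot_loc] a functor, and makes [hot_inv we] inverse to
   [hot_loc w]. *)
Inductive hot_word (R : realType) : topologicalType -> topologicalType -> Type :=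
| hot_loc (X Y : topologicalType) (f : continuousType X Y) : hot_word R X Y
| hot_inv (X Y : topologicalType) (w : continuousType X Y) (we : weak_equiv R w) : hot_word R Y X
| hot_comp (X Y Z : topologicalType) (b : hot_word R Y Z) (a : hot_word R X Y) : hot_word R X Z.

Arguments hot_loc R {X Y}.
Arguments hot_inv {R X Y w}.
Arguments hot_comp {R X Y Z}.

Definition hot_id (R : realType) (X : topologicalType) : hot_word R X X :=
  hot_loc R (cid_map X).

Inductive hot_eq (R : realType) :
    forall X Y, hot_word R X Y -> hot_word R X Y -> Prop :=
| hot_eq_refl (X Y : topologicalType) (a : hot_word R X Y) : hot_eq a a
| hot_eq_sym (X Y : topologicalType) (a b : hot_word R X Y) : hot_eq a b -> hot_eq b a
| hot_eq_trans (X Y : topologicalType) (a b c : hot_word R X Y) :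
    hot_eq a b -> hot_eq b c -> hot_eq a c
| hot_eq_comp (X Y Z : topologicalType) (b b' : hot_word R Y Z) (a a' : hot_word R X Y) :
    hot_eq b b' -> hot_eq a a' -> hot_eq (hot_comp b a) (hot_comp b' a')
| hot_compA (X Y Z W : topologicalType) (c : hot_word R Z W) (b : hot_word R Y Z)
    (a : hot_word R X Y) :
    hot_eq (hot_comp c (hot_comp b a)) (hot_comp (hot_comp c b) a)
| hot_comp1 (X Y : topologicalType) (a : hot_word R X Y) : hot_eq (hot_comp a (hot_id R X)) a
| hot_1comp (X Y : topologicalType) (a : hot_word R X Y) : hot_eq (hot_comp (hot_id R Y) a) a
| hot_loc_comp (X Y Z : topologicalType) (g : continuousType Y Z) (f : continuousType X Y) :
    hot_eq (hot_loc R (ccomp g f)) (hot_comp (hot_loc R g) (hot_loc R f))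
| hot_invK (X Y : topologicalType) (w : continuousType X Y) (we : weak_equiv R w) :
    hot_eq (hot_comp (hot_inv we) (hot_loc R w)) (hot_id R X)
| hot_locK (X Y : topologicalType) (w : continuousType X Y) (we : weak_equiv R w) :
    hot_eq (hot_comp (hot_loc R w) (hot_inv we)) (hot_id R Y).

Definition hot_iso (R : realType) (X Y : topologicalType) :=
  exists (a : hot_word R X Y) (b : hot_word R Y X),
    hot_eq (hot_comp b a) (hot_id R X) /\ hot_eq (hot_comp a b) (hot_id R Y).

Definition path_connected (R : realType) (X : topologicalType) :=
  (exists x : X, True) /\ forall x y : X, joined R x y.

Definition simply_connected (R : realType) (X : topologicalType) :=
  path_connected R X /\ forall (x : X) (a : top_pi R 0 x), a = 1%g.

(* In a K(A, n), "connected" means pi_0 trivial, i.e. path-connected. *)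
Definition is_EilenbergMacLane (R : realType) (A : groupType) (n : nat)
    (X : topologicalType) :=
  [/\ (0 < n)%N,
      (2 <= n)%N -> forall a b : A, (a * b = b * a)%g,
      path_connected R X,
      forall m (x : X), m.+1 = n ->
        exists phi : {multiplicative A -> top_pi R m x}, bijective phi &
      forall m (x : X), m.+1 <> n -> forall a : top_pi R m x, a = 1%g].

Record gpd_realization := GpdRealization {
  real_obj :> infGpd -> topologicalType;
  real_map : forall G H : infGpd, infFunctor G H ->
    continuousType (real_obj G) (real_obj H);
  real_id : forall G : infGpd,
    real_map (infFunctor_id G) = cid_map (real_obj G);
  real_comp : forall (G H K : infGpd) (F' : infFunctor H K)
    (F : infFunctor G H),
    real_map (infFunctor_comp F' F) = ccomp (real_map F') (real_map F)
}.
Arguments real_map _ {G H}.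

Record simpson_realization (R : realType) := SimpsonRealization {
  simpson_functor :> gpd_realization;
  simpson_pt : forall G : infGpd, arr G 0 -> simpson_functor G;
  simpson_pt_nat : forall (G H : infGpd) (F : infFunctor G H) (x : arr G 0),
    real_map simpson_functor F (simpson_pt x) = simpson_pt (F 0%N x);
  simpson_pi0 : forall G : infGpd,
    exists phi : gpd_pi0 G -> top_pi0 R (simpson_functor G),
      (forall x : arr G 0, phi (\pi_(gpd_pi0 G) x) =
         \pi_(top_pi0 R (simpson_functor G)) (simpson_pt x)) /\
      bijective phi;
  simpson_pi : forall (n : nat) (G : infGpd) (x : arr G 0),
    {multiplicative gpd_pi n x -> top_pi R n (simpson_pt x)};
  simpson_pi_bij : forall (n : nat) (G : infGpd) (x : arr G 0),
    bijective (@simpson_pi n G x);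
  simpson_pi_nat : forall (n : nat) (G H : infGpd) (F : infFunctor G H)
    (x : arr G 0) (a : gpd_pi n x),
    simpson_pi n (F 0%N x) (gpd_pi_map F a) =
    top_pi_map (simpson_pt_nat F x) (simpson_pi n x a)
}.

(* Main.v *)
Require Import Defs.
From HB Require Import structures.
From mathcomp Require Import all_boot all_order all_algebra.
From mathcomp Require Import generic_quotient perm algC cyclotomic.
From mathcomp Require Import all_classical all_reals all_analysis.
From mathcomp Require Import ring lra zify.

Set Implicit Arguments.
Unset Strict Implicit.
Unset Printing Implicit Defensive.

Import Order.TTheory GRing.Theory Num.Theory.
Import numFieldNormedType.Exports.

Local Open Scope classical_set_scope.
Local Open Scope quotient_scope.
Local Open Scope ring_scope.

(* Let Q(G) be simply connected. The arrows of G which are trivial in dimensions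
   0 and 1 form a strict oo-groupoid with the same homotopy groups, and by
   Eckmann-Hilton it consists of abelian groups, i.e. it is a chain complex W.
   For each n, the group of (n+1)-chains modulo boundaries embeds in a divisible
   group D; with E the quotient of D by the homology, which is divisible again,
   one gets a map from W to the two-term complex D -> E which is an isomorphism
   on pi_{n+1}. Together these maps give a weak equivalence from Q(W) to a
   product of Eilenberg-Mac Lane spaces.

   Conversely, if a product of spaces K(A_i, n_i) is simply connected, then
   the A_i are abelian and the chain complexes A_i[n_i] have realizations of the
   same type, so it is enough to know that two Eilenberg-Mac Lane spaces Z and
   Z' with the same group are connected by a span of weak equivalences. Its apex
   is a space over Z * Z', obtained from a point by attaching cells, such that
   the image of its n-th homotopy group is the graph of an isomorphism. Attaching
   n-cells could produce too large an image: that it does not follows by deforming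
   an n-sphere, by means of a simplicial approximation, until it splits along
   hyperplanes into pieces, each of which is an affine copy of an attached cell.

   Simple connectivity makes sense in Hot because a word in maps and formal
   inverses of weak equivalences acts as a relation on free homotopy classes of
   loops. *)

(** * Cubes, spheres and their homotopy classes *)

(** The crux is [cls_critical]: if cells of dimension n + 1 are attached to a space that is sent to
    the base point, every sphere of that dimension has its class generated by those of the cells. A
    sphere has to be cut into pieces inside the homotopy group, so the cuts follow hyperplanes whose
    equations decrease in the first coordinate, the one used by the multiplication: each cut is then
    a product. A path of invertible matrices deforms the linear part of a piece to the identity or a
    reflection, and a reflection inverts the class, so closure under inverses replaces any
    bookkeeping of orientations.

    A chain complex need not map to its homology placed in one degree, as homology classes are
    defined on cycles only. The complex D -> E is an injective resolution of the homology group: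
    injectivity of D and E extends the map to all chains, and surjectivity of q leaves a single
    homotopy group.

    Indices are shifted throughout: [top_pi R n] and [gpd_pi n] are the groups of dimension n +
    1. *)

Lemma cts_near (T U : topologicalType) (f g : T -> U) (t : T) :
  (\forall s \near t, g s = f s) -> {for t, continuous g} -> {for t, continuous f}.
Proof.
move=> fg cg A fA; have gt : g t = f t by exact: nbhs_singleton fg.
have : nbhs t (g @^-1` A) by apply: cg; rewrite gt.
by apply: filterS2 fg => s /= ->.
Qed.

Lemma cts_open (T U : topologicalType) (f : T -> U) :
  continuous f <-> forall A, open A -> open (f @^-1` A).
Proof. by split=> [/continuousP//|h]; apply/continuousP. Qed.

Lemma open_preim (T U : topologicalType) (f : T -> U) (A : set U) :
  continuous f -> open A -> open (f @^-1` A).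
Proof. by move=> /cts_open; apply. Qed.

Lemma open_finI (T : topologicalType) (I : finType) (A : I -> set T) :
  (forall i, open (A i)) -> open [set x | forall i, A i x].
Proof.
move=> oA; rewrite openE => x hx; rewrite /interior.
have : \forall y \near x, forall i, A i y.
  by apply: filter_forall => i; apply: open_nbhs_nbhs; split=> //; exact: hx.
by [].
Qed.

Lemma cts_closed (T U : topologicalType) (f : T -> U) :
  continuous f <-> forall A, closed A -> closed (f @^-1` A).
Proof. by split=> [/continuous_closedP//|h]; apply/continuous_closedP. Qed.

Lemma cts_if (R : realType) (T U : topologicalType) (a : T -> R) (f g : T -> U) :
  continuous a -> continuous f -> continuous g ->
  (forall t, a t = 0 -> f t = g t) ->
  continuous (fun t => if a t <= 0 then f t else g t).
Proof.
move=> ca cf cg fg; apply/continuous_subspace_setT.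
apply: (@continuous_within_paste R T U setT a 0 f g closedT ca).
- exact: continuous_subspaceT.
- exact: continuous_subspaceT.
- by move=> t _; exact: fg.
Qed.

Lemma cts_within_total (T U V : topologicalType) (A : set U) (p : T -> U) (f : U -> V) :
  continuous p -> (forall t, A (p t)) -> {within A, continuous f} ->
  continuous (fun t => f (p t)).
Proof.
move=> cp Ap cf; apply/continuous_subspace_setT.
by apply: (@continuous_within_comp _ _ _ setT A p f) => // t _; exact: Ap.
Qed.

Lemma cts_bigmax (R : realType) (T : topologicalType) I (r : seq I) (f : I -> T -> R) :
  (forall i, continuous (f i)) ->
  continuous (fun t => \big[Num.max/0]_(i <- r) f i t).
Proof.
move=> cf; elim: r => [|i r IHr].
  by rewrite (_ : (fun t => _) = cst 0); [exact: cts_cst|apply: funext => t; rewrite big_nil].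
rewrite (_ : (fun t => _) = fun t => Num.max (f i t) (\big[Num.max/0]_(j <- r) f j t)).
  exact: cts_max.
by apply: funext => t; rewrite big_cons.
Qed.

Lemma cts_sum (R : realType) (T : topologicalType) I (r : seq I) (P : pred I) (f : I -> T -> R) :
  (forall i, continuous (f i)) ->
  continuous (fun t => \sum_(i <- r | P i) f i t).
Proof.
move=> cf; elim: r => [|i r IHr].
  by rewrite (_ : (fun t => _) = cst 0); [exact: cts_cst|apply: funext => t; rewrite big_nil].
have [Pi|Pi] := boolP (P i); last first.
  by rewrite (_ : (fun t => _) = fun t => \sum_(i <- r | P i) f i t)//;
     apply: funext => t; rewrite big_cons (negbTE Pi).
rewrite (_ : (fun t => _) = fun t => f i t + \sum_(j <- r | P j) f j t); first exact: cts_add.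
by apply: funext => t; rewrite big_cons Pi.
Qed.

Lemma cts_prod (R : realType) (T : topologicalType) I (r : seq I) (f : I -> T -> R) :
  (forall i, continuous (f i)) ->
  continuous (fun t => \prod_(i <- r) f i t).
Proof.
move=> cf; elim: r => [|i r IHr].
  by rewrite (_ : (fun t => _) = cst 1); [exact: cts_cst|apply: funext => t; rewrite big_nil].
rewrite (_ : (fun t => _) = fun t => f i t * \prod_(j <- r) f j t); first exact: cts_mul.
by apply: funext => t; rewrite big_cons.
Qed.

Lemma cts_opp (R : realType) (T : topologicalType) (p : T -> R) :
  continuous p -> continuous (fun t => - p t).
Proof.
move=> cp; rewrite (_ : (fun t => _) = fun t => -1 * p t); last by apply: funext => t; ring.
by apply: cts_mul cp; exact: cts_cst.
Qed.

Lemma cts_sub (R : realType) (T : topologicalType) (p q : T -> R) :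
  continuous p -> continuous q -> continuous (fun t => p t - q t).
Proof. by move=> cp cq; apply: cts_add => //; exact: cts_opp. Qed.

Lemma cts_coord (R : realType) (T : topologicalType) n (p : T -> 'rV[R]_n) i :
  continuous p -> continuous (fun t => p t ord0 i).
Proof. move=> cp; exact: (cts_comp cp (@coord_continuous R 1 _ ord0 i)). Qed.

Lemma cts_inv (R : realType) (T : topologicalType) (p : T -> R) :
  continuous p -> (forall t, p t != 0) -> continuous (fun t => (p t)^-1).
Proof. by move=> cp p0 t; apply: cvgV; [exact: p0|exact: cp]. Qed.

Lemma cts_norm (R : realType) (T : topologicalType) n (p : T -> 'rV[R]_n) :
  continuous p -> continuous (fun t => `|p t|).
Proof.
move=> cp; apply: (cts_comp cp); exact: norm_continuous.
Qed.

Lemma cts_scale (R : realType) (T : topologicalType) n (a : T -> R) (p : T -> 'rV[R]_n) :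
  continuous a -> continuous p -> continuous (fun t => a t *: p t).
Proof.
move=> ca cp; apply: continuous_row => i.
rewrite (_ : (fun t => _) = fun t => a t * p t ord0 i); last by apply: funext => t; rewrite mxE.
by apply: cts_mul => //; exact: cts_coord.
Qed.

Lemma cts_addv (R : realType) (T : topologicalType) n (p q : T -> 'rV[R]_n) :
  continuous p -> continuous q -> continuous (fun t => p t + q t).
Proof.
move=> ca cp; apply: continuous_row => i.
rewrite (_ : (fun t => _) = fun t => p t ord0 i + q t ord0 i); last by apply: funext => t; rewrite mxE.
by apply: cts_add => //; exact: cts_coord.
Qed.

Lemma norm_rV_le (R : realType) n (x : 'rV[R]_n) (c : R) : 0 <= c ->
  (`|x| <= c) <-> (forall i, `|x ord0 i| <= c).
Proof.
move=> c0; split=> [xc i|h].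
  apply: le_trans xc; rewrite [X in _ <= X]/Num.norm /= mx_normrE.
  by apply: (le_bigmax _ (fun ij : 'I_1 * 'I_n => `|x ij.1 ij.2|) (ord0, i)).
rewrite /Num.norm /= mx_normrE; apply: bigmax_le => // -[i j] _ /=.
by rewrite (ord1 i).
Qed.

Lemma coord_le_norm (R : realType) n (x : 'rV[R]_n) i : `|x ord0 i| <= `|x|.
Proof. exact: ((norm_rV_le x (normr_ge0 x)).1 (lexx _) i). Qed.

Lemma norm_rV_lt (R : realType) n (x : 'rV[R]_n) (c : R) : 0 < c ->
  (`|x| < c) <-> (forall i, `|x ord0 i| < c).
Proof.
move=> c0; split=> [xc i|h].
  exact: le_lt_trans (coord_le_norm _ _) xc.
by rewrite /Num.norm /= mx_normrE; apply/bigmax_ltP; split=> // -[i j] _; rewrite (ord1 i) /=.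
Qed.

Lemma norm_rV_ge (R : realType) n (x : 'rV[R]_n) (c : R) : 0 < c ->
  c <= `|x| -> exists i, c <= `|x ord0 i|.
Proof.
move=> c0 cx; apply/not_existsP => h.
have /norm_rV_lt : forall i, `|x ord0 i| < c.
  by move=> i; rewrite ltNge; apply/negP => ci; apply: (h i).
by move=> /(_ c0); rewrite ltNge cx.
Qed.

(** * Retractions onto the interval and the cube, which make maps on the cube total *)

Section Clamp.
Context (R : realType).

Definition clamp (s : R) : R := Num.max 0 (Num.min 1 s).

Lemma clamp_ge0 s : 0 <= clamp s. Proof. by rewrite /clamp le_max lexx. Qed.
Lemma clamp_le1 s : clamp s <= 1.
Proof. by rewrite /clamp ge_max ler01 ge_min lexx. Qed.
Lemma clamp01 s : 0 <= clamp s <= 1. Proof. by rewrite clamp_ge0 clamp_le1. Qed.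
Lemma clamp_id s : 0 <= s <= 1 -> clamp s = s.
Proof. by move=> /andP[s0 s1]; rewrite /clamp min_r// max_r. Qed.
Lemma clamp_le0 s : s <= 0 -> clamp s = 0.
Proof. by move=> s0; rewrite /clamp min_r ?max_l// (le_trans s0). Qed.
Lemma clamp_ge1 s : 1 <= s -> clamp s = 1.
Proof. by move=> s0; rewrite /clamp min_l// max_r. Qed.
Lemma clamp0 : clamp 0 = 0. Proof. exact: clamp_le0. Qed.
Lemma clamp1 : clamp 1 = 1. Proof. exact: clamp_ge1. Qed.

Lemma cts_clamp (T : topologicalType) (p : T -> R) : continuous p ->
  continuous (fun t => clamp (p t)).
Proof.
move=> cp; apply: cts_max; first exact: cts_cst.
by apply: cts_min => //; exact: cts_cst.
Qed.

Definition clampv n (t : 'rV[R]_n) : 'rV[R]_n := \row_i clamp (t ord0 i).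

Lemma clampv_cube n (t : 'rV[R]_n) : cube (clampv t).
Proof. by move=> i; rewrite mxE clamp01. Qed.

Lemma clampv_id n (t : 'rV[R]_n) : cube t -> clampv t = t.
Proof. by move=> ct; apply/rowP => i; rewrite mxE clamp_id. Qed.

Lemma cts_clampv (T : topologicalType) n (p : T -> 'rV[R]_n) : continuous p ->
  continuous (fun t => clampv (p t)).
Proof.
move=> cp; apply: continuous_row => i.
rewrite (_ : (fun t => _) = fun t => clamp (p t ord0 i)); last by apply: funext => t; rewrite mxE.
by apply: cts_clamp; exact: cts_coord.
Qed.

Definition ocube n : set 'rV[R]_n := [set t | forall i, 0 < t ord0 i < 1].
Arguments ocube n : clear implicits.

Lemma ocube_cube n (t : 'rV[R]_n) : ocube n t -> cube t.
Proof. by move=> ot i; have /andP[/ltW -> /ltW ->] := ot i. Qed.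

Lemma ocube_boundary n (t : 'rV[R]_n) : cube_boundary t -> ~ ocube n t.
Proof. by move=> [_ [i [e|e]]] /(_ i); rewrite e ltxx ?andbF. Qed.

Lemma not_ocube n (t : 'rV[R]_n) : ~ ocube n t -> cube_boundary (clampv t).
Proof.
move=> h; split; first exact: clampv_cube.
have [i ti] : exists i, ~ (0 < t ord0 i < 1) by apply/existsNP.
exists i; rewrite mxE; have [t0|t0] := leP (t ord0 i) 0; first by left; exact: clamp_le0.
have [t1|t1] := leP 1 (t ord0 i); first by right; exact: clamp_ge1.
by exfalso; apply: ti; rewrite t0 t1.
Qed.

End Clamp.
Arguments ocube {R} n.

Section Sph.
Context (R : realType) (n : nat) (X : topologicalType) (x : X).
Implicit Types f g h : 'rV[R]_n -> X.

(* Total representatives of the maps of pairs (cube, boundary) -> (X, x). *)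
Definition is_sph f := continuous f /\ forall t, ~ ocube n t -> f t = x.

Definition htp f g := exists H : R * 'rV[R]_n -> X,
  [/\ continuous H, forall t, H (0, t) = f t, forall t, H (1, t) = g t &
      forall s t, ~ ocube n t -> H (s, t) = x].

Lemma sph_tloop_cts f : is_sph f -> {within @cube R n, continuous f}.
Proof. by move=> [cf _]; exact: continuous_subspaceT. Qed.

Lemma sph_tloop_bd f : is_sph f -> forall t, cube_boundary t -> f t = x.
Proof. by move=> [_ h] t /ocube_boundary; exact: h. Qed.

Definition to_tloop f (hf : is_sph f) : tloop R n x :=
  TLoop (sph_tloop_cts hf) (sph_tloop_bd hf).

Definition of_tloop (u : tloop R n x) : 'rV[R]_n -> X := fun t => u (clampv t).

Lemma of_tloop_sph u : is_sph (of_tloop u).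
Proof.
split=> [|t /not_ocube/tloop_bd]; last by apply.
apply: cts_within_total (tloop_cts u) => [|t]; last exact: clampv_cube.
by apply: cts_clampv; exact: cts_id.
Qed.

Lemma cst_sph : is_sph (fun _ => x).
Proof. by split=> //; exact: cts_cst. Qed.

Lemma sph_clamp f t : is_sph f -> f (clampv t) = f t.
Proof.
move=> [_ h]; have [/ocube_cube/clampv_id -> //|ot] := pselect (ocube n t).
by rewrite !h//; exact/ocube_boundary/not_ocube.
Qed.

Lemma to_tloop_htpy f g (hf : is_sph f) (hg : is_sph g) :
  tloop_htpy (to_tloop hf) (to_tloop hg) <-> htp f g.
Proof.
split=> [[H [cH H0 H1 Hb]]|[H [cH H0 H1 Hb]]].
  exists (fun z => H (clamp z.1, clampv z.2)); split=> /=.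
  - apply: (@cts_within_total _ _ _ _ (fun z : R * 'rV[R]_n => (clamp z.1, clampv z.2)) H _ _ cH).
      by apply: cts_pair; [apply: cts_clamp; exact: cts_fst|apply: cts_clampv; exact: cts_snd].
    by move=> z /=; split; [exact: clamp01|exact: clampv_cube].
  - by move=> t; rewrite clamp0 H0 /= ?(sph_clamp _ hf)//; exact: clampv_cube.
  - by move=> t; rewrite clamp1 H1 /= ?(sph_clamp _ hg)//; exact: clampv_cube.
  - by move=> s t /not_ocube bt; apply: Hb => //; exact: clamp01.
exists H; split=> //=.
- exact: continuous_subspaceT.
- by move=> s t _ /ocube_boundary; exact: Hb.
Qed.

Lemma of_tloopK u (h : is_sph (of_tloop u)) : tloop_htpy (to_tloop h) u.
Proof. by apply: tloop_htpy_eq => t ct; rewrite /= /of_tloop clampv_id. Qed.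

Lemma htp_refl f : is_sph f -> htp f f.
Proof.
move=> [cf hf]; exists (f \o snd); split=> //=.
exact: (cts_comp (@cts_snd _ _) cf).
Qed.

Lemma htp_sph f g : htp f g -> is_sph f /\ is_sph g.
Proof.
move=> [H [cH H0 H1 Hb]]; split; split.
- rewrite (_ : f = fun t => H (0, t)); last by apply: funext.
  apply: (@cts_comp _ _ _ (fun t : 'rV[R]_n => (0 : R, t)) H) => //.
  by apply: cts_pair; [exact: cts_cst|exact: cts_id].
- by move=> t /Hb; rewrite -H0; apply.
- rewrite (_ : g = fun t => H (1, t)); last by apply: funext.
  apply: (@cts_comp _ _ _ (fun t : 'rV[R]_n => (1 : R, t)) H) => //.
  by apply: cts_pair; [exact: cts_cst|exact: cts_id].
- by move=> t /Hb; rewrite -H1; apply.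
Qed.

Lemma htp_sym f g : htp f g -> htp g f.
Proof.
move=> fg; have [hf hg] := htp_sph fg.
by apply/(to_tloop_htpy hg hf)/tloop_htpy_sym/to_tloop_htpy.
Qed.

Lemma htp_trans f g h : htp f g -> htp g h -> htp f h.
Proof.
move=> fg gh; have [hf hg] := htp_sph fg; have [_ hh] := htp_sph gh.
apply/(to_tloop_htpy hf hh); apply: (@tloop_htpy_trans _ _ _ _ _ (to_tloop hg)).
  exact/to_tloop_htpy.
exact/to_tloop_htpy.
Qed.

End Sph.

Section Pi.
Context (R : realType) (n : nat) (X : topologicalType) (x : X).
Implicit Types f g h : 'rV[R]_n.+1 -> X.

(** The value 1 on maps that are not spheres is a default. It makes [cls] total, so that classes can
    be rewritten without carrying a proof of [is_sph]. *)
Definition cls f : top_pi R n x :=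
  if pselect (is_sph x f) is left h then \pi_(top_pi R n x) (to_tloop h) else 1%g.

Lemma cls_to f (h : is_sph x f) : cls f = \pi_(top_pi R n x) (to_tloop h).
Proof. by rewrite /cls; case: pselect => // h'; congr \pi; congr TLoop; exact: Prop_irrelevance. Qed.

Lemma clsP f g : is_sph x f -> is_sph x g -> (cls f = cls g <-> htp x f g).
Proof.
by move=> hf hg; rewrite !cls_to; rewrite top_piP; exact: to_tloop_htpy.
Qed.

Lemma cls_of (u : tloop R n.+1 x) : cls (of_tloop u) = \pi_(top_pi R n x) u.
Proof. by rewrite (cls_to (of_tloop_sph u)); apply/top_piP/of_tloopK. Qed.

Lemma cls_surj (a : top_pi R n x) : exists f, is_sph x f /\ cls f = a.
Proof.
exists (of_tloop (repr a)); split; first exact: of_tloop_sph.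
by rewrite cls_of reprK.
Qed.

Lemma cls1 : cls (fun _ => x) = 1%g.
Proof. by rewrite (cls_to (cst_sph R n.+1 x)); apply/top_piP/tloop_htpy_eq. Qed.

Lemma cls_eq1 f : is_sph x f -> (cls f = 1%g <-> htp x f (fun _ => x)).
Proof. by move=> hf; rewrite -cls1; apply: clsP => //; exact: cst_sph. Qed.

Definition fmul f g (t : 'rV[R]_n.+1) : X :=
  if t ord0 ord0 <= 2^-1 then f (set_fst (2 * t ord0 ord0 + 0) t)
  else g (set_fst (2 * t ord0 ord0 + - 1) t).

Definition frev f (t : 'rV[R]_n.+1) : X := f (set_fst (-1 * t ord0 ord0 + 1) t).

Lemma ocube_set_fst (s : R) (t : 'rV[R]_n.+1) : ~ (0 < s < 1) -> ~ ocube n.+1 (set_fst s t).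
Proof. by move=> h /(_ ord0); rewrite set_fst0. Qed.

Lemma ocube_set_fst' (s : R) (t : 'rV[R]_n.+1) : ~ ocube n.+1 t ->
  (0 < s < 1 -> 0 < t ord0 ord0 < 1) -> ~ ocube n.+1 (set_fst s t).
Proof.
move=> nt h os; apply: nt => i; have := os i; rewrite mxE; case: eqP => [->|//].
by have := os ord0; rewrite mxE eqxx.
Qed.

Lemma fmul_sph f g : is_sph x f -> is_sph x g -> is_sph x (fmul f g).
Proof.
move=> [cf hf] [cg hg]; split.
  rewrite (_ : fmul f g = fun t => if t ord0 ord0 - 2^-1 <= 0 then f (set_fst (2 * t ord0 ord0 + 0) t)
    else g (set_fst (2 * t ord0 ord0 + - 1) t)); last first.
    by apply: funext => t; rewrite /fmul subr_le0.
  apply: cts_if.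
  - apply: cts_sub; last exact: cts_cst.
    exact: coord_continuous.
  - exact: (cts_comp (@continuous_set_affine R n 2 0) cf).
  - exact: (cts_comp (@continuous_set_affine R n 2 (-1)) cg).
  - move=> t /eqP; rewrite subr_eq0 => /eqP ->.
    by rewrite hf ?hg//; apply: ocube_set_fst => /andP[]; lra.
move=> t ot; rewrite /fmul; case: leP => t2; [apply: hf|apply: hg].
  have [t0|t0] := leP (t ord0 ord0) 0; first by apply: ocube_set_fst => /andP[]; lra.
  by apply: ocube_set_fst' => // _; apply/andP; split; lra.
have [t0|t0] := leP 1 (t ord0 ord0); first by apply: ocube_set_fst => /andP[]; lra.
by apply: ocube_set_fst' => // _; apply/andP; split; lra.
Qed.

Lemma frev_sph f : is_sph x f -> is_sph x (frev f).
Proof.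
move=> [cf hf]; split; first exact: (cts_comp (@continuous_set_affine R n (-1) 1) cf).
by move=> t ot; apply: hf; apply: ocube_set_fst' => // /andP[? ?]; apply/andP; split; lra.
Qed.

Lemma cls_mul f g : is_sph x f -> is_sph x g -> cls (fmul f g) = (cls f * cls g)%g.
Proof.
move=> hf hg; rewrite (cls_to hf) (cls_to hg) (cls_to (fmul_sph hf hg)).
rewrite [RHS]top_pi_mulE; apply/top_piP/tloop_htpy_eq => t ct //=.
Qed.

Lemma cls_inv f : is_sph x f -> (cls f * cls (frev f) = 1)%g.
Proof.
move=> hf; rewrite (cls_to hf) (cls_to (frev_sph hf)).
rewrite [LHS]top_pi_mulE; apply/top_piP.
apply: (tloop_htpy_trans _ (tloop_mulV (to_tloop hf))).
by apply: tloop_htpy_eq => t ct.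
Qed.

End Pi.

(** * Attaching cells *)

Lemma tube (T U : topologicalType) (K : set T) (O : set (T * U)) :
  compact K -> open O -> open [set u | forall s, K s -> O (s, u)].
Proof.
move=> /compact_near_coveringP cK oO; rewrite openE => u Ku.
apply: (cK U (nbhs u) (fun u' s => O (s, u'))) => s Ks.
have : nbhs (s, u) O by apply: open_nbhs_nbhs; split=> //; exact: Ku.
by apply: filterS => -[].
Qed.

Lemma cube_compact (R : realType) k : compact (@cube R k).
Proof.
have -> : @cube R k = [set v : 'rV[R]_k | forall i, `[0, 1]%classic (v ord0 i)].
  by apply/seteqP; split=> v h i; have := h i; rewrite /= in_itv.
by apply: (@rV_compact R k (fun=> `[0, 1]%classic)) => i; exact: segment_compact.
Qed.

Lemma nbhs_rV (R : realType) k (t : 'rV[R]_k) (A : set 'rV[R]_k) : nbhs t A ->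
  exists2 e : R, 0 < e & forall t' : 'rV[R]_k, (forall i, `|t ord0 i - t' ord0 i| < e) -> A t'.
Proof.
move=> /nbhs_ballP[e /= e0 eA]; exists e => // t' h; apply: eA.
by split=> // i j; rewrite (ord1 i); exact: h.
Qed.

(** A Lebesgue number argument: the open cover is replaced with a relation [Q] that holds near the
    diagonal, and only the first of the two points has to lie in the cube. *)
Lemma grid_mesh (R : realType) k (W : topologicalType) (f : 'rV[R]_k -> W)
    (Q : W -> W -> Prop) : continuous f ->
  (forall w, exists O : set W, [/\ open O, O w & forall w1 w2, O w1 -> O w2 -> Q w1 w2]) ->
  exists2 M : nat, (0 < M)%N & forall t t' : 'rV[R]_k, cube t ->
    (forall i, `|t ord0 i - t' ord0 i| < M%:R^-1) -> Q (f t) (f t').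
Proof.
move=> cf hO; pose P (M : nat) (t : 'rV[R]_k) := forall t' : 'rV[R]_k, (forall i, `|t ord0 i - t' ord0 i| < M%:R^-1) -> Q (f t) (f t').
have /compact_near_coveringP cK := @cube_compact R k.
have [|N _ hN] := cK nat \oo P _.
  move=> t0 _; have [U [oU Ut0 hQ]] := hO (f t0).
  have [e e0 he] : exists2 e : R, 0 < e & (forall t' : 'rV[R]_k, (forall i, `|t0 ord0 i - t' ord0 i| < e) -> (f @^-1` U) t').
    apply: nbhs_rV; apply: open_nbhs_nbhs; split=> //.
    by move/cts_open : cf; apply.
  exists ([set t : 'rV[R]_k | forall i, `|t0 ord0 i - t ord0 i| < e / 2], [set M : nat | (0 < M)%N /\ (M%:R : R)^-1 < e / 2]) => /=.
    split.
      apply/nbhs_ballP; exists (e / 2); first by rewrite /= divr_gt0.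
      by move=> t' [_ bt] i; exact: bt.
    have [N Ne] : exists N : nat, 2 / e < N%:R.
      by exists (Num.bound (2 / e)); apply: archi_boundP; rewrite divr_ge0// ltW.
    have N0 : 0 < N%:R :> R by apply: le_lt_trans Ne; rewrite divr_ge0// ltW.
    exists N.+1 => //= M NM; split; first by apply: leq_trans NM.
    have NM' : N%:R < M%:R :> R by rewrite ltr_nat.
    have -> : e / 2 = (2 / e)^-1 by rewrite invf_div.
    rewrite ltf_pV2 ?posrE ?divr_gt0//; first exact: lt_trans NM'.
    exact: lt_trans NM'.
  move=> [t M] [/= ht [M0 hM]] t' htt'; apply: hQ.
    by apply: he => i; apply: lt_le_trans (ht i) _; rewrite ler_pdivrMr// ler_peMr ?ltW// ltr1n.
  apply: he => i; rewrite (_ : _ - _ = (t0 ord0 i - t ord0 i) + (t ord0 i - t' ord0 i)); last by ring.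
  apply: le_lt_trans (ler_normD _ _) _; rewrite (splitr e); apply: ltrD => //.
  exact: lt_trans (htt' i) hM.
exists N.+1 => // t t' ct; apply: hN => //=; exact: leqnSn.
Qed.

Section Rclamp.
Context (R : realType) (d : nat).
Implicit Types x y : 'rV[R]_d.

(** The radial retraction onto the closed unit ball of the maximum norm; it takes everything outside
    the ball to the sphere. *)
Definition rclamp x : 'rV[R]_d := (Num.max 1 `|x|)^-1 *: x.

Lemma max1_gt0 x : 0 < Num.max 1 `|x| :> R.
Proof. by rewrite lt_max ltr01. Qed.

Lemma cts_rclamp (T : topologicalType) (p : T -> 'rV[R]_d) :
  continuous p -> continuous (fun t => rclamp (p t)).
Proof.
move=> cp; apply: cts_scale => //; apply: cts_inv.
  by apply: cts_max; [exact: cts_cst|exact: cts_norm].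
by move=> t; rewrite gt_eqF// max1_gt0.
Qed.

Lemma rclamp_id x : `|x| <= 1 -> rclamp x = x.
Proof. by move=> x1; rewrite /rclamp max_l// invr1 scale1r. Qed.

Lemma rclamp_norm x : 1 <= `|x| -> `|rclamp x| = 1.
Proof.
move=> x1; rewrite /rclamp normrZ max_r// ger0_norm ?invr_ge0//.
by rewrite mulVf// gt_eqF// (lt_le_trans ltr01).
Qed.

Lemma rclampZ x (r : R) : 1 <= `|x| -> 1 <= r -> rclamp (r *: x) = rclamp x.
Proof.
move=> x1 r1; have r0 : 0 < r by apply: lt_le_trans r1.
have x0 : 0 < `|x| by apply: lt_le_trans x1.
have rx : 1 <= `|r *: x| by rewrite normrZ ger0_norm ?(ltW r0)// mulr_ege1.
rewrite /rclamp !max_r// scalerA normrZ ger0_norm ?(ltW r0)// invfM mulrAC mulVf ?mul1r//.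
by rewrite gt_eqF.
Qed.

End Rclamp.

Section AttachDef.
Context (R : realType) (Y : topologicalType) (L : Type) (d : nat).

(** As a set, the adjunction space is the disjoint union of [Y] and the open cells, so no quotient
    is taken. The attaching maps enter through [chi], and from there through the topology. *)
Definition attach (att : L -> 'rV[R]_d.+1 -> Y) : Type :=
  (Y + L * {x : 'rV[R]_d.+1 | `|x| < 1})%type.

Context (att : L -> 'rV[R]_d.+1 -> Y).
Notation W := (attach att).

(** The characteristic map of a cell, made total by radial retraction outside the open ball. Its
    values on the closed ball determine it. *)
Definition chi (l : L) (x : 'rV[R]_d.+1) : W :=
  match @idP (`|x| < 1) with
  | ReflectT h => inr (l, exist (fun y : 'rV[R]_d.+1 => `|y| < 1) x h)
  | ReflectF _ => inl (att l (rclamp x))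
  end.

Lemma chi_out l x : 1 <= `|x| -> chi l x = inl (att l (rclamp x)).
Proof. by rewrite /chi; case: {-}_ / idP => // h; rewrite leNgt h. Qed.

Lemma chi_in l x (h : `|x| < 1) : chi l x = inr (l, exist (fun y : 'rV[R]_d.+1 => `|y| < 1) x h).
Proof.
by rewrite /chi; case: {-}_ / idP => [h'|//]; rewrite (bool_irrelevance h h').
Qed.

Lemma chi_val l (u : {x : 'rV[R]_d.+1 | `|x| < 1}) : inr (l, u) = chi l (sval u).
Proof. by case: u => x h; rewrite (chi_in _ h). Qed.

HB.instance Definition _ := gen_eqMixin W.
HB.instance Definition _ := gen_choiceMixin W.

(** The final topology for [inl] and the characteristic maps. *)
Definition attach_op : set_system W :=
  [set O | open (inl @^-1` O : set Y) /\ forall l, open (chi l @^-1` O)].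

Lemma attach_opT : attach_op setT.
Proof. by split=> [|l]; rewrite preimage_setT; exact: openT. Qed.

Lemma attach_opI : setI_closed attach_op.
Proof.
by move=> A B [A1 A2] [B1 B2]; split=> [|l]; rewrite preimage_setI; apply: openI.
Qed.

Lemma attach_op_bigU (I : Type) (f : I -> set W) :
  (forall i, attach_op (f i)) -> attach_op (\bigcup_i f i).
Proof.
move=> h; split=> [|l]; rewrite preimage_bigcup; apply: bigcup_open => i _.
  by have [] := h i.
by have [_] := h i.
Qed.

HB.instance Definition _ := isOpenTopological.Build W attach_opT attach_opI attach_op_bigU.

Lemma attach_openE (O : set W) : open O <-> attach_op O.
Proof. by []. Qed.

Lemma cts_inl : continuous (inl : Y -> W).
Proof. by apply/cts_open => A /attach_openE[]. Qed.

Lemma cts_chi l : continuous (chi l).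
Proof. by apply/cts_open => A /attach_openE[_]. Qed.

Lemma attach_closedE (C : set W) :
  closed C <-> closed (inl @^-1` C : set Y) /\ forall l, closed (chi l @^-1` C).
Proof.
rewrite -!openC attach_openE /attach_op /= -preimage_setC openC.
by split=> -[h1 h2]; split=> // l; have := h2 l; rewrite -preimage_setC openC.
Qed.

Lemma cts_attach (Z : topologicalType) (f : W -> Z) :
  continuous (f \o inl : Y -> Z) -> (forall l, continuous (f \o chi l)) -> continuous f.
Proof.
move=> /cts_open c1 c2; apply/cts_open => A oA; apply/attach_openE; split.
  exact: c1.
by move=> l; have /cts_open := c2 l; apply.
Qed.

(** A product with the locally compact line preserves the final topology. This is what allows
    homotopies on the adjunction space to be defined cell by cell. *)
Lemma cts_attach_joint (Z : topologicalType) (F : R * W -> Z) :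
  continuous (fun z : R * Y => F (z.1, inl z.2)) ->
  (forall l, continuous (fun z : R * 'rV[R]_d.+1 => F (z.1, chi l z.2))) ->
  continuous F.
Proof.
move=> c1 c2; have cs w0 : continuous (fun s => F (s, w0)).
  case: w0 => [y|[l u]].
    apply: (@cts_comp _ _ _ (fun s : R => (s, y)) (fun z => F (z.1, inl z.2))) => //.
    by apply: cts_pair; [exact: cts_id|exact: cts_cst].
  rewrite chi_val.
  apply: (@cts_comp _ _ _ (fun s : R => (s, sval u)) (fun z => F (z.1, chi l z.2))) => //.
  by apply: cts_pair; [exact: cts_id|exact: cts_cst].
apply/cts_open => A oA; rewrite openE => -[s0 w0] /= Aw.
have [e /= e0 he] : \forall s \near s0, A (F (s, w0)).
  by apply: open_nbhs_nbhs; split=> //; have /cts_open := cs w0; apply.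
(* A compact interval around [s0] on which the condition still holds at [w0]; the tube lemma then
   makes [O] open. *)
pose K := `[s0 - e / 2, s0 + e / 2]%classic.
have cK : compact K by exact: segment_compact.
pose O := [set w | forall s, K s -> A (F (s, w))].
have oO : open O.
  apply/attach_openE; split=> [|l].
    by have /cts_open/(_ _ oA) := c1; exact: tube.
  by have /cts_open/(_ _ oA) := c2 l; exact: tube.
exists (K, O) => /=; last by move=> [s w] [/= Ks]; apply.
split.
  exists (e / 2); first by rewrite /= divr_gt0.
  by move=> s /=; rewrite /ball_ ltr_norml => /andP[? ?]; rewrite /K /= in_itv /=; apply/andP; split; lra.
apply: open_nbhs_nbhs; split=> // s; rewrite /K /= in_itv /= => /andP[s1 s2].
by apply: he; rewrite /= ltr_norml; apply/andP; split; lra.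
Qed.

End AttachDef.
Arguments attach {R Y L d}.
Arguments chi {R Y L d}.
Arguments cts_inl {R Y L d att}.
Arguments cts_chi {R Y L d}.

(** * Simplicial approximation of spheres *)

Section Simplex.
Context (R : realType) (d : nat).
Notation D := d.+1.
Implicit Types (x y : 'rV[R]_D) (i : 'I_D.+1).

(** The common value of all the barycentric coordinates at the center 0. *)
Definition bcc : R := D.+1%:R^-1.

Lemma bcc_gt0 : 0 < bcc. Proof. by rewrite invr_gt0 ltr0n. Qed.
Lemma bcc_lt1 : bcc < 1. Proof. by rewrite invf_lt1 ?ltr0n// ltr1n. Qed.
Lemma bccE : D.+1%:R * bcc = 1. Proof. by rewrite divff// pnatr_eq0. Qed.

(* Barycentric coordinates with respect to a simplex centered at 0 and
   contained in the open unit ball of the maximum norm. *)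
Definition bc x i : R :=
  if unlift ord0 i is Some j then x ord0 j + bcc else bcc - \sum_j x ord0 j.

Definition bvec (p : 'I_D.+1 -> R) : 'rV[R]_D := \row_j (p (lift ord0 j) - bcc).

Lemma bc0 x : bc x ord0 = bcc - \sum_j x ord0 j.
Proof. by rewrite /bc unlift_none. Qed.

Lemma bcS x j : bc x (lift ord0 j) = x ord0 j + bcc.
Proof. by rewrite /bc liftK. Qed.

Lemma bc_sum x : \sum_i bc x i = 1.
Proof.
rewrite big_ord_recl bc0 (eq_bigr _ (fun j _ => bcS x j)) big_split /= sumr_const card_ord.
rewrite -mulr_natl -[RHS]bccE -[in RHS]natr1; ring.
Qed.

Lemma bc_bvec p i : \sum_i p i = 1 -> bc (bvec p) i = p i.
Proof.
move=> p1; case: (unliftP ord0 i) => [j ->|->]; first by rewrite bcS mxE subrK.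
rewrite bc0; under eq_bigr do rewrite mxE.
rewrite big_split /= sumrN sumr_const card_ord -mulr_natl.
move: p1; rewrite big_ord_recl => p1; have := bccE; rewrite -natr1 mulrDl mul1r.
by move: p1; set u := \sum_(_ < _) _; set w := _ * _; lra.
Qed.

Lemma bc_conv (s : R) x y i : bc (x + s *: (y - x)) i = (1 - s) * bc x i + s * bc y i.
Proof.
case: (unliftP ord0 i) => [j ->|->]; first by rewrite !bcS !mxE; ring.
rewrite !bc0; have -> : \sum_j (x + s *: (y - x)) ord0 j =
  (1 - s) * \sum_j x ord0 j + s * \sum_j y ord0 j.
  by rewrite !mulr_sumr -big_split /=; apply: eq_bigr => j _; rewrite !mxE; ring.
by ring.
Qed.

Lemma bc_small x i (r : R) : (forall j, `|x ord0 j| <= r) -> bcc - D%:R * r <= bc x i.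
Proof.
move=> h; have r0 : 0 <= r by apply: le_trans (h ord0).
case: (unliftP ord0 i) => [j ->|->].
  have := h j; rewrite bcS ler_norml => /andP[h1 _].
  have : r <= D%:R * r by rewrite ler_peMl// ler1n.
  by move: h1; set w := _ * r; lra.
rewrite bc0 lerD2l lerN2; apply: (@le_trans _ _ (\sum_(j < D) r)).
  by apply: ler_sum => j _; apply: le_trans (ler_norm _) (h j).
by rewrite sumr_const card_ord mulr_natl.
Qed.

Lemma bc_norm_lt1 x : (forall i, 0 <= bc x i) -> `|x| < 1.
Proof.
move=> h; apply/norm_rV_lt => // j; have := h (lift ord0 j); rewrite bcS => h1.
have h2 : bc x (lift ord0 j) <= 1.
  rewrite -(bc_sum x) (bigD1 (lift ord0 j))//= lerDl; exact: sumr_ge0.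
have c0 := bcc_gt0; have c1 := bcc_lt1.
by rewrite bcS in h2; rewrite ltr_norml; apply/andP; split; lra.
Qed.

Lemma bc_norm_ge1 x : 1 <= `|x| -> exists i, bc x i < 0.
Proof.
move=> x1; apply/not_existsP => h; have : `|x| < 1.
  by apply: bc_norm_lt1 => i; rewrite leNgt; apply/negP/h.
by rewrite ltNge x1.
Qed.

Lemma cts_bc (T : topologicalType) (p : T -> 'rV[R]_D) i :
  continuous p -> continuous (fun t => bc (p t) i).
Proof.
move=> cp; case: (unliftP ord0 i) => [j ->|->].
  rewrite (_ : (fun t => _) = fun t => p t ord0 j + bcc); last by apply: funext => t; rewrite bcS.
  by apply: cts_add; [exact: cts_coord|exact: cts_cst].
rewrite (_ : (fun t => _) = fun t => bcc - \sum_j p t ord0 j); last by apply: funext => t; rewrite bc0.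
apply: cts_sub; first exact: cts_cst.
by apply: cts_sum => j; exact: cts_coord.
Qed.

Lemma cts_bvec (T : topologicalType) (p : 'I_D.+1 -> T -> R) :
  (forall i, continuous (p i)) -> continuous (fun t => bvec (fun i => p i t)).
Proof.
move=> cp; apply: continuous_row => j.
rewrite (_ : (fun t => _) = fun t => p (lift ord0 j) t - bcc); last by apply: funext => t; rewrite mxE.
by apply: cts_sub => //; exact: cts_cst.
Qed.

(** The label of a point is a vertex with the largest barycentric coordinate, which is at least
    [bcc] because the coordinates sum to 1. *)
Definition blab x : 'I_D.+1 := [arg max_(i > ord0) bc x i]%O.

Lemma blab_ge x : bcc <= bc x (blab x).
Proof.
rewrite /blab; case: Order.TotalTheory.arg_maxP => //= i _ hi.
rewrite leNgt; apply/negP => lt_c; have := bc_sum x; apply/eqP.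
rewrite lt_eqF// -bccE mulr_natl.
have -> : bcc *+ D.+1 = \sum_(j < D.+1) bcc by rewrite sumr_const card_ord.
by apply: ltr_sum => [|j _]; [apply/hasP; exists ord0; rewrite // mem_index_enum|exact: le_lt_trans (hi j _) lt_c].
Qed.

(** A cutoff function: it is 1 where all the coordinates are at least half their central value, and
    0 where one of them is at most a quarter of it. *)
Definition bcut x : R := \prod_i clamp ((bc x i - bcc / 4) / (bcc / 4)).

Lemma bcut01 x : 0 <= bcut x <= 1.
Proof.
rewrite /bcut prodr_ge0/=; last by move=> i _; exact: clamp_ge0.
by apply: prodr_ile1 => i _; exact: clamp01.
Qed.

Lemma bcut0 x i : bc x i <= bcc / 4 -> bcut x = 0.
Proof.
move=> h; rewrite /bcut (bigD1 i)//= clamp_le0 ?mul0r// pmulr_lle0 ?subr_le0//.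
by rewrite invr_gt0 divr_gt0// bcc_gt0.
Qed.

Lemma bcut1 x : (forall i, bcc / 2 <= bc x i) -> bcut x = 1.
Proof.
move=> h; rewrite /bcut big1// => i _; apply: clamp_ge1.
have c0 := bcc_gt0; rewrite ler_pdivlMr; last by lra.
by have := h i; lra.
Qed.

Lemma cts_bcut (T : topologicalType) (p : T -> 'rV[R]_D) :
  continuous p -> continuous (fun t => bcut (p t)).
Proof.
move=> cp; apply: (@cts_prod _ _ _ _ (fun i t => clamp ((bc (p t) i - bcc / 4) / (bcc / 4)))) => i.
apply: cts_clamp; apply: cts_mul; last exact: cts_cst.
by apply: cts_sub; [exact: cts_bc|exact: cts_cst].
Qed.

End Simplex.
Arguments bcc {R d}.

(** * Kuhn's triangulation of the cube *)

Section Hat.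
Context (R : realType) (k M : nat).
Hypothesis M0 : (0 < M)%N.
Notation V := {ffun 'I_k -> 'I_M.+1}.
Implicit Types (v : V) (t : 'rV[R]_k).

Definition gpt v : 'rV[R]_k := \row_i ((v i)%:R / M%:R).

(** The piecewise affine function that is 1 at the grid vertex [v] and 0 at the others, for Kuhn's
    triangulation of the grid. Written in this way it needs no description of the simplices. *)
Definition hat v t : R := Num.max 0 (1 - \big[Num.max/0]_i (M%:R * t ord0 i - (v i)%:R)
   - \big[Num.max/0]_i ((v i)%:R - M%:R * t ord0 i)).

Let M0' : 0 < M%:R :> R. Proof. by rewrite ltr0n. Qed.

Lemma gpt_cube v : cube (gpt v).
Proof.
move=> i; rewrite mxE divr_ge0// ler_pdivrMr// mul1r ler_nat -ltnS.
by rewrite ltn_ord.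
Qed.

Lemma hat_ge0 v t : 0 <= hat v t.
Proof. by rewrite /hat le_max lexx. Qed.

Lemma cts_hat v : continuous (hat v).
Proof.
have c i : continuous (fun t : 'rV[R]_k => M%:R * t ord0 i).
  by apply: cts_mul; [exact: cts_cst|exact: coord_continuous].
apply: cts_max; first exact: cts_cst.
apply: cts_sub; first apply: cts_sub; first exact: cts_cst.
  apply: (@cts_bigmax _ _ _ _ (fun i t => M%:R * t ord0 i - (v i)%:R)) => i.
  by apply: cts_sub => //; exact: cts_cst.
apply: (@cts_bigmax _ _ _ _ (fun i t => (v i)%:R - M%:R * t ord0 i)) => i.
by apply: cts_sub => //; exact: cts_cst.
Qed.

Lemma hat_gt0P v t : 0 < hat v t ->
  [/\ forall i j, (M%:R * t ord0 i - (v i)%:R) + ((v j)%:R - M%:R * t ord0 j) < 1,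
      forall i, M%:R * t ord0 i - (v i)%:R < 1 & forall i, (v i)%:R - M%:R * t ord0 i < 1].
Proof.
rewrite /hat lt_max ltxx /= -addrA -opprD subr_gt0.
set a := \big[_/_]_i _; set b := \big[_/_]_i _ => ab.
have ha i : M%:R * t ord0 i - (v i)%:R <= a.
  exact: (le_bigmax _ (fun i => M%:R * t ord0 i - (v i)%:R)).
have hb i : (v i)%:R - M%:R * t ord0 i <= b.
  exact: (le_bigmax _ (fun i => (v i)%:R - M%:R * t ord0 i)).
have a0 : 0 <= a by exact: bigmax_ge_id.
have b0 : 0 <= b by exact: bigmax_ge_id.
split=> [i j|i|i]; [have := ha i; have := hb j|have := ha i|have := hb i]; lra.
Qed.

Lemma hat_close v t i : 0 < hat v t -> `|t ord0 i - gpt v ord0 i| < M%:R^-1.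
Proof.
move=> /hat_gt0P[_ h1 h2]; rewrite mxE.
have -> : t ord0 i - (v i)%:R / M%:R = (M%:R * t ord0 i - (v i)%:R) / M%:R.
  by rewrite mulrBl mulrAC divff ?mul1r// gt_eqF.
rewrite normrM [X in _ * X]gtr0_norm ?invr_gt0//.
rewrite -[X in _ < X]mul1r ltr_pM2r ?invr_gt0// ltr_norml.
by have := h1 i; have := h2 i; move=> ? ?; apply/andP; split; lra.
Qed.

Lemma hat_sum_gt0 t : cube t -> 0 < \sum_v hat v t.
Proof.
move=> ct; have fl i : (Num.truncn (M%:R * t ord0 i) < M.+1)%N.
  have /andP[t0 t1] := ct i; have t0' : 0 <= M%:R * t ord0 i by rewrite mulr_ge0.
  have /andP[h _] := truncn_itv t0'.
  rewrite ltnS -(ler_nat R); apply: le_trans h _.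
  by rewrite ler_piMr.
(* The corner obtained by rounding down: no coordinate of [t] lies below it, so the second maximum
   vanishes, and the first one is less than 1. *)
pose v : V := [ffun i => Ordinal (fl i)].
rewrite (bigD1 v)//=; apply: ltr_wpDr; first by apply: sumr_ge0 => u _; exact: hat_ge0.
rewrite /hat lt_max ltxx /= -addrA -opprD subr_gt0.
have itv i : 0 <= M%:R * t ord0 i - (v i)%:R < 1.
  have /andP[t0 t1] := ct i; have t0' : 0 <= M%:R * t ord0 i by rewrite mulr_ge0.
  have /andP[h1 h2] := truncn_itv t0'.
  by rewrite ffunE /=; rewrite -natr1 in h2; apply/andP; split; lra.
set b := (X in _ + X); have -> : b = 0.
  apply: le_anti; rewrite bigmax_ge_id andbT; apply: bigmax_le => // i _.
  by have /andP[h1 h2] := itv i; lra.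
rewrite addr0; apply/bigmax_ltP; split=> // i _.
by have /andP[] := itv i.
Qed.

(** If [v] exceeded [u] at i and [u] exceeded [v] at j, the inequalities given by the two supports
    for i and j would add up to 2 < 2. *)
Lemma hat_comparable v u t : 0 < hat v t -> 0 < hat u t ->
  (forall i, v i <= u i)%N \/ (forall i, u i <= v i)%N.
Proof.
move=> /hat_gt0P[hv _ _] /hat_gt0P[hu _ _]; apply: contrapT => /not_orP[].
move=> /existsNP[i /negP]; rewrite -ltnNge => ui /existsNP[j /negP]; rewrite -ltnNge => vj.
have := hv j i; have := hu i j.
have ui' : (u i)%:R + 1 <= (v i)%:R :> R by rewrite natr1 ler_nat.
have vj' : (v j)%:R + 1 <= (u j)%:R :> R by rewrite natr1 ler_nat.
lra.
Qed.

Lemma hat_step v u t i : 0 < hat v t -> 0 < hat u t -> (u i <= (v i).+1)%N.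
Proof.
move=> /hat_gt0P[_ hv _] /hat_gt0P[_ _ hu]; have := hv i; have := hu i => h1 h2.
have : (u i)%:R < (v i).+2%:R :> R by rewrite -!natr1; lra.
by rewrite ltr_nat ltnS.
Qed.

Definition vsum v : nat := \sum_i v i.

Lemma vsum_inj v u t : 0 < hat v t -> 0 < hat u t -> vsum v = vsum u -> v = u.
Proof.
move=> hv hu; wlog vu : v u hv hu / (forall i, v i <= u i)%N.
  move=> W; have [h|h] := hat_comparable hv hu; first exact: W.
  by move=> e; apply/esym/W.
move=> e; apply/ffunP => i; apply/val_inj/eqP => /=; rewrite eqn_leq vu leqNgt /=.
apply/negP => lt; have : (vsum v < vsum u)%N.
  rewrite /vsum (bigD1 i)//= [X in (_ < X)%N](bigD1 i)//= -addSn leq_add//.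
  by apply: leq_sum => j _.
by rewrite e ltnn.
Qed.

Lemma vsum_close v u t : 0 < hat v t -> 0 < hat u t -> (vsum u <= vsum v + k)%N.
Proof.
move=> hv hu; apply: (@leq_trans (\sum_(i < k) (v i + 1))).
  by apply: leq_sum => i _; rewrite addn1; exact: hat_step hv hu.
by rewrite big_split /= sum1_card card_ord.
Qed.

(* The support of the hat functions at a point is a chain, whose elements are
   told apart by their coordinate sums: this is the covering dimension bound. *)
Lemma hat_card t (S : {set V}) : (forall v, v \in S -> 0 < hat v t) -> (#|S| <= k.+1)%N.
Proof.
move=> hS; have [->|[v0 Sv0]] := set_0Vmem S; first by rewrite cards0.
pose m := [arg min_(v < v0 | v \in S) vsum v]%N.
have [Sm hm] : m \in S /\ forall v, v \in S -> (vsum m <= vsum v)%N.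
  by rewrite /m; case: arg_minnP.
pose f v : 'I_k.+1 := inord (vsum v - vsum m).
rewrite -[k.+1]card_ord -(card_in_imset (f := f)); first exact: max_card.
move=> v u Sv Su /(congr1 val); rewrite /= !inordK; last 2 first.
- by rewrite ltnS leq_subLR; apply: vsum_close (hS _ Sm) (hS _ Su).
- by rewrite ltnS leq_subLR; apply: vsum_close (hS _ Sm) (hS _ Sv).
move=> e; apply: (vsum_inj (hS _ Sv) (hS _ Su)).
by rewrite -(subnK (hm _ Sv)) e subnK// hm.
Qed.

End Hat.

Section AttachTopology.
Context (R : realType) (Y : topologicalType) (L : Type) (d : nat).
Context (att : L -> 'rV[R]_d.+1 -> Y).
Notation W := (attach att).
Notation chi := (chi att).
Notation ball1 := {x : 'rV[R]_d.+1 | `|x| < 1}.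

Lemma open_cell (l : L) (A : set 'rV[R]_d.+1) : open A ->
  open [set w : W | exists u : ball1, A (sval u) /\ w = inr (l, u)].
Proof.
move=> oA; apply/attach_openE; split=> [|l'] /=.
  rewrite (_ : _ @^-1` _ = set0); first exact: open0.
  by apply/seteqP; split=> // y [u []].
have [<-|ll'] := pselect (l = l'); last first.
  rewrite (_ : _ @^-1` _ = set0); first exact: open0.
  apply/seteqP; split=> // x [u [_]]; have [x1|x1] := leP 1 `|x|.
    by rewrite chi_out.
  by rewrite chi_in => -[/esym].
rewrite (_ : _ @^-1` _ = A `&` [set x | `|x| < 1]).
  apply: openI => //; apply: (@open_preim _ _ (fun x : 'rV[R]_d.+1 => `|x|) [set z | z < 1]); last exact: open_lt.
  by apply: cts_norm; exact: cts_id.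
apply/seteqP; split=> x /=.
  move=> [u [Au]]; have [x1|x1] := leP 1 `|x|; first by rewrite chi_out.
  by rewrite chi_in => -[e]; move: Au; rewrite -e.
by move=> [Ax x1]; exists (exist (fun y : 'rV[R]_d.+1 => `|y| < 1) x x1); rewrite -chi_in.
Qed.

(** The value 0 on the base is a default. This coordinate need not be continuous; [cutoff] is a
    continuous substitute on a smaller ball of one cell. *)
Definition cellx (w : W) : 'rV[R]_d.+1 := if w is inr (_, u) then sval u else 0.

Definition cutoff (l : L) (r : R) (w : W) : 'rV[R]_d.+1 :=
  if w is inr (l', u) then
    if pselect (l' = l) then clamp ((1 - `|sval u|) / (1 - r)) *: sval u else 0
  else 0.

Lemma cts_cutoff l r : r < 1 -> continuous (cutoff l r).
Proof.
move=> r1; apply: cts_attach => [|l'].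
  by rewrite (_ : _ \o _ = cst 0); [exact: cts_cst|apply: funext].
have [<-|ll'] := pselect (l' = l); last first.
  rewrite (_ : _ \o _ = cst 0); first exact: cts_cst.
  apply: funext => x /=; have [x1|x1] := leP 1 `|x|; first by rewrite chi_out.
  by rewrite chi_in /=; case: pselect.
rewrite (_ : _ \o _ = fun x => clamp ((1 - `|x|) / (1 - r)) *: x).
  apply: cts_scale; last exact: cts_id.
  apply: cts_clamp; apply: cts_mul; last exact: cts_cst.
  by apply: cts_sub; [exact: cts_cst|apply: cts_norm; exact: cts_id].
apply: funext => x /=; have [x1|x1] := leP 1 `|x|.
  by rewrite chi_out//= clamp_le0 ?scale0r// pmulr_lle0 ?subr_le0// invr_gt0 subr_gt0.
by rewrite chi_in /=; case: pselect.
Qed.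

Lemma cutoff_id l r (u : ball1) : r < 1 -> `|sval u| < r -> cutoff l r (inr (l, u)) = sval u.
Proof.
move=> r1 ur /=; case: pselect => [?|//]; rewrite clamp_ge1 ?scale1r//.
by rewrite ler_pdivlMr ?subr_gt0// mul1r lerD2l lerN2 ltW.
Qed.

Hypothesis att_cts : forall l, {within [set x | `|x| = 1], continuous (att l)}.

(** Since [inl] is injective and closed, a continuous map into the adjunction space with values in
    the base is continuous into [Y]. Continuity of the attaching maps on the sphere is what makes it
    closed. *)
Lemma closed_inl (C : set Y) : closed C -> closed [set w : W | exists2 y, C y & w = inl y].
Proof.
move=> cC; apply/attach_closedE; split=> [|l].
  rewrite (_ : _ @^-1` _ = C)//; apply/seteqP; split=> y /=; first by move=> [y' ? [->]].
  by exists y.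
have -> : chi l @^-1` [set w : W | exists2 y, C y & w = inl y] =
    [set x | 1 <= `|x|] `&` [set x | C (att l (rclamp x))].
  apply/seteqP; split=> x /=.
    move=> [y Cy]; have [x1|x1] := leP 1 `|x|; last by rewrite chi_in.
    by rewrite chi_out// => -[e]; rewrite e.
  by move=> [x1 h]; exists (att l (rclamp x)) => //; rewrite chi_out.
have c1 : closed [set x : 'rV[R]_d.+1 | 1 <= `|x|].
  apply: (@closed_preim _ _ (fun x : 'rV[R]_d.+1 => `|x|) [set z | 1 <= z]); last exact: closed_ge.
  by apply: cts_norm; exact: cts_id.
have : {within [set x | 1 <= `|x|], continuous (fun x => att l (rclamp x))}.
  apply: (@continuous_within_comp _ _ _ [set x : 'rV[R]_d.+1 | 1 <= `|x|] _ (@rclamp R d.+1) (att l) _ _ (@att_cts l)).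
    by apply: cts_rclamp; exact: cts_id.
  by move=> t; exact: rclamp_norm.
move=> /continuous_closedP/(_ _ cC).
move=> /closed_subspaceP[V cV e]; rewrite setIC (_ : _ `&` _ = V `&` [set x | 1 <= `|x|]); first exact: closedI.
by rewrite e.
Qed.

End AttachTopology.
Arguments cellx {R Y L d att}.

Section PushOff.
Context (R : realType) (Y : topologicalType) (L : Type) (d : nat).
Context (att : L -> 'rV[R]_d.+1 -> Y).
Notation W := (attach att).
Notation chi := (chi att).
Notation ball1 := {x : 'rV[R]_d.+1 | `|x| < 1}.
Notation c := (@bcc R d).
Notation bc := (@bc R d).

(** The mesh is so fine that near a point well inside a cell the map stays in that cell, and each
    barycentric coordinate varies by less than a quarter of [bcc]. *)
Lemma cell_mesh k (a : 'rV[R]_k -> W) : continuous a ->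
  exists2 M : nat, (0 < M)%N & forall t t' : 'rV[R]_k, cube t ->
    (forall i, `|t ord0 i - t' ord0 i| < M%:R^-1) ->
    forall l u, a t = inr (l, u) -> (forall i, c / 4 <= bc (sval u) i) ->
    exists u', a t' = inr (l, u') /\ forall i, `|bc (sval u) i - bc (sval u') i| < c / 4.
Proof.
have c0 : 0 < c := @bcc_gt0 R d.
move=> ca; apply: (@grid_mesh R k W a (fun w1 w2 => forall l u, w1 = inr (l, u) ->
    (forall i, c / 4 <= bc (sval u) i) ->
    exists u', w2 = inr (l, u') /\ forall i, `|bc (sval u) i - bc (sval u') i| < c / 4) ca).
case=> [y|[l u]].
  (* No point of this neighborhood satisfies the condition on the coordinates, so the relation holds
     vacuously there. *)
  exists [set w : W | forall l (u : ball1), w = inr (l, u) -> exists i, bc (sval u) i < c / 4].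
  split=> //=.
    apply/attach_openE; split=> [|l].
      rewrite (_ : _ @^-1` _ = setT); first exact: openT.
      by apply/seteqP; split.
    rewrite (_ : _ @^-1` _ = \bigcup_(i in setT) [set x | bc x i < c / 4]).
      apply: bigcup_open => i _.
      by apply: (@open_preim _ _ (fun x => bc x i) [set z | z < c / 4]); [apply: cts_bc; exact: cts_id|exact: open_lt].
    apply/seteqP; split=> x /=.
      move=> h; have [/(@bc_norm_ge1 R d)[i hi]|x1] := leP 1 `|x|.
        by exists i => //=; apply: lt_trans hi _; rewrite divr_gt0.
      by have [i hi] := h l _ (chi_in _ _ x1); exists i.
    move=> [i _ hi] l' u'; have [x1|x1] := leP 1 `|x|; first by rewrite chi_out.
    by rewrite chi_in => -[_ <-] /=; exists i.
  move=> w1 w2 h1 _ l u /h1[i hi] /(_ i); rewrite leNgt hi //.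
pose A := [set x | forall i, `|bc (sval u) i - bc x i| < c / 8].
exists [set w : W | exists u' : ball1, A (sval u') /\ w = inr (l, u')]; split.
- apply: open_cell.
  apply: (@open_finI _ _ (fun i => [set x | `|bc (sval u) i - bc x i| < c / 8])) => i.
  apply: (@open_preim _ _ (fun x => `|bc (sval u) i - bc x i|) [set z | z < c / 8]); last exact: open_lt.
  apply: (@cts_comp _ _ _ (fun x => bc (sval u) i - bc x i) (fun z : R => `|z|)).
    by apply: cts_sub; [exact: cts_cst|apply: cts_bc; exact: cts_id].
  exact: norm_continuous.
- by exists u; split=> // i; rewrite subrr normr0 divr_gt0.
move=> w1 w2 [u1 [A1 ->]] [u2 [A2 ->]] l' u' [<- <-] _; exists u2; split=> // i.
have := A1 i; have := A2 i; rewrite !ltr_norml => /andP[? ?] /andP[? ?].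
by apply/andP; split; lra.
Qed.

End PushOff.

(** * Simplicial approximation inside the cells, and pushing away from their centers *)

Section Deform.
Context (R : realType) (Y : topologicalType) (L : Type) (d : nat).
Context (att : L -> 'rV[R]_d.+1 -> Y).
Notation W := (attach att).
Notation chi := (chi att).
Notation ball1 := {x : 'rV[R]_d.+1 | `|x| < 1}.
Notation c := (@bcc R d).
Notation bc := (@bc R d).
Context (k M : nat) (a : 'rV[R]_k -> W).
Hypothesis M0 : (0 < M)%N.
Notation V := {ffun 'I_k -> 'I_M.+1}.

Definition klab (v : V) : 'I_d.+2 := blab (cellx (a (gpt R v))).

Definition kwt (i : 'I_d.+2) (t : 'rV[R]_k) : R :=
  (\sum_(v | klab v == i) hat v (clampv t)) / (\sum_(v : V) hat v (clampv t)).

(** The simplicial map that sends each grid vertex to the vertex of the simplex named by its label: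
    [kwt i] is its i-th barycentric coordinate. *)
Definition ktau (t : 'rV[R]_k) : 'rV[R]_d.+1 := bvec (fun i => kwt i t).

Lemma kwt_sum t : \sum_i kwt i t = 1.
Proof.
rewrite -mulr_suml (_ : \sum_i _ = \sum_(v : V) hat v (clampv t)).
  by rewrite divff// gt_eqF// hat_sum_gt0//; exact: clampv_cube.
by rewrite [RHS](partition_big klab predT).
Qed.

Lemma bc_ktau t i : bc (ktau t) i = kwt i t.
Proof. exact: bc_bvec (kwt_sum t). Qed.

Lemma kwt_eq0 t i : (forall v, 0 < hat v (clampv t) -> klab v != i) -> kwt i t = 0.
Proof.
move=> h; rewrite /kwt big1 ?mul0r// => v /eqP vi; apply/eqP.
rewrite eq_le hat_ge0 andbT leNgt; apply/negP => /h; rewrite vi eqxx.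
by [].
Qed.

Lemma cts_ktau : continuous ktau.
Proof.
have ch (v : V) : continuous (fun t : 'rV[R]_k => hat v (clampv t)).
  apply: (@cts_comp _ _ _ (@clampv R k) (@hat R k M v)); last exact: cts_hat.
  by apply: cts_clampv; exact: cts_id.
apply: cts_bvec => i; apply: cts_mul.
  exact: (@cts_sum _ _ _ _ _ (fun v t => hat v (clampv t))).
apply: cts_inv.
  exact: (@cts_sum _ _ _ _ _ (fun v t => hat v (clampv t))).
by move=> t; rewrite gt_eqF// hat_sum_gt0//; exact: clampv_cube.
Qed.

(** The radius is chosen with [d.+1%:R * drad = bcc / 2]: by [bc_small], all barycentric coordinates
    are at least [bcc / 2] on the ball of this radius. Scaling by its inverse therefore sends every
    point with a smaller coordinate into the base. *)
Definition drad : R := c / (2 * d.+1%:R).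

Lemma drad_gt0 : 0 < drad.
Proof. by rewrite /drad divr_gt0 ?bcc_gt0// mulr_gt0// ltr0n. Qed.

Lemma drad_inv : 1 <= drad^-1.
Proof.
rewrite invf_ge1 ?drad_gt0// /drad ler_pdivrMr ?mulr_gt0 ?ltr0n// mul1r.
apply: le_trans (ltW (bcc_lt1 R d)) _; rewrite -natrM ler1n.
by [].
Qed.

Definition dscale (s : R) : R := 1 + clamp s * (drad^-1 - 1).

Lemma dscale_ge1 s : 1 <= dscale s.
Proof. by rewrite /dscale lerDl mulr_ge0 ?clamp_ge0// subr_ge0 drad_inv. Qed.

Lemma dscale0 : dscale 0 = 1. Proof. by rewrite /dscale clamp0 mul0r addr0. Qed.
Lemma dscale1 : dscale 1 = drad^-1. Proof. by rewrite /dscale clamp1 mul1r addrC subrK. Qed.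

Lemma cts_dscale : continuous dscale.
Proof.
apply: cts_add; first exact: cts_cst.
by apply: cts_mul; [apply: cts_clamp; exact: cts_id|exact: cts_cst].
Qed.

Definition dmove (s : R) (t : 'rV[R]_k) (x : 'rV[R]_d.+1) : 'rV[R]_d.+1 :=
  x + (clamp s * bcut x) *: (ktau t - x).

(* Inside a cell, the map is first replaced, near the center of the cell, by
   its simplicial approximation, and then pushed away from the center. *)
Definition deform (z : R * 'rV[R]_k) : W :=
  match a z.2 with
  | inl y => inl y
  | inr (l, u) => chi l (dscale z.1 *: dmove z.1 z.2 (sval u))
  end.

(** This is [deform] without the approximation. The two agree where [bcut] vanishes, hence near the
    base, and this one is defined on the whole adjunction space, where [cts_attach_joint]
    applies. *)
Definition pushoff (z : R * W) : W :=
  match z.2 with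
  | inl y => inl y
  | inr (l, u) => chi l (dscale z.1 *: sval u)
  end.

Lemma cts_pushoff : continuous pushoff.
Proof.
apply: cts_attach_joint => [|l] /=.
  apply: (@cts_comp _ _ _ (@snd R Y) (inl : Y -> W)); [exact: cts_snd|exact: cts_inl].
rewrite (_ : (fun z => _) = fun z : R * 'rV[R]_d.+1 => chi l (dscale z.1 *: z.2)).
  apply: (@cts_comp _ _ _ (fun z : R * 'rV[R]_d.+1 => dscale z.1 *: z.2) (chi l)).
    apply: cts_scale; last exact: cts_snd.
    by apply: (@cts_comp _ _ _ fst dscale); [exact: cts_fst|exact: cts_dscale].
  exact: cts_chi.
apply: funext => -[s x]; rewrite /pushoff /=; have [x1|x1] := leP 1 `|x|; last by rewrite chi_in.
rewrite chi_out// chi_out.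
  by rewrite rclampZ// dscale_ge1.
by rewrite normrZ ger0_norm ?mulr_ege1 ?dscale_ge1// (le_trans ler01) ?dscale_ge1.
Qed.

Hypothesis ca : continuous a.

Lemma deform_cts : continuous deform.
Proof.
have cd (g : R * 'rV[R]_k -> 'rV[R]_d.+1) : continuous g ->
    continuous (fun z : R * 'rV[R]_k => dscale z.1 *: dmove z.1 z.2 (g z)).
  move=> cg; apply: cts_scale.
    by apply: (@cts_comp _ _ _ fst dscale); [exact: cts_fst|exact: cts_dscale].
  apply: cts_addv => //; apply: cts_scale.
    apply: cts_mul; first by apply: cts_clamp; exact: cts_fst.
    exact: cts_bcut.
  apply: cts_addv; first by apply: (@cts_comp _ _ _ snd ktau); [exact: cts_snd|exact: cts_ktau].
  rewrite (_ : (fun z => _) = fun z => -1 *: g z); last by apply: funext => z; rewrite scaleN1r.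
  by apply: cts_scale => //; exact: cts_cst.
have ca2 : continuous (fun z : R * 'rV[R]_k => a z.2) by apply: (cts_comp _ ca); exact: cts_snd.
move=> [s0 t0]; case e : (a t0) => [y|[l u]].
  (* Near a point of the base, some coordinate in the cell is less than [bcc / 4], so [bcut]
     vanishes. *)
  apply: (@cts_near _ _ _ (fun z => pushoff (z.1, a z.2))).
    have : open ((fun z : R * 'rV[R]_k => a z.2) @^-1`
        [set w : W | forall l (u : ball1), w = inr (l, u) -> exists i, bc (sval u) i < c / 4]).
      apply: open_preim => //; apply/attach_openE; split=> [|l].
        rewrite (_ : _ @^-1` _ = setT); first exact: openT.
        by apply/seteqP; split.
      rewrite (_ : _ @^-1` _ = \bigcup_(i in setT) [set x | bc x i < c / 4]).
        apply: bigcup_open => i _.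
        by apply: (@open_preim _ _ (fun x => bc x i) [set z | z < c / 4]); [apply: cts_bc; exact: cts_id|exact: open_lt].
      apply/seteqP; split=> x /=.
        move=> h; have [/(@bc_norm_ge1 R d)[i hi]|x1] := leP 1 `|x|.
          by exists i => //=; apply: lt_trans hi _; rewrite divr_gt0// bcc_gt0.
        by have [i hi] := h l _ (chi_in _ _ x1); exists i.
      move=> [i _ hi] l' u'; have [x1|x1] := leP 1 `|x|; first by rewrite chi_out.
      by rewrite chi_in => -[_ <-] /=; exists i.
    move=> op; have : nbhs (s0, t0) ((fun z : R * 'rV[R]_k => a z.2) @^-1`
        [set w : W | forall l (u : ball1), w = inr (l, u) -> exists i, bc (sval u) i < c / 4]).
      by apply: open_nbhs_nbhs; split=> //= l u; rewrite e.
    apply: filterS => -[s t] /=; rewrite /deform /pushoff /=; case: (a t) => [//|[l u]] h.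
    by have [i hi] := h l u erefl; rewrite /dmove (@bcut0 _ _ _ i) ?(ltW hi)// mulr0 scale0r addr0.
  apply: (@cts_comp _ _ _ (fun z : R * 'rV[R]_k => (z.1, a z.2)) pushoff); last exact: cts_pushoff.
  by apply: cts_pair => //; exact: cts_fst.
(* Any radius strictly between the norm of [u] and 1 will do: inside it, the coordinate in the cell
   is the restriction of the continuous map [cutoff l r]. *)
have u1 := svalP u; pose r := (1 + `|sval u|) / 2.
have r1 : r < 1 by rewrite /r; lra.
have ur : `|sval u| < r by rewrite /r; lra.
apply: (@cts_near _ _ _ (fun z => chi l (dscale z.1 *: dmove z.1 z.2 (cutoff l r (a z.2))))).
  have op : open ((fun z : R * 'rV[R]_k => a z.2) @^-1`
      [set w : W | exists u : ball1, `|sval u| < r /\ w = inr (l, u)]).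
    apply: open_preim => //; apply: (@open_cell _ _ _ _ att l [set x | `|x| < r]).
    apply: (@open_preim _ _ (fun x : 'rV[R]_d.+1 => `|x|) [set z | z < r]); last exact: open_lt.
    by apply: cts_norm; exact: cts_id.
  have : nbhs (s0, t0) ((fun z : R * 'rV[R]_k => a z.2) @^-1`
      [set w : W | exists u : ball1, `|sval u| < r /\ w = inr (l, u)]).
    by apply: open_nbhs_nbhs; split=> //=; exists u.
  by apply: filterS => -[s t] /= [u' [u'r e']]; rewrite /deform /= e' cutoff_id.
apply: (@cts_comp _ _ _ (fun z : R * 'rV[R]_k => dscale z.1 *: dmove z.1 z.2 (cutoff l r (a z.2))) (chi l)); last exact: cts_chi.
by apply: cd; apply: (cts_comp ca2); exact: cts_cutoff.
Qed.

Lemma deform0 t : deform (0, t) = a t.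
Proof.
rewrite /deform /=; case: (a t) => [//|[l u]].
by rewrite dscale0 scale1r /dmove clamp0 mul0r scale0r addr0 -chi_val.
Qed.

Lemma deform_inl s t y : a t = inl y -> deform (s, t) = inl y.
Proof. by rewrite /deform /= => ->. Qed.

Lemma deform1_out t l u : a t = inr (l, u) ->
  (exists i, bc (dmove 1 t (sval u)) i < c / 2) ->
  deform (1, t) = inl (att l (rclamp (drad^-1 *: dmove 1 t (sval u)))).
Proof.
move=> e [i hi]; rewrite /deform /= e dscale1; apply: chi_out.
rewrite normrZ ger0_norm ?invr_ge0 ?(ltW drad_gt0)//.
rewrite ler_pdivlMl ?drad_gt0// mulr1 leNgt; apply/negP => h.
have /(bc_small i) : forall j, `|(dmove 1 t (sval u)) ord0 j| <= drad.
  by move=> j; apply: le_trans (ltW h); exact: coord_le_norm.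
have -> : d.+1%:R * drad = c / 2.
  rewrite /drad; have : d.+1%:R != 0 :> R by rewrite pnatr_eq0.
  by move: bcc d.+1%:R => b N N0; field.
by move=> h'; move: hi; rewrite ltNge => /negP; apply; apply: le_trans h'; have := bcc_gt0 R d; lra.
Qed.

Hypothesis mesh : forall t t' : 'rV[R]_k, cube t ->
    (forall i, `|t ord0 i - t' ord0 i| < M%:R^-1) ->
    forall l u, a t = inr (l, u) -> (forall i, c / 4 <= bc (sval u) i) ->
    exists u', a t' = inr (l, u') /\ forall i, `|bc (sval u) i - bc (sval u') i| < c / 4.

(** Suppose that coordinate i is less than [bcc / 2]. Either [bcut] vanishes, or no vertex around
    has label i: there the coordinate would be at least [bcc], and it varies by less than [bcc / 4].
    So the deformation cannot increase coordinate i. If no coordinate is that small, [bcut] is 1 and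
    the point moves to [ktau t], whose coordinates at missing labels vanish. *)
Lemma deform_case t l u : cube t -> a t = inr (l, u) ->
  (exists i, bc (dmove 1 t (sval u)) i < c / 2) \/
  ((forall i, c / 2 <= bc (sval u) i) /\
   (forall i, exists v : V, 0 < hat v t /\ klab v = i)).
Proof.
move=> ct e; have c0 := bcc_gt0 R d.
have dmE i : bc (dmove 1 t (sval u)) i = (1 - bcut (sval u)) * bc (sval u) i + bcut (sval u) * kwt i t.
  by rewrite /dmove clamp1 mul1r bc_conv bc_ktau.
have [[i hi]|/forallNP hc] := pselect (exists i, bc (sval u) i < c / 2).
  left; exists i; rewrite dmE; have [/existsNP[j /negP hj]|hall] := pselect (~ forall j, c / 4 <= bc (sval u) j).
    have hj' : bc (sval u) j <= c / 4 by rewrite ltW// ltNge.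
    by rewrite (bcut0 hj') subr0 mul1r mul0r addr0.
  have {}hall : forall j, c / 4 <= bc (sval u) j by apply: contrapT.
  rewrite (@kwt_eq0 t i) ?mulr0 ?addr0; last first.
    move=> v; rewrite clampv_id// => /(hat_close M0) hv; apply/eqP => vi.
    have [u' [e' h']] := mesh ct hv e hall.
    have vi' : blab (sval u') = i by rewrite -vi /klab e'.
    have := blab_ge (sval u'); rewrite vi' => h1.
    by have := h' i; rewrite ltr_norml => /andP[h3 _]; clear e' e; lra.
  have /andP[b0 b1] := bcut01 (sval u).
  apply: le_lt_trans hi; rewrite ler_piMl//; last by clear e; lra.
  by apply: le_trans (hall i); rewrite divr_ge0// ltW.
have {}hc : forall i, c / 2 <= bc (sval u) i.
  by move=> i; rewrite leNgt; apply/negP/hc.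
have [hl|/existsNP[i /forallNP hi]] := pselect (forall i, exists v : V, 0 < hat v t /\ klab v = i).
  by right.
left; exists i; rewrite dmE bcut1// subrr mul0r add0r mul1r kwt_eq0; last first.
  by move=> v; rewrite clampv_id// => hv; apply/eqP => vi; apply: (hi v).
by rewrite divr_gt0.
Qed.

Lemma labels_le (t : 'rV[R]_k) : (forall i : 'I_d.+2, exists v : V, 0 < hat v t /\ klab v = i) -> (d < k)%N.
Proof.
move=> h; have /choice[f hf] : forall i, exists v : V, 0 < hat v t /\ klab v = i by [].
have fi : injective f by move=> i j e; rewrite -(hf i).2 e (hf j).2.
have := @hat_card R k M t [set f i | i in 'I_d.+2].
rewrite card_imset// card_ord !ltnS => ->//.
by move=> v /imsetP[i _ ->]; exact: (hf i).1.
Qed.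

End Deform.

Section DeformIntoBase.
Context (R : realType) (Y : topologicalType) (L : Type) (d : nat).
Context (att : L -> 'rV[R]_d.+1 -> Y).
Hypothesis att_cts : forall l, {within [set x | `|x| = 1], continuous (att l)}.
Notation W := (attach att).

(* Cells of dimension greater than k can be avoided: Sperner labels of a
   k-dimensional simplex cannot exhaust the d.+2 vertices of the simplex. *)
Lemma sph_into_base k (y : Y) (a : 'rV[R]_k -> W) : (k <= d)%N -> is_sph (inl y : W) a ->
  exists b : 'rV[R]_k -> Y, is_sph y b /\ htp (inl y : W) a (inl \o b).
Proof.
move=> kd sa; have [ca ha] := sa; have [M M0 mesh] := cell_mesh ca.
pose g t := deform M a (1, t).
have cg : continuous g.
  apply: (@cts_comp _ _ _ (fun t : 'rV[R]_k => (1 : R, t)) (deform M a)); last exact: deform_cts.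
  by apply: cts_pair; [exact: cts_cst|exact: cts_id].
have hg t : exists y', g t = inl y'.
  case e : (a t) => [y'|[l u]]; first by exists y'; exact: deform_inl.
  have ct : cube t.
    by apply: ocube_cube; apply: contrapT => /ha; rewrite e.
  have [h|[_ /labels_le]] := deform_case M0 mesh ct e; last by rewrite ltnNge kd.
  by eexists; exact: deform1_out e h.
have /choice[b hb] := hg.
exists b; have hH : htp (inl y : W) a (inl \o b).
  exists (deform M a); split.
  - exact: deform_cts.
  - by move=> t; exact: deform0.
  - by move=> t; rewrite /= -hb.
  - by move=> s t /ha; exact: deform_inl.
split=> //; split; last first.
  by move=> t ot; have : inl (b t) = inl y :> W by [rewrite -hb /g (deform_inl _ _ (ha _ ot))|]; case.
(* Continuity descends to the base because [inl] is a closed injection. *)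
apply/cts_closed => C cC; rewrite (_ : _ @^-1` _ = g @^-1` [set w : W | exists2 y, C y & w = inl y]).
  by apply: closed_preim => //; exact: closed_inl.
apply/seteqP; split=> t /=; first by exists (b t).
by move=> [y' Cy]; rewrite hb => -[->].
Qed.

End DeformIntoBase.

(** * Spheres supported on a ball *)

Section Cut.
Context (R : realType) (n : nat) (B : topologicalType) (b0 : B).
Implicit Types (f g : 'rV[R]_n.+1 -> B) (a : 'rV[R]_n.+1 -> R).

Definition decr_fst a :=
  continuous a /\ forall (r r' : R) t, r <= r' -> a (set_fst r' t) <= a (set_fst r t).

(* Since a decreases along the first coordinate, the supports of the two parts
   stay disjoint while they slide apart in that direction. *)
Lemma htp_cut f a : is_sph b0 f -> decr_fst a -> (forall t, a t = 0 -> f t = b0) ->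
  let fp := fun t => if a t <= 0 then b0 else f t in
  let fn := fun t => if a t <= 0 then f t else b0 in
  [/\ is_sph b0 fp, is_sph b0 fn & htp b0 f (fmul fp fn)].
Proof.
move=> [cf hf] [ca da] a0 fp fn.
have sp : is_sph b0 fp.
  split; last by move=> t ot; rewrite /fp; case: ifP => // _; exact: hf.
  by apply: cts_if => //; [exact: cts_cst|move=> t /a0].
have sn : is_sph b0 fn.
  split; last by move=> t ot; rewrite /fn; case: ifP => // _; exact: hf.
  by apply: cts_if => //; exact: cts_cst.
split=> //.
(* At time 0 both [F] and [G] are the identity, and at time 1 they are the reparametrizations of the
   two halves in [fmul]. The first coordinate of [F] is never the smaller one, so [a] is at most as
   large along [F] as along [G]. *)
pose F (z : R * 'rV[R]_n.+1) := set_fst ((1 + clamp z.1) * z.2 ord0 ord0) z.2.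
pose G (z : R * 'rV[R]_n.+1) := set_fst ((1 + clamp z.1) * z.2 ord0 ord0 - clamp z.1) z.2.
have c0 : continuous (fun z : R * 'rV[R]_n.+1 => (1 + clamp z.1) * z.2 ord0 ord0).
  apply: cts_mul; first by apply: cts_add; [exact: cts_cst|apply: cts_clamp; exact: cts_fst].
  by apply: cts_coord; exact: cts_snd.
have cF : continuous F by apply: continuous_set_fst => //; exact: cts_snd.
have cG : continuous G.
  apply: continuous_set_fst; last exact: cts_snd.
  by apply: cts_sub => //; apply: cts_clamp; exact: cts_fst.
have aFG z : a (F z) <= a (G z).
  by apply: da; rewrite gerBl clamp_ge0.
have fn0 z : 0 <= a (F z) -> fn (G z) = b0.
  move=> h; rewrite /fn; case: ifP => // h'; apply: a0; apply: le_anti; rewrite h'.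
  exact: le_trans h (aFG z).
have obF z : ~ ocube n.+1 z.2 -> ~ ocube n.+1 (F z).
  move=> oz; apply: ocube_set_fst' => // /andP[h1 h2]; have := clamp_ge0 z.1.
  move: (clamp z.1) (z.2 ord0 ord0) h1 h2 => s t0 h1 h2 s0; apply/andP; split.
    by move: h1; rewrite pmulr_rgt0//; lra.
  by nra.
have obG z : ~ ocube n.+1 z.2 -> ~ ocube n.+1 (G z).
  move=> oz; apply: ocube_set_fst' => // /andP[h1 h2]; have := clamp_ge0 z.1.
  move: (clamp z.1) (z.2 ord0 ord0) h1 h2 => s t0 h1 h2 s0.
  by apply/andP; split; nra.
exists (fun z => if a (F z) <= 0 then fn (G z) else fp (F z)); split.
- apply: cts_if.
  + exact: (cts_comp cF ca).
  + exact: (cts_comp cG sn.1).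
  + exact: (cts_comp cF sp.1).
  + by move=> z h; rewrite fn0 ?h// /fp h lexx.
- move=> t; rewrite /F /G /= clamp0 addr0 mul1r subr0 set_fstK /fn /fp.
  by case: ifP => // ->.
- move=> t; rewrite /fmul; have [t2|t2] := leP (t ord0 ord0) 2^-1.
    have -> : set_fst (2 * t ord0 ord0 + 0) t = F (1, t).
      by rewrite /F /= clamp1 addr0.
    case: ifP => // h; rewrite {1}/fp h sn.2//; apply: ocube_set_fst => /andP[].
    by rewrite /= clamp1; lra.
  have -> : set_fst (2 * t ord0 ord0 + -1) t = G (1, t) by rewrite /G /= clamp1.
  case: ifP => // h; rewrite fn0; last by rewrite ltW// ltNge h.
  rewrite sp.2//; apply: ocube_set_fst => /andP[].
  by rewrite /= clamp1; lra.
- move=> s t ot; case: ifP => _; first by apply: sn.2; exact: obG.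
  by apply: sp.2; exact: obF.
Qed.

Context (N : top_pi R n b0 -> Prop).
Hypothesis N1 : N 1%g.
Hypothesis NM : forall u v, N u -> N v -> N (u * v)%g.

(** Cutting along one hypersurface after another writes the class as a product of the classes of
    pieces, each with a constant sign pattern. A piece which is not constant contains a point [t0]
    with its pattern, so only patterns that occur need be considered. *)
Lemma cls_cuts (I : Type) (cut : I -> 'rV[R]_n.+1 -> R) (r : seq I) f :
  (forall i, decr_fst (cut i)) -> is_sph b0 f ->
  (forall i t, cut i t = 0 -> f t = b0) ->
  (forall t0, f t0 <> b0 ->
     N (cls b0 (fun t => if all (fun i => (cut i t <= 0) == (cut i t0 <= 0)) r then f t else b0))) ->
  N (cls b0 f).
Proof.
move=> dc; elim: r f => [|i r IH] f sf f0 h /=.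
  have [[t0 /h]|/forallNP ft] := pselect (exists t0, f t0 <> b0).
    by rewrite (_ : (fun t => _) = f).
  have -> : f = (fun=> b0) by apply: funext => t; apply: contrapT => /ft.
  by rewrite cls1.
have [sp sn fpn] := htp_cut sf (dc i) (f0 i).
rewrite ((clsP sf (fmul_sph sp sn)).2 fpn) cls_mul//; apply: NM; apply: IH => //.
- by move=> j t jt; case: ifP => // _; exact: (f0 j).
- move=> t0; case: ifP => // a0 ft0; have := h t0 ft0; congr (N (cls _ _)).
  apply: funext => t /=; rewrite a0.
  by case: (cut i t <= 0) => //=; case: ifP.
- by move=> j t jt; case: ifP => // _; exact: (f0 j).
- move=> t0; case: ifP => // a0 ft0; have := h t0 ft0; congr (N (cls _ _)).
  apply: funext => t /=; rewrite a0.
  by case: (cut i t <= 0) => //=; case: ifP.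
Qed.

End Cut.

(** * Affine changes of variable for spheres supported on the unit ball *)

Section Linear.
Context (R : realType) (n : nat) (B : topologicalType) (b0 : B).
Notation D := n.+1.
Notation vec := 'rV[R]_D.
Implicit Types (h : vec -> B) (G : 'M[R]_D).

Definition is_bmap h := continuous h /\ forall x, 1 <= `|x| -> h x = b0.

(** The change of variable takes the open cube onto the open unit ball of the maximum norm, where
    linear maps act about the center. *)
Definition bmap h : vec -> B := fun t => h (2 *: t - const_mx 1).

Lemma bmap_out (t : vec) : ~ ocube D t <-> 1 <= `|2 *: t - const_mx 1|.
Proof.
split=> [ot|h ot].
  rewrite leNgt; apply/negP => /norm_rV_lt h; apply: ot => i.
  have := h ltr01 i; rewrite !mxE ltr_norml => /andP[? ?]; apply/andP; split; lra.
suff : `|2 *: t - const_mx 1| < 1 by rewrite ltNge h.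
apply/norm_rV_lt => // i; rewrite !mxE ltr_norml; have /andP[? ?] := ot i.
by apply/andP; split; lra.
Qed.

Lemma cts_aff : continuous (fun t : vec => 2 *: t - const_mx 1).
Proof.
apply: cts_addv; last exact: cts_cst.
by apply: cts_scale; [exact: cts_cst|exact: cts_id].
Qed.

Lemma bmap_sph h : is_bmap h -> is_sph b0 (bmap h).
Proof.
move=> [ch hh]; split; first exact: (cts_comp cts_aff ch).
by move=> t /bmap_out; exact: hh.
Qed.

Lemma bmap_htp h h' (H : R * vec -> B) : continuous H ->
  (forall x, H (0, x) = h x) -> (forall x, H (1, x) = h' x) ->
  (forall s x, 1 <= `|x| -> H (s, x) = b0) -> htp b0 (bmap h) (bmap h').
Proof.
move=> cH H0 H1 Hb; exists (fun z => H (z.1, 2 *: z.2 - const_mx 1)); split.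
- apply: (@cts_comp _ _ _ (fun z : R * vec => (z.1, 2 *: z.2 - const_mx 1)) H) => //.
  apply: cts_pair; first exact: cts_fst.
  by apply: (@cts_comp _ _ _ snd (fun t : vec => 2 *: t - const_mx 1)); [exact: cts_snd|exact: cts_aff].
- by move=> t /=; rewrite H0.
- by move=> t /=; rewrite H1.
- by move=> s t /bmap_out; exact: Hb.
Qed.

Lemma cts_mulmx (T : topologicalType) (p : T -> vec) G :
  continuous p -> continuous (fun t => p t *m G).
Proof.
move=> cp; apply: continuous_row => j.
rewrite (_ : (fun t => _) = fun t => \sum_i p t ord0 i * G i j); last by apply: funext => t; rewrite mxE.
apply: (@cts_sum _ _ _ _ _ (fun i t => p t ord0 i * G i j)) => i.
by apply: cts_mul; [exact: cts_coord|exact: cts_cst].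
Qed.

(** The condition under which precomposition keeps a map constant outside the unit ball. *)
Definition expanding G := forall x : vec, 1 <= `|x| -> 1 <= `|x *m G|.

Lemma is_bmap_mul h G : is_bmap h -> expanding G -> is_bmap (fun x => h (x *m G)).
Proof.
move=> [ch hh] eG; split; first by apply: (cts_comp _ ch); apply: cts_mulmx; exact: cts_id.
by move=> x /eG; exact: hh.
Qed.

Lemma pos_compact (T : topologicalType) (K : set T) (f : T -> R) : compact K ->
  continuous f -> (forall z, K z -> 0 < f z) ->
  exists2 e, 0 < e & forall z, K z -> e < f z.
Proof.
move=> /compact_near_coveringP cK cf f0.
have [|e [/= e0 he]] := @filter_ex _ (0 : R)^'+ _ (fun e => 0 < e /\ forall z, K z -> e < f z).
  apply: filterI; first exact: nbhs_right_gt.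
  apply: (cK R (0 : R)^'+ (fun e z => e < f z)) => z Kz.
  exists ([set z' | f z / 2 < f z'], [set e | e < f z / 2]) => /=.
    split; last by apply: nbhs_right_lt; rewrite divr_gt0// f0.
    apply: open_nbhs_nbhs; split.
      by apply: (@open_preim _ _ f [set y | f z / 2 < y]) => //; exact: open_gt.
    by rewrite /= ltr_pdivrMr// ltr_pMr ?f0// ltr1n.
  by move=> [z' e] [/= h1 h2]; exact: lt_trans h1.
by exists e.
Qed.

Lemma unitmx_ker G : (forall x : vec, x *m G = 0 -> x = 0) -> G \in unitmx.
Proof.
move=> h; rewrite -row_free_unit; apply: inj_row_free => x; exact: h.
Qed.

Lemma mulmx_ker G (x : vec) : G \in unitmx -> x *m G = 0 -> x = 0.
Proof. by move=> uG e; rewrite -(mulmxK uG x) e mul0mx. Qed.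

Lemma sphere_compact : compact [set x : vec | `|x| = 1].
Proof.
apply: bounded_closed_compact.
  exists 1; split; first by rewrite num_real.
  by move=> M M1 x /= ->; rewrite ltW.
apply: (@closed_preim _ _ (fun x : vec => `|x|) [set z | z = 1]); last exact: closed_eq.
by apply: cts_norm; exact: cts_id.
Qed.

Definition mxpath G G' (s : R) : 'M[R]_D := (1 - s) *: G + s *: G'.

(** By compactness of the interval times the unit sphere, one constant works along the whole path;
    its inverse makes all the matrices of the path expanding at once. *)
Lemma mxpath_lower G G' : (forall s : R, 0 <= s <= 1 -> mxpath G G' s \in unitmx) ->
  exists2 e, 0 < e & forall (s : R) (x : vec), 0 <= s <= 1 -> e * `|x| <= `|x *m mxpath G G' s|.
Proof.
move=> uG; pose f (z : R * vec) := `|z.2 *m mxpath G G' z.1|.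
have cf : continuous f.
  apply: cts_norm; rewrite (_ : (fun z => _) = fun z : R * vec => (1 - z.1) *: (z.2 *m G) + z.1 *: (z.2 *m G')).
    apply: cts_addv; apply: cts_scale.
    - by apply: cts_sub; [exact: cts_cst|exact: cts_fst].
    - by apply: cts_mulmx; exact: cts_snd.
    - exact: cts_fst.
    - by apply: cts_mulmx; exact: cts_snd.
  by apply: funext => z; rewrite /mxpath mulmxDr -!scalemxAr.
have cK : compact (`[(0 : R), 1]%classic `*` [set x : vec | `|x| = 1] : set (R * vec)%type).
  by apply: compact_setX; [exact: segment_compact|exact: sphere_compact].
have [|e e0 he] := pos_compact cK cf.
  move=> [s x] [/=]; rewrite in_itv /= => s01 x1; rewrite /f /= normr_gt0.
  apply/eqP => /(mulmx_ker (uG s s01)) x0; move: x1; rewrite x0 normr0 => /eqP.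
  by rewrite eq_sym oner_eq0.
exists e => // s x s01; have [->|x0] := eqVneq x 0; first by rewrite mul0mx !normr0 mulr0.
have nx : 0 < `|x| by rewrite normr_gt0.
have : e < f (s, `|x|^-1 *: x).
  by apply: he; split=> /=; [rewrite in_itv|rewrite normrZ ger0_norm ?invr_ge0// mulVf// gt_eqF].
rewrite /f /= -scalemxAl normrZ ger0_norm ?invr_ge0// mulrC ltr_pdivlMr// => /ltW //.
Qed.

Lemma mx_lower G : G \in unitmx -> exists2 e, 0 < e & forall x : vec, e * `|x| <= `|x *m G|.
Proof.
move=> uG; have pG s : mxpath G G s = G by rewrite /mxpath -scalerDl subrK scale1r.
have [|e e0 he] := @mxpath_lower G G; first by move=> s _; rewrite pG.
by exists e => // x; have := he 0 x; rewrite pG lexx ler01 => ->.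
Qed.

Context (N : top_pi R n b0 -> Prop).
Hypothesis NV : forall u, N u -> N (u^-1)%g.

Definition ball_in h := N (cls b0 (bmap h)).

Lemma ball_in_htp h h' (H : R * vec -> B) : continuous H ->
  (forall x, H (0, x) = h x) -> (forall x, H (1, x) = h' x) ->
  (forall s x, 1 <= `|x| -> H (s, x) = b0) -> ball_in h <-> ball_in h'.
Proof.
move=> cH H0 H1 Hb; have hh := bmap_htp cH H0 H1 Hb.
by have [sh sh'] := htp_sph hh; rewrite /ball_in ((clsP sh sh').2 hh).
Qed.

Lemma ball_in_affine h (p : R -> vec) (A : R -> R) G : is_bmap h -> continuous p -> continuous A ->
  (forall (s : R) x, 0 <= s <= 1 -> 1 <= `|x| -> 1 <= `|A s *: ((x - p s) *m G)|) ->
  ball_in (fun x => h (A 0 *: ((x - p 0) *m G))) <-> ball_in (fun x => h (A 1 *: ((x - p 1) *m G))).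
Proof.
move=> [ch hh] cp cA hb.
apply: (@ball_in_htp _ _ (fun z => h (A (clamp z.1) *: ((z.2 - p (clamp z.1)) *m G)))).
- have cc : continuous (fun z : R * vec => clamp z.1) by apply: cts_clamp; exact: cts_fst.
  apply: (cts_comp _ ch); apply: cts_scale; first exact: (cts_comp cc cA).
  apply: cts_mulmx; apply: cts_addv; first exact: cts_snd.
  rewrite (_ : (fun z => _) = fun z : R * vec => -1 *: p (clamp z.1)); last by apply: funext => z; rewrite scaleN1r.
  by apply: cts_scale; [exact: cts_cst|exact: (cts_comp cc cp)].
- by move=> x /=; rewrite clamp0.
- by move=> x /=; rewrite clamp1.
- by move=> s x x1; apply: hh; apply: hb => //; exact: clamp01.
Qed.

Lemma ball_in_scale h G r : is_bmap h -> expanding G -> 1 <= r ->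
  ball_in (fun x => h (x *m G)) <-> ball_in (fun x => h (x *m (r *: G))).
Proof.
move=> bh eG r1.
have := @ball_in_affine h (fun=> 0) (fun s => 1 + s * (r - 1)) G bh.
rewrite mul0r addr0 mul1r.
have -> : (fun x : vec => h (1 *: ((x - 0) *m G))) = fun x => h (x *m G).
  by apply: funext => x; rewrite scale1r subr0.
have -> : (fun x : vec => h ((1 + (r - 1)) *: ((x - 0) *m G))) = fun x => h (x *m (r *: G)).
  by apply: funext => x; rewrite subr0 addrC subrK scalemxAr.
apply.
- exact: cts_cst.
- by apply: cts_add; [exact: cts_cst|apply: cts_mul; [exact: cts_id|exact: cts_cst]].
move=> s x /andP[s0 _] x1; have s1 : 1 <= 1 + s * (r - 1) by rewrite lerDl mulr_ge0// subr_ge0.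
by rewrite subr0 normrZ ger0_norm ?(le_trans ler01)// mulr_ege1// eG.
Qed.

(** Only expanding multiples of [G] act on maps of the ball. By [scale_max], [N] does not see which
    one is chosen, so the property belongs to [G] up to positive scaling and is stable under
    products and paths. *)
Definition mx_in G := G \in unitmx /\ forall h r, is_bmap h -> 0 < r -> expanding (r *: G) ->
  ball_in h -> ball_in (fun x => h (x *m (r *: G))).

Lemma scale_max h G r r' : is_bmap h -> 0 < r -> 0 < r' -> expanding (r *: G) -> expanding (r' *: G) ->
  ball_in (fun x => h (x *m (r *: G))) <-> ball_in (fun x => h (x *m (r' *: G))).
Proof.
move=> bh; wlog rr : r r' / r <= r'.
  move=> W r0 r0' e e'; have [rr|/ltW rr] := leP r r'; first exact: W.
  by apply: iff_sym; exact: W.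
move=> r0 r0' e _; have := @ball_in_scale h (r *: G) (r' / r) bh e.
rewrite scalerA divfK ?gt_eqF//; apply.
by rewrite ler_pdivlMr// mul1r.
Qed.

Lemma expanding_ex G : G \in unitmx -> exists2 r, 0 < r & expanding (r *: G).
Proof.
move=> /mx_lower[e e0 he]; exists e^-1; first by rewrite invr_gt0.
move=> x x1; rewrite -scalemxAr normrZ ger0_norm ?invr_ge0 ?(ltW e0)//.
rewrite ler_pdivlMl// mulr1; apply: le_trans (he x).
by rewrite ler_peMr// ltW.
Qed.

Lemma mx_in_expanding G : G \in unitmx -> expanding G ->
  (forall h, is_bmap h -> ball_in h -> ball_in (fun x => h (x *m G))) -> mx_in G.
Proof.
move=> uG eG hG; split=> // h r bh r0 er gh.
have e1 : expanding (1 *: G) by rewrite scale1r.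
by apply/(scale_max bh ltr01 r0 e1 er); rewrite scale1r; exact: hG.
Qed.

Lemma mx_in1 : mx_in 1%:M.
Proof.
apply: mx_in_expanding; first exact: unitmx1.
  by move=> x x1; rewrite mulmx1.
by move=> h bh gh; rewrite (_ : (fun x => _) = h)//; apply: funext => x; rewrite mulmx1.
Qed.

Lemma mx_inM G G' : mx_in G -> mx_in G' -> mx_in (G *m G').
Proof.
move=> [uG hG] [uG' hG']; split; first by rewrite unitmx_mul uG.
move=> h r bh r0 er gh.
have [r1 r10 e1] := expanding_ex uG; have [r2 r20 e2] := expanding_ex uG'.
have bh' := is_bmap_mul bh e2.
have := hG _ r1 bh' r10 e1 (hG' h r2 bh r20 e2 gh).
rewrite (_ : (fun x => _) = fun x => h (x *m ((r1 * r2) *: (G *m G')))); last first.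
  by apply: funext => x; rewrite -!scalemxAr -scalemxAl !scalerA mulmxA mulrC.
have e12 : expanding ((r1 * r2) *: (G *m G')).
  move=> x x1; have := e2 _ (e1 x x1).
  by rewrite -!scalemxAr -scalemxAl !scalerA mulmxA mulrC.
by have := (scale_max bh (mulr_gt0 r10 r20) r0 e12 er).1; apply.
Qed.

Lemma mx_in_path G G' : (forall s : R, 0 <= s <= 1 -> mxpath G G' s \in unitmx) ->
  mx_in G -> mx_in G'.
Proof.
move=> uG [_ hG]; have p0 : mxpath G G' 0 = G by rewrite /mxpath subr0 scale1r scale0r addr0.
have p1 : mxpath G G' 1 = G' by rewrite /mxpath subrr scale1r scale0r add0r.
split; first by rewrite -p1; apply: uG; rewrite ler01 lexx.
have [e e0 he] := mxpath_lower uG; move=> h r bh r0 er gh.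
have ee s : 0 <= s <= 1 -> expanding (e^-1 *: mxpath G G' s).
  move=> s01 x x1; rewrite -scalemxAr normrZ ger0_norm ?invr_ge0 ?(ltW e0)//.
  rewrite ler_pdivlMl// mulr1; apply: le_trans (he s x s01).
  by rewrite ler_peMr// ltW.
have e00 : 0 < e^-1 by rewrite invr_gt0.
have e1 : expanding (e^-1 *: G') by rewrite -p1; apply: ee; rewrite ler01 lexx.
apply/(scale_max bh e00 r0 e1 er).
have eG : expanding (e^-1 *: G) by rewrite -p0; apply: ee; rewrite ler01 lexx.
have := hG h _ bh e00 eG gh.
have [ch hh] := bh.
apply: (@ball_in_htp _ _ (fun z => h (e^-1 *: ((1 - clamp z.1) *: (z.2 *m G) + clamp z.1 *: (z.2 *m G')))) _ _ _ _).1.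
- apply: (cts_comp _ ch); apply: cts_scale; first exact: cts_cst.
  have cc : continuous (fun z : R * vec => clamp z.1) by apply: cts_clamp; exact: cts_fst.
  apply: cts_addv; apply: cts_scale => //.
  - by apply: cts_sub => //; exact: cts_cst.
  - by apply: cts_mulmx; exact: cts_snd.
  - by apply: cts_mulmx; exact: cts_snd.
- by move=> x /=; rewrite clamp0 subr0 scale1r scale0r addr0 scalemxAr.
- by move=> x /=; rewrite clamp1 subrr scale1r scale0r add0r scalemxAr.
- move=> s x x1; apply: hh; have := ee (clamp s) (clamp01 s) x x1.
  by rewrite -scalemxAr /mxpath mulmxDr -!scalemxAr.
Qed.

(** The center of the ball moves from 0 to [q] while the matrix is scaled up by a large factor,
    which is removed afterwards. Both homotopies stay constant outside the ball. *)
Lemma mx_in_affine h (q : vec) G : mx_in G -> `|q| < 1 -> is_bmap h ->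
  (forall x : vec, 1 <= `|x| -> 1 <= `|(x - q) *m G|) ->
  ball_in h -> ball_in (fun x => h ((x - q) *m G)).
Proof.
move=> [uG hG] q1 bh hq gh; have [e e0 he] := mx_lower uG.
have q0 : 0 < 1 - `|q| by rewrite subr_gt0.
(* For x outside the open ball, every [(x - (1 - s) *: q) *m G] has norm at least [e * (1 - |q|)];
   the factor [r] brings this above 1. *)
pose r := Num.max 1 (e * (1 - `|q|))^-1.
have r1 : 1 <= r by rewrite /r le_max lexx.
have r0 : 0 < r by apply: lt_le_trans r1.
have eqr : 1 <= r * (e * (1 - `|q|)).
  by rewrite -ler_pdivrMr ?mulr_gt0// div1r /r le_max lexx orbT.
have hr s (x : vec) : 0 <= s <= 1 -> 1 <= `|x| -> 1 <= `|r *: ((x - (1 - s) *: q) *m G)|.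
  move=> /andP[s0 s1] x1; rewrite normrZ ger0_norm ?(ltW r0)//.
  apply: le_trans eqr _; rewrite ler_pM2l//; apply: le_trans (he _).
  rewrite ler_pM2l//; apply: le_trans (lerB_dist _ _); apply: lerB => //.
  by rewrite normrZ ger0_norm ?subr_ge0// ler_piMl// gerBl.
have er : expanding (r *: G).
  by move=> x x1; have := hr 1 x; rewrite subrr scale0r subr0 -scalemxAr ler01 lexx; apply.
have := hG h r bh r0 er gh.
have -> : (fun x : vec => h (x *m (r *: G))) = fun x => h (r *: ((x - (1 - 1) *: q) *m G)).
  by apply: funext => x; rewrite subrr scale0r subr0 scalemxAr.
move/(@ball_in_affine h (fun s => (1 - s) *: q) (fun=> r) G bh _ _ hr).2.
rewrite subr0 scale1r => h1.
have := (@ball_in_affine h (fun=> q) (fun s => 1 + s * (r - 1)) G bh _ _ _).2.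
rewrite mul0r addr0 mul1r [1 + (r - 1)]addrC subrK.
have -> : (fun x : vec => h (1 *: ((x - q) *m G))) = fun x => h ((x - q) *m G).
  by apply: funext => x; rewrite scale1r.
apply.
- exact: cts_cst.
- by apply: cts_add; [exact: cts_cst|apply: cts_mul; [exact: cts_id|exact: cts_cst]].
- move=> s x /andP[s0 _] x1; have s1 : 1 <= 1 + s * (r - 1) by rewrite lerDl mulr_ge0// subr_ge0.
  by rewrite normrZ ger0_norm ?(le_trans ler01)// mulr_ege1// hq.
apply: h1.
- apply: cts_scale; last exact: cts_cst.
  by apply: cts_sub; [exact: cts_cst|exact: cts_id].
- exact: cts_cst.
Qed.

End Linear.

(** * Paths in the general linear group *)

Section GeneralLinear.
Context (R : realType) (n : nat) (B : topologicalType) (b0 : B).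
Notation D := n.+1.
Notation vec := 'rV[R]_D.
Context (N : top_pi R n b0 -> Prop).
Hypothesis NV : forall u, N u -> N (u^-1)%g.
Notation mx_in := (mx_in N).
Implicit Types G : 'M[R]_D.

Definition reflect (j : 'I_D) : 'M[R]_D := diag_mx (\row_k (if k == j then -1 else 1)).

Lemma reflectE (x : vec) j k : (x *m reflect j) ord0 k = (if k == j then -1 else 1) * x ord0 k.
Proof. by rewrite mul_mx_diag !mxE mulrC. Qed.

Lemma diag_mx_unit (e : vec) : (forall i, e ord0 i != 0) -> diag_mx e \in unitmx.
Proof. by move=> h; rewrite unitmxE det_diag unitfE; apply/prodf_neq0 => i _; exact: h. Qed.

(** Reversing the first coordinate is inversion in the homotopy group. This is where closure of [N]
    under inverses is used for matrices. *)
Lemma mx_in_reflect0 : mx_in (reflect ord0).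
Proof.
apply: mx_in_expanding.
- by apply: diag_mx_unit => i; rewrite mxE; case: ifP; rewrite ?oppr_eq0 oner_eq0.
- move=> x x1; have [i hi] := norm_rV_ge ltr01 x1; apply: le_trans (coord_le_norm _ i).
  by rewrite reflectE; case: ifP => _; rewrite ?mulN1r ?normrN ?mul1r.
move=> h bh; rewrite /ball_in => gh.
have e : bmap (fun x => h (x *m reflect ord0)) = frev (bmap h).
  apply: funext => t; rewrite /bmap /frev; congr h; apply/rowP => i.
  rewrite reflectE !mxE; case: eqP => [->|_]; last by rewrite mul1r.
  by ring.
rewrite e; have := NV gh; congr N; apply: mulg1_eq.
by rewrite cls_inv//; exact: bmap_sph.
Qed.

Lemma tperm_row (x : vec) i j k : (x *m tperm_mx i j) ord0 k = x ord0 (tperm i j k).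
Proof.
rewrite -[x in LHS]trmxK -[tperm_mx i j]trmxK -trmx_mul mxE /tperm_mx tr_perm_mx tpermV.
by rewrite -row_permE !mxE.
Qed.

(** In the plane of i and j, the matrix of the path has determinant [- (s ^+ 2 + (1 - s) ^+ 2)],
    which never vanishes; it is the identity on the other coordinates. *)
Lemma tperm_reflect_path i j (s : R) : i != j ->
  mxpath (tperm_mx i j) (reflect i) s \in unitmx.
Proof.
move=> ij; apply: unitmx_ker => x; rewrite /mxpath mulmxDr -!scalemxAr => /rowP e.
have {}e k : (1 - s) * x ord0 (tperm i j k) + s * ((if k == i then -1 else 1) * x ord0 k) = 0.
  by have := e k; rewrite !mxE -tperm_row -reflectE !mxE.
have q0 : 0 < s ^+ 2 + (1 - s) ^+ 2 by nra.
have ei := e i; have ej := e j; rewrite tpermL eqxx in ei.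
rewrite tpermR eq_sym (negbTE ij) in ej.
have xi : x ord0 i = 0.
  have : x ord0 i * (s ^+ 2 + (1 - s) ^+ 2) = 0.
    transitivity ((1 - s) * ((1 - s) * x ord0 i + s * (1 * x ord0 j)) -
      s * ((1 - s) * x ord0 j + s * (-1 * x ord0 i))); first by ring.
    by rewrite ei ej !mulr0 subrr.
  by move/eqP; rewrite mulf_eq0 (gt_eqF q0) orbF => /eqP.
have xj : x ord0 j = 0.
  have : x ord0 j * (s ^+ 2 + (1 - s) ^+ 2) = 0.
    transitivity ((1 - s) * ((1 - s) * x ord0 j + s * (-1 * x ord0 i)) +
      s * ((1 - s) * x ord0 i + s * (1 * x ord0 j))); first by ring.
    by rewrite ei ej !mulr0 addr0.
  by move/eqP; rewrite mulf_eq0 (gt_eqF q0) orbF => /eqP.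
apply/rowP => k; rewrite [RHS]mxE; have [->//|ki] := eqVneq k i; have [->//|kj] := eqVneq k j.
have ik : i != k by rewrite eq_sym.
have jk : j != k by rewrite eq_sym.
by have := e k; rewrite (tpermD ik jk) (negbTE ki); lra.
Qed.

Lemma mxpathC G G' (s : R) : mxpath G G' s = mxpath G' G (1 - s).
Proof. by rewrite /mxpath addrC opprB addrCA subrr addr0. Qed.

Lemma mx_in_pathC G G' : (forall s : R, 0 <= s <= 1 -> mxpath G G' s \in unitmx) ->
  mx_in G' -> mx_in G.
Proof.
move=> uG; apply: mx_in_path => s /andP[s0 s1]; rewrite mxpathC; apply: uG.
by apply/andP; split; lra.
Qed.

Lemma mx_in_tperm_reflect i j : i != j -> mx_in (tperm_mx i j) <-> mx_in (reflect i).
Proof.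
move=> ij; split.
  by apply: mx_in_path => s _; exact: tperm_reflect_path.
by apply: mx_in_pathC => s _; exact: tperm_reflect_path.
Qed.

Lemma mx_in_reflect j : mx_in (reflect j).
Proof.
have [->|j0] := eqVneq j ord0; first exact: mx_in_reflect0.
apply/(mx_in_tperm_reflect j0); rewrite /tperm_mx tpermC.
by apply/mx_in_tperm_reflect; [rewrite eq_sym|exact: mx_in_reflect0].
Qed.

Lemma mx_in_perm (s : 'S_D) : mx_in (perm_mx s).
Proof.
have [ts -> dts] := prod_tpermP s; elim: ts dts => [|[i j] ts IH] /=.
  by rewrite big_nil perm_mx1 => _; exact: mx_in1.
move=> /andP[ij /IH h]; rewrite big_cons perm_mxM; apply: mx_inM => //=.
by apply/mx_in_tperm_reflect => //; exact: mx_in_reflect.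
Qed.

Lemma mx_in_sign (e : vec) : (forall i, e ord0 i = 1 \/ e ord0 i = -1) -> mx_in (diag_mx e).
Proof.
move: {2}#|_|.+1 (ltnSn #|[pred i | e ord0 i == -1]|) => m.
elim: m e => // m IH e; rewrite ltnS => em he.
have [/existsP[j /eqP ej]|] := boolP [exists j, e ord0 j == -1]; last first.
  rewrite negb_exists => /forallP h; rewrite (_ : diag_mx e = 1%:M); first exact: mx_in1.
  rewrite -diag_const_mx; congr diag_mx; apply/rowP => i; rewrite mxE.
  by case: (he i) => // hi; have := h i; rewrite hi eqxx.
pose e' : vec := \row_k (if k == j then 1 else e ord0 k).
rewrite (_ : diag_mx e = diag_mx e' *m reflect j).
  apply: mx_inM; last exact: mx_in_reflect.
  apply: IH => [|i]; last by rewrite mxE; case: ifP => _; [left|exact: he].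
  apply: leq_trans em; apply: proper_card; apply/properP; split.
    apply/fintype.subsetP => i; rewrite !inE mxE; case: ifP => // _ /eqP h.
    by exfalso; have : (1 : R) = -1 by []; lra.
  exists j; rewrite !inE ?ej// mxE eqxx; apply/eqP => h; lra.
rewrite mul_diag_mx /reflect; apply/matrixP => i k; rewrite !mxE.
have [_|_] := eqVneq i k; last by rewrite !mulr0n mulr0.
rewrite !mulr1n; have [->|_] := eqVneq i j; first by rewrite mul1r.
by rewrite mulr1.
Qed.

(** A diagonal entry can be moved to its sign along a segment that avoids 0. *)
Lemma mx_in_diag (e : vec) : (forall i, e ord0 i != 0) -> mx_in (diag_mx e).
Proof.
move=> he; pose e' : vec := \row_k Num.sg (e ord0 k).
apply: (@mx_in_pathC _ (diag_mx e')) => [s /andP[s0 s1]|]; last first.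
  apply: mx_in_sign => i; rewrite mxE; have := he i.
  by case: sgrP => //; [left|right].
rewrite /mxpath -!linearZ -linearD /=; apply: diag_mx_unit => i; rewrite !mxE.
have := he i; case: sgrP => // h _.
  by rewrite gt_eqF// ; have [->|] := eqVneq s 1; [rewrite subrr; lra|move=> s1'; have : s < 1 by [rewrite lt_neqAle s1']; nra].
by rewrite lt_eqF// ; have [->|] := eqVneq s 1; [rewrite subrr; lra|move=> s1'; have : s < 1 by [rewrite lt_neqAle s1']; nra].
Qed.

(** By the LUP decomposition it is enough to treat a permutation matrix, a unitriangular matrix and
    an invertible triangular matrix. Segments of triangular matrices with constant diagonal join the
    last two to the identity and to a diagonal matrix. *)
Lemma mx_in_unit G : G \in unitmx -> mx_in G.
Proof.
move=> uG; have := cormen_lup_correct G; have := cormen_lup_perm G.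
have := @cormen_lup_lower _ _ G; have := @cormen_lup_upper _ _ G.
case: (cormen_lup G) => [[P L] U] /= hU hL /is_perm_mxP[s ->] PLU.
have uP : perm_mx s \in unitmx by [move=> *; exact: unitmx_perm].
have -> : G = perm_mx s^-1 *m (L *m U).
  rewrite -[RHS]/(_ *m (L * U)) -PLU -[_ * G]/(_ *m G) mulmxA -perm_mxM mulVg.
  by rewrite perm_mx1 mul1mx.
have LE : forall s : R, \det (mxpath L 1%:M s) = 1.
  move=> r; rewrite det_trig; last first.
    apply/is_trig_mxP => i j ij; rewrite !mxE (hL i j (ltnW ij)).
    by rewrite (_ : (i == j) = false) ?mulr0 ?addr0//; apply/eqP => e; rewrite e ltnn in ij.
  by rewrite big1// => i _; rewrite !mxE (hL i i (leqnn _)) !eqxx mulr1n; ring.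
have L0 : mx_in L.
  apply: (@mx_in_pathC _ 1%:M); last exact: mx_in1.
  by move=> r _; rewrite unitmxE LE unitr1.
have uU : forall i, U i i != 0.
  have : \det U != 0.
    have : \det (perm_mx s * G) != 0.
      by rewrite -[_ * _]/(_ *m _) -unitfE -unitmxE unitmx_mul uP uG.
    by rewrite PLU -[_ * _]/(_ *m _) det_mulmx mulf_eq0 => /norP[].
  rewrite -det_tr det_trig; last by apply/is_trig_mxP => i j ij; rewrite mxE hU.
  by move/prodf_neq0 => h i; have := h i isT; rewrite mxE.
apply: mx_inM; first exact: mx_in_perm.
apply: mx_inM => //; apply: (@mx_in_pathC _ (diag_mx (\row_i U i i))); last first.
  by apply: mx_in_diag => i; rewrite mxE.
move=> r _; rewrite unitmxE -det_tr det_trig; last first.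
  apply/is_trig_mxP => i j ij; rewrite !mxE (hU j i ij).
  by rewrite (_ : (j == i) = false) ?mulr0n ?mulr0 ?addr0//; apply/eqP => e; rewrite e ltnn in ij.
rewrite unitfE; apply/prodf_neq0 => i _; rewrite !mxE eqxx mulr1n.
by rewrite -mulrDl subrK mul1r.
Qed.

End GeneralLinear.

(** * Spheres in the dimension of the attached cells *)

Section Chamber.
Context (R : realType) (k M : nat).
Hypothesis M0 : (0 < M)%N.
Notation V := {ffun 'I_k -> 'I_M.+1}.

(* A chamber of the arrangement of the hyperplanes M t_i = c and
   M t_i - M t_j = c: the t with 0 < M t_i - m_i < 1 whose fractional parts are
   ordered as prescribed by the ranks rho. *)
Context (m : 'I_k -> nat) (rho : 'I_k -> 'I_k).
Hypothesis mM : forall i, (m i < M)%N.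
Hypothesis rho_inj : injective rho.

Definition frc (t : 'rV[R]_k) i : R := M%:R * t ord0 i - (m i)%:R.

(** The barycentric coordinates in the Kuhn simplex of the chamber. By [betaE] they are the
    successive differences of the fractional parts in decreasing order, preceded by 1 and followed
    by 0; this form shows that they are affine in [t]. *)
Definition beta (r : nat) (t : 'rV[R]_k) : R :=
  (r == 0)%:R + \sum_i frc t i * ((r == (rho i).+1)%:R - (r == rho i)%:R).

Definition fcoord (r : nat) (t : 'rV[R]_k) : R :=
  if r is r'.+1 then \sum_(i | r' == rho i) frc t i else 1.

Lemma betaE r t : beta r t = fcoord r t - fcoord r.+1 t.
Proof.
rewrite /beta /=; under eq_bigr do rewrite mulrBr.
rewrite sumrB addrA; congr (_ - _); last first.
  by rewrite [RHS]big_mkcond; apply: eq_bigr => i _; case: eqP => _; rewrite ?mulr1 ?mulr0.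
case: r => [|r] /=; first by rewrite big1 ?addr0// => i _; rewrite mulr0.
rewrite add0r [RHS]big_mkcond; apply: eq_bigr => i _.
by rewrite eqSS; case: eqP => _; rewrite ?mulr1 ?mulr0.
Qed.

Lemma fcoord_rho t i : fcoord (rho i).+1 t = frc t i.
Proof.
rewrite /= (bigD1 i)//= big1 ?addr0// => j /andP[/eqP e /eqP].
by move=> h; exfalso; apply: h; apply: rho_inj; apply: val_inj.
Qed.

Lemma fcoord_last t : fcoord k.+1 t = 0.
Proof. by rewrite /= big1// => i /eqP e; have := ltn_ord (rho i); rewrite -e ltnn. Qed.

Lemma beta_sum t : \sum_(r < k.+1) beta r t = 1.
Proof.
under eq_bigr do rewrite betaE.
rewrite -(big_mkord xpredT (fun r => fcoord r t - fcoord r.+1 t)).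
have e := @telescope_sumr _ 0 k.+1 (fun r => - fcoord r t) (leq0n _).
transitivity (- fcoord k.+1 t - - fcoord 0 t); last by rewrite fcoord_last /= oppr0 sub0r opprK.
by rewrite -e; apply: eq_bigr => r _; rewrite opprK addrC.
Qed.

Lemma rho_surj (r : nat) : (r < k)%N -> exists i, rho i = r :> nat.
Proof.
move=> rk; exists (invF rho_inj (Ordinal rk)); by rewrite f_invF.
Qed.

(** The r-th vertex of the Kuhn simplex: from the corner [m], the r coordinates with the largest
    fractional parts are raised by 1. *)
Definition chv (r : nat) : V := [ffun i => inord (m i + (rho i < r))].

Lemma chvE r i : chv r i = (m i + (rho i < r))%N :> nat.
Proof. by rewrite ffunE inordK// ltnS; case: (_ < _)%N; rewrite ?addn1 ?addn0// ltnW. Qed.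

Lemma chv_inj r s : (r <= k)%N -> (s <= k)%N -> chv r = chv s -> r = s.
Proof.
wlog rs : r s / (r <= s)%N.
  by move=> W rk sk e; have [/W h|/ltnW/W h] := leqP r s; [exact: h|apply/esym/h].
move=> rk sk e; apply/eqP; rewrite eqn_leq rs leqNgt /=; apply/negP => lt.
have [i ri] := rho_surj (leq_trans lt sk).
have := congr1 (fun v : V => v i : nat) e; rewrite !chvE ri lt ltnn.
by move/eqP; rewrite eqn_add2l.
Qed.

Definition in_chamber t := forall r : 'I_k.+1, 0 < beta r t.

Section InChamber.
Context (t : 'rV[R]_k) (ct : in_chamber t).

Lemma fcoord_anti r s : (r < s)%N -> (s <= k.+1)%N -> fcoord s t < fcoord r t.
Proof.
elim: s => // s IH; rewrite ltnS => rs sk.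
have h : fcoord s.+1 t < fcoord s t.
  by rewrite -subr_gt0 -betaE; exact: (ct (Ordinal sk)).
move: rs; rewrite leq_eqVlt => /orP[/eqP->//|rs].
by apply: lt_trans h _; apply: IH => //; exact: ltnW.
Qed.

Lemma frc01 i : 0 < frc t i < 1.
Proof.
rewrite -fcoord_rho; apply/andP; split.
  by rewrite -(fcoord_last t); apply: fcoord_anti => //; rewrite ltnS ltn_ord.
by apply: (@fcoord_anti 0) => //; rewrite ltnS ltnW.
Qed.

Lemma frc_lt i j : (rho i < rho j)%N -> frc t j < frc t i.
Proof.
move=> ij; rewrite -!fcoord_rho; apply: fcoord_anti; first by rewrite ltnS.
by rewrite ltnS ltnW.
Qed.

Lemma frc_le i j : (rho i <= rho j)%N -> frc t j <= frc t i.
Proof.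
rewrite leq_eqVlt => /orP[/eqP e|/frc_lt/ltW//].
by rewrite (rho_inj (val_inj e)).
Qed.

Lemma chamber_ocube : ocube k t.
Proof.
move=> i; have /andP[f0 f1] := frc01 i.
have M1 : 0 < M%:R :> R by rewrite ltr0n.
have mi : (m i)%:R + 1 <= M%:R :> R by rewrite natr1 ler_nat.
have m0 : 0 <= (m i)%:R :> R by [].
apply/andP; split.
  by rewrite -(pmulr_rgt0 _ M1); rewrite /frc in f0; lra.
by rewrite -(ltr_pM2l M1) mulr1; rewrite /frc in f1; lra.
Qed.

(** Above the vertex [chv r], the largest deviation occurs at the coordinate of rank r, and below it
    at the one of rank r - 1. At the ends r = k and r = 0, the value is 0. *)
Lemma hat_chv (r : 'I_k.+1) : hat (chv r) t = beta r t.
Proof.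
have x1 i : (rho i < r)%N -> M%:R * t ord0 i - (chv r i)%:R = frc t i - 1.
  by move=> h; rewrite chvE h addn1 -natr1 /frc; ring.
have x0 i : (r <= rho i)%N -> M%:R * t ord0 i - (chv r i)%:R = frc t i.
  by move=> h; rewrite chvE ltnNge h addn0.
have -> : beta r t = 1 - fcoord r.+1 t - (1 - fcoord r t) by rewrite betaE; ring.
rewrite /hat.
have -> : \big[Num.max/0]_i (M%:R * t ord0 i - (chv r i)%:R) = fcoord r.+1 t.
  apply: le_anti; apply/andP; split.
    have f0 : 0 <= fcoord r.+1 t.
      have := ltn_ord r; rewrite ltnS leq_eqVlt => /orP[/eqP ->|rk]; first by rewrite fcoord_last.
      by have [i <-] := rho_surj rk; rewrite fcoord_rho; have /andP[/ltW] := frc01 i.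
    apply: bigmax_le => // i _; have [ri|ir] := leqP r (rho i).
      rewrite x0//; have rk : (r < k)%N by apply: leq_ltn_trans ri (ltn_ord _).
      by have [j rj] := rho_surj rk; rewrite -rj fcoord_rho; apply: frc_le; rewrite rj.
    by rewrite x1//; apply: le_trans f0; have /andP[_ /ltW] := frc01 i; rewrite subr_le0.
  have := ltn_ord r; rewrite ltnS leq_eqVlt => /orP[/eqP ->|rk].
    by rewrite fcoord_last; exact: bigmax_ge_id.
  have [i ri] := rho_surj rk; rewrite -ri fcoord_rho.
  apply: le_trans (le_bigmax _ _ i); rewrite ri.
  by rewrite x0// ri.
have -> : \big[Num.max/0]_i ((chv r i)%:R - M%:R * t ord0 i) = 1 - fcoord r t.
  case: r x1 x0 => -[|r] rk x1 x0 /=.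
    rewrite subrr; apply: le_anti; rewrite bigmax_ge_id andbT; apply: bigmax_le => // i _.
    by rewrite -opprB x0// oppr_le0; have /andP[/ltW] := frc01 i.
  have rk' : (r < k)%N by exact: rk.
  have [j rj] := rho_surj rk'.
  have -> : \sum_(i | r == rho i) frc t i = frc t j by rewrite -fcoord_rho /= -rj.
  apply: le_anti; apply/andP; split.
    apply: bigmax_le => [|i _]; first by have /andP[_ /ltW] := frc01 j; rewrite subr_ge0.
    rewrite -opprB; have [ri|ir] := leqP r.+1 (rho i).
      rewrite (x0 i ri); have /andP[? ?] := frc01 i; have /andP[? ?] := frc01 j; lra.
    by rewrite (x1 i ir) opprB lerD2l lerN2; apply: frc_le; rewrite rj.
  apply: le_trans (le_bigmax _ _ j); rewrite -[X in _ <= X]opprB x1 ?rj//.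
  by move: (frc t j) => f; lra.
by rewrite max_r//; have := ct r; rewrite betaE; lra.
Qed.

End InChamber.
End Chamber.

(** * The hyperplane arrangement of the triangulation *)

Section Cuts.
Context (R : realType) (k M : nat).
Hypothesis M0 : (0 < M)%N.
Notation V := {ffun 'I_k -> 'I_M.+1}.
Implicit Types t : 'rV[R]_k.

(** The proof of [hat_card] with one coordinate left out: the sums over the k - 1 others still tell
    the elements of the chain apart, which leaves k values. *)
Lemma hat_card_lt t (S : {set V}) (i0 : 'I_k) : (forall v, v \in S -> 0 < hat v t) ->
  (forall u v, u \in S -> v \in S -> (forall j, j != i0 -> u j = v j) -> u = v) -> (#|S| <= k)%N.
Proof.
move=> hS eS; have [->|[v0 Sv0]] := set_0Vmem S; first by rewrite cards0.
pose sm (v : V) : nat := (\sum_(j | j != i0) v j)%N.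
have smi u v : u \in S -> v \in S -> sm u = sm v -> u = v.
  move=> Su Sv; wlog uv : u v Su Sv / (forall i, u i <= v i)%N.
    move=> W; have [h|h] := hat_comparable (hS _ Su) (hS _ Sv); first exact: W.
    by move=> e; apply/esym/W.
  move=> e; apply: eS => // j ji; apply/val_inj/eqP => /=; rewrite eqn_leq uv leqNgt /=.
  apply/negP => lt; have : (sm u < sm v)%N.
    rewrite /sm (bigD1 j)//= [X in (_ < X)%N](bigD1 j)//= -addSn leq_add//.
    by apply: leq_sum => l _.
  by rewrite e ltnn.
have smc u v : u \in S -> v \in S -> (sm v <= sm u + k.-1)%N.
  move=> Su Sv; apply: (@leq_trans (\sum_(j | j != i0) (u j + 1))).
    by apply: leq_sum => i _; rewrite addn1; exact: hat_step (hS _ Su) (hS _ Sv).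
  rewrite big_split /= leq_add2l sum1_card.
  by rewrite (eq_card (B := predC1 i0))// cardC1 card_ord.
pose m := [arg min_(v < v0 | v \in S) sm v]%N.
have [Sm hm] : m \in S /\ forall v, v \in S -> (sm m <= sm v)%N.
  by rewrite /m; case: arg_minnP.
have k0 : (0 < k)%N by apply: leq_ltn_trans (ltn_ord i0).
pose f v : 'I_k.-1.+1 := inord (sm v - sm m).
rewrite -[X in (_ <= X)%N](prednK k0) -[k.-1.+1]card_ord -(card_in_imset (f := f)); first exact: max_card.
move=> v u Sv Su /(congr1 val); rewrite /= !inordK; last 2 first.
- by rewrite ltnS leq_subLR; exact: smc.
- by rewrite ltnS leq_subLR; exact: smc.
move=> e; apply: (smi _ _ Sv Su).
by rewrite -(subnK (hm _ Sv)) e subnK// hm.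
Qed.

(** The left summand stands for the hyperplanes M t_i = c. The right one stands for M t_i - M t_j =
    c - M with i < j; the shift by M lets a natural number c cover the range from -M to M. *)
Definition cut_ix : Type := ('I_k * 'I_M.+1 + {p : 'I_k * 'I_k | (p.1 < p.2)%N} * 'I_(2 * M).+1)%type.
HB.instance Definition _ := Finite.on cut_ix.

(** The signs make the function decrease along the first coordinate: since i < j, the coordinate 0
    can only occur in the term with a minus sign. *)
Definition hcut (x : cut_ix) t : R :=
  match x with
  | inl (i, c) => (c : nat)%:R - M%:R * t ord0 i
  | inr (p, c) => (c : nat)%:R - M%:R - M%:R * t ord0 (sval p).1 + M%:R * t ord0 (sval p).2
  end.

(** On one of these hyperplanes, the grid vertices around [t] all have the same i-th coordinate, or
    the same difference of two coordinates. They are thus determined by the coordinates other than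
    i, and there are at most k of them. *)
Lemma cut_neq0 x t (S : {set V}) : (forall v, v \in S -> 0 < hat v t) -> (k < #|S|)%N -> hcut x t != 0.
Proof.
move=> hS; rewrite ltnNge => /negP kS; apply/eqP => cx; apply: kS.
case: x cx => [[i c]|[[[i j] /= ij] c]] /= cx.
  apply: (@hat_card_lt t S i hS) => u v Su Sv uv; apply/ffunP => l.
  have [->|] := eqVneq l i; last exact: uv.
  have vc w : w \in S -> w i = c :> nat.
    move=> /hS/hat_gt0P[_ h1 h2]; have := h1 i; have := h2 i.
    rewrite (_ : M%:R * t ord0 i = (c : nat)%:R); last by lra.
    move=> h3 h4; apply/eqP; rewrite eqn_leq -ltnS -[X in _ && X]ltnS -!(ltr_nat R) -!natr1.
    by apply/andP; split; lra.
  by apply: val_inj; rewrite /= !vc.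
apply: (@hat_card_lt t S i hS) => u v Su Sv uv; apply/ffunP => l.
have [->|] := eqVneq l i; last exact: uv.
have ji : j != i by rewrite neq_ltn ij orbT.
have vc w : w \in S -> (w i + M = w j + c)%N.
  move=> /hS/hat_gt0P[h1 _ _]; have := h1 i j; have := h1 j i.
  move=> h3 h4; apply/eqP; rewrite eqn_leq -ltnS -[X in _ && X]ltnS -!(ltr_nat R) -!natr1 !natrD.
  by apply/andP; split; lra.
have := vc _ Su; rewrite (uv j ji) -(vc _ Sv) => /addIn e.
exact: val_inj.
Qed.

(** The function [t'] is [set_fst] spelled out for a dimension that is not syntactically a
    successor. *)
Lemma cut_decr (x : cut_ix) (r r' : R) t (t' := fun s => \row_j (if j == 0%N :> nat then s else t ord0 j)) :
  r <= r' -> hcut x (t' r') <= hcut x (t' r).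
Proof.
move=> rr; have M1 : 0 <= M%:R :> R by [].
case: x => [[i c]|[[[i j] /= ij] c]] /=; rewrite /t' !mxE.
  by case: ifP => // _; rewrite lerD2l lerN2 ler_wpM2l.
rewrite (_ : (j == 0%N :> nat) = false); last by apply/negbTE; rewrite -lt0n (leq_ltn_trans _ ij).
by rewrite lerD2r lerD2l lerN2; case: ifP => // _; rewrite ler_wpM2l.
Qed.

Lemma cts_cut x : continuous (hcut x).
Proof.
have cM i : continuous (fun t => M%:R * t ord0 i).
  by apply: cts_mul; [exact: cts_cst|exact: coord_continuous].
case: x => [[i c]|[p c]] /=; first by apply: cts_sub => //; exact: cts_cst.
apply: cts_add => //; apply: cts_sub => //; exact: cts_cst.
Qed.

(** Off the hyperplanes, the signs determine the integral parts and the order of the fractional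
    parts, and conversely, so a sign pattern and a chamber are the same thing. *)
Lemma chamber_of t0 : ocube k t0 -> (forall x, hcut x t0 != 0) ->
  exists (m : 'I_k -> nat) (rho : 'I_k -> 'I_k),
  [/\ forall i, (m i < M)%N, injective rho, in_chamber M m rho t0 &
      forall t, (in_chamber M m rho t -> forall x, (hcut x t <= 0) = (hcut x t0 <= 0)) /\
        ((forall x, hcut x t != 0) -> (forall x, (hcut x t <= 0) = (hcut x t0 <= 0)) ->
         in_chamber M m rho t)].
Proof.
move=> ot0 c0; pose m i := Num.truncn (M%:R * t0 ord0 i).
have M1 : 0 < M%:R :> R by rewrite ltr0n.
have itv i : (m i)%:R <= M%:R * t0 ord0 i < (m i).+1%:R.
  by apply: truncn_itv; rewrite mulr_ge0//; have /andP[/ltW] := ot0 i.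
have mM i : (m i < M)%N.
  rewrite -(ltr_nat R); have /andP[h _] := itv i; apply: le_lt_trans h _.
  by rewrite gtr_pMr//; have /andP[] := ot0 i.
pose f := frc M m t0.
have f01 i : 0 < f i < 1.
  have /andP[h1 h2] := itv i; rewrite -natr1 in h2.
  have mi : (m i < M.+1)%N by rewrite ltnS ltnW.
  have := c0 (inl (i, Ordinal mi)); rewrite /= => /eqP h3.
  by rewrite /f /frc; apply/andP; split; lra.
have fneq i j : i != j -> f i != f j.
  wlog ij : i j / (i < j)%N.
    by move=> W; rewrite neq_ltn => /orP[h|h]; [apply: W => //|rewrite eq_sym; apply: W => //];
      rewrite neq_ltn h ?orbT.
  (* This index gives the hyperplane on which the fractional parts of coordinates i and j
     coincide. *)
  move=> _; have cc : (m i + M - m j < (2 * M).+1)%N by have := mM i; have := mM j; lia.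
  have := c0 (inr (exist (fun p : 'I_k * 'I_k => (p.1 < p.2)%N) (i, j) ij, Ordinal cc)).
  rewrite /= natrB; last by have := mM j; lia.
  rewrite natrD; apply: contra => /eqP; rewrite /f /frc => e; apply/eqP; lra.
(* The rank of i is the number of coordinates with a larger fractional part. *)
have rk i : (#|[pred j | (f i < f j)%R]| < k)%N.
  rewrite -[X in (_ < X)%N]card_ord; apply: proper_card; apply/properP; split.
    by apply/fintype.subsetP.
  by exists i => //; rewrite inE ltxx.
pose rho i := Ordinal (rk i).
have rho_lt i j : f i < f j -> (rho j < rho i)%N.
  move=> ij; apply: proper_card; apply/properP; split.
    by apply/fintype.subsetP => l; rewrite !inE; exact: lt_trans.
  by exists j; rewrite !inE ?ltxx.
have rho_inj : injective rho.
  move=> i j /(congr1 val) /= e; apply/eqP; apply: contraT => /fneq.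
  by rewrite neq_lt => /orP[/rho_lt|/rho_lt]; rewrite /= e ltnn.
have lt_rho i j : (rho i < rho j)%N -> f j < f i.
  move=> h; rewrite ltNge le_eqVlt; apply/negP => /orP[/eqP e|/rho_lt].
    have [ij|/fneq] := eqVneq i j; first by rewrite ij ltnn in h.
    by rewrite e eqxx.
  by rewrite ltnNge ltnW.
have chI t : (forall i, 0 < frc M m t i < 1) -> (forall i j, (rho i < rho j)%N -> frc M m t j < frc M m t i) ->
    in_chamber M m rho t.
  move=> h1 h2 r; rewrite betaE subr_gt0.
  have e s : (s < k)%N -> exists i, rho i = s :> nat /\ fcoord M m rho s.+1 t = frc M m t i.
    by move=> /(rho_surj rho_inj)[i <-]; exists i; split=> //; exact: fcoord_rho.
  case: r => -[|r] rk' /=.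
    have [k0|k0] := posnP k.
      by rewrite big1// => i; have := ltn_ord i; rewrite {2}k0.
    by have [i [_]] := e 0%N k0; rewrite /= => ->; have /andP[] := h1 i.
  have rk1 : (r < k)%N by exact: rk'.
  have [i [ri]] := e r rk1; rewrite /= => ->.
  move: rk1; rewrite leq_eqVlt => /orP[/eqP rk1|rk1].
    rewrite big1; first by have /andP[] := h1 i.
    by move=> j /eqP /= jk; have := rk j; rewrite -jk rk1 ltnn.
  have [j [rj]] := e r.+1 rk1; rewrite /= => ->.
  by apply: h2; rewrite ri rj.
exists m, rho; split=> //; first exact: chI.
move=> t; split=> [ct [[i c]|[[[i j] /= ij] c]]|cn cs] /=.
- have /andP[h1 h2] := frc01 rho_inj ct i; have /andP[h3 h4] := f01 i.
  rewrite /f /frc in h1 h2 h3 h4; have [cm|cm] := leqP c (m i).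
    have {}cm : (c : nat)%:R <= (m i)%:R :> R by rewrite ler_nat.
    by apply/idP/idP => _; lra.
  have {}cm : (m i)%:R + 1 <= (c : nat)%:R :> R by rewrite natr1 ler_nat.
  by apply/idP/idP => h; exfalso; lra.
- have /andP[h1 h2] := frc01 rho_inj ct i; have /andP[h3 h4] := f01 i.
  have /andP[h1' h2'] := frc01 rho_inj ct j; have /andP[h3' h4'] := f01 j.
  have ij' : i != j by rewrite neq_ltn ij.
  have hs : (frc M m t i < frc M m t j) = (f i < f j).
    have := fneq i j ij'; rewrite neq_lt => /orP[h|h].
      by rewrite h; apply: (frc_lt rho_inj ct); exact: rho_lt.
    by rewrite [RHS]ltNge (ltW h) /=; apply/negbTE; rewrite -leNgt ltW//; apply: (frc_lt rho_inj ct); exact: rho_lt.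
  rewrite /f /frc in h1 h2 h3 h4 h1' h2' h3' h4' hs.
  (* The sign is decided by the integral parts alone, except for the one value of c at which it
     compares the fractional parts. *)
  have [cm|] := ltnP (c + m j) (m i + M).
    have {}cm : (c : nat)%:R + (m j)%:R + 1 <= (m i)%:R + M%:R :> R by rewrite -!natrD natr1 ler_nat.
    by apply/idP/idP => _; lra.
  rewrite leq_eqVlt => /orP[/eqP cm|cm].
    have {}cm : (c : nat)%:R + (m j)%:R = (m i)%:R + M%:R :> R by rewrite -!natrD cm.
    have E (a b : R) : ((c : nat)%:R - M%:R - a + b <= 0) = ~~ (a - (m i)%:R < b - (m j)%:R).
      by rewrite -leNgt; apply/idP/idP => h; lra.
    by rewrite !E hs.
  have {}cm : (m i)%:R + M%:R + 1 <= (c : nat)%:R + (m j)%:R :> R by rewrite -!natrD natr1 ler_nat.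
  by apply/idP/idP => h; exfalso; lra.
- apply: chI => [i|i j].
    have mi : (m i < M.+1)%N by rewrite ltnS ltnW.
    have mi1 : ((m i).+1 < M.+1)%N by rewrite ltnS.
    have /andP[h3 h4] := f01 i; rewrite /f /frc in h3 h4.
    have := cs (inl (i, Ordinal mi)); have := cs (inl (i, Ordinal mi1)) => /=.
    have /eqP := cn (inl (i, Ordinal mi)); rewrite /= -natr1 => h5 h6 h7.
    rewrite /frc; apply/andP; split.
      have : (m i)%:R - M%:R * t ord0 i <= 0 by rewrite h7; lra.
      by lra.
    have : ~~ ((m i)%:R + 1 - M%:R * t ord0 i <= 0) by rewrite h6 -ltNge; lra.
    by rewrite -ltNge; lra.
  move=> /lt_rho fji; have ij : i != j by apply: contraTneq fji => ->; rewrite ltxx.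
  rewrite /f /frc in fji; move: ij; rewrite neq_ltn => /orP[ij|ij].
    have cc : (m i + M - m j < (2 * M).+1)%N by have := mM i; have := mM j; lia.
    pose x : cut_ix := inr (exist (fun p : 'I_k * 'I_k => (p.1 < p.2)%N) (i, j) ij, Ordinal cc).
    have := cs x; have /eqP := cn x; rewrite /x /= natrB; last by have := mM j; lia.
    rewrite natrD /frc => h1 h2.
    have : (m i)%:R + M%:R - (m j)%:R - M%:R - M%:R * t ord0 i + M%:R * t ord0 j <= 0 by rewrite h2; lra.
    by lra.
  have cc : (m j + M - m i < (2 * M).+1)%N by have := mM i; have := mM j; lia.
  pose x : cut_ix := inr (exist (fun p : 'I_k * 'I_k => (p.1 < p.2)%N) (j, i) ij, Ordinal cc).
  have := cs x; rewrite /x /= natrB; last by have := mM i; lia.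
  rewrite natrD /frc => h2.
  have : ~~ ((m j)%:R + M%:R - (m i)%:R - M%:R - M%:R * t ord0 j + M%:R * t ord0 i <= 0) by rewrite h2 -ltNge; lra.
  by rewrite -ltNge; lra.
Qed.

End Cuts.

(** * The class of a sphere of the dimension of the cells *)

Section Critical.
Context (R : realType) (Y : topologicalType) (L : Type) (d : nat).
Context (att : L -> 'rV[R]_d.+1 -> Y).
Notation W := (attach att).
Notation chi := (chi att).
Notation ball1 := {x : 'rV[R]_d.+1 | `|x| < 1}.
Notation c := (@bcc R d).
Notation bc := (@bc R d).
Notation D := d.+1.
Context (B : topologicalType) (b0 : B) (F : W -> B).
Hypothesis cF : continuous F.
Hypothesis F0 : forall y, F (inl y) = b0.
Context (N : top_pi R d b0 -> Prop).
Hypothesis N1 : N 1%g.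
Hypothesis NM : forall u v, N u -> N v -> N (u * v)%g.
Hypothesis NV : forall u, N u -> N (u^-1)%g.
Hypothesis NF : forall l, ball_in N (F \o chi l).

Lemma bc_drad (x : 'rV[R]_D) i : bc x i < c / 2 -> 1 <= `|(drad R d)^-1 *: x|.
Proof.
move=> hi; rewrite normrZ ger0_norm ?invr_ge0 ?(ltW (drad_gt0 _ _))//.
rewrite ler_pdivlMl ?drad_gt0// mulr1 leNgt; apply/negP => h.
have /(bc_small i) : forall j, `|x ord0 j| <= drad R d.
  by move=> j; apply: le_trans (ltW h); exact: coord_le_norm.
have -> : d.+1%:R * drad R d = c / 2.
  rewrite /drad; have : d.+1%:R != 0 :> R by rewrite pnatr_eq0.
  by move: bcc d.+1%:R => b Z Z0; field.
by move=> h'; move: hi; rewrite ltNge => /negP; apply; apply: le_trans h'; have := bcc_gt0 R d; lra.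
Qed.

Lemma chi_ball l : is_bmap b0 (F \o chi l).
Proof.
split; first by apply: (cts_comp _ cF); exact: cts_chi.
by move=> x x1; rewrite /= chi_out.
Qed.

Section Piece.
Context (M : nat) (M0 : (0 < M)%N) (m : 'I_D -> nat) (rho : 'I_D -> 'I_D).
Hypothesis rho_inj : injective rho.
Context (lab : 'I_D.+1 -> 'I_D.+1) (lab_inj : injective lab).
Notation beta := (@beta R D M m rho).
Notation vec := 'rV[R]_D.

(** The simplicial approximation on one chamber, extended to the whole space as an affine map; [lab]
    gives the label of each vertex of the chamber. *)
Definition pmap (t : vec) : vec := bvec (fun i => beta (invF lab_inj i) t).

Lemma bc_pmap t r : bc (pmap t) (lab r) = beta r t.
Proof.
rewrite bc_bvec ?invF_f//.
rewrite (reindex lab)/=; last by exists (invF lab_inj) => i _; rewrite ?invF_f ?f_invF.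
by under eq_bigr do rewrite invF_f; exact: beta_sum.
Qed.

Definition pcoef (i : 'I_D) (r : 'I_D.+1) : R := (r == (rho i).+1 :> nat)%:R - (r == rho i :> nat)%:R.

Definition pmx : 'M[R]_D := \matrix_(i, j) (M%:R * pcoef i (invF lab_inj (lift ord0 j))).

Lemma pmap_affine t s : pmap t = pmap s + (t - s) *m pmx.
Proof.
apply/rowP => j; rewrite !mxE /beta.
have -> : \sum_j0 (t - s) ord0 j0 * pmx j0 j =
  \sum_i frc M m t i * pcoef i (invF lab_inj (lift ord0 j)) -
  \sum_i frc M m s i * pcoef i (invF lab_inj (lift ord0 j)).
  by rewrite -sumrB; apply: eq_bigr => i _; rewrite !mxE /frc; ring.
by rewrite /pcoef; ring.
Qed.

(** On a vector of the kernel, all the coordinates but one have zero variation, and the last one too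
    as the sum is constant. The variations are differences of consecutive entries in the order of
    [rho], so the entries vanish one after the other. *)
Lemma pmx_unit : pmx \in unitmx.
Proof.
apply: unitmx_ker => x ex.
pose g (r : 'I_D.+1) := \sum_i x ord0 i * pcoef i r.
have g1 : \sum_r g r = 0.
  rewrite exchange_big /=; apply: big1 => i _; rewrite -mulr_sumr /pcoef sumrB.
  have e (s : nat) : (s < D.+1)%N -> \sum_(r < D.+1) (r == s :> nat)%:R = 1 :> R.
    move=> h; rewrite (bigD1 (Ordinal h))//= eqxx big1 ?addr0// => r.
    by rewrite -val_eqE /= => /negbTE ->.
  have h1 : (rho i < D.+1)%N by rewrite ltnS ltnW.
  have h2 : ((rho i).+1 < D.+1)%N by rewrite ltnS.
  by rewrite (e _ h1) (e _ h2) subrr mulr0.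
have g0 : forall r, g r = 0.
  have gl j : g (invF lab_inj (lift ord0 j)) = 0.
    have := congr1 (fun y : vec => y ord0 j) ex; rewrite !mxE.
    under eq_bigr do rewrite mxE mulrCA; rewrite -mulr_sumr => /eqP.
    by rewrite mulf_eq0 pnatr_eq0 gtn_eqF//= => /eqP.
  have g00 : g (invF lab_inj ord0) = 0.
    have := g1; rewrite (reindex (invF lab_inj))/=; last first.
      by exists lab => i _; rewrite ?f_invF ?invF_f.
    by rewrite big_ord_recl big1 ?addr0.
  move=> r; rewrite -(invF_f lab_inj r).
  by case: (unliftP ord0 (lab r)) => [j ->|->].
pose X (r : nat) := \sum_(i | r == rho i) x ord0 i.
have gX (r : 'I_D.+1) : g r = (if r : nat is r'.+1 then X r' else 0) - X r.
  rewrite /g /pcoef; under eq_bigr do rewrite mulrBr.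
  rewrite sumrB; congr (_ - _); last first.
    by rewrite /X [RHS]big_mkcond; apply: eq_bigr => i _; case: eqP => _; rewrite ?mulr1 ?mulr0.
  case: r => -[|r] rk /=; first by rewrite big1// => i _; rewrite mulr0.
  by rewrite /X [RHS]big_mkcond; apply: eq_bigr => i _; rewrite eqSS; case: eqP => _; rewrite ?mulr1 ?mulr0.
have X0 (r : nat) : (r < D.+1)%N -> X r = 0.
  elim: r => [|r IH] rk.
    by have := gX (Ordinal rk); rewrite g0 /= sub0r => /eqP; rewrite eq_sym oppr_eq0 => /eqP.
  by have := gX (Ordinal rk); rewrite g0 /= IH ?(ltnW rk)// sub0r => /eqP; rewrite eq_sym oppr_eq0 => /eqP.
apply/rowP => i; rewrite [RHS]mxE; have := X0 (rho i) (ltnW (ltn_ord (rho i))).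
rewrite /X (bigD1 i)//= big1 ?addr0// => j /andP[/eqP e /eqP].
by move=> h; exfalso; apply: h; apply: rho_inj; apply: val_inj.
Qed.

Lemma pmap_center : exists p, pmap p = 0.
Proof.
exists (0 - pmap 0 *m invmx pmx); rewrite (pmap_affine _ 0) subr0 sub0r mulNmx mulmxKV ?subrr//.
exact: pmx_unit.
Qed.

Hypothesis mM : forall i, (m i < M)%N.

(** The preimage of the center lies in the chamber, hence in the open cube. Outside the cube some
    [beta] is not positive, so the scaled point is outside the ball, and [mx_in_affine] applies to
    the cell. *)
Lemma pmap_good l : N (cls b0 (fun t => F (chi l ((drad R d)^-1 *: pmap t)))).
Proof.
have [p ep] := pmap_center.
have pin : in_chamber M m rho p.
  by move=> r; rewrite -bc_pmap ep /bc; case: unlift => [j|]; rewrite ?mxE ?add0r ?bcc_gt0//;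
    rewrite big1 ?subr0 ?bcc_gt0// => i _; rewrite mxE.
have po : ocube D p := chamber_ocube M0 mM rho_inj pin.
pose q : vec := 2 *: p - const_mx 1.
have q1 : `|q| < 1.
  by rewrite ltNge; apply/negP => /bmap_out; apply.
pose G := ((drad R d)^-1 / 2) *: pmx.
have uG : G \in unitmx.
  by rewrite unitmxZ ?pmx_unit// unitfE mulf_neq0// ?invr_eq0 ?gt_eqF// drad_gt0.
have e (t : vec) : (drad R d)^-1 *: pmap t = (2 *: t - const_mx 1 - q) *m G.
  rewrite (pmap_affine t p) ep add0r /q opprB addrA subrK -scalerBr /G.
  by rewrite -scalemxAl -scalemxAr !scalerA; congr (_ *: _); field; rewrite gt_eqF// drad_gt0.
have := @mx_in_affine R d B b0 N (F \o chi l) q G (mx_in_unit NV uG) q1 (chi_ball l).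
rewrite /ball_in; have -> : bmap (fun x => (F \o chi l) ((x - q) *m G)) = fun t => F (chi l ((drad R d)^-1 *: pmap t)).
  by apply: funext => t; rewrite /bmap /= e.
apply; last exact: NF.
move=> x x1; pose t : vec := 2^-1 *: (x + const_mx 1).
have xt : x = 2 *: t - const_mx 1 by rewrite /t scalerA divff ?pnatr_eq0// scale1r addrK.
rewrite xt -e; have nt : ~ ocube D t by apply/bmap_out; rewrite -xt.
have [r hr] : exists r : 'I_D.+1, ~ (0 < beta r t).
  by apply/existsNP => h; apply: nt; exact: (chamber_ocube M0 mM rho_inj h).
apply: (@bc_drad _ (lab r)); rewrite bc_pmap; apply: (@le_lt_trans _ _ 0).
  by rewrite leNgt; apply/negP.
by rewrite divr_gt0// bcc_gt0.
Qed.

End Piece.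

Theorem cls_critical (a : 'rV[R]_D -> W) (y0 : Y) : is_sph (inl y0 : W) a -> N (cls b0 (F \o a)).
Proof.
move=> sa; have [ca ha] := sa; have [M M0 mesh] := cell_mesh ca.
pose g t := F (deform M a (1, t)).
have cd : continuous (fun t => deform M a (1, t)).
  apply: (@cts_comp _ _ _ (fun t : 'rV[R]_D => (1 : R, t)) (deform M a)); last exact: deform_cts.
  by apply: cts_pair; [exact: cts_cst|exact: cts_id].
have sg : is_sph b0 g.
  split; first exact: (cts_comp cd cF).
  by move=> t ot; rewrite /g (deform_inl _ _ (ha _ ot)).
have sFa : is_sph b0 (F \o a).
  split; first exact: (cts_comp ca cF).
  by move=> t ot; rewrite /= ha.
have hg : htp b0 (F \o a) g.
  exists (F \o deform M a); split.
  - by apply: (cts_comp _ cF); exact: deform_cts.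
  - by move=> t; rewrite /= deform0.
  - by [].
  - by move=> s t ot; rewrite /= (deform_inl _ _ (ha _ ot)).
rewrite ((clsP sFa sg).2 hg).
(* Where the deformed map is not constant, all d.+2 labels occur around the point. As many vertices
   fit only around a point off the hyperplanes, each with its own label. *)
have key t : g t <> b0 -> exists l u, [/\ ocube D t, a t = inr (l, u), (forall i, c / 2 <= bc (sval u) i) &
    forall i, exists v : {ffun 'I_D -> 'I_M.+1}, 0 < hat v t /\ klab a v = i].
  move=> gt; have ot : ocube D t by apply: contrapT => ot; apply: gt; exact: sg.2.
  case e : (a t) => [y|[l u]]; first by exfalso; apply: gt; rewrite /g (deform_inl _ _ e).
  exists l, u; have [h|[h1 h2]] := deform_case M0 mesh (ocube_cube ot) e; last by split.
  by exfalso; apply: gt; rewrite /g (deform1_out e h).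
have cut0 t x : g t <> b0 -> @hcut R D M x t != 0.
  move=> /key[l [u [_ _ _ /choice[f hf]]]].
  apply: (@cut_neq0 R D M x t [set f i | i in 'I_D.+1]) => [v /imsetP[i _ ->]|]; first exact: (hf i).1.
  rewrite card_imset ?card_ord//.
  by move=> i j e; rewrite -(hf i).2 e (hf j).2.
apply: (@cls_cuts R d B b0 N N1 NM (cut_ix D M) (@hcut R D M) (enum {: cut_ix D M}) g) => //.
- move=> x; split; first exact: cts_cut.
  move=> r r' t rr; have := @cut_decr R D M x r r' t rr; congr (_ <= _); congr hcut;
    by apply/rowP => j; rewrite !mxE.
- by move=> x t /eqP e; apply: contrapT => /(cut0 _ x); rewrite e.
move=> t0 gt0; have [l [u0 [ot0 at0 bu0 labs]]] := key t0 gt0.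
have [m [rho [mM rho_inj ct0 hchamber]]] := chamber_of M0 ot0 (fun x => cut0 t0 x gt0).
pose u (r : 'I_D.+1) : {ffun 'I_D -> 'I_M.+1} := chv M m rho r.
have ui : injective u.
  move=> r s /(chv_inj mM rho_inj) e; apply: val_inj; apply: e; by rewrite -ltnS.
have uhat (t : 'rV[R]_D) (r : 'I_D.+1) : in_chamber M m rho t -> hat (u r) t = beta M m rho r t.
  by move=> ct; exact: hat_chv.
have usupp (t : 'rV[R]_D) v : in_chamber M m rho t -> 0 < hat v t -> exists r, v = u r.
  move=> ct hv; apply/not_existsP => hn.
  pose S : {set {ffun 'I_D -> 'I_M.+1}} := (u @: 'I_D.+1)%SET.
  have vS : v \notin S by apply/imsetP => -[r _ e]; apply: (hn r).
  have hS w : w \in (v |: S)%SET -> 0 < hat w t.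
    by move=> /setU1P[->//|/imsetP[r _ ->]]; rewrite uhat//; exact: ct.
  by have := hat_card hS; rewrite cardsU1 vS card_imset// card_ord ltnn.
pose lab (r : 'I_D.+1) : 'I_D.+1 := klab a (u r).
have lab_inj : injective lab.
  have labT i : i \in (lab @: 'I_D.+1)%SET.
    apply/imsetP; have [v [hv <-]] := labs i; have [r ->] := usupp _ _ ct0 hv; by exists r.
  have : {in 'I_D.+1 &, injective lab}.
    by apply/imset_injP/eqP/eq_card => i; rewrite labT.
  by move=> h r s e; apply: h.
(* The piece is compared with the affine map on the whole space: outside the chamber both are
   constant. *)
rewrite (_ : (fun t => _) = fun t => F (chi l ((drad R d)^-1 *: pmap M m rho lab_inj t))).
  exact: pmap_good.
apply: funext => t.
have allE : all (fun x => (@hcut R D M x t <= 0) == (hcut x t0 <= 0)) (enum {: cut_ix D M}) <->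
    (forall x, (@hcut R D M x t <= 0) = (hcut x t0 <= 0)).
  split=> [/allP h x|h]; last by apply/allP => x _; rewrite h eqxx.
  by apply/eqP/h; rewrite mem_enum.
have out : ~ in_chamber M m rho t -> F (chi l ((drad R d)^-1 *: pmap M m rho lab_inj t)) = b0.
  move=> /existsNP[r hr]; rewrite chi_out ?F0//.
  apply: (@bc_drad _ (lab r)); rewrite bc_pmap//; apply: (@le_lt_trans _ _ 0).
    by rewrite leNgt; apply/negP.
  by rewrite divr_gt0// bcc_gt0.
have [ct|nct] := pselect (in_chamber M m rho t); last first.
  rewrite out//; case: ifPn => // /allE h; apply: contrapT => gt; apply: nct.
  by apply: (hchamber t).2 => // x; exact: cut0.
rewrite ifT; last by apply/allE; exact: (hchamber t).1.
have ot : ocube D t := chamber_ocube M0 mM rho_inj ct.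
have near r : exists ur, a (gpt R (u r)) = inr (l, ur) /\ (forall i, c / 4 <= bc (sval ur) i).
  have hr : 0 < hat (u r) t0 by rewrite uhat//; exact: ct0.
  have c0 := bcc_gt0 R d.
  have [|ur [e1 e2]] := mesh t0 (gpt R (u r)) (ocube_cube ot0) (fun i => hat_close M0 i hr) l u0 at0.
    by move=> i; apply: le_trans (bu0 i); lra.
  exists ur; split=> // i; clear e1; have := e2 i; have := bu0 i; rewrite ltr_norml => h1 /andP[h2 h3].
  by clear at0 e2; lra.
(* A point of the chamber is close to every vertex, and the vertex with label i has i-th coordinate
   at least [bcc]. So every coordinate exceeds [bcc / 2], which makes [bcut] equal to 1 on the whole
   chamber. *)
have [ut [et bt]] : exists ut, a t = inr (l, ut) /\ forall i, c / 2 <= bc (sval ut) i.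
  have mv (r : 'I_D.+1) : exists ut, a t = inr (l, ut) /\ c - c / 4 <= bc (sval ut) (lab r).
    have [ur [e1 h1]] := near r; have hr : 0 < hat (u r) t by rewrite uhat//; exact: ct.
    have [|ut [e2 h2]] := mesh (gpt R (u r)) t (gpt_cube R M0 (u r)) _ l ur e1 h1.
      by move=> i; rewrite distrC; exact: hat_close.
    exists ut; split=> //.
    have e3 : lab r = blab (sval ur) by rewrite /lab /klab e1.
    have := blab_ge (sval ur); rewrite -e3 => h3.
    have := h2 (lab r); rewrite ltr_norml => /andP[h4 h5].
    by clear e1 e2 at0; lra.
  have [ut [e1 _]] := mv ord0; exists ut; split=> // i.
  have [ut' [e2 h]] := mv (invF lab_inj i); move: h; rewrite f_invF.
  move: e2; rewrite e1 => -[<-]; apply: le_trans.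
  by clear e1 at0; have := bcc_gt0 R d; lra.
rewrite /g /deform /= et dscale1 /dmove clamp1 mul1r bcut1// scale1r addrC subrK.
congr (F (chi l (_ *: _))); congr bvec; apply: funext => i; rewrite /kwt clampv_id; last exact: ocube_cube.
have sumE (P : pred {ffun 'I_D -> 'I_M.+1}) : \sum_(v | P v) hat v t = \sum_(r | P (u r)) beta M m rho r t.
  rewrite (bigID (fun v => v \in (u @: 'I_D.+1)%SET))/= [X in _ + X]big1 ?addr0; last first.
    move=> v /andP[_ /imsetP h]; apply/eqP; rewrite eq_le hat_ge0 andbT leNgt.
    by apply/negP => /(usupp _ _ ct)[r e]; apply: h; exists r.
  rewrite (reindex_onto u (fun v => odflt ord0 [pick r | u r == v])) /=; last first.
    move=> v /andP[_ /imsetP[r _ ->]]; case: pickP => [s /eqP -> //|/(_ r)]; by rewrite eqxx.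
  apply: eq_big => [r|r _]; last by rewrite uhat.
  rewrite imset_f// andbT; case: pickP => [s /eqP /ui ->|/(_ r)]; by rewrite eqxx// andbT.
rewrite !sumE beta_sum divr1 (big_pred1 (invF lab_inj i))// => r /=.
apply/eqP/eqP => [<-|->]; first by rewrite invF_f.
by rewrite -[klab _ _]/(lab _) f_invF.
Qed.

End Critical.

(** * Spaces over B with prescribed homotopy groups *)

Section Tail.
Context (R : realType) (k : nat).

Definition vtail (x : 'rV[R]_k.+1) : 'rV[R]_k := \row_j x ord0 (lift ord0 j).
Definition vcons (s : R) (v : 'rV[R]_k) : 'rV[R]_k.+1 :=
  \row_j (if unlift ord0 j is Some i then v ord0 i else s).

Lemma vcons0 s v : vcons s v ord0 ord0 = s.
Proof. by rewrite mxE unlift_none. Qed.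

Lemma vconsK s v : vtail (vcons s v) = v.
Proof. by apply/rowP => j; rewrite !mxE liftK. Qed.

Lemma cts_vtail : continuous vtail.
Proof.
apply: continuous_row => i.
rewrite (_ : (fun t => _) = fun t : 'rV[R]_k.+1 => t ord0 (lift ord0 i)).
  exact: coord_continuous.
by apply: funext => t; rewrite mxE.
Qed.

Lemma cts_vcons (T : topologicalType) (s : T -> R) (v : T -> 'rV[R]_k) :
  continuous s -> continuous v -> continuous (fun t => vcons (s t) (v t)).
Proof.
move=> cs cv; apply: continuous_row => i.
case: (unliftP ord0 i) => [j ->|->].
  rewrite (_ : (fun t => _) = fun t => v t ord0 j); first exact: cts_coord.
  by apply: funext => t; rewrite mxE liftK.
rewrite (_ : (fun t => _) = s)//.
by apply: funext => t; rewrite mxE unlift_none.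
Qed.

Lemma vtail_le (x : 'rV[R]_k.+1) : `|vtail x| <= `|x|.
Proof. by apply/norm_rV_le => // i; rewrite mxE coord_le_norm. Qed.

Lemma vtail_Z (r : R) x : vtail (r *: x) = r *: vtail x.
Proof. by apply/rowP => i; rewrite !mxE. Qed.

Lemma norm_vcons_lt (x : 'rV[R]_k.+1) : `|x ord0 ord0| < 1 -> `|vtail x| < 1 -> `|x| < 1.
Proof.
move=> x0 /norm_rV_lt xt; apply/norm_rV_lt => // i.
by case: (unliftP ord0 i) => [j ->|->//]; have := xt ltr01 j; rewrite mxE.
Qed.

Lemma norm_vcons_le (x : 'rV[R]_k.+1) : `|x ord0 ord0| <= 1 -> `|vtail x| <= 1 -> `|x| <= 1.
Proof.
move=> x0 /norm_rV_le xt; apply/norm_rV_le => // i.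
by case: (unliftP ord0 i) => [j ->|->//]; have := xt ler01 j; rewrite mxE.
Qed.

Definition unb (x : 'rV[R]_k) : 'rV[R]_k := 2^-1 *: (x + const_mx 1).

Lemma cts_unb : continuous unb.
Proof.
apply: cts_scale; first exact: cts_cst.
by apply: cts_addv; [exact: cts_id|exact: cts_cst].
Qed.

Lemma unbK' x : unb (2 *: x - const_mx 1) = x.
Proof. by rewrite /unb subrK scalerA mulVf ?pnatr_eq0// scale1r. Qed.

Lemma unb_out x : 1 <= `|x| -> ~ ocube k (unb x).
Proof.
move=> x1 ox; move: x1; rewrite leNgt => /negP; apply; apply/norm_rV_lt => // i.
by have := ox i; rewrite !mxE ltr_norml => /andP[? ?]; apply/andP; split; lra.
Qed.

Lemma ocube_norm (t : 'rV[R]_k) : ocube k t -> `|2 *: t - const_mx 1| < 1.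
Proof.
move=> ot; apply/norm_rV_lt => // i; have := ot i; rewrite !mxE ltr_norml => /andP[? ?].
by apply/andP; split; lra.
Qed.

Lemma ocube_norm' (t : 'rV[R]_k) : ~ ocube k t -> 1 <= `|2 *: t - const_mx 1|.
Proof.
move=> ot; rewrite leNgt; apply/negP => /norm_rV_lt h; apply: ot => i.
have := h ltr01 i; rewrite !mxE ltr_norml => /andP[? ?]; apply/andP; split; lra.
Qed.

End Tail.

(** A pointed space over [B]. Closed points are required so that a compact set meets only finitely
    many levels of the tower. *)
Record stage (R : realType) (B : topologicalType) (b0 : B) := Stage {
  st_sp :> topologicalType;
  st_pt : st_sp;
  st_map : st_sp -> B;
  st_cts : continuous st_map;
  st_map_pt : st_map st_pt = b0;
  st_T1 : forall x : st_sp, closed [set x]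
}.

Section Step.
Context (R : realType) (B : topologicalType) (b0 : B).

(** A cell over [B]: an attaching map and a compatible extension to [B]. The type of all such data,
    cut down by [P], is the index type of one step, so that all the cells are attached at once. *)
Record cell (S : stage R b0) (d : nat) (P : ('rV[R]_d.+1 -> B) -> Prop) := Cell {
  cell_att : 'rV[R]_d.+1 -> S;
  cell_map : 'rV[R]_d.+1 -> B;
  cell_att_cts : {within [set x | `|x| = 1], continuous cell_att};
  cell_map_cts : continuous cell_map;
  cell_bd : forall x, `|x| = 1 -> cell_map x = st_map (cell_att x);
  cell_ok : P (fun x => cell_map (rclamp x))
}.

Context (S : stage R b0) (d : nat) (P : ('rV[R]_d.+1 -> B) -> Prop).
Notation L := (cell S P).
Notation att := (fun l : L => cell_att l).
Notation W := (attach att).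

Definition step_map (w : W) : B :=
  match w with inl y => st_map y | inr (l, u) => cell_map l (sval u) end.

Lemma step_map_chi l x : step_map (chi att l x) = cell_map l (rclamp x).
Proof.
have [x1|x1] := leP 1 `|x|; last by rewrite chi_in /= rclamp_id// ltW.
by rewrite chi_out//= cell_bd// rclamp_norm.
Qed.

Lemma step_cts : continuous step_map.
Proof.
apply: cts_attach => [|l]; first exact: st_cts.
rewrite (_ : _ \o _ = fun x => cell_map l (rclamp x)); last by apply: funext => x; exact: step_map_chi.
by apply: (cts_comp _ (@cell_map_cts _ _ _ l)); apply: cts_rclamp; exact: cts_id.
Qed.

Lemma step_T1 (w : W) : closed [set w].
Proof.
case: w => [y|[l u]].
  rewrite (_ : [set _] = [set w : W | exists2 z, [set y] z & w = inl z]).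
    by apply: closed_inl; [exact: cell_att_cts|exact: st_T1].
  by apply/seteqP; split=> [w ->|w [z -> ->]//]; exists y.
apply/attach_closedE; split=> [|l'].
  rewrite (_ : _ @^-1` _ = set0); first exact: closed0.
  by apply/seteqP; split.
have [ll|ll] := pselect (l' = l); last first.
  rewrite (_ : _ @^-1` _ = set0); first exact: closed0.
  apply/seteqP; split=> // x /=; have [x1|x1] := leP 1 `|x|; first by rewrite chi_out.
  by rewrite chi_in => -[].
subst l'; rewrite (_ : _ @^-1` _ = [set sval u]).
  rewrite (_ : [set sval u] = (fun x : 'rV[R]_d.+1 => `|x - sval u|) @^-1` [set z | z = 0]).
    apply: closed_preim; last exact: closed_eq.
    by apply: cts_norm; apply: cts_addv; [exact: cts_id|exact: cts_cst].
  apply/seteqP; split=> x /=; first by move=> ->; rewrite subrr normr0.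
  by move=> /eqP; rewrite normr_eq0 subr_eq0 => /eqP.
apply/seteqP; split=> x /=; last first.
  by move=> ->; rewrite -chi_val.
have [x1|x1] := leP 1 `|x|; first by rewrite chi_out.
by rewrite chi_in => -[<-].
Qed.

Definition step : stage R b0 :=
  @Stage R B b0 W (inl (st_pt S)) step_map step_cts (st_map_pt S) step_T1.

End Step.

Section Tower.
Context (R : realType) (n : nat) (B : topologicalType) (b0 : B).
Context (N : top_pi R n b0 -> Prop).

Definition tower0 : stage R b0.
Proof.
refine (@Stage R B b0 'rV[R]_0 0 (fun _ => b0) (@cts_cst _ _ _) erefl _).
move=> x; rewrite (_ : [set x] = setT); first exact: closedT.
by apply/seteqP; split=> // y _; apply/rowP => -[].
Defined.

(* Cells of dimension n + 1 are attached first, one for each map of the sphere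
   whose class is in N; then cells of dimension n + m + 1 which kill all the
   homotopy classes in dimension n + m that become trivial in B. *)
Definition tower_ok (m : nat) : ('rV[R]_(m + n).+1 -> B) -> Prop :=
  match m return ('rV[R]_(m + n).+1 -> B) -> Prop with
  | 0 => fun h => @ball_in R n B b0 N h
  | _.+1 => fun _ => True
  end.

Fixpoint tower (m : nat) : stage R b0 :=
  if m is m'.+1 then @step R B b0 (tower m') (m' + n) (@tower_ok m') else tower0.

Notation tcell m := (@cell R B b0 (tower m) (m + n) (@tower_ok m)).
Notation tatt m := (fun l : tcell m => cell_att l).

Lemma tatt_cts m (l : tcell m) : {within [set x | `|x| = 1], continuous (cell_att l)}.
Proof. exact: cell_att_cts. Qed.

Definition tinl m : tower m -> tower m.+1 := @inl _ _.

Lemma cts_tinl m : continuous (@tinl m).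
Proof. exact: (@cts_inl R (tower m) (tcell m) (m + n) (tatt m)). Qed.

Lemma closed_tinl m (C : set (tower m)) : closed C -> closed (@tinl m @` C).
Proof.
move=> cC; rewrite (_ : _ @` _ = [set w : attach (tatt m) | exists2 y, C y & w = inl y]).
  by apply: closed_inl => //; exact: tatt_cts.
by apply/seteqP; split=> w [y Cy e]; exists y.
Qed.

(** The direct limit of the tower: as a set it is the initial point with the open cells of all
    levels, so again no quotient is taken. *)
Definition wlim : Type :=
  ('rV[R]_0 + {m : nat & (tcell m * {x : 'rV[R]_(m + n).+1 | `|x| < 1})%type})%type.

Fixpoint wincl (m : nat) : tower m -> wlim :=
  match m return tower m -> wlim with
  | 0 => fun x => inl x
  | m'.+1 => fun x =>
    match x with
    | inl y => wincl y
    | inr c => inr (existT (fun m => (tcell m * {x : 'rV[R]_(m + n).+1 | `|x| < 1})%type) m' c)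
    end
  end.

Definition wlev (w : wlim) : nat := match w with inl _ => 0 | inr c => (projT1 c).+1 end.

Lemma wincl_lev m (x : tower m) : (wlev (wincl x) <= m)%N.
Proof. by elim: m x => [//|m IH] [y|c] //=; exact: leq_trans (IH y) _. Qed.

Lemma wincl_inj m : injective (@wincl m).
Proof.
elim: m => [x y [->]//|m IH] [x|c] [y|c'] //=.
- by move=> /IH ->.
- by move=> e; have := wincl_lev x; rewrite e /= ltnn.
- by move=> e; have := wincl_lev y; rewrite -e /= ltnn.
- move=> [e]; have := projT2_eq e; rewrite (Prop_irrelevance (projT1_eq e) erefl) /=.
  by move=> ->.
Qed.

Lemma wincl_surj w m : (wlev w <= m)%N -> exists x : tower m, wincl x = w.
Proof.
elim: m => [|m IH] h.
  by case: w h => [x|//] _; exists x.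
have [/IH[x <-]|h'] := leqP (wlev w) m; first by exists (tinl x).
have e : wlev w = m.+1 by apply/eqP; rewrite eqn_leq h.
by case: w e {h h' IH} => [//|[j c]] /= [e]; subst j; exists (inr c).
Qed.

HB.instance Definition _ := gen_eqMixin wlim.
HB.instance Definition _ := gen_choiceMixin wlim.

Definition wlim_op : set_system wlim := [set O | forall m, open (@wincl m @^-1` O)].

Lemma wlim_opT : wlim_op setT.
Proof. by move=> m; rewrite preimage_setT; exact: openT. Qed.

Lemma wlim_opI : setI_closed wlim_op.
Proof. by move=> A C hA hC m; rewrite preimage_setI; apply: openI. Qed.

Lemma wlim_op_bigU (I : Type) (f : I -> set wlim) :
  (forall i, wlim_op (f i)) -> wlim_op (\bigcup_i f i).
Proof. by move=> h m; rewrite preimage_bigcup; apply: bigcup_open => i _; exact: h. Qed.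

HB.instance Definition _ := isOpenTopological.Build wlim wlim_opT wlim_opI wlim_op_bigU.

Lemma wlim_openE (O : set wlim) : open O <-> forall m, open (@wincl m @^-1` O).
Proof. by []. Qed.

Lemma cts_wincl m : continuous (@wincl m).
Proof. by apply/cts_open => A /wlim_openE. Qed.

Lemma cts_wlim (Z : topologicalType) (f : wlim -> Z) :
  (forall m, continuous (f \o @wincl m)) -> continuous f.
Proof.
move=> h; apply/cts_open => A oA; apply/wlim_openE => m.
exact: (@open_preim _ _ (f \o @wincl m) A).
Qed.

Lemma wlim_closed (C : set wlim) : (forall m, closed (@wincl m @^-1` C)) -> closed C.
Proof.
by move=> h; rewrite -openC; apply/wlim_openE => m; rewrite -preimage_setC openC.
Qed.

Definition wmap (w : wlim) : B :=
  match w with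
  | inl _ => b0
  | inr c => cell_map (projT2 c).1 (sval (projT2 c).2)
  end.

Lemma wmap_incl m (x : tower m) : wmap (wincl x) = st_map x.
Proof. by elim: m x => [//|m IH] [y|[l u]] //=; exact: IH. Qed.

Lemma cts_wmap : continuous wmap.
Proof.
apply: cts_wlim => m; rewrite (_ : _ \o _ = @st_map R B b0 (tower m)); first exact: st_cts.
by apply: funext => x; exact: wmap_incl.
Qed.

Fixpoint tinls j (e : nat) : tower j -> tower (e + j) :=
  match e return tower j -> tower (e + j) with
  | 0 => id
  | e'.+1 => fun x => tinl (@tinls j e' x)
  end.

Lemma wincl_tinls j e (x : tower j) : wincl (tinls e x) = wincl x.
Proof. by elim: e => //= e IH. Qed.

Lemma cts_tinls j e : continuous (@tinls j e).
Proof.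
elim: e => [|e IH]; first exact: cts_id.
exact: (cts_comp IH (@cts_tinl _)).
Qed.

Lemma closed_tinls j e (C : set (tower j)) : closed C -> closed (@tinls j e @` C).
Proof.
move=> cC; elim: e => [|e IH]; first by rewrite /= image_id.
rewrite (_ : _ @` _ = @tinl _ @` (@tinls j e @` C)); first exact: closed_tinl.
by rewrite image_comp.
Qed.

Lemma closed_wincl m (C : set (tower m)) : closed C -> closed (@wincl m @` C).
Proof.
move=> cC; apply: wlim_closed => j.
have [jm|/ltnW mj] := leqP j m.
  have [e em] : exists e, m = (e + j)%N by exists (m - j)%N; rewrite subnK.
  subst m; rewrite (_ : _ @^-1` _ = @tinls j e @^-1` C).
    by apply: closed_preim => //; exact: cts_tinls.
  apply/seteqP; split=> x /=; last by move=> h; exists (tinls e x) => //; exact: wincl_tinls.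
  by move=> [y Cy]; rewrite -(wincl_tinls e x) => /wincl_inj <-.
have [e em] : exists e, j = (e + m)%N by exists (j - m)%N; rewrite subnK.
subst j; rewrite (_ : _ @^-1` _ = @tinls m e @` C); first exact: closed_tinls.
apply/seteqP; split=> x /= [y Cy e'].
  by exists y => //; apply: wincl_inj; rewrite wincl_tinls.
by exists y => //; rewrite -e' wincl_tinls.
Qed.

Definition wpt : wlim := inl 0.

Lemma wincl_pt m : wincl (st_pt (tower m)) = wpt.
Proof. by elim: m. Qed.

Lemma wmap_pt : wmap wpt = b0. Proof. by []. Qed.

(** Otherwise there are points of the image beyond every level. The complements of the tails of such
    a sequence are open, since each stage contains only finitely many of its points, and these
    complements form an increasing cover of a compact set without a finite subcover. *)
Lemma sph_wlev k (a : 'rV[R]_k -> wlim) : is_sph wpt a ->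
  exists m, forall t, (wlev (a t) <= m)%N.
Proof.
move=> [ca ha]; apply: contrapT => /forallNP h.
have /choice[t ht] m : exists t, (m < wlev (a t))%N.
  have /existsNP[t /negP] := h m; rewrite -ltnNge => ht; by exists t.
pose U i := [set w : wlim | forall m, (i <= m)%N -> w <> a (t m)].
have oU i : open (U i).
  apply/wlim_openE => j; rewrite -closedC.
  have -> : ~` (@wincl j @^-1` U i) =
      \big[setU/set0]_(m < j) [set x | (i <= m)%N /\ wincl x = a (t m)].
    apply/seteqP; split=> x /=.
      move=> /existsNP[m /not_implyP[im /contrapT e]].
      have mj : (m < j)%N by apply: leq_trans (ht m) _; rewrite -e; exact: wincl_lev.
      by rewrite -(bigcup_mkord j (fun m => [set x | (i <= m)%N /\ wincl x = a (t m)])); exists m.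
    rewrite -(bigcup_mkord j (fun m => [set x | (i <= m)%N /\ wincl x = a (t m)])) => -[m _ [im e]].
    by move=> /(_ m im).
  apply: closed_bigsetU => m _.
  have [[im [y ey]]|hn] := pselect ((i <= m)%N /\ exists y : tower j, wincl y = a (t m)).
    rewrite (_ : [set _ | _] = [set y]); first exact: st_T1.
    apply/seteqP; split=> x /= => [[_ e]|->//].
    by apply: wincl_inj; rewrite e ey.
  rewrite (_ : [set _ | _] = set0); first exact: closed0.
  by apply/seteqP; split=> // x /= [im e]; apply: hn; split=> //; exists x.
have /compact_near_coveringP cK := @cube_compact R k.
have [|i _ hi] := cK nat \oo (fun i s => U i (a s)) _.
  move=> s _; exists (a @^-1` U (wlev (a s)), [set i | (wlev (a s) <= i)%N]) => /=.
    split; last by exists (wlev (a s)).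
    apply: open_nbhs_nbhs; split; first exact: open_preim.
    move=> m hm e; have := ht m; rewrite -e => h'.
    by move: hm; rewrite leqNgt h'.
  by move=> [s' i] /= [h1 h2] m im; apply: h1; exact: leq_trans h2 im.
have ct : cube (t i).
  apply: ocube_cube; apply: contrapT => /ha e; have := ht i; rewrite e.
  by [].
by have := hi i (leqnn i) (t i) ct i (leqnn i).
Qed.

Lemma sph_factor k (a : 'rV[R]_k -> wlim) : is_sph wpt a ->
  exists m (b : 'rV[R]_k -> tower m), is_sph (st_pt (tower m)) b /\ a = @wincl m \o b.
Proof.
move=> sa; have [ca ha] := sa; have [m hm] := sph_wlev sa.
have /choice[b hb] t : exists x : tower m, wincl x = a t by exact: wincl_surj.
exists m, b; split; last by apply: funext => t; rewrite /= hb.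
split; last by move=> t /ha; rewrite -hb -(wincl_pt m) => /wincl_inj.
apply/cts_closed => C cC; rewrite (_ : _ @^-1` _ = a @^-1` (@wincl m @` C)).
  by apply: closed_preim => //; exact: closed_wincl.
apply/seteqP; split=> t /=; first by move=> Cb; exists (b t).
by move=> [x Cx]; rewrite -hb => /wincl_inj <-.
Qed.

Lemma htp_comp k (X X' : topologicalType) (f : X -> X') x (a b : 'rV[R]_k -> X) :
  continuous f -> htp x a b -> htp (f x) (f \o a) (f \o b).
Proof.
move=> cf [H [cH H0 H1 Hb]]; exists (f \o H); split=> /=.
- exact: (cts_comp cH cf).
- by move=> t; rewrite H0.
- by move=> t; rewrite H1.
- by move=> s t /Hb ->.
Qed.

Lemma sph_comp k (X X' : topologicalType) (f : X -> X') x (a : 'rV[R]_k -> X) :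
  continuous f -> is_sph x a -> is_sph (f x) (f \o a).
Proof. by move=> cf [ca ha]; split=> [|t /ha /= ->//]; exact: (cts_comp ca cf). Qed.

(** The cells added after stage m0 have dimension at least m0 + n + 1, which exceeds k, so a sphere
    can be pushed off them one stage at a time. *)
Lemma sph_descend k m0 e (b : 'rV[R]_k -> tower (e + m0)) : (k <= m0 + n)%N ->
  is_sph (st_pt _) b -> exists b' : 'rV[R]_k -> tower m0, is_sph (st_pt _) b' /\
   htp (st_pt _) b (@tinls m0 e \o b').
Proof.
move=> km; elim: e b => [|e IH] b sb; first by exists b; split=> //; exact: htp_refl.
have ke : (k <= (e + m0) + n)%N by apply: leq_trans km _; rewrite leq_add2r leq_addl.
have [b1 [sb1 h1]] := @sph_into_base R (tower (e + m0)) (tcell (e + m0)) (e + m0 + n)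
  (tatt (e + m0)) (@tatt_cts _) k (st_pt _) b ke sb.
have [b' [sb' h']] := IH b1 sb1; exists b'; split=> //.
apply: htp_trans h1 _; exact: (htp_comp (@cts_tinl (e + m0)) h').
Qed.

Lemma wlim_descend k m0 (a : 'rV[R]_k -> wlim) : (k <= m0 + n)%N -> is_sph wpt a ->
  exists b : 'rV[R]_k -> tower m0, is_sph (st_pt _) b /\ htp wpt a (@wincl m0 \o b).
Proof.
move=> km sa; have [m [b [sb ->]]] := sph_factor sa.
have [mm|/ltnW mm] := leqP m0 m.
  have [e em] : exists e, m = (e + m0)%N by exists (m - m0)%N; rewrite subnK.
  subst m; have [b' [sb' h]] := sph_descend km sb; exists b'; split=> //.
  have := htp_comp (@cts_wincl (e + m0)) h; rewrite wincl_pt.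
  by congr htp; apply: funext => t; rewrite /= wincl_tinls.
have [e em] : exists e, m0 = (e + m)%N by exists (m0 - m)%N; rewrite subnK.
subst m0; exists (@tinls m e \o b).
have ept : tinls e (st_pt (tower m)) = st_pt (tower (e + m)).
  by apply: wincl_inj; rewrite wincl_tinls !wincl_pt.
split; first by have := sph_comp (@cts_tinls m e) sb; rewrite ept.
rewrite (_ : _ \o (_ \o _) = wincl (m := m) \o b).
  by apply: htp_refl; have := sph_comp (@cts_wincl m) sb; rewrite wincl_pt.
by apply: funext => t; rewrite /= wincl_tinls.
Qed.

Lemma wlim_low k (a : 'rV[R]_k -> wlim) : (k <= n)%N -> is_sph wpt a -> htp wpt a (fun=> wpt).
Proof.
move=> kn sa; have [b [sb h]] := @wlim_descend k 0 a kn sa.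
rewrite (_ : (fun=> wpt) = @wincl 0 \o b)//; apply: funext => t /=.
by congr inl; apply/rowP => -[].
Qed.

(** The sphere and the nullhomotopy of its image are the data of a cell of the next stage, and that
    cell provides the nullhomotopy upstairs. *)
Lemma wlim_kill m (b : 'rV[R]_(m.+1 + n) -> tower m.+1) : is_sph (st_pt _) b ->
  htp b0 (@st_map _ _ _ (tower m.+1) \o b) (fun=> b0) -> htp wpt (@wincl m.+1 \o b) (fun=> wpt).
Proof.
set k := (m.+1 + n)%N; move=> sb [H [cH H0 H1 Hb]]; have [cb hb] := sb.
pose pt := st_pt (tower m.+1).
(* On the boundary of the cube, this is [b] on the bottom face and constant elsewhere. A sign test
   is enough, as on the lateral faces [b] already takes the value [pt]. *)
pose ca (x : 'rV[R]_k.+1) := if x ord0 ord0 <= 0 then b (unb (vtail x)) else pt.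
pose cm (x : 'rV[R]_k.+1) := H (2^-1 * (x ord0 ord0 + 1), unb (vtail x)).
have x0c : continuous (fun x : 'rV[R]_k.+1 => x ord0 ord0) by exact: coord_continuous.
have cbt : continuous (fun x : 'rV[R]_k.+1 => b (unb (vtail x))).
  apply: (@cts_comp _ _ _ (fun x => unb (vtail x)) b) => //.
  by apply: (cts_comp (@cts_vtail R k)); exact: cts_unb.
have out (x : 'rV[R]_k.+1) : 1 <= `|vtail x| -> b (unb (vtail x)) = pt.
  by move=> /unb_out; exact: hb.
have side (x : 'rV[R]_k.+1) : `|x| = 1 -> `|vtail x| < 1 -> x ord0 ord0 = 1 \/ x ord0 ord0 = -1.
  move=> x1 v1; have : ~ (`|x ord0 ord0| < 1).
    by move=> h; have := norm_vcons_lt h v1; rewrite x1 ltxx.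
  move=> /negP; rewrite -leNgt => h; have : `|x ord0 ord0| = 1.
    by apply: le_anti; rewrite h -x1 coord_le_norm.
  by case: ger0P => _ e; [left|right]; rewrite -e ?opprK.
have ca_cts : {within [set x | `|x| = 1], continuous ca}.
  apply: (@continuous_within_paste R _ _ _ (fun x : 'rV[R]_k.+1 => x ord0 ord0)) => //.
  - apply: (@closed_preim _ _ (fun x : 'rV[R]_k.+1 => `|x|) [set z | z = 1]); last exact: closed_eq.
    by apply: cts_norm; exact: cts_id.
  - exact: continuous_subspaceT.
  - by apply: continuous_subspaceT; exact: cts_cst.
  - move=> x /= x1 x0; apply: out; rewrite leNgt; apply/negP => /(side x x1).
    by rewrite x0 => -[/eqP|/eqP]; [rewrite eq_sym oner_eq0|rewrite eq_sym oppr_eq0 oner_eq0].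
have cm_cts : continuous cm.
  apply: (cts_comp _ cH); apply: cts_pair.
    by apply: cts_mul; [exact: cts_cst|apply: cts_add => //; exact: cts_cst].
  by apply: (cts_comp (@cts_vtail R k)); exact: cts_unb.
have bd x : `|x| = 1 -> cm x = st_map (ca x).
  move=> x1; rewrite /cm /ca; have [v1|v1] := leP 1 `|vtail x|.
    rewrite Hb; last exact: unb_out.
    by case: ifP => _; rewrite ?(out _ v1) st_map_pt.
  have [->|->] := side x x1 v1.
    rewrite (_ : 2^-1 * (1 + 1) = 1); last by lra.
    by rewrite H1 ifN ?st_map_pt// -ltNge.
  rewrite addNr mulr0 H0 ifT//; lra.
pose l : tcell m.+1 := @Cell R B b0 (tower m.+1) k (@tower_ok m.+1) ca cm ca_cts cm_cts bd I.
(* The homotopy sweeps the cell from its bottom face, where it is [b], to its top face, where it is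
   constant. *)
pose K (z : R * 'rV[R]_k) := chi (tatt m.+1) l (vcons (2 * clamp z.1 - 1) (2 *: z.2 - const_mx 1)).
have cK : continuous K.
  apply: (@cts_comp _ _ _ (fun z : R * 'rV[R]_k => vcons (2 * clamp z.1 - 1) (2 *: z.2 - const_mx 1)) (chi (tatt m.+1) l)); last exact: cts_chi.
  apply: cts_vcons.
    by apply: cts_sub; [apply: cts_mul; [exact: cts_cst|apply: cts_clamp; exact: cts_fst]|exact: cts_cst].
  apply: cts_addv; last exact: cts_cst.
  by apply: cts_scale; [exact: cts_cst|exact: cts_snd].
have x0le (s : R) : `|2 * clamp s - 1| <= 1.
  by have /andP[? ?] := clamp01 s; rewrite ler_norml; apply/andP; split; lra.
have caout s (v : 'rV[R]_k) : 1 <= `|v| -> chi (tatt m.+1) l (vcons (2 * clamp s - 1) v) = inl pt.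
  move=> v1; set x := vcons _ _; have vx : vtail x = v by rewrite vconsK.
  have xv : `|x| = `|v|.
    have vle : `|v| <= `|x| by rewrite -vx vtail_le.
    apply: le_anti; rewrite vle andbT.
    apply/norm_rV_le => // i; case: (unliftP ord0 i) => [j ->|->].
      by rewrite mxE liftK coord_le_norm.
    by rewrite vcons0; apply: le_trans v1.
  rewrite chi_out ?xv//; congr inl; rewrite /= /ca; case: ifP => // _; apply: out.
  rewrite /rclamp vtail_Z vx xv normrZ max_r// ger0_norm ?invr_ge0// mulVf//.
  by rewrite gt_eqF// (lt_le_trans ltr01).
have K0 t : K (0, t) = inl (b t).
  rewrite /K; have [ot|ot] := pselect (ocube k t); last first.
    by rewrite caout ?hb//; exact: ocube_norm'.
  have tv := ocube_norm ot; set x := vcons _ _.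
  have x00 : x ord0 ord0 = -1 by rewrite vcons0 /= clamp0 mulr0 sub0r.
  have x1 : `|x| = 1.
    apply: le_anti; rewrite norm_vcons_le ?vconsK ?x00 ?normrN ?normr1 ?(ltW tv)//=.
    by have := coord_le_norm x ord0; rewrite x00 normrN normr1.
  rewrite chi_out ?x1// rclamp_id ?x1//= /ca x00 ifT; last by lra.
  by rewrite vconsK unbK'.
have K1 t : K (1, t) = inl pt.
  rewrite /K; have [ot|ot] := pselect (ocube k t); last first.
    by rewrite caout//; exact: ocube_norm'.
  have tv := ocube_norm ot; set x := vcons _ _.
  have x00 : x ord0 ord0 = 1 by rewrite vcons0 /= clamp1; lra.
  have x1 : `|x| = 1.
    apply: le_anti; rewrite norm_vcons_le ?vconsK ?x00 ?normr1 ?(ltW tv)//=.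
    by have := coord_le_norm x ord0; rewrite x00 normr1.
  by rewrite chi_out ?x1// rclamp_id ?x1//= /ca x00 ifN// -ltNge.
exists (@wincl m.+2 \o K); split=> /=.
- by apply: (cts_comp cK); exact: (@cts_wincl m.+2).
- by move=> t; rewrite K0.
- by move=> t; rewrite K1; exact: (wincl_pt m.+2).
- by move=> s t ot; rewrite /K caout; [exact: (wincl_pt m.+2)|exact: ocube_norm'].
Qed.

Lemma wlim_high k (a : 'rV[R]_k -> wlim) : (n < k)%N -> is_sph wpt a ->
  htp b0 (wmap \o a) (fun=> b0) -> htp wpt a (fun=> wpt).
Proof.
move=> nk sa h; have [m em] : exists m, k = (m.+1 + n)%N.
  by exists (k - n.+1)%N; rewrite addSnnS subnK.
subst k; have [b [sb hb]] := @wlim_descend _ m.+1 a (leqnn _) sa.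
apply: (htp_trans hb); apply: wlim_kill => //; apply: (htp_trans _ h); apply: htp_sym.
have := htp_comp cts_wmap hb; rewrite wmap_pt; congr htp.
by apply: funext => t; exact: (wmap_incl (b t)).
Qed.

Hypothesis N1 : N 1%g.
Hypothesis NM : forall u v, N u -> N v -> N (u * v)%g.
Hypothesis NV : forall u, N u -> N (u^-1)%g.

Lemma wlim_image (a : 'rV[R]_n.+1 -> wlim) : is_sph wpt a -> N (cls b0 (wmap \o a)).
Proof.
move=> sa; have [b [sb hb]] := @wlim_descend n.+1 1 a (leqnn _) sa.
have sa' := sph_comp cts_wmap sa; rewrite wmap_pt in sa'.
have sb' := sph_comp (@st_cts _ _ _ (tower 1)) sb; rewrite st_map_pt in sb'.
have h : htp b0 (wmap \o a) (@st_map _ _ _ (tower 1) \o b).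
  have := htp_comp cts_wmap hb; rewrite wmap_pt; congr htp.
  by apply: funext => t; exact: (wmap_incl (b t)).
rewrite ((clsP sa' sb').2 h).
apply: (@cls_critical R (tower 0) (tcell 0) n (tatt 0) B b0 (@st_map _ _ _ (tower 1)) _ _ N N1 NM NV _ b (st_pt (tower 0))) => //.
- exact: (@st_cts _ _ _ (tower 1)).
- move=> l; rewrite (_ : _ \o _ = fun x => cell_map l (rclamp x)); first exact: (cell_ok l).
  by apply: funext => x; exact: step_map_chi.
Qed.

Lemma wlim_onto u : N u -> exists a : 'rV[R]_n.+1 -> wlim, is_sph wpt a /\ cls b0 (wmap \o a) = u.
Proof.
move=> Nu; have [f [sf fu]] := cls_surj u; have [cf hf] := sf.
pose cm (x : 'rV[R]_n.+1) := f (unb x).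
have cmo x : 1 <= `|x| -> cm x = b0 by move=> /unb_out; exact: hf.
have cmc : continuous cm := cts_comp (@cts_unb R n.+1) cf.
have cmr : (fun x => cm (rclamp x)) = cm.
  apply: funext => x; have [x1|/ltW x1] := leP 1 `|x|; last by rewrite rclamp_id.
  by rewrite !cmo// rclamp_norm.
have ok : @tower_ok 0 (fun x => cm (rclamp x)).
  rewrite /= cmr /ball_in; rewrite (_ : bmap cm = f) ?fu//.
  by apply: funext => t; rewrite /bmap /cm unbK'.
have ac : {within [set x : 'rV[R]_n.+1 | `|x| = 1], continuous (fun _ : 'rV[R]_n.+1 => st_pt (tower 0))}.
  by apply: continuous_subspaceT; exact: cts_cst.
have bd x : `|x| = 1 -> cm x = st_map (st_pt (tower 0)) by move=> x1; rewrite cmo ?x1// st_map_pt.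
pose l : tcell 0 := @Cell R B b0 (tower 0) n (@tower_ok 0) (fun=> st_pt (tower 0)) cm ac cmc bd ok.
pose a (t : 'rV[R]_n.+1) := @wincl 1 (chi (tatt 0) l (2 *: t - const_mx 1)).
exists a; split.
  split.
    have c1 : continuous (fun t : 'rV[R]_n.+1 => chi (tatt 0) l (2 *: t - const_mx 1)).
      by apply: (cts_comp (@cts_aff R n)); exact: cts_chi.
    exact: (cts_comp c1 (@cts_wincl 1)).
  by move=> t /ocube_norm' h; rewrite /a chi_out//=; exact: (wincl_pt 1).
rewrite (_ : wmap \o a = f)//; apply: funext => t; rewrite /a /= (wmap_incl (m := 1)).
rewrite [LHS](step_map_chi (S := tower 0) l) /= -[RHS](congr1 f (unbK' t)).
by have := congr1 (fun g => g (2 *: t - const_mx 1)) cmr.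
Qed.

End Tower.

(** * Change of base point *)

Section FreeHomotopy.
Context (R : realType) (n : nat) (X : topologicalType).
Notation vec := 'rV[R]_n.
Implicit Types (f g : vec -> X) (p : R -> X) (G : R * vec -> X) (D : R * R -> X).

Definition ctr (t : vec) : vec := 2 *: t - const_mx 1.

Lemma cts_ctr : continuous ctr.
Proof.
apply: cts_addv; last exact: cts_cst.
by apply: cts_scale; [exact: cts_cst|exact: cts_id].
Qed.

(* G, squeezed into the middle of the cube, surrounded by a shell on which D
   depends only on the distance to the center. *)
Definition shell (G : R * vec -> X) (D : R * R -> X) (z : R * vec) : X :=
  if `|ctr z.2| - 2^-1 <= 0 then G (z.1, unb (2 *: ctr z.2))
  else D (z.1, clamp (2 - 2 * `|ctr z.2|)).

Lemma cts_shell G D : continuous G -> continuous D ->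
  (forall s t, ~ ocube n t -> G (s, t) = D (s, 1)) -> continuous (shell G D).
Proof.
move=> cG cD h.
have cc : continuous (fun z : R * vec => ctr z.2) by apply: (cts_comp _ cts_ctr); exact: cts_snd.
have cn : continuous (fun z : R * vec => `|ctr z.2|) by exact: cts_norm.
apply: cts_if.
- by apply: cts_sub => //; exact: cts_cst.
- apply: (cts_comp _ cG); apply: cts_pair; first exact: cts_fst.
  apply: (cts_comp _ (@cts_unb R n)); apply: cts_scale => //; exact: cts_cst.
- apply: (cts_comp _ cD); apply: cts_pair; first exact: cts_fst.
  apply: cts_clamp; apply: cts_sub; first exact: cts_cst.
  by apply: cts_mul => //; exact: cts_cst.
- move=> [s t] /= /eqP; rewrite subr_eq0 => /eqP e; rewrite h.
    by rewrite e divff ?pnatr_eq0// clamp_id; [congr (D (_, _)); lra|lra].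
  by apply: unb_out; rewrite normrZ e ger0_norm// divff ?pnatr_eq0.
Qed.

Lemma shell_bd G D s t : ~ ocube n t -> shell G D (s, t) = D (s, 0).
Proof.
move=> ot; have h : 1 <= `|ctr t| by exact: ocube_norm'.
by rewrite /shell /= ifN ?clamp_le0//; [lra|rewrite -ltNge; lra].
Qed.

Lemma shell_ext G D G' D' s s' t : (forall t, G (s, t) = G' (s', t)) ->
  (forall r, 0 <= r <= 1 -> D (s, r) = D' (s', r)) -> shell G D (s, t) = shell G' D' (s', t).
Proof. by move=> hG hD; rewrite /shell /= hG hD// clamp01. Qed.

Definition squeeze f (t : vec) : X := f (unb (2 *: ctr t)).

Lemma squeeze_htp x f : is_sph x f -> htp x f (squeeze f).
Proof.
move=> [cf hf]; exists (fun z => f (unb ((1 + clamp z.1) *: ctr z.2))); split=> /=.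
- apply: (cts_comp _ cf); apply: (cts_comp _ (@cts_unb R n)); apply: cts_scale.
    by apply: cts_add; [exact: cts_cst|apply: cts_clamp; exact: cts_fst].
  by apply: (cts_comp _ cts_ctr); exact: cts_snd.
- by move=> t; rewrite clamp0 addr0 scale1r unbK'.
- by move=> t; rewrite clamp1.
- move=> s t ot; apply/hf/unb_out; rewrite normrZ ger0_norm ?addr_ge0 ?clamp_ge0//.
  by rewrite mulr_ege1 ?lerDl ?clamp_ge0//; exact: ocube_norm'.
Qed.

Lemma shell_squeeze x f s t : is_sph x f -> shell (f \o snd) (fun=> x) (s, t) = squeeze f t.
Proof.
move=> [_ hf]; rewrite /shell /squeeze /=; case: ifPn => // h; apply/esym/hf/unb_out.
by rewrite normrZ ger0_norm//; rewrite -ltNge in h; lra.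
Qed.

(** Sends spheres at the end [p 1] to spheres at the start [p 0]. *)
Definition transport p g (t : vec) : X := shell (g \o snd) (p \o snd) (0, t).

Definition fhtp p f g := exists H : R * vec -> X,
  [/\ continuous H, forall t, H (0, t) = f t, forall t, H (1, t) = g t &
      forall s t, ~ ocube n t -> H (s, t) = p (clamp s)].

Lemma cts_shell_at G D s : continuous (shell G D) -> continuous (fun t => shell G D (s, t)).
Proof.
move=> c; apply: (@cts_comp _ _ _ (fun t : vec => (s, t)) (shell G D)) => //.
by apply: cts_pair; [exact: cts_cst|exact: cts_id].
Qed.

Lemma transport_sph p g : continuous p -> is_sph (p 1) g -> is_sph (p 0) (transport p g).
Proof.
move=> cp [cg hg]; split; last by move=> t ot; rewrite /transport shell_bd.
apply: cts_shell_at; apply: cts_shell.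
- exact: (cts_comp (@cts_snd _ _) cg).
- exact: (cts_comp (@cts_snd _ _) cp).
- by move=> s t; exact: hg.
Qed.

Lemma fhtp_transport p g : continuous p -> is_sph (p 1) g -> fhtp p (transport p g) g.
Proof.
move=> cp [cg hg].
(* The radius of the inner cube grows from 1/2 to 1, which reduces the shell to nothing. *)
pose r (z : R * vec) : R := (1 + clamp z.1) / 2.
exists (fun z => if `|ctr z.2| - r z <= 0 then g (unb ((r z)^-1 *: ctr z.2))
  else p (clamp (clamp z.1 + Num.max 0 (2 - 2 * `|ctr z.2|)))).
have cc : continuous (fun z : R * vec => ctr z.2) by apply: (cts_comp _ cts_ctr); exact: cts_snd.
have cn : continuous (fun z : R * vec => `|ctr z.2|) by exact: cts_norm.
have c1 : continuous (fun z : R * vec => clamp z.1) by apply: cts_clamp; exact: cts_fst.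
have cr : continuous r by apply: cts_mul; [apply: cts_add => //; exact: cts_cst|exact: cts_cst].
have r0 z : 0 < r z by rewrite divr_gt0// ltr_wpDr// clamp_ge0.
have r1 z : r z <= 1 by rewrite /r; have := clamp_le1 z.1; lra.
split.
- apply: cts_if.
  + exact: cts_sub.
  + apply: (cts_comp _ cg); apply: (cts_comp _ (@cts_unb R n)); apply: cts_scale => //.
    by apply: cts_inv => // z; rewrite gt_eqF.
  + apply: (cts_comp _ cp); apply: cts_clamp; apply: cts_add => //; apply: cts_max; first exact: cts_cst.
    by apply: cts_sub; [exact: cts_cst|apply: cts_mul => //; exact: cts_cst].
  + move=> z /eqP; rewrite subr_eq0 => /eqP e; rewrite hg; last first.
      by apply: unb_out; rewrite normrZ e ger0_norm ?invr_ge0 ?(ltW (r0 z))// mulVf// gt_eqF.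
    rewrite e; congr p; apply/esym/clamp_ge1; rewrite -lerBlDl le_max; apply/orP; right.
    by rewrite /r; lra.
- move=> t; rewrite /transport /shell /r /= clamp0 addr0 div1r invrK add0r.
  case: ifPn => // _; congr p; have [y0|y0] := leP (2 - 2 * `|ctr t|) 0.
    by rewrite (clamp_le0 y0) clamp0.
  by [].
- move=> t; rewrite /r /= clamp1 (_ : (1 + 1) / 2 = 1 :> R); last by lra.
  rewrite invr1 scale1r unbK'; case: ifPn => // h; rewrite clamp_ge1; last by rewrite lerDl le_max lexx.
  apply/esym/hg => ot; have := ocube_norm ot; rewrite -/(ctr t).
  by rewrite -ltNge in h; lra.
- move=> s t ot /=; have h : 1 <= `|ctr t| by exact: ocube_norm'.
  have rz := r1 (s, t); have rz0 := r0 (s, t); case: ifPn => h'.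
    have e : `|ctr t| = 1 by apply: le_anti; rewrite h andbT; rewrite subr_le0 in h'; exact: le_trans h' rz.
    have er : r (s, t) = 1 by apply: le_anti; rewrite rz -e -subr_le0 h'.
    rewrite er invr1 scale1r unbK' hg//; congr p; move: er; rewrite /r /=; lra.
  by rewrite max_l ?addr0 ?(clamp_id (clamp01 s))//; lra.
Qed.

(* The shell absorbs the motion of the base point along p. *)
Lemma fhtp_uniq p f g : continuous p -> fhtp p f g -> htp (p 0) f (transport p g).
Proof.
move=> cp [H [cH H0 H1 Hb]].
have sf : is_sph (p 0) f.
  split; last by move=> t ot; rewrite -H0 Hb// clamp0.
  rewrite (_ : f = fun t => H (0, t)); last by apply: funext.
  apply: (@cts_comp _ _ _ (fun t : vec => (0 : R, t)) H) => //.
  by apply: cts_pair; [exact: cts_cst|exact: cts_id].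
apply: (htp_trans (squeeze_htp sf)).
exists (shell H (fun z => p (clamp z.1 * z.2))); split.
- apply: cts_shell => //.
    by apply: (cts_comp _ cp); apply: cts_mul; [apply: cts_clamp; exact: cts_fst|exact: cts_snd].
  by move=> s t ot; rewrite Hb// mulr1.
- move=> t; rewrite -(shell_squeeze 0 t sf); apply: shell_ext => [u|r _] /=; first by rewrite H0.
  by rewrite clamp0 mul0r.
- move=> t; apply: shell_ext => [u|r _] /=; first by rewrite H1.
  by rewrite clamp1 mul1r.
- by move=> s t ot; rewrite shell_bd// mulr0.
Qed.

Lemma transport_htp p g g' : continuous p -> htp (p 1) g g' ->
  htp (p 0) (transport p g) (transport p g').
Proof.
move=> cp [H [cH H0 H1 Hb]]; exists (shell H (p \o snd)); split.
- apply: cts_shell => //; first exact: (cts_comp (@cts_snd _ _) cp).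
- by move=> t; apply: shell_ext => // u; rewrite H0.
- by move=> t; apply: shell_ext => // u; rewrite H1.
- by move=> s t ot; rewrite shell_bd.
Qed.

Lemma transport_path_htp (P : R * R -> X) g : continuous P -> 
  (forall s, P (s, 0) = P (0, 0)) -> (forall s, P (s, 1) = P (0, 1)) -> is_sph (P (0, 1)) g ->
  htp (P (0, 0)) (transport (fun r => P (0, r)) g) (transport (fun r => P (1, r)) g).
Proof.
move=> cP P0 P1 [cg hg]; exists (shell (g \o snd) P); split.
- apply: cts_shell => //; first exact: (cts_comp (@cts_snd _ _) cg).
  by move=> s t ot /=; rewrite hg// P1.
- by move=> t; exact: shell_ext.
- by move=> t; exact: shell_ext.
- by move=> s t ot; rewrite shell_bd.
Qed.

Definition rpath p : R -> X := fun s => p (1 - s).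

Lemma cts_rpath p : continuous p -> continuous (rpath p).
Proof.
move=> cp; apply: (cts_comp _ cp).
by apply: cts_sub; [exact: cts_cst|exact: cts_id].
Qed.

Lemma fhtp_rev p f g : fhtp p f g -> fhtp (rpath p) g f.
Proof.
move=> [H [cH H0 H1 Hb]]; exists (fun z => H (1 - clamp z.1, z.2)); split.
- apply: (cts_comp _ cH); apply: cts_pair; last exact: cts_snd.
  by apply: cts_sub; [exact: cts_cst|apply: cts_clamp; exact: cts_fst].
- by move=> t /=; rewrite clamp0 subr0 H1.
- by move=> t /=; rewrite clamp1 subrr H0.
- move=> s t ot /=; rewrite Hb// /rpath clamp_id//.
  by have /andP[? ?] := clamp01 s; apply/andP; split; lra.
Qed.

Lemma transportK p f : continuous p -> is_sph (p 0) f ->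
  htp (p 0) f (transport p (transport (rpath p) f)).
Proof.
move=> cp sf; apply: fhtp_uniq => //.
have s' : is_sph (rpath p 1) f by rewrite /rpath subrr.
have := fhtp_rev (fhtp_transport (cts_rpath cp) s').
by congr fhtp; apply: funext => s; rewrite /rpath opprB addrC subrK.
Qed.

End FreeHomotopy.

Lemma fhtp_mul (R : realType) n (X : topologicalType) (p : R -> X) (f g f' g' : 'rV[R]_n.+1 -> X) :
  continuous p -> fhtp p f f' -> fhtp p g g' -> fhtp p (fmul f g) (fmul f' g').
Proof.
move=> cp [H [cH H0 H1 Hb]] [K [cK K0 K1 Kb]].
have cA a b : continuous (fun z : R * 'rV[R]_n.+1 => (z.1, set_fst (a * z.2 ord0 ord0 + b) z.2)).
  apply: cts_pair; first exact: cts_fst.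
  apply: (@cts_comp _ _ _ (@snd R 'rV[R]_n.+1) (fun t : 'rV[R]_n.+1 => set_fst (a * t ord0 ord0 + b) t)).
    exact: cts_snd.
  exact: continuous_set_affine.
have c2 : continuous (fun z : R * 'rV[R]_n.+1 => z.2 ord0 ord0) by apply: cts_coord; exact: cts_snd.
exists (fun z : R * 'rV[R]_n.+1 => if z.2 ord0 ord0 - 2^-1 <= 0 then H (z.1, set_fst (2 * z.2 ord0 ord0 + 0) z.2)
   else K (z.1, set_fst (2 * z.2 ord0 ord0 + -1) z.2)); split.
- apply: cts_if.
  + by apply: cts_sub => //; exact: cts_cst.
  + exact: (cts_comp (cA 2 0) cH).
  + exact: (cts_comp (cA 2 (-1)) cK).
  + move=> z /eqP; rewrite subr_eq0 => /eqP ->.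
    by rewrite Hb ?Kb//; apply: ocube_set_fst => /andP[]; lra.
- by move=> t /=; rewrite /fmul subr_le0 H0 K0.
- by move=> t /=; rewrite /fmul subr_le0 H1 K1.
- move=> s t ot /=; case: leP => t2; [apply: Hb|apply: Kb].
    have [t0|t0] := leP (t ord0 ord0) 0; first by apply: ocube_set_fst => /andP[]; lra.
    by apply: ocube_set_fst' => // _; apply/andP; split; lra.
  have [t0|t0] := leP 1 (t ord0 ord0); first by apply: ocube_set_fst => /andP[]; lra.
  by apply: ocube_set_fst' => // _; apply/andP; split; lra.
Qed.

Section BaseChange.
Context (R : realType).

Lemma joined_path (X : topologicalType) (x y : X) : joined R x y ->
  exists p : R -> X, [/\ continuous p, p 0 = x & p 1 = y].
Proof.
move=> [p [cp p0 p1]]; exists (fun s => p (clamp s)); split; rewrite ?clamp0 ?clamp1//.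
apply: cts_within_total cp => [|s]; last exact: clamp01.
by apply: cts_clamp; exact: cts_id.
Qed.

Lemma path_joined (X : topologicalType) (p : R -> X) : continuous p -> joined R (p 0) (p 1).
Proof. by move=> cp; exists p; split=> //; exact: continuous_subspaceT. Qed.

Definition ptr n (X : topologicalType) (p : R -> X) (u : top_pi R n (p 1)) : top_pi R n (p 0) :=
  cls (p 0) (transport p (of_tloop (repr u))).

Lemma ptrE n (X : topologicalType) (p : R -> X) g : continuous p -> is_sph (p 1) g ->
  ptr (cls (n := n) (p 1) g) = cls (p 0) (transport p g).
Proof.
move=> cp sg; have sr := of_tloop_sph (repr (cls (n := n) (p 1) g)).
apply/clsP; [exact: transport_sph|exact: transport_sph|].
by apply: transport_htp => //; apply/clsP => //; rewrite cls_of reprK.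
Qed.

(** A product of free homotopies along [p] is again one, and [fhtp_uniq] identifies its start with
    the transport of the product. *)
Lemma ptrM n (X : topologicalType) (p : R -> X) (u v : top_pi R n (p 1)) : continuous p ->
  ptr (u * v)%g = (ptr u * ptr v)%g.
Proof.
move=> cp; have [f [sf <-]] := cls_surj u; have [g [sg <-]] := cls_surj v.
rewrite -cls_mul// !ptrE//; last exact: fmul_sph.
rewrite -cls_mul; [|exact: transport_sph|exact: transport_sph].
apply/esym/clsP; [by apply: fmul_sph; exact: transport_sph|by apply: transport_sph => //; exact: fmul_sph|].
by apply: fhtp_uniq => //; apply: fhtp_mul => //; exact: fhtp_transport.
Qed.

Lemma ptr_inj n (X : topologicalType) (p : R -> X) : continuous p -> injective (@ptr n X p).
Proof.
move=> cp u v; have [f [sf <-]] := cls_surj u; have [g [sg <-]] := cls_surj v.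
rewrite !ptrE// => /clsP h; have {}h := h (transport_sph cp sf) (transport_sph cp sg).
have cq := cts_rpath cp.
have q0 : rpath p 0 = p 1 by rewrite /rpath subr0.
have q1 : rpath p 1 = p 0 by rewrite /rpath subrr.
have qq : rpath (rpath p) = p by apply: funext => s; rewrite /rpath opprB addrC subrK.
have h1 := @transport_htp R n.+1 X (rpath p) _ _ cq; rewrite q0 q1 in h1; have {}h1 := h1 _ _ h.
have K := @transportK R n.+1 X (rpath p); rewrite q0 qq in K.
apply/clsP => //; apply: (htp_trans (K _ cq sf)); apply: (htp_trans h1).
by apply: htp_sym; exact: K.
Qed.

Lemma ptr_surj n (X : topologicalType) (p : R -> X) (w : top_pi R n (p 0)) : continuous p ->
  exists u, ptr u = w.
Proof.
move=> cp; have [f [sf <-]] := cls_surj w.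
have cq := cts_rpath cp.
have q0 : rpath p 0 = p 1 by rewrite /rpath subr0.
have q1 : rpath p 1 = p 0 by rewrite /rpath subrr.
have sq : is_sph (p 1) (transport (rpath p) f).
  by rewrite -q0; apply: transport_sph => //; rewrite q1.
exists (cls (p 1) (transport (rpath p) f)); rewrite ptrE//.
apply/clsP => //; first exact: transport_sph.
by apply: htp_sym; exact: transportK.
Qed.

Lemma inj_surj_bij (T U : Type) (f : T -> U) : injective f -> (forall y, exists x, f x = y) -> bijective f.
Proof.
move=> fi /choice[g gK]; exists g => // x; apply: fi; exact: gK.
Qed.

Lemma top_pi_map_cls n (X Y : topologicalType) (f : continuousType X Y) (x : X) (y : Y) (fxy : f x = y) a :
  is_sph x a -> top_pi_map fxy (cls (n := n) x a : top_pi R n x) = cls y (f \o a).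
Proof.
move=> sa; rewrite (cls_to sa) top_pi_mapE.
have sfa : is_sph y (f \o a).
  rewrite -fxy; split; last by move=> t /(sa.2) /= ->.
  by apply: (cts_comp sa.1); exact: cts_fun.
rewrite (cls_to sfa); apply/top_piP/tloop_htpy_eq => t ct //=.
Qed.

Lemma cls_comp_mul n (X Y : topologicalType) (f : X -> Y) (x : X) (a b : 'rV[R]_n.+1 -> X) :
  continuous f -> is_sph x a -> is_sph x b ->
  cls (f x) (f \o fmul a b) = (cls (f x) (f \o a) * cls (f x) (f \o b))%g.
Proof.
move=> cf sa sb; rewrite -cls_mul; [|exact: sph_comp|exact: sph_comp].
by congr cls; apply: funext => t; rewrite /fmul /=; case: ifP.
Qed.

(** The group structure turns a trivial kernel into injectivity at [x0], and transport along paths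
    carries the result to the other base points. *)
Lemma weak_equiv_at (X Y : topologicalType) (f : continuousType X Y) (x0 : X) :
  path_connected R X -> path_connected R Y ->
  (forall n (a : 'rV[R]_n.+1 -> X), is_sph x0 a -> htp (f x0) (f \o a) (fun=> f x0) -> htp x0 a (fun=> x0)) ->
  (forall n (b : 'rV[R]_n.+1 -> Y), is_sph (f x0) b -> exists a, is_sph x0 a /\ htp (f x0) (f \o a) b) ->
  weak_equiv R f.
Proof.
move=> [_ cX] [_ cY] kf sf; have cf : continuous f by move=> t; exact: cts_fun.
have injx n (a b : 'rV[R]_n.+1 -> X) : is_sph x0 a -> is_sph x0 b ->
    htp (f x0) (f \o a) (f \o b) -> htp x0 a b.
  move=> sa sb ab; have sr := frev_sph sb.
  have : (cls x0 a * cls x0 (frev b))%g = 1%g :> top_pi R n x0.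
    rewrite -cls_mul//; apply/cls_eq1; first exact: fmul_sph.
    apply: kf; first exact: fmul_sph.
    apply/cls_eq1; first by apply: sph_comp => //; exact: fmul_sph.
    rewrite cls_comp_mul// ((clsP (sph_comp cf sa) (sph_comp cf sb)).2 ab) -cls_comp_mul//.
    have : cls x0 (fmul b (frev b)) = cls x0 (fun=> x0) by rewrite cls_mul// cls_inv// cls1.
    move=> /(clsP (fmul_sph sb sr) (cst_sph R n.+1 x0)) /(htp_comp cf) h.
    by apply/(cls_eq1 (htp_sph h).1).
  rewrite -(cls_inv sb) => /mulIg e; exact/clsP.
split.
  apply: inj_surj_bij.
    move=> u v; elim/quotW: u => u; elim/quotW: v => v _.
    by apply/top_pi0P; exact: cX.
  move=> y; elim/quotW: y => y; exists (\pi_(top_pi0 R X) x0); rewrite top_pi0_mapE.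
  by apply/top_pi0P; exact: cY.
move=> n x; have [p [cp p0 p1]] := joined_path (cX x x0).
have cq := cts_rpath cp.
have q0 : rpath p 0 = x0 by rewrite /rpath subr0.
have q1 : rpath p 1 = x by rewrite /rpath subrr.
have cfq : continuous (f \o rpath p) := cts_comp cq cf.
have cfp : continuous (f \o p) := cts_comp cp cf.
have tr (r : R -> X) (a : 'rV[R]_n.+1 -> X) : f \o transport r a = transport (f \o r) (f \o a).
  by apply: funext => t; rewrite /transport /shell /=; case: ifP.
apply: inj_surj_bij.
  move=> u v; have [a [sa <-]] := cls_surj u; have [b [sb <-]] := cls_surj v.
  rewrite !top_pi_map_cls// => /clsP ab.
  have {}ab := ab (sph_comp cf sa) (sph_comp cf sb).
  have := @transport_htp R n.+1 Y (f \o rpath p) (f \o a) (f \o b) cfq.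
  rewrite /= q1 q0 -!tr => /(_ ab) h.
  have stq (c : 'rV[R]_n.+1 -> X) : is_sph x c -> is_sph x0 (transport (rpath p) c).
    by move=> sc; rewrite -q0; apply: transport_sph => //; rewrite q1.
  have hx := injx n _ _ (stq _ sa) (stq _ sb) h.
  have T := @transport_htp R n.+1 X p; rewrite p0 p1 in T; have h' := T _ _ cp hx.
  apply/clsP => //; have K := @transportK R n.+1 X p; rewrite p0 in K.
  by apply: (htp_trans (K _ cp sa)); apply: (htp_trans h'); apply: htp_sym; exact: K.
move=> w; have [b [sb <-]] := cls_surj w.
have sb' : is_sph (f x0) (transport (f \o rpath p) b).
  by have := @transport_sph R n.+1 Y (f \o rpath p) b cfq; rewrite /= q0 q1; apply.
have [a [sa ha]] := sf n _ sb'.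
have sta : is_sph x (transport p a) by rewrite -p0; apply: transport_sph => //; rewrite p1.
exists (cls x (transport p a)); rewrite top_pi_map_cls// tr.
apply/clsP => //; first by have := sph_comp cf sta; rewrite tr.
have := @transport_htp R n.+1 Y (f \o p) _ _ cfp; rewrite /= p1 p0 => /(_ _ _ ha) h.
apply: (htp_trans h); apply: htp_sym.
by have := @transportK R n.+1 Y (f \o p) b cfp; rewrite /= p0; apply.
Qed.

End BaseChange.

(** * Products *)

Lemma dep_choice (I : Type) (Z : I -> Type) (P : forall i, Z i -> Prop) :
  (forall i, exists x, P i x) -> exists f : forall i, Z i, forall i, P i (f i).
Proof. by move=> h; exists (fun i => projT1 (cid (h i))) => i; case: cid. Qed.

Definition cts_map (X Y : topologicalType) (f : X -> Y) (cf : continuous f) : continuousType X Y :=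
  HB.pack f (isContinuous.Build X Y f cf).

Section Products.
Context (R : realType) (I : Type) (Z : I -> topologicalType).
Notation P := (prod_topology Z : topologicalType).

Lemma cts_eval i : continuous (fun z : P => z i).
Proof.
move=> z; have /cvg_sup/(_ i) h : z --> z by apply: cvg_id.
move=> U /(@initial_continuous _ _ (fun z : P => z i) z) /=; exact: h.
Qed.

Lemma cts_tuple (T : topologicalType) (p : T -> P) :
  (forall i, continuous (fun t => p t i)) -> continuous p.
Proof.
move=> cp t; apply/cvg_sup => i U.
have /= -> := @nbhsE (initial_topology (fun z : P => z i)) (p t).
move=> [B [[C oC <-] Ct]] BU; apply: filterS BU _.
by apply: (cp i t); exact: open_nbhs_nbhs.
Qed.

Lemma prod_sph k (z : P) (a : 'rV[R]_k -> P) :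
  is_sph z a <-> forall i, is_sph (z i) (fun t => a t i).
Proof.
split=> [[ca ha] i|h].
  by split=> [|t /ha ->//]; exact: (cts_comp ca (@cts_eval i)).
split=> [|t ot]; first by apply: cts_tuple => i; exact: (h i).1.
by apply: functional_extensionality_dep => i; exact: (h i).2.
Qed.

Lemma prod_htp k (z : P) (a b : 'rV[R]_k -> P) :
  (forall i, htp (z i) (fun t => a t i) (fun t => b t i)) -> htp z a b.
Proof.
move=> /(dep_choice (Z := fun i => R * 'rV[R]_k -> Z i))[H hH]; exists (fun s i => H i s); split.
- by apply: cts_tuple => i; have [] := hH i.
- by move=> t; apply: functional_extensionality_dep => i; have [] := hH i.
- by move=> t; apply: functional_extensionality_dep => i; have [] := hH i.
- by move=> s t ot; apply: functional_extensionality_dep => i; have [_ _ _ ->] := hH i.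
Qed.

Lemma htp_eval k (z : P) (a b : 'rV[R]_k -> P) i :
  htp z a b -> htp (z i) (fun t => a t i) (fun t => b t i).
Proof. by move=> /(htp_comp (@cts_eval i)). Qed.

Lemma path_connected_prod : (forall i, path_connected R (Z i)) -> path_connected R P.
Proof.
move=> h; split.
  by have [z _] := dep_choice (fun i => (h i).1); exists z.
move=> x y; have /dep_choice[p hp] : forall i, exists p : R -> Z i, [/\ continuous p, p 0 = x i & p 1 = y i].
  by move=> i; apply: joined_path; exact: (h i).2.
have -> : x = (fun i => p i 0) by apply: functional_extensionality_dep => i; have [_ ->] := hp i.
have -> : y = (fun i => p i 1) by apply: functional_extensionality_dep => i; have [_ _ ->] := hp i.
apply: (@path_joined R P (fun s i => p i s)); apply: cts_tuple => i; by have [] := hp i.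
Qed.

Lemma path_connected_eval i : path_connected R P -> path_connected R (Z i).
Proof.
move=> [[z _] h]; split; first by exists (z i).
(* A section of the i-th projection, with the other coordinates frozen at those of [z]. *)
pose put (x : Z i) : P := fun j => if pselect (i = j) is left e then ecast j (Z j) e x else z j.
have putK x : put x i = x.
  by rewrite /put; case: pselect => // e; rewrite (Prop_irrelevance e erefl).
move=> x y; have [p [cp p0 p1]] := joined_path (h (put x) (put y)).
rewrite -(putK x) -(putK y) -p0 -p1.
by apply: (@path_joined R (Z i) (fun s => p s i)); exact: (cts_comp cp (@cts_eval i)).
Qed.

Lemma simply_connected_eval i : simply_connected R P -> simply_connected R (Z i).
Proof.
move=> [cP h]; split; first exact: path_connected_eval.
have [[z0 _] _] := cP.
pose put (z : P) (x : Z i) : P := fun j => if pselect (i = j) is left e then ecast j (Z j) e x else z j.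
have putK z x : put z x i = x.
  by rewrite /put; case: pselect => // e; rewrite (Prop_irrelevance e erefl).
move=> x u; pose z := put z0 x; have [a [sa <-]] := cls_surj u.
apply/cls_eq1 => //.
have cput : continuous (put z).
  apply: cts_tuple => j; rewrite /put; case: pselect => e.
    by case: j / e => /=; exact: cts_id.
  exact: cts_cst.
have sp : is_sph (put z x) (put z \o a) by exact: sph_comp.
have /(cls_eq1 sp)/(htp_eval i) := h _ (cls (n := 0) (put z x) (put z \o a)).
rewrite putK (_ : (fun t => (put z \o a) t i) = a) //.
by apply: funext => t /=; rewrite putK.
Qed.

End Products.

Section WeakEquiv.
Context (R : realType).

Lemma weak_equiv_inj n (X Y : topologicalType) (f : continuousType X Y) (x : X) (a b : 'rV[R]_n.+1 -> X) :
  weak_equiv R f -> is_sph x a -> is_sph x b -> htp (f x) (f \o a) (f \o b) -> htp x a b.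
Proof.
move=> [_ /(_ n x)/bij_inj fi] sa sb h.
have cf : continuous f by move=> t; exact: cts_fun.
apply/clsP => //; apply: fi; rewrite !top_pi_map_cls//; apply/clsP => //; exact: sph_comp.
Qed.

Lemma weak_equiv_surj n (X Y : topologicalType) (f : continuousType X Y) (x : X) (b : 'rV[R]_n.+1 -> Y) :
  weak_equiv R f -> is_sph (f x) b -> exists a, is_sph x a /\ htp (f x) (f \o a) b.
Proof.
move=> [_ /(_ n x)[g gK Kg]] sb.
have cf : continuous f by move=> t; exact: cts_fun.
have [a [sa ea]] := cls_surj (g (cls (f x) b)); exists a; split => //.
apply/(clsP (n := n)) => //; first exact: sph_comp.
by have := Kg (cls (f x) b); rewrite -ea top_pi_map_cls.
Qed.

Lemma weak_equiv_prod (I : Type) (W Z : I -> topologicalType) (w : forall i, continuousType (W i) (Z i)) :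
  (forall i, path_connected R (W i)) -> (forall i, path_connected R (Z i)) ->
  (forall i, weak_equiv R (w i)) ->
  exists f : continuousType (prod_topology W) (prod_topology Z), weak_equiv R f.
Proof.
move=> cW cZ ww.
pose f : (prod_topology W : topologicalType) -> (prod_topology Z : topologicalType) := fun x i => w i (x i).
have cf : continuous f.
  by apply: cts_tuple => i; apply: (cts_comp (@cts_eval _ W i)) => t; exact: cts_fun.
have [[x0 _] _] := path_connected_prod cW.
exists (cts_map cf); apply: (@weak_equiv_at R _ _ (cts_map cf) x0).
- exact: path_connected_prod.
- exact: path_connected_prod.
- move=> n a sa h; apply: prod_htp => i; apply: (weak_equiv_inj (ww i)).
  + exact: (prod_sph _ _).1.
  + exact: cst_sph.
  + exact: (htp_eval i h).
- move=> n b sb.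
  have /dep_choice[a ha] : forall i, exists a : 'rV[R]_n.+1 -> W i,
      is_sph (x0 i) a /\ htp (w i (x0 i)) (w i \o a) (fun t => b t i).
    by move=> i; apply: weak_equiv_surj => //; have /prod_sph := sb; apply.
  exists (fun t i => a i t); split; first by apply/prod_sph => i; exact: (ha i).1.
  by apply: prod_htp => i; exact: (ha i).2.
Qed.

End WeakEquiv.

(** * Uniqueness of Eilenberg-Mac Lane spaces *)

Section Span.
Context (R : realType) (n : nat).

(** The group left free is the one of dimension n + 1. *)
Definition one_pi (Z : topologicalType) := path_connected R Z /\
  forall m, m <> n -> forall (z : Z) (u : top_pi R m z), u = 1%g.

Lemma one_pi_htp (Z : topologicalType) m (z : Z) (a : 'rV[R]_m.+1 -> Z) :
  one_pi Z -> m <> n -> is_sph z a -> htp z a (fun=> z).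
Proof. by move=> [_ h] mn sa; apply/(cls_eq1 sa)/h. Qed.

Context (Z Z' : topologicalType) (z : Z) (z' : Z') (phi : top_pi R n z -> top_pi R n z').
Hypotheses (hZ : one_pi Z) (hZ' : one_pi Z') (phiM : {morph phi : u v / (u * v)%g}) (phi_bij : bijective phi).

Let B : topologicalType := (Z * Z')%type.
Let b0 : B := (z, z').

Let cf1 : continuous (@fst Z Z') := @cts_fst Z Z'.
Let cf2 : continuous (@snd Z Z') := @cts_snd Z Z'.

Let m1 (u : top_pi R n b0) : top_pi R n z := top_pi_map (f := cts_map cf1) erefl u.
Let m2 (u : top_pi R n b0) : top_pi R n z' := top_pi_map (f := cts_map cf2) erefl u.

Let m1E a : is_sph b0 a -> m1 (cls b0 a) = cls z (fst \o a).
Proof. exact: top_pi_map_cls. Qed.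
Let m2E a : is_sph b0 a -> m2 (cls b0 a) = cls z' (snd \o a).
Proof. exact: top_pi_map_cls. Qed.

Let m1M u v : m1 (u * v)%g = (m1 u * m1 v)%g.
Proof.
have [a [sa <-]] := cls_surj u; have [b [sb <-]] := cls_surj v.
rewrite -cls_mul// !m1E//; last exact: fmul_sph.
exact: (cls_comp_mul cf1 sa sb).
Qed.
Let m2M u v : m2 (u * v)%g = (m2 u * m2 v)%g.
Proof.
have [a [sa <-]] := cls_surj u; have [b [sb <-]] := cls_surj v.
rewrite -cls_mul// !m2E//; last exact: fmul_sph.
exact: (cls_comp_mul cf2 sa sb).
Qed.

Let morph1 (G H : groupType) (f : G -> H) : {morph f : u v / (u * v)%g} -> f 1%g = 1%g.
Proof. by move=> fM; apply: (@mulgI _ (f 1%g)); rewrite -fM !mulg1. Qed.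

Let N (u : top_pi R n b0) : Prop := phi (m1 u) = m2 u.

Let N1 : N 1%g.
Proof. by rewrite /N (morph1 m1M) (morph1 m2M) (morph1 phiM). Qed.
Let NM u v : N u -> N v -> N (u * v)%g.
Proof. by rewrite /N m1M m2M phiM => -> ->. Qed.
Let NV u : N u -> N u^-1%g.
Proof.
rewrite /N => e; apply: (@mulgI _ (m2 u)).
by rewrite -{1}e -phiM -m1M -m2M mulgV (morph1 m1M) (morph1 m2M) (morph1 phiM).
Qed.

Let W : topologicalType := wlim N.

Let W_connected : path_connected R W.
Proof.
split; first by exists (wpt N).
suff h (x : W) : joined R x (wpt N) by move=> x y; exact: joined_trans (h x) (joined_sym (h y)).
have sx : is_sph (wpt N) (fun _ : 'rV[R]_0 => x).
  by split=> [|t []]; [exact: cts_cst|case].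
have [H [cH H0 H1 _]] := wlim_low (leq0n n) sx.
rewrite -(H0 0) -(H1 0); apply: (@path_joined R W (fun s => H (s, 0))).
by apply: (cts_comp _ cH); apply: cts_pair; [exact: cts_id|exact: cts_cst].
Qed.

Let w1 : W -> Z := fst \o @wmap R n B b0 N.
Let w2 : W -> Z' := snd \o @wmap R n B b0 N.
Let cw : continuous (@wmap R n B b0 N) := @cts_wmap R n B b0 N.
Let cw1 : continuous w1 := cts_comp cw cf1.
Let cw2 : continuous w2 := cts_comp cw cf2.

Let pair_htp k (a b : 'rV[R]_k -> B) : htp z (fst \o a) (fst \o b) -> htp z' (snd \o a) (snd \o b) -> htp b0 a b.
Proof.
move=> [H [cH H0 H1 Hb]] [K [cK K0 K1 Kb]]; exists (fun s => (H s, K s)); split.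
- exact: cts_pair.
- by move=> t; rewrite H0 K0 /=; case: (a t).
- by move=> t; rewrite H1 K1 /=; case: (b t).
- by move=> s t ot; rewrite Hb ?Kb.
Qed.

(** In dimensions up to n the space has no homotopy. Above, a class dies as soon as its image in [B]
    does, and the groups of both factors vanish except in dimension n + 1. *)
Let W_kernel k (a : 'rV[R]_k.+1 -> W) : is_sph (wpt N) a ->
  (k = n -> htp z (w1 \o a) (fun=> z) /\ htp z' (w2 \o a) (fun=> z')) -> htp (wpt N) a (fun=> wpt N).
Proof.
move=> sa h; have [kn|nk] := leqP k.+1 n; first exact: wlim_low.
apply: wlim_high => //.
have s1 : is_sph z (w1 \o a) := sph_comp cw1 sa.
have s2 : is_sph z' (w2 \o a) := sph_comp cw2 sa.
apply: pair_htp; have [/h[]//|/eqP kn] := eqVneq k n; exact: one_pi_htp.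
Qed.

Let W_onto (b1 : 'rV[R]_n.+1 -> Z) (b2 : 'rV[R]_n.+1 -> Z') : is_sph z b1 -> is_sph z' b2 ->
  phi (cls z b1) = cls z' b2 ->
  exists a, [/\ is_sph (wpt N) a, htp z (w1 \o a) b1 & htp z' (w2 \o a) b2].
Proof.
move=> s1 s2 e.
have sb : is_sph b0 (fun t => (b1 t, b2 t)).
  by split=> [|t ot]; [exact: (cts_pair s1.1 s2.1)|rewrite s1.2// s2.2].
have /wlim_onto[a [sa ea]] : N (cls b0 (fun t => (b1 t, b2 t))) by rewrite /N m1E// m2E.
have /(clsP (sph_comp cw sa) sb) h := ea.
by exists a; split => //; [exact: (htp_comp cf1 h)|exact: (htp_comp cf2 h)].
Qed.

Lemma one_pi_span : exists (W : topologicalType) (f : continuousType W Z) (g : continuousType W Z'),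
  [/\ path_connected R W, weak_equiv R f & weak_equiv R g].
Proof.
exists W, (cts_map cw1), (cts_map cw2); split=> //.
- apply: (@weak_equiv_at R _ _ (cts_map cw1) (wpt N)) => //; first exact: hZ.1.
    move=> k a sa h; apply: W_kernel => // e; split=> //; subst k.
    have s2 : is_sph z' (w2 \o a) := sph_comp cw2 sa.
    (* The image of the class lies on the graph of [phi], so a trivial first component forces a
       trivial second one. *)
    apply/(cls_eq1 s2); have := wlim_image N1 NM NV sa.
    have sa' : is_sph b0 (@wmap R n B b0 N \o a) := sph_comp cw sa.
    rewrite /N m1E// m2E// => <-; rewrite -(morph1 phiM); congr phi.
    by apply/(cls_eq1 (sph_comp cf1 sa')).
  move=> k b sb; have [e|/eqP kn] := eqVneq k n; last first.
    exists (fun=> wpt N); split; first exact: cst_sph.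
    by apply: htp_sym; exact: one_pi_htp.
  subst k; have [b2 [s2 e2]] := cls_surj (phi (cls z b)).
  by have [a [sa h _]] := W_onto sb s2 (esym e2); exists a.
- apply: (@weak_equiv_at R _ _ (cts_map cw2) (wpt N)) => //; first exact: hZ'.1.
    move=> k a sa h; apply: W_kernel => // e; split=> //; subst k.
    have s1 : is_sph z (w1 \o a) := sph_comp cw1 sa.
    apply/(cls_eq1 s1); have := wlim_image N1 NM NV sa.
    have sa' : is_sph b0 (@wmap R n B b0 N \o a) := sph_comp cw sa.
    rewrite /N m1E// m2E// => e; apply: (bij_inj phi_bij); rewrite (morph1 phiM) e.
    by apply/(cls_eq1 (sph_comp cf2 sa')).
  move=> k b sb; have [e|/eqP kn] := eqVneq k n; last first.
    exists (fun=> wpt N); split; first exact: cst_sph.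
    by apply: htp_sym; exact: one_pi_htp.
  subst k; have [psi _ psiK] := phi_bij; have [b1 [s1 e1]] := cls_surj (psi (cls z' b)).
  by have [|a [sa _ h]] := W_onto s1 sb; [rewrite e1 psiK|exists a].
Qed.

End Span.

(** * Isomorphisms in Hot and simple connectivity *)

Section HotIso.
Context (R : realType).
Implicit Types X Y Z : topologicalType.

Lemma hot_iso_sym X Y : hot_iso R X Y -> hot_iso R Y X.
Proof. by move=> [a [b [? ?]]]; exists b, a. Qed.

Lemma hot_iso_trans X Y Z : hot_iso R X Y -> hot_iso R Y Z -> hot_iso R X Z.
Proof.
have inner (U V T : topologicalType) (a : hot_word R U V) (b : hot_word R V U) (c : hot_word R V T) (d : hot_word R T V) :
    hot_eq (hot_comp b a) (hot_id R U) -> hot_eq (hot_comp d c) (hot_id R V) ->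
    hot_eq (hot_comp (hot_comp b d) (hot_comp c a)) (hot_id R U).
  move=> ba dc; apply: hot_eq_trans ba.
  apply: (hot_eq_trans (hot_eq_sym (hot_compA _ _ _))); apply: hot_eq_comp; first exact: hot_eq_refl.
  apply: (hot_eq_trans (hot_compA _ _ _)).
  apply: hot_eq_trans (hot_1comp a); apply: hot_eq_comp => //; exact: hot_eq_refl.
move=> [a [b [ba ab]]] [c [d [dc cd]]]; exists (hot_comp c a), (hot_comp b d).
by split; exact: inner.
Qed.

Lemma weak_equiv_hot_iso X Y (f : continuousType X Y) : weak_equiv R f -> hot_iso R X Y.
Proof.
move=> wf; exists (hot_loc R f), (hot_inv wf).
by split; [exact: hot_invK|exact: hot_locK].
Qed.

End HotIso.

(** * Free loops and the words of Hot *)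

Section FreeLoops.
Context (R : realType).
Implicit Types X Y Z : topologicalType.

(** The point 0 is on the boundary of the cube, so [f 0] serves as the base point and none has to be
    named. *)
Definition floop X (f : 'rV[R]_1 -> X) := is_sph (f 0) f.

Definition freq X (f g : 'rV[R]_1 -> X) := exists H : R * 'rV[R]_1 -> X,
  [/\ continuous H, forall t, H (0, t) = f t, forall t, H (1, t) = g t &
      forall s t, ~ ocube 1 t -> H (s, t) = H (s, 0)].

Lemma ocube_0 : ~ ocube 1 (0 : 'rV[R]_1).
Proof. by move=> /(_ ord0); rewrite mxE ltxx. Qed.

Lemma sph_floop X (x : X) f : is_sph x f -> floop f.
Proof. by move=> sf; rewrite /floop (sf.2 _ ocube_0). Qed.

Lemma cst_floop X (x : X) : floop (fun=> x).
Proof. exact: cst_sph. Qed.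

Lemma freq_refl X f : floop f -> @freq X f f.
Proof.
move=> [cf hf]; exists (fun z => f z.2); split => //.
exact: (cts_comp (@cts_snd _ _) cf).
Qed.

Lemma freq_sym X f g : @freq X f g -> freq g f.
Proof.
move=> [H [cH H0 H1 Hb]]; exists (fun z => H (1 - z.1, z.2)); split.
- apply: (cts_comp _ cH); apply: cts_pair; last exact: cts_snd.
  by apply: cts_sub; [exact: cts_cst|exact: cts_fst].
- by move=> t /=; rewrite subr0.
- by move=> t /=; rewrite subrr.
- by move=> s t ot /=; exact: Hb.
Qed.

Lemma freq_trans X f g h : @freq X f g -> freq g h -> freq f h.
Proof.
move=> [H [cH H0 H1 Hb]] [K [cK K0 K1 Kb]].
exists (fun z => if z.1 - 2^-1 <= 0 then H (2 * z.1 + 0, z.2) else K (2 * z.1 + -1, z.2)); split.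
- apply: cts_if.
  + by apply: cts_sub; [exact: cts_fst|exact: cts_cst].
  + by apply: (cts_comp _ cH); exact: cts_aff_pair.
  + by apply: (cts_comp _ cK); exact: cts_aff_pair.
  + move=> [s t] /= /eqP; rewrite subr_eq0 => /eqP ->.
    by rewrite divff ?pnatr_eq0// addr0 subrr H1 K0.
- by move=> t /=; rewrite sub0r oppr_le0 invr_ge0 ler0n mulr0 addr0.
- move=> t /=; rewrite ifN; last by rewrite -ltNge; lra.
  by rewrite (_ : 2 * 1 - 1 = 1 :> R) ?K1//; lra.
- by move=> s t ot /=; case: ifP => _; [exact: Hb|exact: Kb].
Qed.

Lemma freq_comp X Y (f : X -> Y) a b : continuous f -> freq a b -> freq (f \o a) (f \o b).
Proof.
move=> cf [H [cH H0 H1 Hb]]; exists (f \o H); split=> /=.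
- exact: (cts_comp cH cf).
- by move=> t; rewrite H0.
- by move=> t; rewrite H1.
- by move=> s t ot /=; rewrite Hb.
Qed.

Lemma floop_comp X Y (f : X -> Y) a : continuous f -> floop a -> floop (f \o a).
Proof. by move=> cf /(sph_comp cf). Qed.

Lemma freq_fhtp X f g : @freq X f g -> exists p : R -> X,
  [/\ continuous p, p 0 = f 0, p 1 = g 0 & fhtp p f g].
Proof.
move=> [H [cH H0 H1 Hb]].
have ch : continuous (fun s : R => H (s, 0)).
  by apply: (cts_comp _ cH); apply: cts_pair; [exact: cts_id|exact: cts_cst].
exists (fun s => H (s, 0)); split=> //.
exists (fun z => H (clamp z.1, z.2)); split.
- apply: (cts_comp _ cH); apply: cts_pair; last exact: cts_snd.
  by apply: cts_clamp; exact: cts_fst.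
- by move=> t; rewrite clamp0.
- by move=> t; rewrite clamp1.
- by move=> s t ot /=; exact: Hb.
Qed.

Lemma fhtp_freq X (p : R -> X) f g : fhtp p f g -> freq f g.
Proof.
move=> [H [cH H0 H1 Hb]]; exists H; split=> // s t ot.
by rewrite Hb// Hb//; exact: ocube_0.
Qed.

Lemma htp_freq X (x : X) f g : htp x f g -> freq f g.
Proof.
move=> [H [cH H0 H1 Hb]]; exists H; split=> // s t ot.
by rewrite Hb// Hb//; exact: ocube_0.
Qed.

Lemma transport_freq X (p : R -> X) g : continuous p -> is_sph (p 1) g -> freq (transport p g) g.
Proof. by move=> cp sg; apply: fhtp_freq; exact: fhtp_transport. Qed.

Lemma weak_equiv_joined X Y (w : continuousType X Y) x x' : weak_equiv R w ->
  joined R (w x) (w x') -> joined R x x'.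
Proof.
move=> [wi _] j; apply/top_pi0P/(bij_inj wi); rewrite !top_pi0_mapE.
exact/top_pi0P.
Qed.

Lemma comp_transport n X Y (f : X -> Y) (r : R -> X) (a : 'rV[R]_n -> X) :
  f \o transport r a = transport (f \o r) (f \o a).
Proof. by apply: funext => t; rewrite /transport /shell /=; case: ifP. Qed.

Lemma weak_equiv_free_surj X Y (w : continuousType X Y) v : weak_equiv R w -> floop v ->
  exists u, floop u /\ freq (w \o u) v.
Proof.
move=> ww sv; have [h _] := ww; have [g _ gK] := h.
have /top_pi0P : \pi_(top_pi0 R Y) (w (repr (g (\pi_(top_pi0 R Y) (v 0))))) = \pi_(top_pi0 R Y) (v 0).
  by rewrite -top_pi0_mapE reprK gK.
set x := repr _; move=> /joined_path[p [cp p0 p1]].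
have st : is_sph (w x) (transport p v) by rewrite -p0; apply: transport_sph => //; rewrite p1.
have [a [sa ha]] := weak_equiv_surj ww st.
exists a; split; first exact: sph_floop sa.
by apply: (freq_trans (htp_freq ha)); apply: transport_freq => //; rewrite p1.
Qed.

Lemma clamp_idem (s : R) : clamp (clamp s) = clamp s.
Proof. exact/clamp_id/clamp01. Qed.

(* A free homotopy of the images moves the base point along a loop, which
   comes from a loop of the source. *)
Lemma weak_equiv_free_inj X Y (w : continuousType X Y) u v : weak_equiv R w -> floop u -> floop v ->
  freq (w \o u) (w \o v) -> freq u v.
Proof.
move=> ww su sv h; have cw : continuous w by move=> t; exact: cts_fun.
have [x ux] : exists x, x = u 0 by exists (u 0).
have [q0 [cq0 q00 q01 _]] := freq_fhtp h.
have /(weak_equiv_joined ww)/joined_path[p [cp p0 p1]] : joined R (w (u 0)) (w (v 0)).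
  by rewrite -[w (u 0)]q00 -[w (v 0)]q01; exact: path_joined.
have sv1 : is_sph (p 1) v by rewrite p1.
have fv : freq (transport p v) v by exact: transport_freq.
apply: freq_trans fv.
have st : is_sph (u 0) (transport p v) by rewrite -p0; exact: transport_sph.
have {}h : freq (w \o u) (w \o transport p v).
  by apply: (freq_trans h); apply: freq_comp => //; apply: freq_sym; exact: transport_freq.
move: st h; move: (transport p v) => {sv1 p cp p0 p1 v sv q0 cq0 q00 q01} v sv h.
have [q [cq q0 q1 hq]] := freq_fhtp h; rewrite /= (sv.2 _ ocube_0) in q0 q1.
(* The track of the base point is a loop in [Y]. A lift [c] of this loop to [X] yields the path
   along which [v] has to be transported. *)
have sw : is_sph (w (u 0)) (fun t : 'rV[R]_1 => q (clamp (t ord0 ord0))).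
  split=> [|t ot].
    by apply: (cts_comp _ cq); apply: cts_clamp; apply: cts_coord; exact: cts_id.
  have [t0|t0] := leP (t ord0 ord0) 0; first by rewrite clamp_le0.
  have [t1|t1] := leP 1 (t ord0 ord0); first by rewrite clamp_ge1.
  by case: ot => i; rewrite (ord1 i) t0 t1.
have [c [sc hc]] := weak_equiv_surj ww sw.
pose cst1 (r : R) : 'rV[R]_1 := const_mx r.
have ccst : continuous cst1.
  by apply: continuous_row => i; rewrite (_ : (fun t => cst1 t ord0 i) = id); [exact: cts_id|apply: funext => r; rewrite mxE].
pose pc (r : R) := c (cst1 (clamp r)).
have cpc : continuous pc.
  by apply: (cts_comp _ sc.1); apply: (cts_comp _ ccst); apply: cts_clamp; exact: cts_id.
have oc r : r = 0 \/ r = 1 -> ~ ocube 1 (cst1 r).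
  by move=> e /(_ ord0); rewrite mxE; case: e => ->; rewrite ltxx ?andbF.
have pc0 : pc 0 = u 0 by rewrite /pc clamp0 sc.2//; apply: oc; left.
have pc1 : pc 1 = u 0 by rewrite /pc clamp1 sc.2//; apply: oc; right.
apply: (@freq_trans _ _ (transport pc v)); last by apply: transport_freq => //; rewrite pc1.
apply: (@htp_freq _ (u 0)); apply: (weak_equiv_inj (n := 0) ww) => //.
  by have := @transport_sph R 1 X pc v cpc; rewrite pc0 pc1; apply.
have h1 : htp (w (u 0)) (w \o u) (transport q (w \o v)) by rewrite -q0; exact: fhtp_uniq.
apply: (htp_trans h1).
have [H [cH H0 H1 Hb]] := htp_sym hc.
pose P (z : R * R) := H (z.1, cst1 (clamp z.2)).
have cP : continuous P.
  apply: (cts_comp _ cH); apply: cts_pair; first exact: cts_fst.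
  by apply: (cts_comp _ ccst); apply: cts_clamp; exact: cts_snd.
have P0 s : P (s, 0) = w (u 0) by rewrite /P /= clamp0 Hb//; apply: oc; left.
have P1 s : P (s, 1) = w (u 0) by rewrite /P /= clamp1 Hb//; apply: oc; right.
have := @transport_path_htp R 1 Y P (w \o v) cP; rewrite P0 P1 => /(_ _ _ (sph_comp cw sv)).
rewrite comp_transport.
have e0 : transport (fun r => P (0, r)) (w \o v) = transport q (w \o v).
  apply: funext => t; rewrite /transport /shell /=; case: ifP => // _.
  by rewrite /P /= H0 mxE !clamp_idem.
have e1 : transport (fun r => P (1, r)) (w \o v) = transport (w \o pc) (w \o v).
  apply: funext => t; rewrite /transport /shell /=; case: ifP => // _.
  by rewrite /P /= H1 /=.
by rewrite e0 e1; apply=> s; rewrite ?P0 ?P1.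
Qed.

(** A relation and not a function, as a formal inverse has no underlying map. For such a letter,
    existence and uniqueness up to free homotopy are surjectivity and injectivity of the weak
    equivalence on free loops. *)
Fixpoint word_rel X Y (a : hot_word R X Y) : ('rV[R]_1 -> X) -> ('rV[R]_1 -> Y) -> Prop :=
  match a with
  | hot_loc X Y f => fun u v => freq (f \o u) v
  | hot_inv X Y w _ => fun u v => freq (w \o v) u
  | hot_comp X Y Z b a => fun u v => exists m, [/\ floop m, word_rel a u m & word_rel b m v]
  end.

Lemma word_rel_freq X Y (a : hot_word R X Y) u u' v v' : floop u -> floop u' -> floop v -> floop v' ->
  freq u u' -> freq v v' -> word_rel a u v -> word_rel a u' v'.
Proof.
elim: a u u' v v' => {X Y} [X Y f|X Y w we|X Y Z b IHb a IHa] u u' v v' su su' sv sv' uu vv /=.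
- move=> h; have cf : continuous f by move=> t; exact: cts_fun.
  by apply: freq_trans vv; apply: freq_trans h; apply: freq_sym; exact: freq_comp.
- move=> h; have cf : continuous w by move=> t; exact: cts_fun.
  by apply: freq_trans uu; apply: freq_trans h; apply: freq_sym; exact: freq_comp.
- move=> [m [sm am bm]]; exists m; split=> //.
    exact: (IHa u u' m m su su' sm sm uu (freq_refl sm) am).
  exact: (IHb m m v v' sm sm sv sv' (freq_refl sm) vv bm).
Qed.

Lemma word_rel_fun X Y (a : hot_word R X Y) u v v' : floop u -> floop v -> floop v' ->
  word_rel a u v -> word_rel a u v' -> freq v v'.
Proof.
elim: a u v v' => {X Y} [X Y f|X Y w we|X Y Z b IHb a IHa] u v v' su sv sv' /=.
- by move=> h h'; apply: freq_trans h'; exact: freq_sym.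
- move=> h h'; apply: (weak_equiv_free_inj we) => //; apply: (freq_trans h); exact: freq_sym.
- move=> [m [sm am bm]] [m' [sm' am' bm']]; apply: (IHb m) => //.
  apply: (word_rel_freq _ _ _ _ _ (freq_refl sv') bm') => //.
  exact: (IHa u).
Qed.

Lemma hot_eq_rel X Y (a b : hot_word R X Y) : hot_eq a b ->
  forall u v, floop u -> floop v -> (word_rel a u v <-> word_rel b u v).
Proof.
elim=> {X Y a b} /=.
- by [].
- by move=> X Y a b _ IH u v su sv; split=> /IH; apply.
- move=> X Y a b c _ IH1 _ IH2 u v su sv.
  by rewrite (IH1 u v su sv) (IH2 u v su sv).
- move=> X Y Z b b' a a' _ IHb _ IHa u v su sv; split=> -[m [sm am bm]]; exists m; split=> //.
  + exact/IHa.
  + exact/IHb.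
  + exact/IHa.
  + exact/IHb.
- move=> X Y Z W c b a u v su sv; split=> [[m [sm [m' [sm' h1 h2]] h3]]|[m [sm h1 [m' [sm' h2 h3]]]]].
    by exists m'; split=> //; exists m.
  by exists m'; split=> //; exists m.
- move=> X Y a u v su sv; split=> [[m [sm h1 h2]]|h].
    by apply: (word_rel_freq sm su sv sv _ (freq_refl sv) h2); exact: freq_sym.
  by exists u; split=> //; exact: freq_refl.
- move=> X Y a u v su sv; split=> [[m [sm h1 h2]]|h].
    by apply: (word_rel_freq su su sm sv (freq_refl su) _ h1).
  by exists v; split=> //; exact: freq_refl.
- move=> X Y Z g f u v su sv.
  have cf : continuous f by move=> t; exact: cts_fun.
  have cg : continuous g by move=> t; exact: cts_fun.
  split=> [h|[m [sm h1 h2]]].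
    exists (f \o u); split=> //; first exact: floop_comp.
    by apply: freq_refl; exact: floop_comp.
  by apply: freq_trans h2; exact: (freq_comp cg h1).
- move=> X Y w we u v su sv; have cw : continuous w by move=> t; exact: cts_fun.
  split=> [[m [sm h1 h2]]|h].
    by apply: (weak_equiv_free_inj we) => //; apply: (freq_trans h1); exact: freq_sym.
  exists (w \o u); split; [exact: floop_comp|by apply: freq_refl; exact: floop_comp|].
  by apply: freq_comp => //; exact: freq_sym.
- move=> X Y w we u v su sv; have cw : continuous w by move=> t; exact: cts_fun.
  split=> [[m [sm h1 h2]]|h].
    by apply: freq_trans h2; exact: freq_sym.
  have [m [sm hm]] := weak_equiv_free_surj we su.
  by exists m; split=> //; exact: freq_trans hm h.
Qed.

Lemma transport_cst n X (p : R -> X) : continuous p ->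
  htp (p 0) (transport (n := n) p (fun=> p 1)) (fun=> p 0).
Proof.
move=> cp.
exists (shell (fun z => p (1 - clamp z.1)) (fun z => p ((1 - clamp z.1) * z.2))); split.
- apply: cts_shell => /=.
  + apply: (cts_comp _ cp); apply: cts_sub; first exact: cts_cst.
    by apply: cts_clamp; exact: cts_fst.
  + apply: (cts_comp _ cp); apply: cts_mul; last exact: cts_snd.
    by apply: cts_sub; [exact: cts_cst|apply: cts_clamp; exact: cts_fst].
  + by move=> s t _; rewrite mulr1.
- by move=> t; apply: shell_ext => [u|r _] /=; rewrite clamp0 subr0 ?mul1r.
- by move=> t; rewrite /shell /= clamp1 subrr mul0r; case: ifP.
- by move=> s t ot; rewrite shell_bd// mulr0.
Qed.

(** A form of simple connectivity without base points, which relations between free loops can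
    transfer. *)
Lemma simply_connectedP X : simply_connected R X <->
  (exists x : X, True) /\ forall u v : 'rV[R]_1 -> X, floop u -> floop v -> freq u v.
Proof.
split=> [[[hx jX] h1]|[hx h]].
  have null (u : 'rV[R]_1 -> X) : floop u -> freq u (fun=> u 0).
    by move=> su; apply: (@htp_freq _ (u 0)); apply/(cls_eq1 (n := 0) su); exact: h1.
  split=> // u v su sv; apply: (freq_trans (null u su)); apply: freq_trans (freq_sym (null v sv)).
  have [p [cp p0 p1]] := joined_path (jX (u 0) (v 0)); rewrite -p0 -p1.
  by exists (fun z => p z.1); split=> //; exact: (cts_comp (@cts_fst _ _) cp).
split; first split=> //.
  move=> x y; have [p [cp p0 p1 _]] := freq_fhtp (h _ _ (cst_floop x) (cst_floop y)).
  by rewrite -p0 -p1; exact: path_joined.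
move=> x u; have [f [sf <-]] := cls_surj u; apply/cls_eq1 => //.
have [p [cp p0 p1 hp]] := freq_fhtp (h _ _ (sph_floop sf) (cst_floop x)).
have p0x : p 0 = x by rewrite p0 (sf.2 _ ocube_0).
have := fhtp_uniq cp hp; rewrite p0x => h1; apply: (htp_trans h1).
by have := @transport_cst 1 X p cp; rewrite p0x p1.
Qed.

Lemma simply_connected_hot_iso X Y : hot_iso R X Y -> simply_connected R X -> simply_connected R Y.
Proof.
move=> [a [b [ba ab]]] /simply_connectedP[[x _] hX]; apply/simply_connectedP; split.
  have [_ /(_ (freq_refl (cst_floop x)))[m _]] := hot_eq_rel ba (cst_floop x) (cst_floop x).
  by exists (m 0).
move=> u v su sv.
have [_ /(_ (freq_refl su))[m [sm _ mu]]] := hot_eq_rel ab su su.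
have [_ /(_ (freq_refl sv))[m' [sm' _ mv]]] := hot_eq_rel ab sv sv.
apply: (word_rel_fun sm su sv mu).
exact: (word_rel_freq sm' sm sv sv (hX _ _ sm' sm) (freq_refl sv) mv).
Qed.

End FreeLoops.

(** * Strict oo-groupoids of abelian groups *)

(** The statement may depend on the proof of the inequality, which lets the iterated maps [src_to],
    [tgt_to] and [unt_to] be handled without casts. *)
Lemma leq_induction j (P : forall i, (j <= i)%N -> Prop) : (forall h, P j h) ->
  (forall i (h : (j <= i)%N) (h' : (j <= i.+1)%N), P i h -> P i.+1 h') -> forall i h, P i h.
Proof.
move=> Pj PS; elim=> [|i IHi] h.
  by case: j h P Pj PS => // h P Pj _; exact: Pj.
have [ji|ij] := leqP j i; first exact: (PS i ji).
have e : j = i.+1 by apply/eqP; rewrite eqn_leq h ij.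
by subst j; exact: Pj.
Qed.

(** The identities without compositions, shared by strict categories and by the groups below, for
    which compositions are yet to be defined. *)
Record globular (X : infGraph) : Prop := Globular {
  gl_src_src : forall i (u : arr X i.+2), src (src u) = src (tgt u);
  gl_tgt_src : forall i (u : arr X i.+2), tgt (src u) = tgt (tgt u);
  gl_src_unt : forall i (u : arr X i), src (unt u) = u;
  gl_tgt_unt : forall i (u : arr X i), tgt (unt u) = u
}.

Lemma infCat_globular (X : infCat) : globular X.
Proof. by split; [exact: src_src|exact: tgt_src|exact: src_unt|exact: tgt_unt]. Qed.

Section GlobularTheory.
Context (X : infGraph) (gX : globular X).

Lemma src_to_trans i j k (h1 : (k <= j)%N) (h2 : (j <= i)%N) (h3 : (k <= i)%N) (u : arr X i) :
  src_to h1 (src_to h2 u) = src_to h3 u.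
Proof.
move: i h2 h3 u; apply: leq_induction => [h2 h3 u|i h2 h2' IH h3 u].
  by rewrite src_to_id (bool_irrelevance h1 h3).
rewrite (src_toS h2) (src_toS (leq_trans h1 h2)); exact: IH.
Qed.

Lemma tgt_to_trans i j k (h1 : (k <= j)%N) (h2 : (j <= i)%N) (h3 : (k <= i)%N) (u : arr X i) :
  tgt_to h1 (tgt_to h2 u) = tgt_to h3 u.
Proof.
move: i h2 h3 u; apply: leq_induction => [h2 h3 u|i h2 h2' IH h3 u].
  by rewrite tgt_to_id (bool_irrelevance h1 h3).
rewrite (tgt_toS h2) (tgt_toS (leq_trans h1 h2)); exact: IH.
Qed.

Lemma unt_to_trans i j k (h1 : (k <= j)%N) (h2 : (j <= i)%N) (h3 : (k <= i)%N) (u : arr X k) :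
  unt_to h2 (unt_to h1 u) = unt_to h3 u.
Proof.
move: i h2 h3; apply: leq_induction => [h2 h3|i h2 h2' IH h3].
  by rewrite unt_to_id (bool_irrelevance h1 h3).
by rewrite (unt_toS h2) (unt_toS (leq_trans h1 h2)) (IH (leq_trans h1 h2)).
Qed.

Lemma src_to_unt i j (h : (j <= i)%N) (u : arr X j) : src_to h (unt_to h u) = u.
Proof.
move: i h; apply: leq_induction => [h|i h h' IH]; first by rewrite src_to_id unt_to_id.
by rewrite (src_toS h) (unt_toS h) gl_src_unt.
Qed.

Lemma tgt_to_unt i j (h : (j <= i)%N) (u : arr X j) : tgt_to h (unt_to h u) = u.
Proof.
move: i h; apply: leq_induction => [h|i h h' IH]; first by rewrite tgt_to_id unt_to_id.
by rewrite (tgt_toS h) (unt_toS h) gl_tgt_unt.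
Qed.

Lemma src_to_unt_to i j k (h1 : (k <= j)%N) (h2 : (j <= i)%N) (h3 : (k <= i)%N) (u : arr X k) :
  src_to h2 (unt_to h3 u) = unt_to h1 u.
Proof. by rewrite -(unt_to_trans h1 h2 h3) src_to_unt. Qed.

Lemma tgt_to_unt_to i j k (h1 : (k <= j)%N) (h2 : (j <= i)%N) (h3 : (k <= i)%N) (u : arr X k) :
  tgt_to h2 (unt_to h3 u) = unt_to h1 u.
Proof. by rewrite -(unt_to_trans h1 h2 h3) tgt_to_unt. Qed.

Lemma src_to_tgt i j (h : (j <= i)%N) (h' : (j <= i.+1)%N) (u : arr X i.+2) :
  src_to h' (tgt u) = src_to h' (src u).
Proof. by rewrite !(src_toS h) gl_src_src. Qed.

Lemma tgt_to_src i j (h : (j <= i)%N) (h' : (j <= i.+1)%N) (u : arr X i.+2) :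
  tgt_to h' (src u) = tgt_to h' (tgt u).
Proof. by rewrite !(tgt_toS h) gl_tgt_src. Qed.

Lemma src_to_tgt_to i j k (h1 : (k < j)%N) (h2 : (j <= i)%N) (h3 : (k <= i)%N) (u : arr X i) :
  src_to (ltnW h1) (tgt_to h2 u) = src_to h3 u.
Proof.
case: j h1 h2 => // j h1 h2; move: i h2 h3 u; apply: leq_induction => [h2 h3 u|i h2 h2' IH h3 u].
  by rewrite tgt_to_id; congr src_to; exact: bool_irrelevance.
rewrite (tgt_toS h2) (src_toS (leq_trans (ltnW h1) h2)) (IH (leq_trans (ltnW h1) h2)).
case: i h2 {h2' IH h3} u => // i h2 u; exact: (@src_to_tgt i k (leq_trans h1 h2)).
Qed.

Lemma tgt_to_src_to i j k (h1 : (k < j)%N) (h2 : (j <= i)%N) (h3 : (k <= i)%N) (u : arr X i) :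
  tgt_to (ltnW h1) (src_to h2 u) = tgt_to h3 u.
Proof.
case: j h1 h2 => // j h1 h2; move: i h2 h3 u; apply: leq_induction => [h2 h3 u|i h2 h2' IH h3 u].
  by rewrite src_to_id; congr tgt_to; exact: bool_irrelevance.
rewrite (src_toS h2) (tgt_toS (leq_trans (ltnW h1) h2)) (IH (leq_trans (ltnW h1) h2)).
case: i h2 {h2' IH h3} u => // i h2 u; exact: (@tgt_to_src i k (leq_trans h1 h2)).
Qed.

Lemma src_unt_to i j (h : (j <= i)%N) (h' : (j <= i.+1)%N) (u : arr X j) : src (unt_to h' u) = unt_to h u.
Proof. by rewrite (unt_toS h) gl_src_unt. Qed.

Lemma tgt_unt_to i j (h : (j <= i)%N) (h' : (j <= i.+1)%N) (u : arr X j) : tgt (unt_to h' u) = unt_to h u.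
Proof. by rewrite (unt_toS h) gl_tgt_unt. Qed.

End GlobularTheory.

(** A globular abelian group with units is a chain complex in another form. No composition is
    recorded, since the additive one is forced. *)
Record gab := Gab {
  gab_arr : nat -> zmodType;
  gab_src : forall i, gab_arr i.+1 -> gab_arr i;
  gab_tgt : forall i, gab_arr i.+1 -> gab_arr i;
  gab_unt : forall i, gab_arr i -> gab_arr i.+1;
  gab_srcB : forall i, zmod_morphism (@gab_src i);
  gab_tgtB : forall i, zmod_morphism (@gab_tgt i);
  gab_untB : forall i, zmod_morphism (@gab_unt i);
  gab_globular : globular (@InfGraph gab_arr gab_src gab_tgt gab_unt)
}.

Section ZmodMorph.
Context (U V : zmodType) (f : U -> V) (fB : zmod_morphism f).

Lemma morphB0 : f 0 = 0. Proof. by rewrite -[X in f X](subrr 0) fB subrr. Qed.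
Lemma morphBN x : f (- x) = - f x. Proof. by rewrite -sub0r fB morphB0 sub0r. Qed.
Lemma morphBD x y : f (x + y) = f x + f y. Proof. by rewrite -{1}[y]opprK fB morphBN opprK. Qed.

End ZmodMorph.

Section GabGpd.
Context (W : gab).

Definition gab_graph : infGraph := InfGraph (@gab_src W) (@gab_tgt W) (@gab_unt W).
Notation X := gab_graph.
Let gX : globular X := gab_globular W.

Lemma gsB i (u v : gab_arr W i.+1) : src (u - v : arr X i.+1) = src (u : arr X i.+1) - src (v : arr X i.+1) :> gab_arr W i.
Proof. exact: gab_srcB. Qed.
Lemma gtB i (u v : gab_arr W i.+1) : tgt (u - v : arr X i.+1) = tgt (u : arr X i.+1) - tgt (v : arr X i.+1) :> gab_arr W i.
Proof. exact: gab_tgtB. Qed.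
Lemma gkB i (u v : gab_arr W i) : unt (u - v : arr X i) = unt (u : arr X i) - unt (v : arr X i) :> gab_arr W i.+1.
Proof. exact: gab_untB. Qed.

Lemma src_toB i j (h : (j <= i)%N) : zmod_morphism (@src_to X i j h : gab_arr W i -> gab_arr W j).
Proof.
move: i h; apply: leq_induction => [h u v|i h h' IH u v]; first by rewrite !src_to_id.
by rewrite !(src_toS h) gsB IH.
Qed.

Lemma tgt_toB i j (h : (j <= i)%N) : zmod_morphism (@tgt_to X i j h : gab_arr W i -> gab_arr W j).
Proof.
move: i h; apply: leq_induction => [h u v|i h h' IH u v]; first by rewrite !tgt_to_id.
by rewrite !(tgt_toS h) gtB IH.
Qed.

Lemma unt_toB i j (h : (j <= i)%N) : zmod_morphism (@unt_to X i j h : gab_arr W j -> gab_arr W i).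
Proof.
move: i h; apply: leq_induction => [h u v|i h h' IH u v]; first by rewrite !unt_to_id.
by rewrite !(unt_toS h) IH gkB.
Qed.

(** The only additive choice: the pair (v, u) is the sum of the pairs (v - k s v, 0) and (k s v, u),
    on which the unit laws prescribe the composite. *)
Definition gab_comp i j (h : (j < i)%N) (v u : arr X i) (_ : src_to (ltnW h) v = tgt_to (ltnW h) u) : arr X i :=
  (v : gab_arr W i) - unt_to (ltnW h) (src_to (ltnW h) v) + u.

Let sD i j (h : (j <= i)%N) := morphBD (@src_toB i j h).
Let tD i j (h : (j <= i)%N) := morphBD (@tgt_toB i j h).
Let kD i j (h : (j <= i)%N) := morphBD (@unt_toB i j h).
Let s1D i : forall u v : gab_arr W i.+1, src (u + v : arr X i.+1) = src (u : arr X i.+1) + src (v : arr X i.+1) :> gab_arr W i := morphBD (@gsB i).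
Let t1D i : forall u v : gab_arr W i.+1, tgt (u + v : arr X i.+1) = tgt (u : arr X i.+1) + tgt (v : arr X i.+1) :> gab_arr W i := morphBD (@gtB i).
Let k1D i : forall u v : gab_arr W i, unt (u + v : arr X i) = unt (u : arr X i) + unt (v : arr X i) :> gab_arr W i.+1 := morphBD (@gkB i).

Let s_ks i (h h' : (i <= i.+1)%N) (v : arr X i.+1) : src (unt_to h (src_to h' v)) = src v.
Proof. by rewrite unt_to1 src_to1 gl_src_unt. Qed.

Lemma gab_src_comp_top i (h : (i < i.+1)%N) v u (c : _ = _) : src (@gab_comp i.+1 i h v u c) = src u.
Proof. by rewrite /gab_comp s1D gsB s_ks subrr add0r. Qed.

Lemma gab_src_comp i j (h' : (j < i.+1)%N) (h : (j < i)%N) v u (c' c : _ = _) :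
  src (@gab_comp i.+1 j h' v u c') = @gab_comp i j h (src v) (src u) c.
Proof.
by rewrite /gab_comp s1D gsB (src_unt_to gX (ltnW h)) (src_toS (ltnW h)).
Qed.

Lemma gab_tgt_comp_top i (h : (i < i.+1)%N) v u (c : _ = _) : tgt (@gab_comp i.+1 i h v u c) = tgt v.
Proof.
by rewrite /gab_comp t1D gtB c unt_to1 gl_tgt_unt// tgt_to1 subrK.
Qed.

Lemma gab_tgt_comp i j (h' : (j < i.+1)%N) (h : (j < i)%N) v u (c' c : _ = _) :
  tgt (@gab_comp i.+1 j h' v u c') = @gab_comp i j h (tgt v) (tgt u) c.
Proof.
rewrite /gab_comp t1D gtB (tgt_unt_to gX (ltnW h)).
case: i h' h v u c c' => // i h' h v u c c'.
by rewrite (@src_to_tgt _ gX i j h) (src_toS (ltnW h)).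
Qed.

Lemma gab_src_comp_to i j (h : (j < i)%N) v u c : src_to (ltnW h) (@gab_comp i j h v u c) = src_to (ltnW h) u.
Proof. by rewrite /gab_comp sD src_toB src_to_unt// subrr add0r. Qed.

Lemma gab_compA i j (h : (j < i)%N) w v u (c1 c2 c3 c4 : _ = _) :
  @gab_comp i j h (@gab_comp i j h w v c1) u c2 = @gab_comp i j h w (@gab_comp i j h v u c3) c4.
Proof. by rewrite {1}/gab_comp gab_src_comp_to /gab_comp !addrA. Qed.

Let exchange_rearrange (V : zmodType) (d c b a jd kd jb kc : V) :
  d - jd + c - kc + (b - jb + a) = d - kd + b - (jd - kd + jb) + (c - kc + a).
Proof.
rewrite opprD opprB !addrA; congr (_ + a).
rewrite [d - kd + b + kd]addrAC subrK.
by rewrite [LHS](ACl (1*5*2*6*3*4)).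
Qed.

Lemma gab_src_comp_low i j k (hij : (j < i)%N) (hjk : (k < j)%N) (hik : (k < i)%N) v u c :
  src_to (ltnW hik) (@gab_comp i j hij v u c) = src_to (ltnW hik) u.
Proof.
rewrite /gab_comp sD src_toB -(src_to_trans (ltnW hjk) (ltnW hij) (ltnW hik) (unt_to _ _)).
by rewrite src_to_unt// (src_to_trans _ _ (ltnW hik)) subrr add0r.
Qed.

Lemma gab_exchange i j k (hij : (j < i)%N) (hjk : (k < j)%N) (hik : (k < i)%N) (d c b a : arr X i)
    c1 c2 c3 c4 c5 c6 :
  @gab_comp i k hik (@gab_comp i j hij d c c1) (@gab_comp i j hij b a c2) c3 =
  @gab_comp i j hij (@gab_comp i k hik d b c4) (@gab_comp i k hik c a c5) c6.
Proof.
rewrite [LHS]/gab_comp (@gab_src_comp_low i j k hij hjk hik) [RHS]/gab_comp.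
rewrite /gab_comp sD src_toB (src_to_unt_to gX (ltnW hjk)) kD unt_toB.
by rewrite (unt_to_trans _ _ (ltnW hik)); exact: exchange_rearrange.
Qed.

Lemma gab_comp_unt_r i j (h : (j < i)%N) u c : @gab_comp i j h u (unt_to (ltnW h) (src_to (ltnW h) u)) c = u.
Proof. by rewrite /gab_comp subrK. Qed.

Lemma gab_comp_unt_l i j (h : (j < i)%N) u c : @gab_comp i j h (unt_to (ltnW h) (tgt_to (ltnW h) u)) u c = u.
Proof. by rewrite /gab_comp src_to_unt// subrr add0r. Qed.

Lemma gab_unt_comp i j (h : (j < i)%N) (h' : (j < i.+1)%N) v u c c' :
  unt (@gab_comp i j h v u c) = @gab_comp i.+1 j h' (unt v) (unt u) c'.
Proof.
by rewrite /gab_comp k1D gkB (src_toS (ltnW h)) gl_src_unt// (unt_toS (ltnW h)).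
Qed.

Definition gab_cat : infCat := @InfCat X gab_comp (gl_src_src gX) (gl_tgt_src gX)
  gab_src_comp_top gab_src_comp gab_tgt_comp_top gab_tgt_comp (gl_src_unt gX) (gl_tgt_unt gX)
  gab_compA (fun i j k hij hjk hik d c b a _ _ _ => @gab_exchange i j k hij hjk hik d c b a)
  gab_comp_unt_r gab_comp_unt_l gab_unt_comp.

Lemma gab_inv i j (h : (j < i)%N) (u : arr gab_cat i) : exists v, inverses h u v.
Proof.
pose s := unt_to (ltnW h) (src_to (ltnW h) u : arr X j) : gab_arr W i.
pose t := unt_to (ltnW h) (tgt_to (ltnW h) u : arr X j) : gab_arr W i.
pose v : arr gab_cat i := (s - (u : gab_arr W i) + t : gab_arr W i).
have e1 : src_to (ltnW h) v = tgt_to (ltnW h) u.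
  by rewrite /v (sD _ (s - u)) src_toB !src_to_unt// subrr add0r.
have e2 : src_to (ltnW h) u = tgt_to (ltnW h) v.
  by rewrite /v (tD _ (s - u)) tgt_toB !tgt_to_unt// subrK.
exists v, e2, e1; split; rewrite /= /gab_comp.
  by rewrite -/s -/t /v addrA addrA subrK subrr add0r.
by rewrite e1 -/s -/t /v addrK subrK.
Qed.

Definition gab_gpd : infGpd := InfGpd gab_inv.

End GabGpd.

Record gab_hom (W W' : gab) := GabHom {
  gab_map :> forall i, gab_arr W i -> gab_arr W' i;
  gab_mapB : forall i, zmod_morphism (@gab_map i);
  gab_map_src : forall i u, gab_map (gab_src u : gab_arr W i) = gab_src (gab_map u);
  gab_map_tgt : forall i u, gab_map (gab_tgt u : gab_arr W i) = gab_tgt (gab_map u);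
  gab_map_unt : forall i (u : gab_arr W i), gab_map (gab_unt u) = gab_unt (gab_map u)
}.

Section GraphMap.
Context (X Y : infGraph) (f : forall i, arr X i -> arr Y i).
Hypotheses (fs : forall i (u : arr X i.+1), f (src u) = src (f u))
  (ft : forall i (u : arr X i.+1), f (tgt u) = tgt (f u))
  (fk : forall i (u : arr X i), f (unt u) = unt (f u)).

Lemma graph_map_src_to i j (h : (j <= i)%N) u : f (src_to h u) = src_to h (f u).
Proof.
move: i h u; apply: leq_induction => [h u|i h h' IH u]; first by rewrite !src_to_id.
by rewrite !(src_toS h) IH fs.
Qed.

Lemma graph_map_unt_to i j (h : (j <= i)%N) u : f (unt_to h u) = unt_to h (f u).
Proof.
move: i h; apply: leq_induction => [h|i h h' IH]; first by rewrite !unt_to_id.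
by rewrite !(unt_toS h) fk IH.
Qed.

End GraphMap.

Section GabFunctor.
Context (W W' : gab) (f : gab_hom W W').
Let fs i (u : arr (gab_graph W) i.+1) : f _ (src u) = src (f _ u : arr (gab_graph W') i.+1) := gab_map_src f u.
Let ft i (u : arr (gab_graph W) i.+1) : f _ (tgt u) = tgt (f _ u : arr (gab_graph W') i.+1) := gab_map_tgt f u.
Let fk i (u : arr (gab_graph W) i) : f _ (unt u) = unt (f _ u : arr (gab_graph W') i) := gab_map_unt f u.

Lemma gab_map_comp i j (h : (j < i)%N) v u c c' :
  f i (@gab_comp W i j h v u c) = @gab_comp W' i j h (f i v) (f i u) c'.
Proof.
rewrite /gab_comp (morphBD (@gab_mapB _ _ f i)) gab_mapB.
rewrite (@graph_map_unt_to (gab_graph W) (gab_graph W') f fk).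
by rewrite (@graph_map_src_to (gab_graph W) (gab_graph W') f fs).
Qed.

Definition gab_functor : infFunctor (gab_gpd W) (gab_gpd W') :=
  @InfFunctor (gab_gpd W) (gab_gpd W') f fs ft fk gab_map_comp.

End GabFunctor.

Record zsub (V : zmodType) := ZSub {
  zmem :> V -> Prop;
  zmem0 : zmem 0;
  zmemB : forall u v, zmem u -> zmem v -> zmem (u - v)
}.

Record subz (V : zmodType) (P : zsub V) := Subz { subz_val : V; subz_mem : P subz_val }.

HB.instance Definition _ V P := gen_eqMixin (@subz V P).
HB.instance Definition _ V P := gen_choiceMixin (@subz V P).

Section SubZ.
Context (V : zmodType) (P : zsub V).
Implicit Types u v w : subz P.

Lemma subz_inj : injective (@subz_val V P).
Proof. by move=> [u hu] [v hv] /= e; subst v; congr Subz; exact: Prop_irrelevance. Qed.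

Lemma zmemN (u : V) : P u -> P (- u).
Proof. by move=> hu; rewrite -sub0r; apply: zmemB => //; exact: zmem0. Qed.

Lemma zmemD (u v : V) : P u -> P v -> P (u + v).
Proof. by move=> hu hv; rewrite -[v]opprK; apply: zmemB => //; exact: zmemN. Qed.

Definition subz_add u v : subz P := Subz (zmemD (subz_mem u) (subz_mem v)).
Definition subz_opp u : subz P := Subz (zmemN (subz_mem u)).
Definition subz_zero : subz P := Subz (zmem0 P).

Lemma subz_addA : associative subz_add. Proof. by move=> u v w; apply: subz_inj; exact: addrA. Qed.
Lemma subz_addC : commutative subz_add. Proof. by move=> u v; apply: subz_inj; exact: addrC. Qed.
Lemma subz_add0 : left_id subz_zero subz_add. Proof. by move=> u; apply: subz_inj; exact: add0r. Qed.
Lemma subz_addN : left_inverse subz_zero subz_opp subz_add.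
Proof. by move=> u; apply: subz_inj; exact: addNr. Qed.

HB.instance Definition _ := GRing.isZmodule.Build (subz P) subz_addA subz_addC subz_add0 subz_addN.

End SubZ.

Definition dprod (I : Type) (V : I -> zmodType) := forall i, V i.

HB.instance Definition _ I (V : I -> zmodType) := gen_eqMixin (dprod V).
HB.instance Definition _ I (V : I -> zmodType) := gen_choiceMixin (dprod V).

Section DProd.
Context (I : Type) (V : I -> zmodType).
Implicit Types u v w : dprod V.

Lemma dprodP u v : (forall i, u i = v i) -> u = v.
Proof. exact: functional_extensionality_dep. Qed.

Let add u v : dprod V := fun i => u i + v i.
Let opp u : dprod V := fun i => - u i.
Let zero : dprod V := fun i => 0.

Let addA : associative add. Proof. by move=> u v w; apply: dprodP => i; exact: addrA. Qed.
Let addC : commutative add. Proof. by move=> u v; apply: dprodP => i; exact: addrC. Qed.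
Let add0 : left_id zero add. Proof. by move=> u; apply: dprodP => i; exact: add0r. Qed.
Let addN : left_inverse zero opp add. Proof. by move=> u; apply: dprodP => i; exact: addNr. Qed.

HB.instance Definition _ := GRing.isZmodule.Build (dprod V) addA addC add0 addN.

End DProd.

(** A copy of the group whose type records commutativity, so that an additive structure can be
    declared on it. *)
Definition abz (A : groupType) (_ : forall a b : A, (a * b)%g = (b * a)%g) : Type := A.

Section AbelianZmod.
Context (A : groupType) (AC : forall a b : A, (a * b)%g = (b * a)%g).
Notation abz := (abz AC).

HB.instance Definition _ := gen_eqMixin abz.
HB.instance Definition _ := gen_choiceMixin abz.

Let addA : associative (fun a b : abz => (a * b)%g : abz). Proof. exact: mulgA. Qed.
Let addC : commutative (fun a b : abz => (a * b)%g : abz). Proof. exact: AC. Qed.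
Let add0 : left_id (1%g : abz) (fun a b : abz => (a * b)%g : abz). Proof. exact: mul1g. Qed.
Let addN : left_inverse (1%g : abz) (fun a : abz => a^-1%g) (fun a b : abz => (a * b)%g : abz).
Proof. exact: mulVg. Qed.

HB.instance Definition _ := GRing.isZmodule.Build abz addA addC add0 addN.

End AbelianZmod.

Section GabProd.
Context (I : Type) (W : I -> gab).

Definition gab_prod : gab.
Proof.
refine (@Gab (fun n => dprod (fun i => gab_arr (W i) n))
  (fun n u => fun i => gab_src (u i)) (fun n u => fun i => gab_tgt (u i))
  (fun n u => fun i => gab_unt (u i)) _ _ _ _).
- by move=> n u v; apply: dprodP => i; exact: gab_srcB.
- by move=> n u v; apply: dprodP => i; exact: gab_tgtB.
- by move=> n u v; apply: dprodP => i; exact: gab_untB.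
- split=> n u /=; apply: dprodP => i.
  + exact: (gl_src_src (gab_globular (W i))).
  + exact: (gl_tgt_src (gab_globular (W i))).
  + exact: (gl_src_unt (gab_globular (W i))).
  + exact: (gl_tgt_unt (gab_globular (W i))).
Defined.

Definition gab_proj i : gab_hom gab_prod (W i).
Proof. by refine (@GabHom gab_prod (W i) (fun n u => u i) _ _ _ _). Defined.

End GabProd.

(* The chain complex q : D -> E, with E in degree n and D in degree n + 1. *)
Section TwoTerm.
Context (E D : zmodType) (q : D -> E) (qB : zmod_morphism q) (n : nat).
Notation V := (E * D)%type.

(** Arrows of all dimensions are kept in the one group E * D. Those of dimension m are the fixed
    points of [tsrc m]: 0 below n, the summand E at n, and everything above. *)
Definition tsrc (m : nat) (v : V) : V := if (n < m)%N then v else if m == n then (v.1, 0) else 0.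
Definition ttgt (m : nat) (v : V) : V := if (n < m)%N then v else if m == n then (v.1 + q v.2, 0) else 0.

Lemma tsrcB m : zmod_morphism (tsrc m).
Proof.
move=> u v; rewrite /tsrc; case: ifP => // _; case: ifP => // _; last by rewrite subrr.
by apply/eqP; rewrite xpair_eqE /= subrr !eqxx.
Qed.

Lemma ttgtB m : zmod_morphism (ttgt m).
Proof.
move=> u v; rewrite /ttgt; case: ifP => // _; case: ifP => // _; last by rewrite subrr.
apply/eqP; rewrite xpair_eqE /= subrr eqxx andbT (qB u.2 v.2) opprD !addrA.
by rewrite [u.1 - v.1 + _]addrAC eqxx.
Qed.

Lemma tsrc0 m : tsrc m 0 = 0. Proof. exact: morphB0 (@tsrcB m). Qed.
Lemma ttgt0 m : ttgt m 0 = 0. Proof. exact: morphB0 (@ttgtB m). Qed.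
Let q0 : q 0 = 0 := morphB0 qB.

Lemma tsrcK m v : tsrc m (tsrc m v) = tsrc m v.
Proof. by rewrite /tsrc; case: (n < m)%N => //=; case: (m == n). Qed.
Lemma tsrc_tgt m v : tsrc m (ttgt m v) = ttgt m v.
Proof. by rewrite /tsrc /ttgt; case: (n < m)%N => //=; case: (m == n). Qed.
Lemma ttgt_fixed m v : tsrc m v = v -> ttgt m v = v.
Proof. by rewrite /tsrc /ttgt; case: (n < m)%N => //=; case: (m == n) => //= <- /=; rewrite q0 addr0. Qed.
Lemma tsrc_high m v : (n < m)%N -> tsrc m v = v. Proof. by rewrite /tsrc => ->. Qed.
Lemma ttgt_high m v : (n < m)%N -> ttgt m v = v. Proof. by rewrite /ttgt => ->. Qed.
Lemma tsrc_low m v : (m < n)%N -> tsrc m v = 0.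
Proof. by move=> mn; rewrite /tsrc ltnNge (ltnW mn) (ltn_eqF mn). Qed.
Lemma ttgt_low m v : (m < n)%N -> ttgt m v = 0.
Proof. by move=> mn; rewrite /ttgt ltnNge (ltnW mn) (ltn_eqF mn). Qed.

Lemma tsrcS m v : tsrc m v = v -> tsrc m.+1 v = v.
Proof.
have [nm|mn] := leqP n m; first by rewrite (@tsrc_high m.+1).
by rewrite tsrc_low// => <-; exact: tsrc0.
Qed.
Lemma tsrc_srcS m v : tsrc m (tsrc m.+1 v) = tsrc m v.
Proof. by have [nm|mn] := leqP n m; [rewrite (@tsrc_high m.+1)|rewrite !(@tsrc_low m)]. Qed.
Lemma tsrc_tgtS m v : tsrc m (ttgt m.+1 v) = tsrc m v.
Proof. by have [nm|mn] := leqP n m; [rewrite (@ttgt_high m.+1)|rewrite !(@tsrc_low m)]. Qed.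
Lemma ttgt_srcS m v : ttgt m (tsrc m.+1 v) = ttgt m v.
Proof. by have [nm|mn] := leqP n m; [rewrite (@tsrc_high m.+1)|rewrite !(@ttgt_low m)]. Qed.
Lemma ttgt_tgtS m v : ttgt m (ttgt m.+1 v) = ttgt m v.
Proof. by have [nm|mn] := leqP n m; [rewrite (@ttgt_high m.+1)|rewrite !(@ttgt_low m)]. Qed.

Definition tsub (m : nat) : zsub V.
Proof.
refine (@ZSub V (fun v => tsrc m v = v) (tsrc0 m) _).
by move=> u v hu hv; rewrite tsrcB hu hv.
Defined.

Definition two_term : gab.
Proof.
refine (@Gab (fun m => subz (tsub m)) (fun m u => @Subz _ (tsub m) (tsrc m (subz_val u)) (tsrcK _ _))
  (fun m u => @Subz _ (tsub m) (ttgt m (subz_val u)) (tsrc_tgt _ _))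
  (fun m u => @Subz _ (tsub m.+1) (subz_val u) (tsrcS (subz_mem u))) _ _ _ _).
- by move=> m u v; apply: subz_inj; exact: tsrcB.
- by move=> m u v; apply: subz_inj; exact: ttgtB.
- by move=> m u v; exact: subz_inj.
- split=> m u; apply: subz_inj => /=.
  + by rewrite tsrc_srcS tsrc_tgtS.
  + by rewrite ttgt_srcS ttgt_tgtS.
  + exact: (subz_mem u).
  + exact: (ttgt_fixed (subz_mem u)).
Defined.

Notation G := (gab_gpd two_term).

Lemma two_term_htpy m (u v : arr G m) : arr_htpy u v <->
  exists a : V, [/\ tsrc m.+1 a = a, tsrc m a = subz_val (u : gab_arr two_term m) & ttgt m a = subz_val (v : gab_arr two_term m)].
Proof.
split=> [[a [<- <-]]|[a [ha hu hv]]]; first by exists (subz_val (a : subz (tsub m.+1))); split=> //; exact: (subz_mem (a : subz (tsub m.+1))).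
by exists (@Subz _ (tsub m.+1) a ha); split; apply: subz_inj.
Qed.

Definition two_pt : arr G 0 := (0 : gab_arr two_term 0).

Lemma two_pt_unt m : unt_to (leq0n m) two_pt = (0 : gab_arr two_term m).
Proof. exact: (morphB0 (@unt_toB two_term m 0 (leq0n m))). Qed.

Lemma tsrcn v : tsrc n v = (v.1, 0). Proof. by rewrite /tsrc ltnn eqxx. Qed.
Lemma ttgtn v : ttgt n v = (v.1 + q v.2, 0). Proof. by rewrite /ttgt ltnn eqxx. Qed.

Lemma two_term_low (q_surj : forall e, exists d, q d = e) m (u : arr G m) : (m <= n)%N ->
  arr_htpy u (0 : gab_arr two_term m).
Proof.
case: u => /= u hu; rewrite leq_eqVlt => /orP[/eqP mn|mn]; apply/two_term_htpy => /=; last first.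
  have u0 : u = 0 by rewrite -hu tsrc_low.
  by exists 0; rewrite u0; split; [exact: tsrc0|exact: tsrc0|exact: ttgt0].
(* Surjectivity of q provides an arrow from u to 0 in dimension n. *)
subst m; have [d qd] := q_surj (- u.1); exists (u.1, d).
by rewrite tsrc_high// tsrcn ttgtn -hu /= tsrcn qd subrr.
Qed.

Lemma two_loopP m (u : gloop m two_pt) (v := subz_val (gloop_arr u : gab_arr two_term m.+1)) :
  [/\ tsrc m.+1 v = v, tsrc m v = 0 & ttgt m v = 0].
Proof.
split; first exact: (subz_mem (gloop_arr u : gab_arr two_term m.+1)).
  by have := gloop_src u; rewrite two_pt_unt => /(congr1 (@subz_val _ _)).
by have := gloop_tgt u; rewrite two_pt_unt => /(congr1 (@subz_val _ _)).
Qed.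

Lemma two_term_pi (q_surj : forall e, exists d, q d = e) m (a : gpd_pi m two_pt) : m <> n -> a = 1%g.
Proof.
move=> mn; elim/quotW: a => u; apply/gpd_piP.
have -> : gloop_arr (gloop_one m two_pt) = (0 : gab_arr two_term m.+1).
  by rewrite /= two_pt_unt; exact: (morphB0 (@gkB two_term m)).
have [|nm] := leqP m.+1 n; first exact: two_term_low.
have {}nm : (n < m)%N by rewrite ltn_neqAle -ltnS nm andbT; apply/eqP => e; case: mn.
suff -> : gloop_arr u = (0 : gab_arr two_term m.+1) by exact: arr_htpy_refl.
by apply: subz_inj; have [_ + _] := two_loopP u; rewrite tsrc_high.
Qed.

Lemma two_loop_subproof d : q d = 0 -> tsrc n.+1 (0, d) = (0, d). Proof. by rewrite tsrc_high. Qed.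

Definition two_loop d (qd : q d = 0) : gloop n two_pt.
Proof.
refine (@GLoop G n two_pt (@Subz _ (tsub n.+1) (0, d) (two_loop_subproof qd)) _ _).
  by rewrite two_pt_unt; apply: subz_inj; rewrite /= tsrcn.
by rewrite two_pt_unt; apply: subz_inj; rewrite /= ttgtn qd /= addr0.
Defined.

Lemma two_loop_inv (u : gloop n two_pt) : exists d (qd : q d = 0), u = two_loop qd.
Proof.
have [h1 h2 h3] := two_loopP u; move: h1 h2 h3; rewrite tsrcn ttgtn.
set v := subz_val _ => h1 [e2] [e3]; rewrite e2 add0r in e3.
exists v.2, e3; apply: gloop_eq; apply: subz_inj.
by rewrite /= -/v; case: (v) e2 => a b /= ->.
Qed.

Lemma two_loop_htpy d d' (qd : q d = 0) (qd' : q d' = 0) : arr_htpy (two_loop qd) (two_loop qd') -> d = d'.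
Proof. by move=> /two_term_htpy[a [_]]; rewrite tsrc_high// ttgt_high// => -> []. Qed.

Lemma two_loop_mul d d' (qd : q d = 0) (qd' : q d' = 0) (qdd : q (d + d') = 0) :
  gloop_mul (two_loop qd) (two_loop qd') = two_loop qdd.
Proof.
apply: gloop_eq; apply: subz_inj => /=; rewrite /gab_comp.
rewrite src_to1 (_ : src (gloop_arr (two_loop qd)) = 0 :> gab_arr two_term n); last first.
  by apply: subz_inj; rewrite /= tsrcn.
rewrite (morphB0 (@unt_toB two_term n.+1 n _)) subr0 /=.
by apply/eqP; rewrite xpair_eqE /= add0r !eqxx.
Qed.

End TwoTerm.

(** * Divisible groups *)

Lemma int_subgroup_principal (P : int -> Prop) : P 0 -> (forall a b, P a -> P b -> P (a - b)) ->
  exists k : nat, forall m, P m <-> exists m', m = m' * k%:Z.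
Proof.
move=> P0 PB.
have PN a : P a -> P (- a) by move=> pa; rewrite -sub0r; exact: PB.
have PD a b : P a -> P b -> P (a + b) by move=> pa pb; rewrite -[b]opprK; apply: PB => //; exact: PN.
have PMn a (c : nat) : P a -> P (a *+ c).
  by move=> pa; elim: c => [|c IH]; rewrite ?mulr0n// mulrS; exact: PD.
have PM a b : P a -> P (b * a).
  move=> pa; case: b => c; first by rewrite mulrC -mulrzz -pmulrn; exact: PMn.
  by rewrite NegzE mulNr; apply: PN; rewrite mulrC -mulrzz -pmulrn; exact: PMn.
have [[k [k0 Pk]]|none] := pselect (exists k : nat, (0 < k)%N /\ P k%:Z); last first.
  exists 0%N => m; split=> [Pm|[m' ->]]; last by rewrite mulr0.
  exists 0; rewrite mul0r; apply/eqP; rewrite -absz_eq0 -leqn0 leqNgt; apply/negP => m0.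
  apply: none; exists `|m|%N; split=> //.
  by rewrite abszE; case: (ger0P m) => // _; exact: PN.
have ex : exists k, (0 < k)%N && `[< P k%:Z >] by exists k; rewrite k0; exact/asboolP.
case: (ex_minnP ex) => {k0 Pk k}k /andP[k0 /asboolP Pk] kmin.
exists k => m; split=> [Pm|[m' ->]]; last exact: PM.
exists (m %/ k%:Z)%Z; have e := divz_eq m k%:Z.
have Pr : P (m %% k%:Z)%Z.
  have -> : (m %% k%:Z)%Z = m - (m %/ k%:Z)%Z * k%:Z by rewrite {2}e addrAC subrr add0r.
  by apply: PB => //; exact: PM.
have kz : k%:Z != 0 by rewrite eqz_nat -lt0n.
have r0 := modz_ge0 m kz; have rk := ltz_pmod m (k0 : 0 < k%:Z).
rewrite {1}e; move: r0 rk Pr; case: (m %% k%:Z)%Z => // -[|r]; first by rewrite addr0.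
move=> _ rk Pr; have := kmin r.+1; rewrite /= => /(_ (introT (asboolP _) Pr)).
by rewrite ltz_nat in rk; rewrite leqNgt rk.
Qed.

Section Divisible.

Definition divisible (D : zmodType) := forall (k : nat) (w : D), (0 < k)%N -> exists y, y *+ k = w.

(* A functional subgroup is the graph of a homomorphism from a subgroup of A to D. *)
Definition functional_subgroup (A D : zmodType) (G : set (A * D)) :=
  [/\ G 0, forall u v, G u -> G v -> G (u - v) & forall w, G (0, w) -> w = 0].

Context (A D : zmodType).
Implicit Types (G : set (A * D)) (a : A).

Lemma fsub_uniq G a w w' : functional_subgroup G -> G (a, w) -> G (a, w') -> w = w'.
Proof.
move=> [_ GB Gf] h h'; apply/eqP; rewrite -subr_eq0; apply/eqP/Gf.
by have := GB _ _ h h'; congr G; apply/eqP; rewrite xpair_eqE /= subrr !eqxx.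
Qed.

Lemma fsubN G u : functional_subgroup G -> G u -> G (- u).
Proof. by move=> [G0 GB _] h; rewrite -sub0r; exact: GB. Qed.

Lemma fsubD G u v : functional_subgroup G -> G u -> G v -> G (u + v).
Proof. by move=> Gs h h'; rewrite -[v]opprK; have [_ GB _] := Gs; apply: GB => //; exact: fsubN. Qed.

Lemma fsub_mulz G u (m : int) : functional_subgroup G -> G u -> G (u *~ m).
Proof.
move=> Gs h; have hn (c : nat) : G (u *+ c).
  by elim: c => [|c IH]; [case: Gs|rewrite mulrS; exact: fsubD].
by case: m => c; [rewrite -pmulrn|rewrite NegzE mulrNz -pmulrn; exact: fsubN].
Qed.

Lemma pair_mulz a (w : D) (m : int) : (a, w) *~ m = (a *~ m, w *~ m).
Proof. by rewrite [LHS]surjective_pairing !raddfMz. Qed.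

Lemma fsub_extend1 G a y : functional_subgroup G ->
  (forall (m : int) w, G (a *~ m, w) -> w = y *~ m) ->
  functional_subgroup [set u | exists g (m : int), G g /\ u = g + (a, y) *~ m].
Proof.
move=> Gs h; split.
- by exists 0, 0; split; [case: Gs|rewrite mulr0z addr0].
- move=> _ _ [g [m [hg ->]]] [g' [m' [hg' ->]]]; exists (g - g'), (m - m'); split.
    by have [_ GB _] := Gs; exact: GB.
  by rewrite mulrzBr opprD addrACA.
- move=> w [[g1 g2] [m [hg]]] e.
  have e1 : 0 = g1 + a *~ m by move: (congr1 fst e); rewrite /= raddfMz.
  have e2 : w = g2 + y *~ m by move: (congr1 snd e); rewrite /= raddfMz.
  have /h e3 : G (a *~ m, - g2).
    have := fsubN Gs hg; congr G; apply/eqP; rewrite xpair_eqE /= eqxx andbT.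
    by rewrite eq_sym -addr_eq0 addrC -e1.
  by rewrite e2 -e3 subrr.
Qed.

Lemma fsub_sub_extend1 G a y :
  G `<=` [set u | exists g (m : int), G g /\ u = g + (a, y) *~ m].
Proof. by move=> g hg; exists g, 0; rewrite mulr0z addr0. Qed.

Lemma fsub_maximal G0 : functional_subgroup G0 ->
  exists G, [/\ functional_subgroup G, G0 `<=` G & forall G', functional_subgroup G' -> G `<=` G' -> G' `<=` G].
Proof.
(* Taking the union with [G0] makes the empty chain harmless: its union is the empty set, which
   satisfies [P]. *)
move=> s0; pose P : set (set (A * D)) := [set G | functional_subgroup (G0 `|` G)].
have [F FP Ft|G [PG Gmax]] := @Zorn_bigcup _ P; last first.
  exists (G0 `|` G); split=> [//|u h|G' s' GG']; first by left.
  have [e|ne] := pselect (G' `<=` G); first by move=> u /e; right.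
  have GsG : G `<=` G' by move=> u h; apply: GG'; right.
  by case: (Gmax G'); [split|rewrite /P /= (_ : G0 `|` G' = G')//; apply/setUidPr => u h; apply: GG'; left].
rewrite /P /=; set U := \bigcup_(X in F) X.
have [[X0 FX0]|F0] := pselect (exists X, F X); last first.
  rewrite (_ : U = set0) ?setU0//; apply/seteqP; split=> // u [X FX _].
  by case: F0; exists X.
have common u v : (G0 `|` U) u -> (G0 `|` U) v -> exists X, [/\ F X, (G0 `|` X) u & (G0 `|` X) v].
  move=> [hu|[X FX hu]] [hv|[Y FY hv]].
  - by exists X0; split=> //; left.
  - by exists Y; split=> //; [left|right].
  - by exists X; split=> //; [right|left].
  - have [XY|YX] := Ft _ _ FX FY.
      by exists Y; split=> //; right=> //; exact: XY.
    by exists X; split=> //; right=> //; exact: YX.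
have inc X : F X -> (G0 `|` X) `<=` (G0 `|` U) by move=> FX u [h|h]; [left|right; exists X].
split.
- by left; case: s0.
- move=> u v hu hv; have [X [FX hu' hv']] := common u v hu hv.
  by apply: (inc X FX); have [_ B _] := FP X FX; exact: B.
- move=> w hw; have [X [FX h _]] := common _ _ hw hw.
  by have [_ _ f] := FP X FX; exact: f.
Qed.

(** Baer's argument. For a maximal extension and any a, the multiples of a in its domain are those
    of some k a, and dividing the value at k a by k extends the map to a. *)
Lemma divisible_extend G0 : divisible D -> functional_subgroup G0 ->
  exists f : A -> D, zmod_morphism f /\ forall a w, G0 (a, w) -> f a = w.
Proof.
move=> Ddiv s0; have [G [Gs G0G Gmax]] := fsub_maximal s0.
have Gtot a : exists w, G (a, w).
  have [|u v [w hw] [w' hw']|k Pk] := @int_subgroup_principal (fun m => exists w, G (a *~ m, w)).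
  - by exists 0; rewrite mulr0z; case: Gs.
  - by exists (w - w'); rewrite mulrzBr; have [_ B _] := Gs; exact: (B _ _ hw hw').
  have [w hw] := (Pk k).2 (ex_intro _ 1 (esym (mul1r _))).
  have [y hy] : exists y, y *+ k = w.
    case: (posnP k) => [k0|k0]; last exact: Ddiv.
    rewrite k0 mulr0z in hw; have [_ _ f] := Gs.
    by exists 0; rewrite k0 mulr0n (f _ hw).
  have ext : forall (m : int) w', G (a *~ m, w') -> w' = y *~ m.
    move=> m w' h; have [m' em] := (Pk m).1 (ex_intro _ w' h).
    apply: (fsub_uniq Gs h).
    by have := fsub_mulz m' Gs hw; rewrite pair_mulz em -hy pmulrn -!mulrzA (mulrC m').
  have := Gmax _ (fsub_extend1 Gs ext) (@fsub_sub_extend1 G a y) (a, y).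
  move=> h; exists y; apply: h; exists 0, 1; rewrite mulr1z add0r; split=> //; by case: Gs.
have [f hf] := choice Gtot; exists f; split.
  move=> u v; apply: (fsub_uniq Gs (hf _)).
  by have [_ B _] := Gs; exact: (B _ _ (hf u) (hf v)).
by move=> a w /G0G h; exact: (fsub_uniq Gs (hf a)).
Qed.

End Divisible.

(** The multiplicative group of the field [algC], later written additively. It is divisible and has
    nontrivial torsion of every order greater than 1, so it can play the part of Q/Z. *)
Record cunit := CUnit { cunit_val : algC; cunit_neq0 : cunit_val != 0 }.

HB.instance Definition _ := gen_eqMixin cunit.
HB.instance Definition _ := gen_choiceMixin cunit.

Lemma cunit_inj : injective cunit_val.
Proof. by move=> [u hu] [v hv] /= e; subst v; congr CUnit; exact: bool_irrelevance. Qed.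

Definition cunit_mul (u v : cunit) := CUnit (mulf_neq0 (cunit_neq0 u) (cunit_neq0 v)).
Definition cunit_inv (u : cunit) := CUnit (invr_neq0 (cunit_neq0 u)).
Definition cunit_one := CUnit (oner_neq0 algC).

Lemma cunit_mulA : associative cunit_mul. Proof. by move=> u v w; apply: cunit_inj; exact: mulrA. Qed.
Lemma cunit_mulC : commutative cunit_mul. Proof. by move=> u v; apply: cunit_inj; exact: mulrC. Qed.
Lemma cunit_mul1 : left_id cunit_one cunit_mul. Proof. by move=> u; apply: cunit_inj; exact: mul1r. Qed.
Lemma cunit_mulV : left_inverse cunit_one cunit_inv cunit_mul.
Proof. by move=> u; apply: cunit_inj; exact/mulVf/cunit_neq0. Qed.

HB.instance Definition _ := GRing.isZmodule.Build cunit cunit_mulA cunit_mulC cunit_mul1 cunit_mulV.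

Lemma cunit_valMn (u : cunit) k : cunit_val (u *+ k) = cunit_val u ^+ k.
Proof. by elim: k => // k IH; rewrite mulrS exprS -IH. Qed.

Lemma cunit_divisible : divisible cunit.
Proof.
move=> k w k0.
have r0 : k.-root (cunit_val w) != 0 by rewrite rootC_eq0// cunit_neq0.
by exists (CUnit r0); apply: cunit_inj; rewrite cunit_valMn /= rootCK.
Qed.

Lemma cunit_torsion (k : nat) : k != 1%N -> exists c : cunit, c != 0 /\ c *+ k = 0.
Proof.
case: (posnP k) => [-> _|k0 k1].
  (* For k = 0 there is no torsion condition, and any unit other than 1 will do. *)
  have two0 : 2 != 0 :> algC by rewrite pnatr_eq0.
  exists (CUnit two0); split; last exact: mulr0n.
  by apply/eqP => /(congr1 cunit_val) /= /eqP; rewrite pnatr_eq1.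
have [z zk] := C_prim_root_exists k0.
have z1 := prim_expr_order zk.
have z0 : z != 0 by apply/eqP => e; move: z1; rewrite e expr0n gtn_eqF// => /eqP; rewrite eq_sym oner_eq0.
exists (CUnit z0); split; last by apply: cunit_inj; rewrite cunit_valMn.
apply/eqP => /(congr1 cunit_val) /= e.
by have := prim_order_dvd zk 1; rewrite expr1 e eqxx dvdn1 (negbTE k1).
Qed.

Section Characters.
Context (A : zmodType) (B : zsub A).

(** Let k be the order of a modulo B, with 0 for infinite order. A nonzero c killed by k is an
    admissible value at a for a map that vanishes on B, and divisibility extends it to A. *)
Lemma char_exists (a : A) : ~ B a ->
  exists f : A -> cunit, [/\ zmod_morphism f, forall b, B b -> f b = 0 & f a != 0].
Proof.
move=> Ba; have [|u v|k Pk] := @int_subgroup_principal (fun m => B (a *~ m)).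
- by rewrite mulr0z; exact: zmem0.
- by rewrite mulrzBr; exact: zmemB.
have k1 : k != 1%N.
  by apply/eqP => k1; apply: Ba; rewrite -[a]mulr1z; apply/Pk; exists 1; rewrite k1 mul1r.
have [c [c0 ck]] := cunit_torsion k1.
pose G : set (A * cunit) := [set u | B u.1 /\ u.2 = 0].
have Gs : functional_subgroup G.
  split=> [|u v [h1 h2] [h3 h4]|w []//]; first by split=> //; exact: zmem0.
  by split; [exact: zmemB|rewrite /= h2 h4 subrr].
have ext : forall (m : int) w, G (a *~ m, w) -> w = c *~ m.
  move=> m w [/= /Pk[m' ->] ->].
  by rewrite mulrC mulrzA -pmulrn ck mul0rz.
have [f [fB hf]] := divisible_extend cunit_divisible (fsub_extend1 Gs ext).
exists f; split=> //.
  by move=> b Bb; apply: hf; apply: (@fsub_sub_extend1 _ _ G a c (b, 0)).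
rewrite (_ : f a = c)//; apply: hf; exists 0, 1; rewrite mulr1z add0r; split=> //.
by split=> //; exact: zmem0.
Qed.

(* The map f collects, for each a outside B, a character which is trivial on B but not at a. *)
Lemma divisible_quotient : exists (D : zmodType) (f : A -> D),
  [/\ divisible D, zmod_morphism f & forall a, f a = 0 <-> B a].
Proof.
have /choice[chi hchi] : forall a, exists f : A -> cunit,
    [/\ zmod_morphism f, forall b, B b -> f b = 0 & ~ B a -> f a != 0].
  move=> a; have [Ba|Ba] := pselect (B a); last by have [f [h1 h2 h3]] := char_exists Ba; exists f.
  by exists (fun=> 0); split=> // u v; rewrite subrr.
exists (dprod (fun _ : A => cunit)), (fun u a => chi a u); split.
- move=> k w k0.
  have /choice[y hy] : forall a, exists y, y *+ k = w a by move=> a; exact: cunit_divisible.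
  exists y; apply: dprodP => a; rewrite -hy.
  by elim: k {k0 hy} => [|k IH]; rewrite ?mulr0n// !mulrS -IH.
- by move=> u v; apply: dprodP => a; have [-> _ _] := hchi a.
- move=> a; split=> [e|Ba]; last by apply: dprodP => b; have [_ h _] := hchi b; exact: h.
  apply: contrapT => Ba; have [_ _ /(_ Ba)/eqP[]] := hchi a.
  exact: (congr1 (fun g => g a) e).
Qed.

End Characters.

(** The second use of [divisible_quotient] gives a map with the right kernel but perhaps not onto.
    So E is its image, which inherits divisibility from D. *)
Lemma divisible_presentation (A : zmodType) (Z B : zsub A) :
  exists (D E : zmodType) (f : A -> D) (q : D -> E),
  [/\ divisible E, zmod_morphism f, zmod_morphism q & forall e, exists d, q d = e] /\
    (forall a, f a = 0 <-> B a) /\ forall d, q d = 0 <-> exists2 a, Z a & f a = d.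
Proof.
have [D [f [Ddiv fB fker]]] := divisible_quotient B.
have h0 : exists2 a, Z a & f a = 0 by exists 0; [exact: zmem0|exact: morphB0 fB].
have hB d d' : (exists2 a, Z a & f a = d) -> (exists2 a, Z a & f a = d') -> exists2 a, Z a & f a = d - d'.
  by move=> [a Za <-] [a' Za' <-]; exists (a - a'); [exact: zmemB|exact: fB].
have [D' [g [D'div gB gker]]] := divisible_quotient (ZSub h0 hB).
have i0 : exists d, g d = 0 by exists 0; exact: morphB0 gB.
have iB e e' : (exists d, g d = e) -> (exists d, g d = e') -> exists d, g d = e - e'.
  by move=> [d <-] [d' <-]; exists (d - d'); exact: gB.
exists D, (subz (ZSub i0 iB)), f, (fun d => @Subz _ (ZSub i0 iB) (g d) (ex_intro _ d erefl)); split; [split=> //|split=> //].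
- move=> k [w [d hd]] k0; have [y hy] := Ddiv k d k0.
  exists (@Subz _ (ZSub i0 iB) (g y) (ex_intro _ y erefl)); apply: subz_inj => /=.
  rewrite -hd -hy {hd hy}; elim: k {k0} => [|k IH]; first by rewrite !mulr0n /= (morphB0 gB).
  by rewrite !mulrS /= IH (morphBD gB).
- by move=> u v; apply: subz_inj; exact: gB.
- by move=> [w [d hd]]; exists d; exact: subz_inj.
- by move=> d; split=> [/(congr1 (@subz_val _ _))/gker//|h]; apply: subz_inj; exact/gker.
Qed.

(** * The abelian part of a strict oo-groupoid *)

Section TotalComp.
Context (X : infCat).

Lemma src_to_comp_top i j (h : (j < i)%N) (h' : (j <= i)%N) v u c :
  src_to h' (acomp h v u c : arr X i) = src_to h' u.
Proof.
elim: i h h' v u c => // i IH h h' v u c; have [ji|ij] := ltnP j i.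
  have c' : src_to (ltnW ji) (src v) = tgt_to (ltnW ji) (src u).
    rewrite -(src_toS (ltnW ji) (ltnW h)) c (tgt_toS (ltnW ji)).
    by case: i ji {IH h h' v c} u => // i ji u; rewrite (@tgt_to_src _ (infCat_globular X) i j ji).
  by rewrite !(src_toS (ltnW ji)) (src_comp _ c') IH.
have e : j = i by apply/eqP; rewrite eqn_leq ij -ltnS h.
by subst j; rewrite !src_to1 src_comp_top.
Qed.

Lemma tgt_to_comp_top i j (h : (j < i)%N) (h' : (j <= i)%N) v u c :
  tgt_to h' (acomp h v u c : arr X i) = tgt_to h' v.
Proof.
elim: i h h' v u c => // i IH h h' v u c; have [ji|ij] := ltnP j i.
  have c' : src_to (ltnW ji) (tgt v) = tgt_to (ltnW ji) (tgt u).
    rewrite -(tgt_toS (ltnW ji) (ltnW h)) -c (src_toS (ltnW ji)).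
    by case: i ji {IH h h' u c} v => // i ji v; rewrite (@src_to_tgt _ (infCat_globular X) i j ji).
  by rewrite !(tgt_toS (ltnW ji)) (tgt_comp _ c') IH.
have e : j = i by apply/eqP; rewrite eqn_leq ij -ltnS h.
by subst j; rewrite !tgt_to1 tgt_comp_top.
Qed.

Lemma src_to_comp i j k (hik : (k < i)%N) (hjk : (k < j)%N) (hij : (j <= i)%N) v u c c' :
  src_to hij (acomp hik v u c : arr X i) = acomp hjk (src_to hij v) (src_to hij u) c'.
Proof.
move: i hij hik v u c c'; apply: leq_induction => [h hik v u c|i h h' IH hik v u c].
  rewrite !src_to_id => c'; rewrite (bool_irrelevance hik hjk) in c *.
  by congr acomp; exact: Prop_irrelevance.
have ki : (k < i)%N by exact: leq_trans hjk h.
rewrite !(src_toS h) => c'.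
have c2 : src_to (ltnW ki) (src v) = tgt_to (ltnW ki) (src u).
  by rewrite -(src_to_trans (ltnW hjk) h) c' (tgt_to_src_to (infCat_globular X) hjk h (ltnW ki)).
by rewrite (src_comp _ c2); exact: IH.
Qed.

Lemma tgt_to_comp i j k (hik : (k < i)%N) (hjk : (k < j)%N) (hij : (j <= i)%N) v u c c' :
  tgt_to hij (acomp hik v u c : arr X i) = acomp hjk (tgt_to hij v) (tgt_to hij u) c'.
Proof.
move: i hij hik v u c c'; apply: leq_induction => [h hik v u c|i h h' IH hik v u c].
  rewrite !tgt_to_id => c'; rewrite (bool_irrelevance hik hjk) in c *.
  by congr acomp; exact: Prop_irrelevance.
have ki : (k < i)%N by exact: leq_trans hjk h.
rewrite !(tgt_toS h) => c'.
have c2 : src_to (ltnW ki) (tgt v) = tgt_to (ltnW ki) (tgt u).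
  by rewrite -(src_to_tgt_to (infCat_globular X) hjk h) c' (tgt_to_trans _ _ (ltnW ki)).
by rewrite (tgt_comp _ c2); exact: IH.
Qed.

End TotalComp.

Section Cells.
Context (G : infGpd) (x : arr G 0).
Let gG := infCat_globular G.

(** The case j = i makes an arrow of dimension 0 or 1 equal to a unit of x, so each of these
    dimensions has a single arrow. *)
Definition simple i (u : arr G i) := forall j (h : (j <= i)%N), (j <= 1)%N ->
  src_to h u = unt_to (leq0n j) x /\ tgt_to h u = unt_to (leq0n j) x.

Record scell i := SCell { scell_arr :> arr G i; scellP : simple scell_arr }.

HB.instance Definition _ i := gen_eqMixin (scell i).
HB.instance Definition _ i := gen_choiceMixin (scell i).

Lemma scell_inj i : injective (@scell_arr i).
Proof. by move=> [u hu] [v hv] /= e; subst v; congr SCell; exact: Prop_irrelevance. Qed.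

Lemma scell_low i (u v : scell i) : (i <= 1)%N -> u = v.
Proof.
move=> i1; apply: scell_inj; rewrite -[LHS](src_to_id (leqnn i)) -[RHS](src_to_id (leqnn i)).
by rewrite (scellP u (leqnn i) i1).1 (scellP v (leqnn i) i1).1.
Qed.

Lemma simple_unt i : simple (unt_to (leq0n i) x).
Proof. by move=> j h j1; rewrite (src_to_unt_to gG (leq0n j)) (tgt_to_unt_to gG (leq0n j)). Qed.

Definition scell_zero i : scell i := SCell (@simple_unt i).

Lemma simple_src i (u : scell i.+1) : simple (src u).
Proof.
move=> j h j1; have h' := leqW h; have [e1 e2] := scellP u h' j1.
split; first by rewrite -(src_toS h h') e1.
have := h; rewrite leq_eqVlt => /orP[/eqP ji|ji]; last first.
  by rewrite -(src_to1 (leqnSn i)) -e2 -(tgt_to_src_to gG ji (leqnSn i)); congr tgt_to; exact: bool_irrelevance.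
by subst j; rewrite tgt_to_id -(src_to1 h') e1.
Qed.

Lemma simple_tgt i (u : scell i.+1) : simple (tgt u).
Proof.
move=> j h j1; have h' := leqW h; have [e1 e2] := scellP u h' j1.
split; last by rewrite -(tgt_toS h h') e2.
have := h; rewrite leq_eqVlt => /orP[/eqP ji|ji]; last first.
  by rewrite -(tgt_to1 (leqnSn i)) -e1 -(src_to_tgt_to gG ji (leqnSn i)); congr src_to; exact: bool_irrelevance.
by subst j; rewrite src_to_id -(tgt_to1 h') e2.
Qed.

Lemma simple_unit i (u : scell i) : simple (unt u).
Proof.
move=> j h j1; have [ji|ij] := leqP j i.
  by rewrite (src_toS ji) (tgt_toS ji) src_unt tgt_unt; exact: scellP.
have i0 : i = 0 by case: i ij {u h} => // i; rewrite ltnNge (leq_trans j1).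
subst i; have -> : u = scell_zero 0 by exact: scell_low.
by rewrite /= unt_to_id -(unt_to1 (leq0n 1)); exact: simple_unt.
Qed.

Definition scell_src i (u : scell i.+1) : scell i := SCell (simple_src u).
Definition scell_tgt i (u : scell i.+1) : scell i := SCell (simple_tgt u).
Definition scell_unt i (u : scell i) : scell i.+1 := SCell (simple_unit u).

Lemma scell_src0 i (h : (0 <= i)%N) (u : scell i) : src_to h u = x.
Proof. by rewrite (scellP u h isT).1 unt_to_id. Qed.
Lemma scell_tgt0 i (h : (0 <= i)%N) (u : scell i) : tgt_to h u = x.
Proof. by rewrite (scellP u h isT).2 unt_to_id. Qed.

Lemma scell_c0 i (h : (0 <= i)%N) (u v : scell i) : src_to h u = tgt_to h v.
Proof. by rewrite scell_src0 scell_tgt0. Qed.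

Lemma comp0_unit j (h : (0 < j)%N) c :
  acomp h (unt_to (leq0n j) x) (unt_to (leq0n j) x) c = unt_to (leq0n j) x.
Proof.
have e : unt_to (leq0n j) x = unt_to (ltnW h) (src_to (ltnW h) (unt_to (leq0n j) x)).
  by rewrite (src_to_unt_to gG (leqnn 0)) unt_to_id; congr unt_to; exact: bool_irrelevance.
by move: c; rewrite {2 4}e => c; exact: comp_unt_r.
Qed.

Lemma simple_comp0 i (h : (0 < i)%N) (u v : scell i) c : simple (acomp h u v c).
Proof.
move=> j hj j1; have [su tu] := scellP u hj j1; have [sv tv] := scellP v hj j1.
case: j hj j1 su tu sv tv => [|j] hj j1 su tu sv tv.
  by rewrite src_to_comp_top tgt_to_comp_top.
have c1 : src_to (ltnW (ltn0Sn j)) (src_to hj u) = tgt_to (ltnW (ltn0Sn j)) (src_to hj v).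
  by rewrite su sv (src_to_unt_to gG (leqnn 0)) (tgt_to_unt_to gG (leqnn 0)).
have c2 : src_to (ltnW (ltn0Sn j)) (tgt_to hj u) = tgt_to (ltnW (ltn0Sn j)) (tgt_to hj v).
  by rewrite tu tv (src_to_unt_to gG (leqnn 0)) (tgt_to_unt_to gG (leqnn 0)).
rewrite (src_to_comp _ c1) (tgt_to_comp _ c2).
move: c1 c2; rewrite su tu sv tv => c1 c2; by rewrite !comp0_unit.
Qed.

(** In dimension 0 there is no composition, and only one element; the value u is a default. *)
Definition scell_add i : scell i -> scell i -> scell i :=
  match i with
  | 0 => fun u _ => u
  | i.+1 => fun u v => SCell (@simple_comp0 i.+1 (ltn0Sn i) u v (scell_c0 _ u v))
  end.

Lemma scell_addE i (h : (0 < i)%N) u v c : scell_add u v = acomp h u v c :> arr G i.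
Proof.
case: i h u v c => // i h u v c; rewrite /= (bool_irrelevance h (ltn0Sn i)) in c *.
by congr acomp; exact: Prop_irrelevance.
Qed.

Lemma scell_addA i : associative (@scell_add i).
Proof. by case: i => // i u v w; apply: scell_inj => /=; symmetry; apply: Defs.compA. Qed.

Lemma scell_zeroE i (h : (0 <= i)%N) : scell_zero i = unt_to h x :> arr G i.
Proof. by congr unt_to; exact: bool_irrelevance. Qed.

Lemma scell_add0 i : left_id (scell_zero i) (@scell_add i).
Proof.
case: i => [|i] u; first exact: scell_low.
apply: scell_inj; rewrite /=; move: (scell_c0 _ _ _) => c.
have e : unt_to (leq0n i.+1) x = unt_to (ltnW (ltn0Sn i)) (tgt_to (ltnW (ltn0Sn i)) u).
  by rewrite scell_tgt0; exact: scell_zeroE.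
by move: c; rewrite /= e => c; exact: comp_unt_l.
Qed.

Lemma scell_addr0 i : right_id (scell_zero i) (@scell_add i).
Proof.
case: i => [|i] u; first exact: scell_low.
apply: scell_inj; rewrite /=; move: (scell_c0 _ _ _) => c.
have e : unt_to (leq0n i.+1) x = unt_to (ltnW (ltn0Sn i)) (src_to (ltnW (ltn0Sn i)) u).
  by rewrite scell_src0; exact: scell_zeroE.
by move: c; rewrite /= e => c; exact: comp_unt_r.
Qed.

Lemma scell_units i (h : (1 < i)%N) (u : scell i) c c' :
  acomp h u (scell_zero i) c = u /\ acomp h (scell_zero i) u c' = u.
Proof.
have z : scell_zero i = unt_to (ltnW h) (unt_to (leq0n 1) x) :> arr G i.
  by rewrite (unt_to_trans _ _ (leq0n i)).
have [su tu] := scellP u (ltnW h) (leqnn 1).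
split.
  have e : scell_zero i = unt_to (ltnW h) (src_to (ltnW h) u) :> arr G i by rewrite su.
  by move: c; rewrite e => c; exact: comp_unt_r.
have e : scell_zero i = unt_to (ltnW h) (tgt_to (ltnW h) u) :> arr G i by rewrite tu.
by move: c'; rewrite e => c'; exact: comp_unt_l.
Qed.

(* Eckmann-Hilton, for the compositions along dimensions 0 and 1. *)
Lemma scell_addC i : commutative (@scell_add i).
Proof.
have [i1|i1] := leqP i 1; first by move=> u v; exact: scell_low.
move=> u v; have i0 := ltnW i1.
have c1 (a b : scell i) : src_to (ltnW i1) a = tgt_to (ltnW i1) b.
  by rewrite (scellP a _ (leqnn 1)).1 (scellP b _ (leqnn 1)).2.
have c0 (a b : scell i) := scell_c0 (ltnW i0) a b.
pose z := scell_zero i.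
have [uz zu] := scell_units (c1 u z) (c1 z u); have [vz zv] := scell_units (c1 v z) (c1 z v).
have ex (d c b a : scell i) (dc : scell i) (ba : scell i) (db ca : scell i) :
    acomp i1 d c (c1 d c) = dc -> acomp i1 b a (c1 b a) = ba ->
    scell_add d b = db -> scell_add c a = ca -> scell_add dc ba = acomp i1 db ca (c1 db ca) :> arr G i.
  move=> e1 e2 e3 e4; have f3 := congr1 (@scell_arr i) e3; have f4 := congr1 (@scell_arr i) e4.
  rewrite (scell_addE (c0 d b)) in f3; rewrite (scell_addE (c0 c a)) in f4.
  rewrite (scell_addE (c0 dc ba)); move: (c0 dc ba) (c1 db ca); rewrite -e1 -e2 -f3 -f4 => c3 c6.
  by apply: comp_exchange.
apply: scell_inj.
rewrite (ex u z z v u v u v uz zv (scell_addr0 u) (scell_add0 v)).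
by rewrite (ex z v u z v u u v zv uz (scell_add0 u) (scell_addr0 v)).
Qed.

(** Faces of an inverse are inverses of faces: in dimension 1, composing with a unit gives a unit,
    so the inverse is again simple. *)
Lemma scell_opp_subproof i (u : scell i) : exists v : scell i, scell_add v u = scell_zero i.
Proof.
case: i u => [|i] u; first by exists u; exact: scell_low.
have [v [c [c' [e e']]]] := infgpd_inv (ltn0Sn i) u.
have sv : simple v.
  move=> [|j] h j1.
    rewrite (bool_irrelevance h (ltnW (ltn0Sn i))) c' -c scell_tgt0 scell_src0.
    by rewrite unt_to_id.
  have [su tu] := scellP u h j1; have hj := ltn0Sn j.
  have s2 : src_to (ltnW hj) (src_to h v) = tgt_to (ltnW hj) (src_to h u).
    by rewrite (src_to_trans _ _ (ltnW (ltn0Sn i))) c' (tgt_to_src_to gG hj h (ltnW (ltn0Sn i))).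
  have t2 : src_to (ltnW hj) (tgt_to h v) = tgt_to (ltnW hj) (tgt_to h u).
    by rewrite (src_to_tgt_to gG hj h (ltnW (ltn0Sn i))) c' (tgt_to_trans _ _ (ltnW (ltn0Sn i))).
  have uE (w : arr G j.+1) (k : _ = _) : acomp hj w (unt_to (leq0n j.+1) x) k = w.
    have := k; rewrite (tgt_to_unt_to gG (leqnn 0)) unt_to_id => kx.
    have ex : unt_to (leq0n j.+1) x = unt_to (ltnW hj) (src_to (ltnW hj) w).
      by rewrite kx; congr unt_to; exact: bool_irrelevance.
    by move: k; rewrite ex => k; exact: comp_unt_r.
  have e0 : unt_to (ltnW (ltn0Sn i)) (src_to (ltnW (ltn0Sn i)) u) = unt_to (leq0n i.+1) x.
    by rewrite scell_src0; congr unt_to; exact: bool_irrelevance.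
  have es := congr1 (src_to h) e'; have et := congr1 (tgt_to h) e'.
  rewrite (src_to_comp _ s2) e0 (src_to_unt_to gG (leq0n j.+1)) in es.
  rewrite (tgt_to_comp _ t2) e0 (tgt_to_unt_to gG (leq0n j.+1)) in et.
  split.
    by rewrite -es; move: s2 {es}; rewrite su => s2; rewrite uE.
  by rewrite -et; move: t2 {et}; rewrite tu => t2; rewrite uE.
exists (SCell sv); apply: scell_inj.
rewrite (@scell_addE _ (ltn0Sn i) (SCell sv) u c') /= e' scell_src0.
by congr unt_to; exact: bool_irrelevance.
Qed.

Definition scell_opp i (u : scell i) : scell i := projT1 (cid (scell_opp_subproof u)).

Lemma scell_addN i : left_inverse (scell_zero i) (@scell_opp i) (@scell_add i).
Proof. by move=> u; rewrite /scell_opp; case: cid. Qed.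

HB.instance Definition _ i := GRing.isZmodule.Build (scell i) (@scell_addA i) (@scell_addC i)
  (@scell_add0 i) (@scell_addN i).

Lemma morphD_zmod (U V : zmodType) (f : U -> V) : {morph f : u v / u + v} -> zmod_morphism f.
Proof. by move=> fD u v; rewrite -[X in _ = f X - _](subrK v u) (fD (u - v)) addrK. Qed.

Lemma scell_srcB i : zmod_morphism (@scell_src i).
Proof.
apply: morphD_zmod => u v; case: i u v => [|i] u v; first exact: scell_low.
by apply: scell_inj => /=; apply: src_comp.
Qed.

Lemma scell_tgtB i : zmod_morphism (@scell_tgt i).
Proof.
apply: morphD_zmod => u v; case: i u v => [|i] u v; first exact: scell_low.
by apply: scell_inj => /=; apply: tgt_comp.
Qed.

Lemma scell_untB i : zmod_morphism (@scell_unt i).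
Proof.
apply: morphD_zmod => u v; case: i u v => [|i] u v; first exact: scell_low.
by apply: scell_inj => /=; apply: unt_comp.
Qed.

Definition scell_gab : gab.
Proof.
refine (@Gab (fun i => scell i) scell_src scell_tgt scell_unt scell_srcB scell_tgtB scell_untB _).
split=> i u; apply: scell_inj => /=; [exact: src_src|exact: tgt_src|exact: src_unt|exact: tgt_unt].
Defined.

Notation W := scell_gab.

Lemma scell_src_to i j (h : (j <= i)%N) (u : arr (gab_graph W) i) :
  scell_arr (src_to h u : scell j) = src_to h (scell_arr (u : scell i)).
Proof. exact: (@graph_map_src_to (gab_graph W) G (fun i u => scell_arr (u : scell i))). Qed.
Lemma scell_unt_to i j (h : (j <= i)%N) (u : arr (gab_graph W) j) :
  scell_arr (unt_to h u : scell i) = unt_to h (scell_arr (u : scell j)).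
Proof. exact: (@graph_map_unt_to (gab_graph W) G (fun i u => scell_arr (u : scell i))). Qed.

(** With w the unit on the source of v and d = v - w, the exchange law computes the composite of d +
    w and 0 + u as the sum of the composites of d with 0 and of w with u, which is d + u. For j = 0
    the composition is the addition itself. *)
Lemma scell_comp i j (h : (j < i)%N) (v u : arr (gab_graph W) i) c c' :
  scell_arr (@gab_comp W i j h v u c : scell i) = acomp h (scell_arr (v : scell i)) (scell_arr (u : scell i)) c'.
Proof.
have i0 : (0 < i)%N by exact: leq_ltn_trans (leq0n j) h.
pose vv : scell i := v; pose uu : scell i := u.
have [j0|j0] := posnP j.
  subst j; rewrite /gab_comp.
  have -> : unt_to (ltnW h) (src_to (ltnW h) v) = (0 : gab_arr W i).
    apply: scell_inj; rewrite scell_unt_to scell_src_to (@scell_src0 i _ vv).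
    by congr unt_to; exact: bool_irrelevance.
  by rewrite subr0; exact: (@scell_addE i h vv uu).
pose w : scell i := unt_to (ltnW h) (src_to (ltnW h) v); pose d : scell i := (v : gab_arr W i) - w.
have sd : src_to (ltnW h) (d : arr (gab_graph W) i) = (0 : gab_arr W j).
  by rewrite (@src_toB W) (src_to_unt (gab_globular W)) subrr.
have sd' : src_to (ltnW h) d = scell_zero j :> arr G j.
  by have := scell_src_to (ltnW h) d; rewrite sd => <-.
have wE : w = unt_to (ltnW h) (src_to (ltnW h) vv) :> arr G i by rewrite scell_unt_to scell_src_to.
have zE : scell_zero i = unt_to (ltnW h) (scell_zero j) :> arr G i.
  by rewrite (unt_to_trans _ _ (leq0n i)).
have c1 : src_to (ltnW h) d = tgt_to (ltnW h) (scell_zero i) :> arr G j.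
  by rewrite sd' zE tgt_to_unt.
have c2 : src_to (ltnW h) w = tgt_to (ltnW h) uu :> arr G j by rewrite wE src_to_unt.
have e1 : acomp h d (scell_zero i) c1 = d.
  by move: c1; rewrite zE -sd' => c1; exact: comp_unt_r.
have e2 : acomp h w uu c2 = uu.
  by move: c2; rewrite wE c' => c2; exact: comp_unt_l.
have e3 := @scell_addE i i0 d w (scell_c0 (ltnW i0) d w).
have e4 := @scell_addE i i0 (scell_zero i) uu (scell_c0 (ltnW i0) _ _).
rewrite scell_add0 in e4.
have dw : scell_add d w = vv by exact: subrK.
rewrite dw in e3.
rewrite /gab_comp -/w -/d; transitivity (scell_arr (scell_add d uu)); first by [].
rewrite (@scell_addE i i0 d uu (scell_c0 (ltnW i0) _ _)).
have key (p r s t : arr G i) : acomp h d (scell_zero i) c1 = p -> acomp h w uu c2 = r ->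
    acomp i0 d w (scell_c0 (ltnW i0) d w) = s -> acomp i0 (scell_zero i) uu (scell_c0 (ltnW i0) _ _) = t ->
    forall c3 c6, acomp i0 p r c3 = acomp h s t c6.
  by move=> <- <- <- <- c3 c6; apply: comp_exchange => //; exact: scell_c0.
exact: key e1 e2 (esym e3) (esym e4) _ _.
Qed.

Definition scell_functor : infFunctor (gab_gpd W) G :=
  @InfFunctor (gab_gpd W) G (fun i u => scell_arr (u : scell i)) (fun _ _ => erefl) (fun _ _ => erefl)
    (fun _ _ => erefl) scell_comp.

End Cells.

(** * Maps to two-term complexes *)

Section TwoTermHom.
Context (W : gab) (n : nat).
Notation X := (gab_graph W).
Let gX : globular X := gab_globular W.

Definition degenerate (m : nat) : gab_arr W m -> Prop :=
  match m with
  | 0 => fun z => z = 0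
  | m.+1 => fun z => z = gab_unt (gab_src z)
  end.

Lemma degenerate0 m : degenerate (0 : gab_arr W m).
Proof. by case: m => //= m; rewrite (morphB0 (@gab_srcB W m)) (morphB0 (@gab_untB W m)). Qed.

Lemma degenerateB m (u v : gab_arr W m) : degenerate u -> degenerate v -> degenerate (u - v).
Proof.
case: m u v => [|m] u v /= e e'; first by rewrite e e' subrr.
by rewrite gab_srcB gab_untB -e -e'.
Qed.

Lemma degenerate_unt m (u : gab_arr W m) : degenerate (gab_unt u).
Proof. exact: (congr1 (@gab_unt W m) (esym (gl_src_unt gX (u : arr X m)))). Qed.

Let A := gab_arr W n.+1.
Notation gs m := (@gab_src W m).
Notation gt m := (@gab_tgt W m).
Notation gk m := (@gab_unt W m).

Let s0 m : gs m 0 = 0 := morphB0 (@gab_srcB W m).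
Let t0 m : gt m 0 = 0 := morphB0 (@gab_tgtB W m).
Let k0 m : gk m 0 = 0 := morphB0 (@gab_untB W m).
Let sk m (u : gab_arr W m) : gs m (gk m u) = u := gl_src_unt gX (u : arr X m).
Let tk m (u : gab_arr W m) : gt m (gk m u) = u := gl_tgt_unt gX (u : arr X m).
Let ss m (u : gab_arr W m.+2) : gs m (gs m.+1 u) = gs m (gt m.+1 u) := gl_src_src gX (u : arr X m.+2).
Let ts m (u : gab_arr W m.+2) : gt m (gs m.+1 u) = gt m (gt m.+1 u) := gl_tgt_src gX (u : arr X m.+2).

(** The difference of source and target has source 0, and a unit with source 0 is 0. So boundaries
    meet the units trivially, and a map may be prescribed on both. *)
Lemma degenerate_eq0 m (z : gab_arr W m) u : degenerate z -> z = gs m u - gt m u -> z = 0.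
Proof. by case: m z u => //= m z u hz e; rewrite hz e gab_srcB ss subrr k0. Qed.

Lemma degenerate_src_to m i (h : (m <= i.+1)%N) (u : arr X i) : (i < m)%N -> degenerate (src_to h (unt u) : gab_arr W m).
Proof.
move=> im; have e : m = i.+1 by apply/eqP; rewrite eqn_leq h im.
by subst m; rewrite src_to_id; exact: degenerate_unt.
Qed.

Let Z : zsub A.
Proof.
refine (@ZSub A (fun u => gs n u = 0 /\ gt n u = 0) (conj (s0 n) (t0 n)) _).
by move=> u v [h1 h2] [h3 h4]; rewrite gab_srcB gab_tgtB h1 h2 h3 h4 subrr.
Defined.

Let B : zsub A.
Proof.
refine (@ZSub A (fun u => exists a, u = gt n.+1 a - gs n.+1 a) _ _).
  by exists 0; rewrite s0 t0 subrr.
move=> _ _ [a ->] [b ->]; exists (a - b); rewrite gab_srcB gab_tgtB.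
by rewrite !opprB !addrA [LHS](ACl (1*4*3*2)).
Defined.

Let B_null (u : A) : B u <-> exists a, gs n.+1 a = u /\ gt n.+1 a = 0.
Proof.
split=> [[a ->]|[a [<- ta]]]; last by exists (- a); rewrite (morphBN (@gab_tgtB W _)) (morphBN (@gab_srcB W _)) ta oppr0 add0r opprK.
exists (gk _ (gt _ a) - a); by rewrite gab_srcB gab_tgtB sk tk subrr.
Qed.

(** The normalized chain: the projection onto the kernel of the source along the units. *)
Let tail (u : A) : A := u - gk n (gs n u).
Let tailB : zmod_morphism tail.
Proof. by move=> u v; rewrite /tail gab_srcB gab_untB opprD addrACA -opprD. Qed.
Let tail_unt u : tail (gk n u) = 0. Proof. by rewrite /tail sk subrr. Qed.
Let tail_Z u : gs n u = 0 -> tail u = u. Proof. by rewrite /tail => ->; rewrite k0 subr0. Qed.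

(** On (n+1)-arrows, the D-component is the embedding applied to the normalized chain. The
    E-component on n-arrows must then satisfy e(t u) = e(s u) + q(d u) and vanish on units; this
    prescribes it on a subgroup, and divisibility of E extends it. *)
Lemma two_term_hom : exists (E D : zmodType) (q : D -> E) (qB : zmod_morphism q) (f : gab_hom W (two_term qB n)),
  [/\ forall e, exists d, q d = e,
      forall u, gs n u = 0 -> gt n u = 0 -> (subz_val (f n.+1 u)).2 = 0 -> exists a, gs n.+1 a = u /\ gt n.+1 a = 0 &
      forall d, q d = 0 -> exists u, [/\ gs n u = 0, gt n u = 0 & (subz_val (f n.+1 u)).2 = d]].
Proof.
have [D [E [f [q [[Ediv fB qB qsurj] [fker qker]]]]]] := divisible_presentation Z B.
pose d u := f (tail u).
have dB : zmod_morphism d by move=> u v; rewrite /d tailB fB.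
have dk u : d (gk n u) = 0 by rewrite /d tail_unt (morphB0 fB).
have dst a : d (gs _ a) = d (gt _ a).
  apply/esym/eqP; rewrite -subr_eq0 -dB; apply/eqP; rewrite /d; apply/fker.
  by exists a; rewrite tail_Z// gab_srcB ss subrr.
(* This graph is functional because a chain u with equal source and target has a cycle as its
   normalized chain, and q kills the images of cycles. *)
pose G0 : set (gab_arr W n * E) := [set p | exists u z, [/\ degenerate z, p.1 = gt n u - gs n u + z & p.2 = q (d u)]].
have G0s : functional_subgroup G0.
  split.
  - exists 0, 0; split; first exact: degenerate0.
      by rewrite s0 t0 subrr addr0.
    by rewrite (morphB0 dB) (morphB0 qB).
  - move=> [u1 u2] [v1 v2] [u [z [hz /= -> ->]]] [v [z' [hz' /= -> ->]]].
    exists (u - v), (z - z'); split; first exact: degenerateB.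
      rewrite /= gab_srcB gab_tgtB !opprD !opprK !addrA.
      by rewrite [LHS](ACl (1*4*2*5*3*6)).
    by rewrite dB qB.
  - move=> w [u [z [hz /= e ->]]].
    have z0 : z = 0.
      apply: (degenerate_eq0 (u := u) hz); apply/eqP.
      by rewrite -subr_eq0 opprB addrC -e.
    have st : gs n u = gt n u by move: e; rewrite z0 addr0 => /esym/eqP; rewrite subr_eq0 => /eqP.
    apply/qker; exists (tail u) => //.
    split; rewrite /tail; first by rewrite gab_srcB sk subrr.
    by rewrite gab_tgtB tk st subrr.
have [e [eB eG]] := divisible_extend Ediv G0s.
have est u : e (gt n u) = e (gs n u) + q (d u).
  apply/eqP; rewrite addrC -subr_eq -eB; apply/eqP/eG.
  by exists u, 0; split; [exact: degenerate0|rewrite addr0|].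
have edeg z : degenerate z -> e z = 0.
  move=> hz; apply: eG; exists 0, z; split=> //; first by rewrite s0 t0 subrr add0r.
  by rewrite (morphB0 dB) (morphB0 qB).
(* In higher dimensions both components are read off iterated sources; where these do not exist, the
   value 0 is the required one. *)
pose ep i (u : gab_arr W i) : E := if pselect (n <= i)%N is left h then e (src_to h (u : arr X i)) else 0.
pose dp i (u : gab_arr W i) : D := if pselect (n < i)%N is left h then d (src_to h (u : arr X i)) else 0.
have epE i (h : (n <= i)%N) u : ep i u = e (src_to h (u : arr X i)).
  by rewrite /ep; case: pselect => // h'; rewrite (bool_irrelevance h' h).
have dpE i (h : (n < i)%N) u : dp i u = d (src_to h (u : arr X i)).
  by rewrite /dp; case: pselect => // h'; rewrite (bool_irrelevance h' h).
have ep0 i u : (i < n)%N -> ep i u = 0.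
  by move=> h; rewrite /ep; case: pselect => // h'; have := leq_trans h h'; rewrite ltnn.
have dp0 i u : (i <= n)%N -> dp i u = 0.
  by move=> h; rewrite /dp; case: pselect => // h'; have := leq_ltn_trans h h'; rewrite ltnn.
have fixed i u : tsrc n i (ep i u, dp i u) = (ep i u, dp i u).
  case: (ltngtP i n) => [h|h|e0]; first by rewrite tsrc_low// ep0// dp0// ltnW.
    by rewrite tsrc_high.
  by subst i; rewrite tsrcn (dp0 n).
pose F i (u : gab_arr W i) : gab_arr (two_term qB n) i := @Subz _ (tsub E D n i) _ (fixed i u).
have epS i (h : (n <= i)%N) u : ep i.+1 u = ep i (gs i u).
  by rewrite (epE _ (leqW h)) (epE _ h) (src_toS h).
have dpS i (h : (n < i)%N) u : dp i.+1 u = dp i (gs i u).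
  by rewrite (dpE _ (leqW h)) (dpE _ h) (src_toS h).
have epB i : zmod_morphism (ep i).
  move=> u v; have [h|h] := leqP n i; last by rewrite !ep0// subrr.
  by rewrite !(epE _ h) (@src_toB W) eB.
have dpB i : zmod_morphism (dp i).
  move=> u v; have [h|h] := ltnP n i; last by rewrite !dp0// subrr.
  by rewrite !(dpE _ h) (@src_toB W) dB.
have epn u : ep n u = e u by rewrite (epE _ (leqnn n)) src_to_id.
have dpn u : dp n.+1 u = d u by rewrite (dpE _ (ltnSn n)) src_to_id.
have FB i : zmod_morphism (F i).
  by move=> u v; apply: subz_inj; rewrite /= epB dpB.
have Fs i u : F i (gs i u) = gab_src (F i.+1 u).
  apply: subz_inj => /=; case: (ltngtP i n) => [h|h|e0].
  - by rewrite tsrc_low// ep0// dp0// ltnW.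
  - by rewrite tsrc_high// epS ?dpS// ltnW.
  - by subst i; rewrite tsrcn (dp0 n)//= epS.
have Ft i u : F i (gt i u) = gab_tgt (F i.+1 u).
  apply: subz_inj => /=; case: (ltngtP i n) => [h|h|e0].
  - by rewrite ttgt_low// ep0// dp0// ltnW.
  - rewrite ttgt_high// epS ?dpS//; last exact: ltnW.
    case: i h u => // i h u; congr (_, _).
      by rewrite !(epE _ (leqW h)) (@src_to_tgt X gX i n h).
    have [ni|ni] := ltnP n i.
      by rewrite !(dpE _ (leqW ni)) (@src_to_tgt X gX i n.+1 ni).
    have e0 : i = n by apply/eqP; rewrite eqn_leq ni -ltnS h.
    by subst i; rewrite !dpn.
  - by subst i; rewrite ttgtn (dp0 n)//= epS// !epn dpn est.
have Fk i u : F i.+1 (gk i u) = gab_unt (F i u).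
  apply: subz_inj => /=; congr (_, _).
    have [h|h] := leqP n i; first by rewrite epS// sk.
    rewrite [RHS]ep0//; have [h'|h'] := leqP n i.+1; last exact: ep0.
    by rewrite (epE _ h'); apply: edeg; exact: (degenerate_src_to h').
  have [h|h] := ltnP n i; first by rewrite dpS// sk.
  rewrite [RHS]dp0//; have [h'|h'] := ltnP n i.+1; last exact: dp0.
  have e0 : i = n by apply/eqP; rewrite eqn_leq h -ltnS h'.
  by subst i; rewrite dpn dk.
exists E, D, q, qB, (GabHom FB Fs Ft Fk); split=> //.
- by move=> u su tu; rewrite /= dpn /d tail_Z// => /fker/B_null.
- by move=> d0 /qker[u [su tu] <-]; exists u; split=> //=; rewrite dpn /d tail_Z.
Qed.

End TwoTermHom.

(** * Realizations *)

Definition mk_multiplicative (A B : groupType) (f : A -> B) (fM : {morph f : x y / (x * y)%g}) :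
  {multiplicative A -> B} := HB.pack f (isMultiplicative.Build A B f fM).

Lemma multiplicative1 (A B : groupType) (f : {multiplicative A -> B}) : f 1%g = 1%g.
Proof. by apply: (@mulgI _ (f 1%g)); rewrite -gmulfM !mulg1. Qed.

Section Realization.
Context (R : realType) (Q : simpson_realization R).
Implicit Types G H : infGpd.

Lemma real_connected G (x : arr G 0) : (forall y : arr G 0, arr_htpy x y) -> path_connected R (Q G).
Proof.
move=> h; have [phi [phiE [psi _ psiK]]] := simpson_pi0 Q G.
split; first by exists (simpson_pt Q x).
suff all_x (z : Q G) : joined R (simpson_pt Q x) z.
  by move=> y z; exact: joined_trans (joined_sym (all_x y)) (all_x z).
apply/top_pi0P; rewrite -phiE -[RHS]psiK; congr phi.
by rewrite -[psi _]reprK; apply/gpd_pi0P.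
Qed.

Lemma real_connected_inv G : path_connected R (Q G) -> exists x : arr G 0, True.
Proof.
move=> [[z _] _]; have [phi [_ [psi _ _]]] := simpson_pi0 Q G.
by exists (repr (psi (\pi_(top_pi0 R (Q G)) z))).
Qed.

Lemma simpson_pi_inj n G (x : arr G 0) : injective (@simpson_pi R Q n G x).
Proof. exact: bij_inj (@simpson_pi_bij R Q n G x). Qed.

Lemma simpson_pi_surj n G (x : arr G 0) v : exists u, @simpson_pi R Q n G x u = v.
Proof. by have [psi _ psiK] := @simpson_pi_bij R Q n G x; exists (psi v). Qed.

Section RealMap.
Context (G H : infGpd) (F : infFunctor G H) (x : arr G 0) (n : nat).
Notation f := (real_map Q F).
Notation p := (simpson_pt Q x).

Let cf : continuous f. Proof. by move=> t; exact: cts_fun. Qed.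

Lemma real_map_cls (a : 'rV[R]_n.+1 -> Q G) u : is_sph p a -> cls p a = simpson_pi Q n x u ->
  cls (simpson_pt Q (F 0 x)) (f \o a) = simpson_pi Q n (F 0 x) (gpd_pi_map F u).
Proof. by move=> sa e; rewrite simpson_pi_nat -e top_pi_map_cls. Qed.

Lemma real_map_ker (a : 'rV[R]_n.+1 -> Q G) u : is_sph p a -> cls p a = simpson_pi Q n x u ->
  htp (f p) (f \o a) (fun=> f p) -> gpd_pi_map F u = 1%g.
Proof.
move=> sa e h; apply: (@simpson_pi_inj n); rewrite -(real_map_cls sa e) multiplicative1.
have sfa := sph_comp cf sa; rewrite simpson_pt_nat in sfa h.
exact/(cls_eq1 sfa).
Qed.

Lemma real_map_htp (a : 'rV[R]_n.+1 -> Q G) (b : 'rV[R]_n.+1 -> Q H) u :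
  is_sph p a -> is_sph (f p) b -> cls p a = simpson_pi Q n x u ->
  cls (simpson_pt Q (F 0 x)) b = simpson_pi Q n (F 0 x) (gpd_pi_map F u) -> htp (f p) (f \o a) b.
Proof.
move=> sa sb ea; rewrite -(real_map_cls sa ea) => eb.
have sfa := sph_comp cf sa; rewrite simpson_pt_nat in sfa sb *.
exact/(clsP sfa sb).
Qed.

End RealMap.

Lemma real_weak_equiv G H (F : infFunctor G H) (x : arr G 0) :
  path_connected R (Q G) -> path_connected R (Q H) ->
  (forall n (u : gpd_pi n x), gpd_pi_map F u = 1%g -> u = 1%g) ->
  (forall n (v : gpd_pi n (F 0 x)), exists u : gpd_pi n x, gpd_pi_map F u = v) ->
  weak_equiv R (real_map Q F).
Proof.
move=> cG cH ker surj; apply: (weak_equiv_at (x0 := simpson_pt Q x)) => // n.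
  move=> a sa h; have [u eu] := simpson_pi_surj (cls (n := n) (simpson_pt Q x) a).
  apply/(cls_eq1 sa); rewrite -eu (ker _ u) ?multiplicative1//.
  exact: (real_map_ker sa (esym eu) h).
move=> b sb; have [v ev] := simpson_pi_surj (cls (n := n) (simpson_pt Q (F 0 x)) b).
have [u eu] := surj n v; have [a [sa ea]] := cls_surj (simpson_pi Q n x u).
by exists a; split=> //; apply: (real_map_htp sa sb ea); rewrite eu.
Qed.

(** [Q] is not assumed to preserve products. The map into the product of the realizations is
    assembled from its components and tested on homotopy groups. *)
Lemma real_prod_weak_equiv G (I : Type) (K : I -> infGpd) (F : forall i, infFunctor G (K i)) (x : arr G 0) :
  path_connected R (Q G) -> (forall i, path_connected R (Q (K i))) ->
  (forall n (u : gpd_pi n x), (forall i, gpd_pi_map (F i) u = 1%g) -> u = 1%g) ->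
  (forall n (v : forall i, gpd_pi n (F i 0 x)), exists u : gpd_pi n x, forall i, gpd_pi_map (F i) u = v i) ->
  exists f : continuousType (Q G) (prod_topology (fun i => Q (K i))), weak_equiv R f.
Proof.
move=> cG cK ker surj.
pose P : topologicalType := prod_topology (fun i => Q (K i)).
pose f : Q G -> P := fun y i => real_map Q (F i) y.
have cf : continuous f by apply: cts_tuple => i t; exact: cts_fun.
exists (cts_map cf); apply: (weak_equiv_at (f := cts_map cf) (x0 := simpson_pt Q x)) => //.
- exact: path_connected_prod.
- move=> n a sa h; have [u eu] := simpson_pi_surj (cls (n := n) (simpson_pt Q x) a).
  apply/(cls_eq1 sa); rewrite -eu (ker _ u) ?multiplicative1// => i.
  exact: (real_map_ker sa (esym eu) (htp_eval i h)).
- move=> n b sb.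
  have /dep_choice[v ev] i := simpson_pi_surj (cls (n := n) (simpson_pt Q (F i 0 x)) (fun t => b t i)).
  have [u eu] := surj n v; have [a [sa ea]] := cls_surj (simpson_pi Q n x u).
  exists a; split=> //; apply: prod_htp => i.
  have sbi := (prod_sph _ _).1 sb i.
  by apply: (real_map_htp sa sbi ea); rewrite eu ev.
Qed.

End Realization.

Section EilenbergMacLane.
Context (R : realType).

Lemma joined_pi n (X : topologicalType) (x y : X) : joined R x y ->
  exists phi : {multiplicative top_pi R n y -> top_pi R n x}, bijective phi.
Proof.
move=> /joined_path[p [cp <- <-]].
exists (mk_multiplicative (fun u v => ptrM u v cp)); apply: inj_surj_bij; first exact: ptr_inj.
by move=> w; exact: ptr_surj.
Qed.

Lemma one_pi_EM (A : groupType) n (X : topologicalType) : is_EilenbergMacLane R A n.+1 X -> one_pi R n X.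
Proof. by move=> [_ _ cX _ h]; split=> // m mn x; apply: h; case. Qed.

Lemma EM_of_pi n (X : topologicalType) (x : X) (A : groupType) (phi : {multiplicative A -> top_pi R n x}) :
  bijective phi -> (forall a b : A, (a * b)%g = (b * a)%g) -> path_connected R X ->
  (forall m, m <> n -> forall u : top_pi R m x, u = 1%g) -> is_EilenbergMacLane R A n.+1 X.
Proof.
move=> bphi AC cX triv; split=> //.
- move=> m y [e]; subst m; have [psi bpsi] := joined_pi n (cX.2 y x).
  have chiM : {morph (psi \o phi) : u v / (u * v)%g} by move=> u v /=; rewrite !gmulfM.
  by exists (mk_multiplicative chiM); exact: bij_comp.
- move=> m y mn u; have [psi [chi _ chiK]] := joined_pi m (cX.2 y x).
  by rewrite -[u]chiK (triv m _ (chi u)) ?multiplicative1// => e; apply: mn; rewrite e.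
Qed.

End EilenbergMacLane.

Lemma unt_gab_pt (W : gab) n : unt_to (leq0n n) ((0 : gab_arr W 0) : arr (gab_gpd W) 0) = (0 : gab_arr W n).
Proof. exact: (morphB0 (@unt_toB W n 0 (leq0n n))). Qed.

Lemma gab_one_pt (W : gab) n : gloop_one n ((0 : gab_arr W 0) : arr (gab_gpd W) 0) = (0 : gab_arr W n.+1) :> arr (gab_gpd W) n.+1.
Proof. by rewrite /= unt_gab_pt; exact: (morphB0 (@gkB W n)). Qed.

Section TwoTermRealization.
Context (R : realType) (Q : simpson_realization R).
Context (E D : zmodType) (q : D -> E) (qB : zmod_morphism q) (n : nat).
Hypothesis q_surj : forall e, exists d, q d = e.
Notation K := (two_term qB n).
Notation G := (gab_gpd K).
Notation pt := (two_pt qB n).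

Lemma two_term_htpyC (u v : arr G 0) : arr_htpy u v.
Proof. by apply: (arr_htpy_trans (two_term_low q_surj u (leq0n n))); apply: arr_htpy_sym; exact: two_term_low. Qed.

Lemma real_two_connected : path_connected R (Q G).
Proof. by apply: (@real_connected _ _ _ pt) => y; exact: two_term_htpyC. Qed.

Lemma real_two_trivial m (u : top_pi R m (simpson_pt Q pt)) : m <> n -> u = 1%g.
Proof.
by move=> mn; have [v <-] := simpson_pi_surj u; rewrite (two_term_pi q_surj v mn) multiplicative1.
Qed.

Lemma two_pi_abelian (a b : gpd_pi n pt) : (a * b)%g = (b * a)%g.
Proof.
elim/quotW: a => u; elim/quotW: b => v.
have [d [qd ->]] := two_loop_inv u; have [d' [qd' ->]] := two_loop_inv v.
have q1 : q (d + d') = 0 by rewrite (morphBD qB) qd qd' addr0.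
have q2 : q (d' + d) = 0 by rewrite (morphBD qB) qd qd' addr0.
rewrite ![(_ * _)%g]gpd_pi_mulE (two_loop_mul qB n qd qd' q1) (two_loop_mul qB n qd' qd q2).
by congr (\pi_(gpd_pi n pt) _); apply: gloop_eq; apply: subz_inj => /=; rewrite addrC.
Qed.

Lemma two_loop_null m (y : arr G 0) (u : gloop m y) : y = pt -> m <> n -> arr_htpy u (0 : gab_arr K m.+1).
Proof.
move=> e mn; subst y; have := two_term_pi q_surj (\pi_(gpd_pi m pt) u) mn => /gpd_piP.
by rewrite gab_one_pt.
Qed.

Lemma two_loop_val (y : arr G 0) (u : gloop n y) : y = pt ->
  exists d, q d = 0 /\ subz_val (gloop_arr u : gab_arr K n.+1) = (0, d).
Proof. by move=> e; subst y; have [d [qd ->]] := two_loop_inv u; exists d. Qed.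

Lemma real_two_EM : is_EilenbergMacLane R (gpd_pi n pt) n.+1 (Q G).
Proof.
apply: (@EM_of_pi _ _ _ _ _ (@simpson_pi R Q n G pt)).
- exact: simpson_pi_bij.
- exact: two_pi_abelian.
- exact: real_two_connected.
- by move=> m mn u; exact: real_two_trivial.
Qed.

Lemma real_two_one_pi : one_pi R n (Q G).
Proof. exact: one_pi_EM real_two_EM. Qed.

End TwoTermRealization.

(** * Chain complexes realize to products of Eilenberg-Mac Lane spaces *)

Section Forward.
Context (R : realType) (Q : simpson_realization R).

Lemma gab_product (W : gab) : (forall u v : gab_arr W 0, u = v) ->
  exists (A : nat -> groupType) (Z : nat -> topologicalType),
    (forall i, is_EilenbergMacLane R (A i) i.+1 (Z i)) /\
    exists f : continuousType (Q (gab_gpd W)) (prod_topology Z), weak_equiv R f.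
Proof.
move=> W0.
(* The data are packed into one type so that they can be chosen for all n simultaneously. *)
pose T (n : nat) := {E : zmodType & {D : zmodType & {q : D -> E & {qB : zmod_morphism q & gab_hom W (two_term qB n)}}}}.
pose P n (t : T n) := let: existT E (existT D (existT q (existT qB f))) := t in
    [/\ forall e, exists d, q d = e,
      forall u, gab_src u = 0 -> gab_tgt u = 0 -> (subz_val (f n.+1 u)).2 = 0 -> exists a, gab_src a = u /\ gab_tgt a = 0 &
      forall d, q d = 0 -> exists u, [/\ gab_src u = 0, gab_tgt u = 0 & (subz_val (f n.+1 u)).2 = d]].
have [t ht] : exists t : forall n, T n, forall n, P n (t n).
  apply: dep_choice => n; have [E [D [q [qB [f hf]]]]] := two_term_hom W n.
  by exists (existT _ E (existT _ D (existT _ q (existT _ qB f)))).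
pose E n := projT1 (t n); pose D n := projT1 (projT2 (t n)).
pose q n : D n -> E n := projT1 (projT2 (projT2 (t n))).
pose qB n : zmod_morphism (q n) := projT1 (projT2 (projT2 (projT2 (t n)))).
pose f n : gab_hom W (two_term (qB n) n) := projT2 (projT2 (projT2 (projT2 (t n)))).
have {ht} ht n : [/\ forall e, exists d, q n d = e,
      forall u, gab_src u = 0 -> gab_tgt u = 0 -> (subz_val (f n n.+1 u)).2 = 0 -> exists a, gab_src a = u /\ gab_tgt a = 0 &
      forall d, q n d = 0 -> exists u, [/\ gab_src u = 0, gab_tgt u = 0 & (subz_val (f n n.+1 u)).2 = d]].
  by have := ht n; rewrite /P /f /qB /q /E /D; case: (t n) => E' [D' [q' [qB' f']]].
pose K n := gab_gpd (two_term (qB n) n).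
pose F n : infFunctor (gab_gpd W) (K n) := gab_functor (f n).
pose x : arr (gab_gpd W) 0 := (0 : gab_arr W 0).
have Fx n : F n 0 x = two_pt (qB n) n by exact: (morphB0 (@gab_mapB _ _ (f n) 0)).
exists (fun n => gpd_pi n (two_pt (qB n) n)), (fun n => Q (K n)); split.
  by move=> n; apply: real_two_EM; have [] := ht n.
apply: (real_prod_weak_equiv (F := F) (x := x)).
- by apply: (real_connected Q (x := x)) => y; rewrite (W0 y x); exact: arr_htpy_refl.
- by move=> n; apply: real_two_connected; have [] := ht n.
- move=> n u; elim/quotW: u => u /(_ n); rewrite gpd_pi_mapE => /gpd_piP.
  move=> h; apply/gpd_piP.
  have su : gab_src (gloop_arr u : gab_arr W n.+1) = 0 by have := gloop_src u; rewrite unt_gab_pt.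
  have tu : gab_tgt (gloop_arr u : gab_arr W n.+1) = 0 by have := gloop_tgt u; rewrite unt_gab_pt.
  have [_ /(_ _ su tu) ku _] := ht n.
  have [|a [sa ta]] := ku.
    move: h; have -> : gloop_arr (gloop_one n (F n 0 x)) = (0 : gab_arr (two_term (qB n) n) n.+1).
      by rewrite Fx; exact: gab_one_pt.
    move=> /two_term_htpy[a [_]]; rewrite tsrc_high// ttgt_high// => e1 e2.
    have -> : subz_val (f n n.+1 (gloop_arr u)) = a := esym e1.
    by rewrite e2.
  by rewrite gab_one_pt; exists a.
- move=> m v.
  (* Only component m constrains u, since in the other factors the group of this dimension
     vanishes. *)
  have [u [su tu uv]] : exists u : gab_arr W m.+1, [/\ gab_src u = 0, gab_tgt u = 0 &
      subz_val (f m m.+1 u) = subz_val (gloop_arr (repr (v m)) : gab_arr (two_term (qB m) m) m.+1)].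
    have [d [qd ->]] := two_loop_val (repr (v m)) (Fx m).
    have [_ _ /(_ _ qd)[u [su tu ud]]] := ht m; exists u; split=> //.
    rewrite -ud [LHS]surjective_pairing; congr (_, _).
    have := gab_map_src (f m) u; rewrite su (morphB0 (@gab_mapB _ _ (f m) m)).
    by move=> /(congr1 (@subz_val _ _)) /=; rewrite tsrcn => -[].
  have us : src (u : arr (gab_gpd W) m.+1) = unt_to (leq0n m) x by rewrite unt_gab_pt.
  have ut : tgt (u : arr (gab_gpd W) m.+1) = unt_to (leq0n m) x by rewrite unt_gab_pt.
  exists (\pi_(gpd_pi m x) (GLoop us ut)) => n; rewrite gpd_pi_mapE -[v n]reprK; apply/gpd_piP.
  have [e|mn] := pselect (m = n); last first.
    apply: (arr_htpy_trans (two_loop_null _ _ (Fx n) mn)); first by have [] := ht n.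
    by apply: arr_htpy_sym; apply: (two_loop_null _ _ (Fx n) mn); have [] := ht n.
  subst n; have -> : gloop_arr (gloop_map (F m) (GLoop us ut)) = gloop_arr (repr (v m)) by exact: subz_inj.
  exact: arr_htpy_refl.
Qed.

End Forward.

(** * The two implications *)

Section Main.
Context (R : realType) (Q : simpson_realization R).
Implicit Types G : infGpd.

Lemma simply_connected_pi1 G (x : arr G 0) (u : gpd_pi 0 x) : simply_connected R (Q G) -> u = 1%g.
Proof. by move=> [_ h]; apply: (@simpson_pi_inj R Q 0); rewrite multiplicative1; exact: h. Qed.

(** An arrow of dimension at least 2 with simple source and target is simple, so loops of these
    dimensions and their homotopies do not leave the subgroupoid. In dimension 1 both groups are
    trivial. *)
Lemma scell_weak_equiv G (x : arr G 0) : simply_connected R (Q G) ->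
  weak_equiv R (real_map Q (scell_functor x)).
Proof.
move=> sG; pose W := scell_gab x; pose F := scell_functor x.
pose x' : arr (gab_gpd W) 0 := (0 : gab_arr W 0).
have Fx m : unt_to (leq0n m) (F 0 x') = unt_to (leq0n m) x by rewrite /F /= unt_to_id.
have simple_of m (a : arr G m.+2) : simple x (src a) -> simple x (tgt a) -> simple x a.
  move=> hs ht j h j1; have h' : (j <= m.+1)%N by exact: leq_trans j1 _.
  by rewrite (src_toS h') (tgt_toS h') (hs j h' j1).1 (ht j h' j1).2.
apply: (real_weak_equiv (x := x')).
- apply: (real_connected Q (x := x')) => y; rewrite (@scell_low _ x 0 x' y)//; exact: arr_htpy_refl.
- exact: sG.1.
- case=> [|n] u; elim/quotW: u => u.
    move=> _; apply/gpd_piP; rewrite (@scell_low _ x 1 (gloop_arr u) (gloop_arr (gloop_one 0 x')))//.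
    exact: arr_htpy_refl.
  rewrite gpd_pi_mapE => /gpd_piP[a [sa ta]]; apply/gpd_piP.
  have ha : simple x a.
    apply: simple_of; first by rewrite sa; exact: (scellP (gloop_arr u : scell x n.+2)).
    rewrite ta /= (Fx n.+1) -(unt_to1 (leqnSn n.+1)) (unt_to_trans _ _ (leq0n n.+2)).
    exact: simple_unt.
  exists (SCell ha : gab_arr W n.+3); split; first by apply: scell_inj; rewrite /= sa.
  rewrite gab_one_pt; apply: scell_inj; rewrite /= ta /= (Fx n.+1).
  by rewrite -(unt_to1 (leqnSn n.+1)) (unt_to_trans _ _ (leq0n n.+2)).
- case=> [|n] v; first by exists 1%g; rewrite (simply_connected_pi1 v sG); exact: simply_connected_pi1.
  elim/quotW: v => v.
  have hv : simple x v.
    by apply: simple_of; rewrite ?gloop_src ?gloop_tgt Fx; exact: simple_unt.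
  have us : src ((SCell hv : gab_arr W n.+2) : arr (gab_gpd W) n.+2) = unt_to (leq0n n.+1) x'.
    by rewrite unt_gab_pt; apply: scell_inj; rewrite /= gloop_src Fx.
  have ut : tgt ((SCell hv : gab_arr W n.+2) : arr (gab_gpd W) n.+2) = unt_to (leq0n n.+1) x'.
    by rewrite unt_gab_pt; apply: scell_inj; rewrite /= gloop_tgt Fx.
  exists (\pi_(gpd_pi n.+1 x') (GLoop us ut)); rewrite gpd_pi_mapE.
  by congr (\pi_(gpd_pi n.+1 _) _); exact: gloop_eq.
Qed.

Lemma simply_connected_product G : simply_connected R (Q G) ->
  exists (A : nat -> groupType) (Z : nat -> topologicalType),
    (forall i, is_EilenbergMacLane R (A i) i.+1 (Z i)) /\ hot_iso R (Q G) (prod_topology Z).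
Proof.
move=> sG; have [x _] := real_connected_inv sG.1.
have [A [Z [hZ [f wf]]]] := @gab_product R Q (scell_gab x) (fun u v => scell_low u v (leq0n 1)).
exists A, Z; split=> //; apply: hot_iso_trans (weak_equiv_hot_iso wf).
by apply: hot_iso_sym; exact: weak_equiv_hot_iso (scell_weak_equiv x sG).
Qed.

(** Only n = 1 is at stake, and there the group is the fundamental group, which is trivial. *)
Lemma EM_abelian (A : groupType) n (X : topologicalType) : is_EilenbergMacLane R A n X ->
  simply_connected R X -> forall a b : A, (a * b)%g = (b * a)%g.
Proof.
move=> [n0 AC cX h _] [_ s1] a b.
case: n n0 AC h => // -[|n] _ AC h; last exact: AC.
have [[x _] _] := cX; have [phi bphi] := h 0 x erefl.
by apply: (bij_inj bphi); rewrite [LHS]s1 [RHS]s1.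
Qed.

Section Backward.
Context (I : Type) (A : I -> groupType) (n : I -> nat) (AC : forall i (a b : A i), (a * b)%g = (b * a)%g).

(** The row vectors of length 0 serve as the zero group E, which leaves A_i alone in its degree. *)
Let zeroB i : zmod_morphism (fun _ : abz (@AC i) => 0 : 'rV[int]_0).
Proof. by move=> u v; rewrite subrr. Qed.
Let zero_surj i (e : 'rV[int]_0) : exists d : abz (@AC i), 0 = e.
Proof. by exists 0; apply/rowP => -[]. Qed.

(* The group A_i, placed in degree n_i + 1. *)
Let K i := two_term (@zeroB i) (n i).
Let W := gab_prod K.

Lemma real_gab_prod : exists f : continuousType (Q (gab_gpd W)) (prod_topology (fun i => Q (gab_gpd (K i)))),
  weak_equiv R f.
Proof.
pose x : arr (gab_gpd W) 0 := (0 : gab_arr W 0).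
have htpyP m (u v : arr (gab_gpd W) m) :
    (forall i, arr_htpy ((u : gab_arr W m) i : arr (gab_gpd (K i)) m) ((v : gab_arr W m) i)) -> arr_htpy u v.
  move=> /(dep_choice (Z := fun i => gab_arr (K i) m.+1))[a ha].
  by exists (a : gab_arr W m.+1); split; apply: dprodP => i; have [] := ha i.
apply: (real_prod_weak_equiv (F := fun i => gab_functor (gab_proj K i)) (x := x)).
- by apply: (real_connected Q (x := x)) => y; apply: htpyP => i; apply: two_term_htpyC; exact: zero_surj.
- by move=> i; apply: real_two_connected; exact: zero_surj.
- move=> m u; elim/quotW: u => u h; apply/gpd_piP; apply: htpyP => i.
  have := h i; rewrite gpd_pi_mapE => /gpd_piP.
  have -> : gloop_arr (gloop_one m (gab_functor (gab_proj K i) 0 x)) = (0 : gab_arr (K i) m.+1) by exact: gab_one_pt.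
  by rewrite gab_one_pt.
- move=> m v.
  pose u : gab_arr W m.+1 := fun i => gloop_arr (repr (v i)).
  have us : src (u : arr (gab_gpd W) m.+1) = unt_to (leq0n m) x.
    rewrite unt_gab_pt; apply: dprodP => i; have := gloop_src (repr (v i)).
    by rewrite -[RHS]/(unt_to _ _) (unt_gab_pt (K i)).
  have ut : tgt (u : arr (gab_gpd W) m.+1) = unt_to (leq0n m) x.
    rewrite unt_gab_pt; apply: dprodP => i; have := gloop_tgt (repr (v i)).
    by rewrite -[RHS]/(unt_to _ _) (unt_gab_pt (K i)).
  exists (\pi_(gpd_pi m x) (GLoop us ut)) => i; rewrite gpd_pi_mapE -[v i]reprK.
  by congr (\pi_(gpd_pi m _) _); exact: gloop_eq.
Qed.

Lemma EM_product_real (Z : I -> topologicalType) : (forall i, is_EilenbergMacLane R (A i) (n i).+1 (Z i)) ->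
  exists G : infGpd, hot_iso R (prod_topology Z) (Q G).
Proof.
move=> hZ; exists (gab_gpd W).
(* The apex and both maps are packed together for a simultaneous choice. The product of the apexes
   is then a span between the two products. *)
have span i : exists t : {V : topologicalType & (continuousType V (Q (gab_gpd (K i))) * continuousType V (Z i))%type},
    let: existT V (f, g) := t in [/\ path_connected R V, weak_equiv R f & weak_equiv R g].
  have [_ _ cZ hpi _] := hZ i; have [[z _] _] := cZ; have [phi bphi] := hpi (n i) z erefl.
  pose pt := two_pt (@zeroB i) (n i).
  pose lp (a : abz (@AC i)) : gloop (n i) pt := @two_loop _ _ _ (@zeroB i) (n i) a erefl.
  pose psi (a : A i) : top_pi R (n i) (simpson_pt Q pt) := simpson_pi Q (n i) pt (\pi_(gpd_pi (n i) pt) (lp a)).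
  have psiM : {morph psi : a b / (a * b)%g}.
    move=> a b; rewrite /psi -gmulfM; apply: (congr1 (simpson_pi Q (n i) pt)).
    rewrite [RHS]gpd_pi_mulE; congr (\pi_(gpd_pi (n i) pt) _); apply/esym.
    exact: (@two_loop_mul _ _ _ (@zeroB i) (n i) (a : abz (@AC i)) (b : abz (@AC i))).
  have psi_inj : injective psi.
    by move=> a b /simpson_pi_inj/gpd_piP/two_loop_htpy.
  have psi_bij : bijective psi.
    apply: inj_surj_bij => // w; have [v <-] := simpson_pi_surj w; elim/quotW: v => l.
    have [d [qd ->]] := two_loop_inv l; exists d; rewrite /psi /lp.
    by rewrite (Prop_irrelevance qd erefl).
  have [psi' psiK psiK'] := psi_bij.
  have chiM : {morph (fun u => phi (psi' u)) : u v / (u * v)%g}.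
    move=> u v; rewrite -gmulfM; congr (phi _); apply: psi_inj.
    by rewrite psiM !psiK'.
  have chi_bij : bijective (fun u => phi (psi' u)).
    by apply: (bij_comp bphi); exists psi.
  have [V [f [g [cV wf wg]]]] := one_pi_span (real_two_one_pi Q (@zeroB i) (n i) (@zero_surj i)) (one_pi_EM (hZ i)) chiM chi_bij.
  by exists (existT _ V (f, g)).
have [t ht] := dep_choice span.
pose V i := projT1 (t i).
have {}ht i : [/\ path_connected R (V i), weak_equiv R (projT2 (t i)).1 & weak_equiv R (projT2 (t i)).2].
  by have := ht i; rewrite /V; case: (t i) => V' [f g].
have cV i : path_connected R (V i) by have [] := ht i.
have [|f wf] := weak_equiv_prod cV (fun i => real_two_connected Q (@zeroB i) (n i) (@zero_surj i)) (w := fun i => (projT2 (t i)).1).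
  by move=> i; have [] := ht i.
have [||g wg] := weak_equiv_prod cV _ (w := fun i => (projT2 (t i)).2).
- by move=> i; have [] := hZ i.
- by move=> i; have [] := ht i.
have [h wh] := real_gab_prod.
apply: hot_iso_trans (hot_iso_sym (weak_equiv_hot_iso wh)).
exact: hot_iso_trans (hot_iso_sym (weak_equiv_hot_iso wg)) (weak_equiv_hot_iso wf).
Qed.

End Backward.
End Main.

(* Since [hot_loc] is the identity on objects, the object R(G) of Hot is Q G. *)
Theorem mainTheorem4 (R : realType) (Q : simpson_realization R)
    (X : topologicalType) (X1 : simply_connected R X) :
  (exists G : infGpd, hot_iso R X (Q G)) <->
  (exists (I : Type) (A : I -> groupType) (n : I -> nat)
     (Z : I -> topologicalType),
     (forall i, is_EilenbergMacLane R (A i) (n i) (Z i)) /\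
     hot_iso R X (prod_topology Z)).
Proof.
split=> [[G XG]|[I [A [n [Z [hZ XZ]]]]]].
  have [A [Z [hZ GZ]]] := simply_connected_product (simply_connected_hot_iso XG X1).
  by exists nat, A, S, Z; split=> //; exact: hot_iso_trans XG GZ.
(* Simple connectivity passes to the product and then to each factor, which makes every group
   abelian. *)
have sZ := simply_connected_hot_iso XZ X1.
have AC i := EM_abelian (hZ i) (simply_connected_eval i sZ).
(* The degrees are positive, as is needed for the shifted indexing of the homotopy groups. *)
have hZ' i : is_EilenbergMacLane R (A i) (n i).-1.+1 (Z i).
  by have := hZ i; have [n0 _ _ _ _] := hZ i; rewrite prednK.
by have [G ZG] := EM_product_real Q AC hZ'; exists G; exact: hot_iso_trans XZ ZG.
Qed.
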